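(* Let $\mathcal{H}$ be a hypergeometric sheaf of type $(D,m)$ with $D>m\ge0$ in characteristic $p$, and let $G$ be its geometric monodromy group. Suppose that (a) $G$ is a finite almost quasisimple group: $S\lhd G/\mathbf{Z}(G)\le\mathrm{Aut}(S)$ for some finite non-abelian simple group $S$; and (b) for some normal subgroup $R$ of $G/\mathbf{Z}(G)$ containing $S$, $R$ admits either a $d$-dimensional linear representation $\Phi:R\to\mathrm{GL}_d(\mathbb{F})$, or an $e$-dimensional projective representation $\Psi:R\to\mathrm{PGL}_e(\mathbb{F})$, over an algebraically closed field $\mathbb{F}$ of characteristic $\neq p$, which is nontrivial on $S$. Then for the dimension $W=D-m$ of the wild part of $I(\infty)$ on $\mathcal{H}$ we have, respectively, $$W\le d\cdot[G/\mathbf{Z}(G):R]\le d\cdot|\mathrm{Out}(S)|,\qquad\text{resp.}\qquad W\le(e^2-1)\cdot[G/\mathbf{Z}(G):R]\le(e^2-1)\cdot|\mathrm{Out}(S)|.$$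
   Context: Hypergeometric sheaf of type $(D,m)$ in characteristic $p$: Katz's $\mathcal{H}yp_\psi(\chi_1,\ldots,\chi_D;\rho_1,\ldots,\rho_m)$ on $\mathbb{G}_m/\overline{\mathbb{F}_p}$ ($\overline{\mathbb{Q}_\ell}$-coefficients, $\ell\neq p$), geometrically irreducible (no $\chi_i$ equals a $\rho_j$), lisse of rank $D$, tame at $0$, and whose $I(\infty)$-representation is the sum of a tame part of rank $m$ and a totally wild part of rank $W=D-m$ with all breaks $1/W$. The geometric monodromy group is the Zariski closure of the image of $\pi_1(\mathbb{G}_m/\overline{\mathbb{F}_p})$. *)

(* Defs.v *)
From HB Require Import structures.
From mathcomp Require Import all_boot all_order all_algebra all_fingroup.
From mathcomp Require Import all_solvable all_field all_character.
From mathcomp.multinomials Require Import mpoly.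

Set Implicit Arguments.
Unset Strict Implicit.
Unset Printing Implicit Defensive.

Import Order.TTheory GRing.Theory Num.Theory.
Local Open Scope ring_scope.

(** * Rank-one valuations, written additively, with values in [rat]

    All the valued fields below are algebraic over a discretely valued field,
    so that rational values suffice.  [v 0] is unconstrained: it stands for
    +oo, and this is taken care of by [vge] and [vgt]. *)

Definition vge (F : fieldType) (v : F -> rat) (r : rat) (x : F) : Prop :=
  x != 0 -> r <= v x.

Definition vgt (F : fieldType) (v : F -> rat) (r : rat) (x : F) : Prop :=
  x != 0 -> r < v x.

Record valuation (F : fieldType) (v : F -> rat) : Prop := Valuation {
  valuationM : forall x y, x != 0 -> y != 0 -> v (x * y) = v x + v y;
  valuationD : forall r x y, vge v r x -> vge v r y -> vge v r (x + y) }.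

(** * The coefficient field *)

(* [(E, v)] is an algebraic closure of Q_l with its valuation, normalised by
   v(l) = 1.  Q_l is the closure of Q in E; it is required to be complete, and
   E to be algebraic over it. *)
Definition in_closure_rat (E : fieldType) (v : E -> rat) (x : E) : Prop :=
  forall r : rat, exists a : rat, vge v r (x - ratr a).

Record Qlbar (l : nat) (E : closedFieldType) (v : E -> rat) : Prop := IsQlbar {
  Qlbar_char0 : [pchar E] =i pred0;
  Qlbar_valuation : valuation v;
  Qlbar_norm : v l%:R = 1;
  Qlbar_complete : forall u : nat -> rat,
    (forall r : rat, exists N, forall i j, (N <= i)%N -> (N <= j)%N ->
        vge v r (ratr (u i) - ratr (u j))) ->
    exists x : E, forall r : rat, exists N, forall i, (N <= i)%N ->
        vge v r (x - ratr (u i));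
  Qlbar_algebraic : forall x : E, exists P : {poly E},
    [/\ P != 0, root P x & forall i, in_closure_rat v P`_i] }.

(** * The function field of G_m and its Galois group

    [Om] is a separable closure of kbar(t), where kbar, the set of elements of
    [Om] that are algebraic over F_p, is an algebraic closure of F_p.  A lisse
    sheaf on G_m is a continuous representation of the absolute Galois group
    which is trivial on the inertia groups of all places over G_m. *)

Definition in_Fpbar (p : nat) (Om : fieldType) (x : Om) : Prop :=
  exists2 n, (0 < n)%N & x ^+ (p ^ n) = x.

(* In [sepclosure_alg], every element is a simple root of a polynomial with
   coefficients in kbar[t]. *)
Record sepclosure_Fpbar_t (p : nat) (Om : fieldType) (t : Om) : Prop :=
  IsSepclosure {
  sepclosure_char : p \in [pchar Om];
  sepclosure_trans : ~ in_Fpbar p t;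
  sepclosure_alg : forall x : Om, exists P : {poly {poly Om}},
    let Pt := map_poly (fun c : {poly Om} => c.[t]) P in
    [/\ forall i j, in_Fpbar p P`_i`_j, root Pt x & ~~ root Pt^`() x];
  sepclosure_closed : forall P : {poly Om},
    (1 < size P)%N -> separable_poly P -> exists x, root P x }.

(* Endomorphisms of [Om] over a subfield over which it is algebraic are
   automorphisms, so these are the Galois groups of [Om] over kbar(t) and
   over F_q(t), with composition as the group law. *)
Definition Gal_geom (p : nat) (Om : fieldType) (t : Om)
    (s : {rmorphism Om -> Om}) : Prop :=
  s t = t /\ forall c, in_Fpbar p c -> s c = c.

Definition Gal_arith (q : nat) (Om : fieldType) (t : Om)
    (s : {rmorphism Om -> Om}) : Prop :=
  s t = t /\ forall c, c ^+ q = c -> s c = c.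

(** Places of [Om], each normalised so that a uniformiser of kbar(t) at the
    place below has valuation 1. *)

Definition place_at (Om : fieldType) (t a : Om) (v : Om -> rat) : Prop :=
  valuation v /\ v (t - a) = 1.

Definition place_at_infty (Om : fieldType) (t : Om) (v : Om -> rat) : Prop :=
  valuation v /\ v t = -1.

Definition inertia (p : nat) (Om : fieldType) (t : Om) (v : Om -> rat)
    (s : {rmorphism Om -> Om}) : Prop :=
  Gal_geom p t s /\ forall x, vge v 0 x -> vgt v 0 (s x - x).

Definition wild_inertia (p : nat) (Om : fieldType) (t : Om) (v : Om -> rat)
    (s : {rmorphism Om -> Om}) : Prop :=
  inertia p t v s /\ forall x, x != 0 -> vgt v (v x) (s x - x).

(* The geometric Frobenius elements (inverses of x |-> x ^+ Q on the residue
   field) of the decomposition group of [v]. *)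
Definition geom_frobenius (Om : fieldType) (v : Om -> rat) (Q : nat)
    (s : {rmorphism Om -> Om}) : Prop :=
  forall x, vge v 0 x -> vgt v 0 (s x ^+ Q - x).

(** Upper numbering ramification groups.  [finite_galois p t L] : L is a finite
    Galois subextension of [Om] over kbar(t), given as the fixed field of the
    pointwise stabiliser of a finite Galois-stable sequence. *)

Definition finite_galois (p : nat) (Om : fieldType) (t : Om)
    (L : Om -> Prop) : Prop :=
  exists s : seq Om,
    (forall g, Gal_geom p t g -> forall x, x \in s -> g x \in s) /\
    (forall x, L x <->
       (forall g, Gal_geom p t g -> {in s, forall y, g y = y} -> g x = x)).

Definition uniformiser (Om : fieldType) (v : Om -> rat) (L : Om -> Prop)
    (pi : Om) : Prop :=
  [/\ L pi, pi != 0, 0 < v pi &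
      forall x, L x -> x != 0 -> 0 < v x -> v pi <= v x].

Definition inertia_orbit (p : nat) (Om : fieldType) (t : Om) (v : Om -> rat)
    (x : Om) (c : seq Om) : Prop :=
  uniq c /\ forall y, y \in c <-> exists2 g, inertia p t v g & g x = y.

(* The upper numbering is computed on a finite Galois L, with inertia group
   Gamma of order e (the residue field being algebraically closed, L is totally
   ramified over the completion), from
     phi(u) = (1/e) \sum_(g in Gamma) min(i(g), u + 1) - 1
   where i(g) = v_L(g pi - pi) for a uniformiser pi of L, and v_L = e * v; thus
   s is in Gamma^r = Gamma_(psi(r)) iff phi(i(s) - 1) >= r.  Elements of Gamma
   are indexed by the conjugates y = g pi of pi; the term of the identity,
   where i is infinite, is the first one of the sum below. *)
Definition upper_ramification (p : nat) (Om : fieldType) (t : Om)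
    (v : Om -> rat) (r : rat) (s : {rmorphism Om -> Om}) : Prop :=
  inertia p t v s /\
  forall L pi c, finite_galois p t L -> uniformiser v L pi ->
    inertia_orbit p t v pi c -> s pi != pi ->
    r + 1 <= v (s pi - pi)
             + \sum_(y <- c | y != pi) Num.min (v (y - pi)) (v (s pi - pi)).

(** * Representations *)

(* Continuity is expressed at the identity, the topology of the Galois group
   being the Krull topology. *)
Record continuous_rep (Om : fieldType) (G : {rmorphism Om -> Om} -> Prop)
    (E : fieldType) (vE : E -> rat) (D : nat)
    (rho : {rmorphism Om -> Om} -> 'M[E]_D) : Prop := ContinuousRep {
  continuous_rep1 : rho (idfun : {rmorphism Om -> Om}) = 1%:M;
  continuous_repM : forall s s', G s -> G s' ->
    rho (s \o s' : {rmorphism Om -> Om}) = rho s *m rho s';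
  continuous_repC : forall r : rat, exists xs : seq Om, forall s, G s ->
    {in xs, forall x, s x = x} ->
    forall i j, vge vE r ((rho s - 1%:M) i j) }.

(* Matrices act on column vectors. *)
Definition rep_stable (Om : fieldType) (G : {rmorphism Om -> Om} -> Prop)
    (E : fieldType) (D : nat) (rho : {rmorphism Om -> Om} -> 'M[E]_D)
    (U : {vspace 'cV[E]_D}) : Prop :=
  forall s, G s -> forall x, x \in U -> rho s *m x \in U.

Definition rep_trivial_on (Om : fieldType) (G : {rmorphism Om -> Om} -> Prop)
    (E : fieldType) (D : nat) (rho : {rmorphism Om -> Om} -> 'M[E]_D)
    (U : {vspace 'cV[E]_D}) : Prop :=
  forall s, G s -> forall x, x \in U -> rho s *m x = x.

Definition rep_no_invariants_in (Om : fieldType)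
    (G : {rmorphism Om -> Om} -> Prop)
    (E : fieldType) (D : nat) (rho : {rmorphism Om -> Om} -> 'M[E]_D)
    (U : {vspace 'cV[E]_D}) : Prop :=
  forall x, x \in U -> (forall s, G s -> rho s *m x = x) -> x = 0.

Definition rep_irreducible (Om : fieldType) (G : {rmorphism Om -> Om} -> Prop)
    (E : fieldType) (D : nat) (rho : {rmorphism Om -> Om} -> 'M[E]_D) : Prop :=
  (0 < D)%N /\
  forall U : {vspace 'cV[E]_D},
    rep_stable G rho U -> U = 0%VS \/ U = fullv.

(* All the breaks of the representation [U] of the inertia group at [v] are
   equal to [b]. *)
Definition all_breaks_eq (p : nat) (Om : fieldType) (t : Om) (v : Om -> rat)
    (E : fieldType) (D : nat) (rho : {rmorphism Om -> Om} -> 'M[E]_D)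
    (U : {vspace 'cV[E]_D}) (b : rat) : Prop :=
  rep_no_invariants_in (upper_ramification p t v b) rho U /\
  forall r, b < r -> rep_trivial_on (upper_ramification p t v r) rho U.

(** * Hypergeometric sheaves *)

(* Characters of the additive and multiplicative groups of the subfield F_q of
   [Om], as functions on [Om] whose values outside F_q are irrelevant. *)
Definition nontrivial_additive_char (q : nat) (Om E : fieldType)
    (psi : Om -> E) : Prop :=
  [/\ psi 0 = 1,
      forall x y, x ^+ q = x -> y ^+ q = y -> psi (x + y) = psi x * psi y
    & exists2 x, x ^+ q = x & psi x != 1].

Definition multiplicative_char (q : nat) (Om E : fieldType)
    (chi : Om -> E) : Prop :=
  chi 1 = 1 /\
  forall x y, x != 0 -> y != 0 -> x ^+ q = x -> y ^+ q = y ->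
    chi (x * y) = chi x * chi y.

Definition distinct_chars (q : nat) (Om E : fieldType)
    (chi chi' : Om -> E) : Prop :=
  exists x, [/\ x != 0, x ^+ q = x & chi x != chi' x].

(* Trace and norm from F_(q^n) to F_q. *)
Definition trF (q n : nat) (Om : fieldType) (x : Om) : Om :=
  \sum_(i < n) x ^+ (q ^ i).

Definition nmF (q n : nat) (Om : fieldType) (x : Om) : Om :=
  \prod_(i < n) x ^+ (q ^ i).

(* Katz's hypergeometric sum
     (-1)^(D+m-1) \sum psi(Tr(\sum_i x_i - \sum_j y_j))
                     \prod_i chi_i(N x_i) \prod_j rhobar_j(N y_j)
   over x_i, y_j in (F_(q^n))^* with \prod_i x_i = a \prod_j y_j. *)
Definition hypergeometric_sum (q n : nat) (Om E : fieldType) (D m : nat)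
    (psi : Om -> E) (chi : 'I_D -> Om -> E) (eta : 'I_m -> Om -> E)
    (Fn : finFieldType) (emb : {rmorphism Fn -> Om}) (a : Fn) : E :=
  (-1) ^+ (D + m).-1 *
  \sum_(x : {ffun 'I_D -> Fn} | [forall i, x i != 0])
  \sum_(y : {ffun 'I_m -> Fn} | [forall j, y j != 0]
                              && (\prod_i x i == a * \prod_j y j))
     (psi (trF q n (emb (\sum_i x i - \sum_j y j)))
      * \prod_i chi i (nmF q n (emb (x i)))
      * \prod_j (eta j (nmF q n (emb (y j))))^-1).

(* [rho] is the lisse sheaf Hyp_psi(chi_1,...,chi_D; eta_1,...,eta_m) on G_m
   over F_q.  Katz constructs it by iterated multiplicative convolution of
   Artin-Schreier-Kummer sheaves; here the sheaf is given by its trace function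
   at all points of G_m over all finite extensions of F_q.  By Chebotarev this
   determines an irreducible sheaf up to isomorphism. *)
Record Katz_hyp (p q : nat) (Om : fieldType) (t : Om)
    (E : fieldType) (vE : E -> rat) (D m : nat)
    (psi : Om -> E) (chi : 'I_D -> Om -> E) (eta : 'I_m -> Om -> E)
    (rho : {rmorphism Om -> Om} -> 'M[E]_D) : Prop := KatzHyp {
  hyp_continuous : continuous_rep (Gal_arith q t) vE rho;
  hyp_lisse : forall a v, in_Fpbar p a -> a != 0 -> place_at t a v ->
    forall s, inertia p t v s -> rho s = 1%:M;
  hyp_trace : forall (n : nat) (Fn : finFieldType)
      (emb : {rmorphism Fn -> Om}) (a : Fn) v s,
    (0 < n)%N -> #|Fn| = (q ^ n)%N -> a != 0 -> place_at t (emb a) v ->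
    Gal_arith q t s -> geom_frobenius v (q ^ n) s ->
    \tr (rho s) = hypergeometric_sum q n psi chi eta emb a }.

(* [rho], a representation of the Galois group over kbar(t), is a geometrically
   irreducible hypergeometric sheaf of type (D,m).  The last three clauses are
   the standard properties of these sheaves when D > m: geometric
   irreducibility, tameness at 0, and the structure at infinity. *)
Record hypergeometric (p : nat) (Om : fieldType) (t : Om)
    (E : fieldType) (vE : E -> rat) (D m : nat)
    (rho : {rmorphism Om -> Om} -> 'M[E]_D) : Prop := Hypergeometric {
  hyp_arith : exists (f : nat) (psi : Om -> E) (chi : 'I_D -> Om -> E)
      (eta : 'I_m -> Om -> E) (rhoA : {rmorphism Om -> Om} -> 'M[E]_D),
    let q := (p ^ f)%N in
    [/\ (0 < f)%N /\ nontrivial_additive_char q psi,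
        (forall i, multiplicative_char q (chi i)) /\
        (forall j, multiplicative_char q (eta j)),
        forall i j, distinct_chars q (chi i) (eta j),
        Katz_hyp p q t vE psi chi eta rhoA
      & forall s, Gal_geom p t s -> rho s = rhoA s];
  hyp_irreducible : rep_irreducible (Gal_geom p t) rho;
  hyp_tame0 : forall v, place_at t 0 v ->
    rep_trivial_on (wild_inertia p t v) rho fullv;
  hyp_infty : forall v, place_at_infty t v ->
    exists Tame Wild : {vspace 'cV[E]_D},
    [/\ (Tame + Wild)%VS = fullv /\ (Tame :&: Wild)%VS = 0%VS,
        rep_stable (inertia p t v) rho Tame /\
        rep_stable (inertia p t v) rho Wild,
        \dim Tame = m /\ rep_trivial_on (wild_inertia p t v) rho Tame,
        \dim Wild = (D - m)%N /\
        rep_no_invariants_in (wild_inertia p t v) rho Wild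
      & all_breaks_eq p t v rho Wild ((D - m)%:R)^-1] }.

Arguments hypergeometric p [Om] t [E] vE D m rho.

(** * Monodromy *)

(* Zariski closure in GL_D of a set [X] of D x D matrices. *)
Definition zariski_closure (E : fieldType) (D : nat) (X : 'M[E]_D -> Prop)
    (A : 'M[E]_D) : Prop :=
  A \in unitmx /\
  forall P : {mpoly E[D * D]},
    (forall B, X B -> P.@[fun i => mxvec B 0 i] = 0) ->
    P.@[fun i => mxvec A 0 i] = 0.

Definition geometric_monodromy (p : nat) (Om : fieldType) (t : Om)
    (E : fieldType) (D : nat) (rho : {rmorphism Om -> Om} -> 'M[E]_D) :
    'M[E]_D -> Prop :=
  zariski_closure (fun B => exists2 s, Gal_geom p t s & rho s = B).

(* The finite group [gT] is isomorphic, through [f], to the group of matrices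
   [M]; in particular [M] is finite. *)
Definition finite_matrix_group (gT : finGroupType) (E : fieldType) (D : nat)
    (f : gT -> 'M[E]_D) (M : 'M[E]_D -> Prop) : Prop :=
  [/\ injective f, forall x y, f (x * y)%g = f x *m f y
    & forall A, M A <-> exists x, f x = A].

(** * Groups *)

Definition Out (gT : finGroupType) (S : {group gT}) :
    {set coset_of (conj_aut S @* S)} :=
  (Aut S / (conj_aut S @* S))%g.

(* S <| A <= Aut(S) for a non-abelian simple group S : conjugation embeds A
   in Aut(S). *)
Definition almost_simple (gT : finGroupType) (S A : {group gT}) : Prop :=
  [/\ simple S, ~~ abelian S, S <| A & 'C_A(S) = 1]%g.

(* A homomorphism R -> PGL_e(F), given by matrices representing the images. *)
Definition projective_repr (gT : finGroupType) (R : {group gT})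
    (F : fieldType) (e : nat) (Psi : gT -> 'M[F]_e) : Prop :=
  (forall x, x \in R -> Psi x \in unitmx) /\
  forall x y, x \in R -> y \in R ->
    exists2 c : F, c != 0 & Psi (x * y)%g = c *: (Psi x *m Psi y).

(* Main.v *)
Require Import Defs.
From HB Require Import structures.
From mathcomp Require Import all_boot all_order all_algebra all_fingroup.
From mathcomp Require Import all_solvable all_field all_character.
From mathcomp Require Import ring lra zify.
From mathcomp.classical Require Import boolp.
From mathcomp.classical Require classical_sets filter.

Set Implicit Arguments.
Unset Strict Implicit.
Unset Printing Implicit Defensive.

Import Order.TTheory GRing.Theory Num.Theory.
Local Open Scope ring_scope.

(** The inequality is local at infinity. Let Gamma be the inertia group at infinity of a finite
    Galois level through which the sheaf factors, f : Gamma -> G the induced map, and W = D - m.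
    Upper ramification groups of index larger than 1/W act trivially on both the tame and the wild
    part, so an element outside the kernel of f has upper number at most 1/W.

    In the other direction, let V be a representation of a group Gamma of this kind, nontrivial on
    wild inertia, and let k be the last index for which the lower ramification group Gamma_k acts
    nontrivially. A simple submodule M without Gamma_k-invariants has the single slope phi(k) =
    [ramsum] k / |Gamma|, so its Swan conductor dim M * phi(k) is a positive integer, whence 1 <=
    codim(V^Gamma) * phi(k) ([local_bound]). Applied to a subgroup Gamma' of Gamma, together with
    phi(k) <= 1/W on Gamma, this gives W <= codim(V^Gamma') * [Gamma : Gamma'] ([wild_bound]).

    The choice of V is group theory ([wild_dim_bound]). Write Gbar = G/Z(G). If wild inertia does
    not map into R, the regular representation of Gbar/R gives W <= [Gbar : R]. If it maps into the
    centre, the image of inertia is abelian and a character gives W <= 1. Otherwise some wild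
    element is nontrivial in Gbar, and since Gbar is almost simple one of its conjugates lies
    outside the kernel of Phi ([almost_simple_moved]); a conjugate of Phi is pulled back to the
    preimage of R in Gamma, whose index is at most [Gbar : R]. A projective representation is
    replaced by conjugation on e by e matrices, which fixes the identity: hence e^2 - 1. Finally
    [Gbar : R] <= |Out(S)| because Gbar embeds in Aut(S) and R contains S ([index_le_Out]).

    Integrality of the Swan conductor is the Hasse-Arf theorem. For cyclic p-groups it follows from
    Sen's congruences between the jumps ([sen]), proved by comparing values of elements of trace
    zero with the different. Herbrand's theorem ([herb_quotient]) passes from cyclic quotients to
    p-groups ([hasse_arf]), monomiality of representations of p-groups ([pgroup_rep_dvd]) from
    characters to all representations of wild inertia, and the tame character accounts for the part
    prime to p.

    The link with the absolute Galois group rests on a place at infinity and on automorphisms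
    obtained by Zorn's lemma, and on compactness: an element of a finite level with given upper
    number lifts to an element of the corresponding upper ramification group of [Om]
    ([upper_lift]). *)

Section Subfield.

(** Subfields are predicates: constants, levels and fixed fields are all compared inside the single
    field [Om]. *)
Record subfld (F : fieldType) (K : F -> Prop) : Prop := Subfld {
  subfld1 : K 1;
  subfldB : forall x y, K x -> K y -> K (x - y);
  subfldM : forall x y, K x -> K y -> K (x * y);
  subfldV : forall x, K x -> K x^-1 }.

Variables (F : fieldType) (K : F -> Prop) (Kf : subfld K).

Lemma subfld0 : K 0.
Proof. by rewrite -(subrr 1); apply: (subfldB Kf); exact: (subfld1 Kf). Qed.

Lemma subfldN x : K x -> K (- x).
Proof. by move=> Kx; rewrite -sub0r; apply: (subfldB Kf) => //; exact: subfld0. Qed.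

Lemma subfldD x y : K x -> K y -> K (x + y).
Proof. by move=> Kx Ky; rewrite -(opprK y); apply: (subfldB Kf) => //; exact: subfldN. Qed.

Lemma subfld_div x y : K x -> K y -> K (x / y).
Proof. by move=> Kx Ky; apply/(subfldM Kf)/(subfldV Kf). Qed.

Lemma subfldX x n : K x -> K (x ^+ n).
Proof.
move=> Kx; elim: n => [|n IH]; first exact: (subfld1 Kf).
by rewrite exprS; apply: (subfldM Kf).
Qed.

Lemma subfldXz x (z : int) : K x -> K (x ^ z).
Proof.
move=> Kx; case: z => n; first exact: subfldX.
by rewrite NegzE -exprnN; apply: (subfldV Kf); apply: subfldX.
Qed.

Lemma subfld_sum (I : Type) (r : seq I) (P : pred I) (f : I -> F) :
  (forall i, P i -> K (f i)) -> K (\sum_(i <- r | P i) f i).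
Proof. by move=> Kf'; apply: big_ind => //; [exact: subfld0|exact: subfldD]. Qed.

Lemma subfld_prod (I : Type) (r : seq I) (P : pred I) (f : I -> F) :
  (forall i, P i -> K (f i)) -> K (\prod_(i <- r | P i) f i).
Proof. by move=> Kf'; apply: big_ind => //; [exact: (subfld1 Kf)|exact: (subfldM Kf)]. Qed.

Lemma subfld_horner (q : {poly F}) x :
  (forall i, K q`_i) -> K x -> K q.[x].
Proof.
move=> Kq Kx; rewrite horner_coef; apply: subfld_sum => i _.
by apply: (subfldM Kf) => //; apply: subfldX.
Qed.

End Subfield.

(** * Rank-one valuations and 1-units *)

Section Valuation.

Variables (Om : fieldType) (v : Om -> rat).
Hypothesis vV : valuation v.

Lemma vl1 : v 1 = 0.
Proof.
have := valuationM vV (oner_neq0 _) (oner_neq0 _).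
by rewrite mulr1 => /eqP; rewrite -subr_eq subrr => /eqP.
Qed.

Lemma vlM x y : x != 0 -> y != 0 -> v (x * y) = v x + v y.
Proof. exact: valuationM vV x y. Qed.

Lemma vlX x n : x != 0 -> v (x ^+ n) = n%:R * v x.
Proof.
move=> x0; elim: n => [|n IH]; first by rewrite expr0 vl1 mul0r.
by rewrite exprS vlM ?expf_neq0 // IH -{1}(mul1r (v x)) -mulrDl nat1r.
Qed.

Lemma vlN x : v (- x) = v x.
Proof.
have [->|x0] := eqVneq x 0; first by rewrite oppr0.
rewrite -mulN1r vlM ?oppr_eq0 ?oner_neq0 //.
suff -> : v (-1) = 0 by rewrite add0r.
have : v ((-1) * (-1)) = v (-1) + v (-1) by rewrite vlM ?oppr_eq0 ?oner_neq0.
by rewrite mulrNN mulr1 vl1 => h; lra.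
Qed.

Lemma vlV x : v x^-1 = - v x \/ x = 0.
Proof.
have [->|x0] := eqVneq x 0; [by right|left].
have : v (x * x^-1) = v x + v x^-1 by rewrite vlM ?invr_eq0.
by rewrite divff // vl1 => h; lra.
Qed.

Lemma vl_inv x : x != 0 -> v x^-1 = - v x.
Proof. by case: (vlV x) => // ->; rewrite eqxx. Qed.

Lemma vl_div x y : x != 0 -> y != 0 -> v (x / y) = v x - v y.
Proof. by move=> x0 y0; rewrite vlM ?invr_eq0 // vl_inv. Qed.

Lemma vlXz x (z : int) : x != 0 -> v (x ^ z) = z%:~R * v x.
Proof.
move=> x0; case: z => n; first by rewrite vlX.
by rewrite NegzE -exprnN vl_inv ?expf_neq0 // vlX // mulrNz mulNr.
Qed.

Lemma vlY (I : Type) (r : seq I) (P : pred I) (f : I -> Om) :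
  (forall i, P i -> f i != 0) ->
  v (\prod_(i <- r | P i) f i) = \sum_(i <- r | P i) v (f i).
Proof.
move=> f0; elim: r => [|i r IH]; first by rewrite !big_nil vl1.
rewrite !big_cons; case: ifP => // Pi; rewrite vlM ?IH ?f0 //.
by apply: (big_ind (fun x => x != 0)) => //; [exact: oner_neq0|move=> x y; exact: mulf_neq0].
Qed.

Lemma vge0 r : vge v r 0.
Proof. by rewrite /vge eqxx. Qed.

Lemma vgt0 r : vgt v r 0.
Proof. by rewrite /vgt eqxx. Qed.

Lemma vgeD r x y : vge v r x -> vge v r y -> vge v r (x + y).
Proof. exact: valuationD. Qed.

Lemma vgeN r x : vge v r x -> vge v r (- x).
Proof. by rewrite /vge oppr_eq0 vlN. Qed.

Lemma vgtN r x : vgt v r x -> vgt v r (- x).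
Proof. by rewrite /vgt oppr_eq0 vlN. Qed.

Lemma vgeB r x y : vge v r x -> vge v r y -> vge v r (x - y).
Proof. by move=> hx hy; apply/vgeD/vgeN. Qed.

Lemma vgeW r s x : s <= r -> vge v r x -> vge v s x.
Proof. by move=> sr h /h; apply: le_trans. Qed.

Lemma vgtW r x : vgt v r x -> vge v r x.
Proof. by move=> h /h /ltW. Qed.

Lemma vgt_le r s x : s <= r -> vgt v r x -> vgt v s x.
Proof. by move=> sr h /h; apply: le_lt_trans. Qed.

Lemma vge_gt r s x : s < r -> vge v r x -> vgt v s x.
Proof. by move=> sr h /h; apply: lt_le_trans. Qed.

Lemma vgtE r x : x != 0 -> vgt v r x -> r < v x.
Proof. by move=> x0 /(_ x0). Qed.

Lemma vge_refl x : vge v (v x) x.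
Proof. by move=> _. Qed.

Lemma vgtP r x : vgt v r x -> exists2 s, r < s & vge v s x.
Proof.
move=> h; have [->|x0] := eqVneq x 0.
  by exists (r + 1); [lra|exact: vge0].
by exists (v x); [exact: h|exact: vge_refl].
Qed.

Lemma vgtD r x y : vgt v r x -> vgt v r y -> vgt v r (x + y).
Proof.
move=> /vgtP[s rs hx] /vgtP[s' rs' hy].
apply: (@vge_gt (Num.min s s')); first by rewrite lt_min rs rs'.
by apply: vgeD; [apply: vgeW hx|apply: vgeW hy]; rewrite ge_min lexx ?orbT.
Qed.

Lemma vgtB r x y : vgt v r x -> vgt v r y -> vgt v r (x - y).
Proof. by move=> hx hy; apply/vgtD/vgtN. Qed.

Lemma vgeM r s x y : vge v r x -> vge v s y -> vge v (r + s) (x * y).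
Proof.
move=> hx hy; rewrite /vge mulf_eq0 negb_or => /andP[x0 y0].
by rewrite vlM // lerD ?hx ?hy.
Qed.

Lemma vgeM0 r x y : vge v 0 x -> vge v r y -> vge v r (x * y).
Proof. by move=> hx hy; rewrite -(add0r r); apply: vgeM. Qed.

Lemma vgtM r s x y : vge v r x -> vgt v s y -> vgt v (r + s) (x * y).
Proof.
move=> hx hy; rewrite /vgt mulf_eq0 negb_or => /andP[x0 y0].
by rewrite vlM // ler_ltD ?hx ?hy.
Qed.

Lemma vge_sum r (I : Type) (s : seq I) (P : pred I) (f : I -> Om) :
  (forall i, P i -> vge v r (f i)) -> vge v r (\sum_(i <- s | P i) f i).
Proof. by move=> hf; apply: big_ind => //; [exact: vge0|exact: vgeD]. Qed.

Lemma vgt_sum r (I : Type) (s : seq I) (P : pred I) (f : I -> Om) :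
  (forall i, P i -> vgt v r (f i)) -> vgt v r (\sum_(i <- s | P i) f i).
Proof. by move=> hf; apply: big_ind => //; [exact: vgt0|exact: vgtD]. Qed.

Lemma vge01 : vge v 0 1.
Proof. by rewrite /vge vl1. Qed.

Lemma vge_prod (I : Type) (s : seq I) (P : pred I) (f : I -> Om) :
  (forall i, P i -> vge v 0 (f i)) -> vge v 0 (\prod_(i <- s | P i) f i).
Proof. by move=> hf; apply: big_ind => //; [exact: vge01|move=> x y; exact: vgeM0]. Qed.

Lemma vgeX x n : vge v 0 x -> vge v 0 (x ^+ n).
Proof.
by move=> hx; elim: n => [|n IH]; [exact: vge01|rewrite exprS; apply: vgeM0].
Qed.

Lemma vl_dom x y : x != 0 -> vgt v (v x) y -> x + y != 0 /\ v (x + y) = v x.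
Proof.
move=> x0 hy; have xy0 : x + y != 0.
  apply: contraTneq isT => /eqP; rewrite addr_eq0 => /eqP E.
  by have := hy; rewrite /vgt -oppr_eq0 -E x0 => /(_ isT); rewrite E vlN ltxx.
split=> //; apply/le_anti/andP; split; last first.
  by apply: vgeD xy0; [exact: vge_refl|exact: vgtW].
rewrite leNgt; apply/negP => lt.
have : vgt v (v x) (x + y - y) by apply: vgtB hy => _.
by rewrite addrK => /(_ x0); rewrite ltxx.
Qed.

Lemma vge_unit x : x != 0 -> v x = 0 -> vge v 0 x.
Proof. by move=> _ vx _; rewrite vx. Qed.

(** Values are finite, so only 0 is arbitrarily small; this turns approximations into equalities. *)
Lemma vge_all0 x : (forall n : nat, vge v n%:R x) -> x = 0.
Proof.
move=> h; apply/eqP/negP => /negP x0.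
have := h (Num.Def.truncn `|v x|).+1 x0.
move/(le_trans)/(_ (ler_norm _)) => le.
have := truncnS_gt `|v x|; rewrite ltNge; move/negP; apply.
exact: le.
Qed.

Definition intpoly (q : {poly Om}) := forall i, vge v 0 q`_i.

Lemma vge_horner q x : intpoly q -> vge v 0 x -> vge v 0 q.[x].
Proof.
move=> hq hx; rewrite horner_coef; apply: vge_sum => i _.
by apply: vgeM0 => //; apply: vgeX.
Qed.

(** [x - y] divides [q.[x] - q.[y]] with an integral quotient. *)
Lemma vge_horner_sub q x y r : intpoly q -> vge v 0 x -> vge v 0 y ->
  vge v r (x - y) -> vge v r (q.[x] - q.[y]).
Proof.
move=> + hx hy hr; elim/poly_ind: q => [|q c IH] hq; first by rewrite !horner0 subrr; exact: vge0.
have hq' : intpoly q.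
  by move=> i; have := hq i.+1; rewrite coefD coefMX coefC /= addr0.
rewrite !hornerMXaddC.
have -> : q.[x] * x + c - (q.[y] * y + c) = x * (q.[x] - q.[y]) + q.[y] * (x - y) by ring.
by apply: vgeD; apply: vgeM0 => //; [exact: IH|exact: vge_horner].
Qed.

(* 1-units of level r *)
Definition oneu (r : rat) (x : Om) := [/\ x != 0, v x = 0 & vge v r (x - 1)].

Lemma oneuM r x y : oneu r x -> oneu r y -> oneu r (x * y).
Proof.
case=> x0 vx hx [y0 vy hy]; split; rewrite ?mulf_neq0 ?vlM ?vx ?vy ?addr0 //.
have -> : x * y - 1 = x * (y - 1) + (x - 1) by ring.
by apply: vgeD => //; apply: vgeM0 => //; apply: vge_unit.
Qed.

Lemma oneuV r x : oneu r x -> oneu r x^-1.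
Proof.
case=> x0 vx hx; split; rewrite ?invr_eq0 // ?vl_inv ?vx ?oppr0 //.
have -> : x^-1 - 1 = - (x^-1 * (x - 1)) by field.
apply: vgeN; apply: vgeM0 => //; apply: vge_unit; rewrite ?invr_eq0 //.
by rewrite vl_inv ?vx ?oppr0.
Qed.

Lemma oneu1 r : oneu r 1.
Proof. by split; rewrite ?oner_neq0 ?vl1 // subrr; exact: vge0. Qed.

Lemma oneuX r x n : oneu r x -> oneu r (x ^+ n).
Proof.
by move=> h; elim: n => [|n IH]; [exact: oneu1|rewrite exprS; apply: oneuM].
Qed.

Lemma oneuXz r x (z : int) : oneu r x -> oneu r (x ^ z).
Proof.
move=> h; case: z => n; first exact: oneuX.
by rewrite NegzE -exprnN; apply/oneuV/oneuX.
Qed.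

Lemma oneu_gt0 r x : 0 < r -> vge v r (x - 1) -> oneu r x.
Proof.
move=> r0 h; have h' : vgt v (v 1) (x - 1) by rewrite vl1; apply: vge_gt h.
have := vl_dom (oner_neq0 _) h'; have -> : 1 + (x - 1) = x by ring.
by rewrite vl1 => -[].
Qed.

End Valuation.

(** * Totally ramified actions of finite groups and the lower numbering *)

Section LocalAction.

Variables (Om : fieldType) (v : Om -> rat) (kk : Om -> Prop).

(** [kk] is a field of representatives of the residue field, as exists in equal characteristic. *)
Record coeff_field : Prop := CoeffField {
  cf_val : valuation v;
  cf_kk : subfld kk;
  cf_unit : forall c, kk c -> c != 0 -> v c = 0;
  cf_res : forall x, vge v 0 x -> exists2 c, kk c & vgt v 0 (x - c) }.

(** Models a totally ramified Galois extension of local fields without completing: [G] preserves [v]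
    and [kk] already contains all residues. Each [act g] is defined on [Om], but only its
    restriction to [L] is constrained. *)
Record tot (X : finGroupType) (G : {group X}) (act : X -> {rmorphism Om -> Om})
    (L : Om -> Prop) (pi : Om) : Prop := Tot {
  tot_L : subfld L;
  tot_kk : forall c, kk c -> L c;
  tot_stab : forall g x, g \in G -> L x -> L (act g x);
  tot_M : forall g h x, g \in G -> h \in G -> L x ->
    act (g * h)%g x = act g (act h x);
  tot_v : forall g x, g \in G -> L x -> v (act g x) = v x;
  tot_c : forall g c, g \in G -> kk c -> act g c = c;
  tot_pi : L pi;
  tot_pi0 : pi != 0;
  tot_vpi : 0 < v pi;
  tot_unif : forall x, L x -> x != 0 -> exists z : int, v x = z%:~R * v pi;
  tot_faith : forall g, g \in G -> (forall x, L x -> act g x = x) -> g = 1%g }.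

Hypothesis CF : coeff_field.
Let vV := cf_val CF.
Let Kf := cf_kk CF.

Lemma kk_int c : kk c -> vge v 0 c.
Proof. by move=> kc c0; rewrite (cf_unit CF). Qed.

Section OneAction.

Variables (X : finGroupType) (G : {group X}) (act : X -> {rmorphism Om -> Om}).
Variables (L : Om -> Prop) (pi : Om).
Hypothesis T : tot G act L pi.

Let Lf := tot_L T.
Let pi0 := tot_pi0 T.
Let Lpi := tot_pi T.
Let vpi := tot_vpi T.

Lemma pi_int : vge v 0 pi.
Proof. by move=> _; apply: ltW. Qed.

Lemma tot1 x : L x -> act 1%g x = x.
Proof.
move=> Lx; apply: (fmorph_inj (act 1%g)).
by rewrite -(tot_M T) ?mulg1.
Qed.

Lemma tot_nat x : L x -> vge v 0 x -> x != 0 -> exists n : nat, v x = n%:R * v pi.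
Proof.
move=> Lx hx x0; have [z vz] := tot_unif T Lx x0.
have := hx x0; rewrite vz pmulr_lge0 // ler0z => z0.
by exists `|z|%N; rewrite -{1}(gez0_abs z0).
Qed.

(** The truncated [pi]-adic expansion with digits in [kk], which replaces completeness: divide the
    remainder by [pi ^+ M] and subtract its residue. *)
Lemma tot_approx (M : nat) x : L x -> vge v 0 x ->
  exists2 q : {poly Om}, (forall i, kk q`_i) & vge v (M%:R * v pi) (x - q.[pi]).
Proof.
move=> Lx hx; elim: M => [|M [q kq hq]].
  exists 0; first by move=> i; rewrite coef0; exact: (subfld0 Kf).
  by rewrite mul0r horner0 subr0.
set y := x - q.[pi] in hq.
have Ly : L y.
  apply: (subfldB Lf) => //; apply: (subfld_horner Lf) => // i.
  exact: (tot_kk T).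
have pM0 : pi ^+ M != 0 by rewrite expf_neq0.
have hz : vge v 0 (y / pi ^+ M).
  rewrite /vge mulf_eq0 negb_or => /andP[y0 _].
  by rewrite (vl_div vV) // (vlX vV) // subr_ge0 hq.
have [c kc hc] := cf_res CF hz.
exists (q + c%:P * 'X^M).
  move=> i; rewrite coefD coefCM coefXn; apply: (subfldD Kf) => //.
  by apply: (subfldM Kf) => //; case: eqP => _; [exact: (subfld1 Kf)|exact: (subfld0 Kf)].
rewrite !hornerE opprD addrA -/y.
have -> : y - c * pi ^+ M = (y / pi ^+ M - c) * pi ^+ M by rewrite mulrBl divfK.
have Lz : L (y / pi ^+ M - c).
  by apply: (subfldB Lf); [apply: (subfld_div Lf) => //; apply: (subfldX Lf)|exact: (tot_kk T)].
rewrite /vge mulf_eq0 negb_or => /andP[z0 _].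
rewrite (vlM vV) // (vlX vV) // -nat1r mulrDl mul1r lerD2r.
have [n vn] := tot_nat Lz (vgtW hc) z0.
have := hc z0; rewrite vn pmulr_lgt0 // ltr0n => n0.
by rewrite ler_peMl ?ler1n //; exact: ltW.
Qed.

Lemma act_int g x : g \in G -> L x -> vge v 0 x -> vge v 0 (act g x).
Proof. by move=> Gg Lx hx; rewrite /vge fmorph_eq0 (tot_v T). Qed.

Lemma act_horner g (q : {poly Om}) x : g \in G -> (forall i, kk q`_i) -> act g q.[x] = q.[act g x].
Proof.
move=> Gg kq; rewrite -horner_map; congr horner.
by apply/polyP => i; rewrite coef_map /= (tot_c T).
Qed.

Lemma kk_intpoly (q : {poly Om}) : (forall i, kk q`_i) -> intpoly v q.
Proof. by move=> kq i; apply: kk_int. Qed.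

Lemma big_mult (r : rat) : exists M : nat, r <= M%:R * v pi.
Proof.
exists (Num.Def.truncn `|r / v pi|).+1.
rewrite -ler_pdivrMr //; apply: (le_trans (ler_norm _)).
exact/ltW/truncnS_gt.
Qed.

(** Up to a small error [x] is a polynomial in [pi] over [kk], and [act g pi - pi] divides the
    variation of such a polynomial. *)
Lemma act_sub_ge r g x : g \in G -> vge v r (act g pi - pi) -> L x -> vge v 0 x ->
  vge v r (act g x - x).
Proof.
move=> Gg hr Lx hx; have [M hM] := big_mult r.
have [q kq hq] := tot_approx M Lx hx.
have Lq : L q.[pi] by apply: (subfld_horner Lf) => // i; apply: (tot_kk T).
have -> : act g x - x = act g (x - q.[pi]) - (x - q.[pi]) + (act g q.[pi] - q.[pi]).
  by rewrite rmorphB /=; ring.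
apply: (vgeD vV); [apply: (vgeB vV)|].
- rewrite /vge fmorph_eq0 (tot_v T) //; last exact: (subfldB Lf).
  exact: (vgeW hM hq).
- exact: vgeW hM hq.
rewrite act_horner //; apply: vge_horner_sub => //; first exact: kk_intpoly.
  by apply: act_int => //; exact: pi_int.
exact: pi_int.
Qed.

(** [pi] generates the integers of [L] topologically, so an element fixing it moves integral
    elements by arbitrarily small amounts. *)
Lemma tot_pi_faith g : g \in G -> act g pi = pi -> g = 1%g.
Proof.
move=> Gg gpi; apply: (tot_faith T) => // x Lx.
have intP y : L y -> vge v 0 y -> act g y = y.
  move=> Ly hy; apply/eqP; rewrite -subr_eq0; apply/eqP.
  apply: (vge_all0 (v := v)) => n; apply: act_sub_ge => //.
  by rewrite gpi subrr; exact: vge0.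
have [x0|x0] := eqVneq x 0; first by rewrite x0 rmorph0.
have [h|h] := lerP 0 (v x); first by apply: intP.
apply: invr_inj; rewrite -fmorphV; apply: intP; first exact: (subfldV Lf).
by move=> _; rewrite (vl_inv vV) // oppr_ge0 ltW.
Qed.

(** Write [x] as a power of [pi] times a unit [e]; each factor is multiplied by a 1-unit of level
    [r]. *)
Lemma act_oneu r g x : 0 <= r -> g \in G -> vge v r (act g pi / pi - 1) ->
  L x -> x != 0 -> oneu v r (act g x / x).
Proof.
move=> r0 Gg hr Lx x0; have [z vz] := tot_unif T Lx x0.
pose e := x / pi ^ z.
have piz0 : pi ^ z != 0 by rewrite expfz_neq0.
have e0 : e != 0 by rewrite mulf_neq0 ?invr_eq0.
have Le : L e by apply: (subfld_div Lf) => //; apply: (subfldXz Lf).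
have ve : v e = 0 by rewrite (vl_div vV) // (vlXz vV) // vz subrr.
have ge0 : act g e != 0 by rewrite fmorph_eq0.
have gpi0 : act g pi != 0 by rewrite fmorph_eq0.
have -> : act g x / x = (act g pi / pi) ^ z * (act g e / e).
  rewrite /e fmorph_div fmorphXz /= expfzMl exprz_inv invfM invrK.
  rewrite -invr_expz.
  have h : act g pi ^ z != 0 by rewrite expfz_neq0.
  move: (act g pi ^ z) (pi ^ z) (act g x) h piz0 => a b c a0 b0.
  by field; rewrite ?a0 ?b0 ?x0.
apply: (oneuM vV).
  apply: (oneuXz vV); split=> //.
    by rewrite mulf_neq0 ?invr_eq0.
  by rewrite (vl_div vV) // (tot_v T) // subrr.
split; first by rewrite mulf_neq0 ?invr_eq0.
  by rewrite (vl_div vV) // (tot_v T) // subrr.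
have -> : act g e / e - 1 = e^-1 * (act g e - e) by field.
apply: vgeM0 => //; first by apply: vge_unit; rewrite ?invr_eq0 // (vl_inv vV) // ve oppr0.
apply: act_sub_ge => //; last by apply: vge_unit.
have -> : act g pi - pi = pi * (act g pi / pi - 1) by field.
by apply: vgeM0 => //; exact: pi_int.
Qed.

(** The largest [i] with [g] in the lower ramification group [G_i]. At [g = 1] the value is junk,
    because [v 0] is; hence the separate clause for 1 in [ram]. *)
Definition ram_w (g : X) : nat := `|numq (v (act g pi / pi - 1) / v pi)|%N.

Lemma ram_wP g : g \in G -> g != 1%g -> v (act g pi / pi - 1) = (ram_w g)%:R * v pi.
Proof.
move=> Gg g1.
have L1 : L (act g pi / pi - 1).
  by apply: (subfldB Lf); [apply: (subfld_div Lf) => //; exact: (tot_stab T)|exact: (subfld1 Lf)].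
have n0 : act g pi / pi - 1 != 0.
  rewrite subr_eq0; apply: contraNneq g1 => h; apply/eqP/tot_pi_faith => //.
  by rewrite -[LHS](divfK pi0) h mul1r.
have h0 : vge v 0 (act g pi / pi - 1).
  apply: (vgeB vV); last exact: vge01.
  by move=> _; rewrite (vl_div vV) ?fmorph_eq0 // (tot_v T) // subrr.
have [n vn] := tot_nat L1 h0 n0.
have vpi0 : v pi != 0 by rewrite lt0r_neq0.
by rewrite /ram_w vn mulfK // (numq_int n).
Qed.

Definition ram (i : nat) : {set X} := [set g in G | (g == 1%g) || (i <= ram_w g)%N].

Lemma ramP i g : g \in G -> g \in ram i <-> vge v (i%:R * v pi) (act g pi / pi - 1).
Proof.
move=> Gg; rewrite inE Gg /=; have [->|g1] /= := eqVneq g 1%g.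
  by rewrite (tot1 Lpi) divff // subrr; split=> // _; exact: vge0.
split=> [le _|h]; first by rewrite (ram_wP Gg g1) ler_pM2r // ler_nat.
have := h; rewrite /vge (ram_wP Gg g1) ler_pM2r // ler_nat; apply.
rewrite subr_eq0; apply: contraNneq g1 => h'; apply/eqP/tot_pi_faith => //.
by rewrite -[LHS](divfK pi0) h' mul1r.
Qed.

Lemma ram_oneu i g x : g \in ram i -> L x -> x != 0 -> oneu v (i%:R * v pi) (act g x / x).
Proof.
move=> gi Lx x0; have Gg : g \in G by move: gi; rewrite inE => /andP[].
by apply: act_oneu => //; [rewrite mulr_ge0 ?ler0n ?ltW|apply/ramP].
Qed.

Lemma ram_group_set i : group_set (ram i).
Proof.
apply/group_setP; split; first by rewrite inE group1 eqxx.
move=> g h gi hi.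
have Gg : g \in G by move: gi; rewrite inE => /andP[].
have Gh : h \in G by move: hi; rewrite inE => /andP[].
apply/ramP; rewrite ?groupM // (tot_M T) //.
have hpi0 : act h pi != 0 by rewrite fmorph_eq0.
have -> : act g (act h pi) / pi = (act g (act h pi) / act h pi) * (act h pi / pi) by field; rewrite hpi0 pi0.
have [_ _ ] := oneuM vV (ram_oneu gi (tot_stab T Gh Lpi) hpi0) (ram_oneu hi Lpi pi0).
by [].
Qed.

Canonical ram_group i := Group (ram_group_set i).

Lemma ram_sub i : ram i \subset G.
Proof. by apply/subsetP => g; rewrite inE => /andP[]. Qed.

Lemma ram0 : ram 0 = G.
Proof. by apply/setP => g; rewrite inE leq0n orbT andbT. Qed.

Lemma ram_le i j : (i <= j)%N -> ram j \subset ram i.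
Proof.
move=> ij; apply/subsetP => g; rewrite !inE => /andP[-> /=].
by case: eqP => //= _; apply: leq_trans.
Qed.

End OneAction.
End LocalAction.

(** * Residues and the graded pieces of the ramification filtration *)

Section Residue.

Variables (Om : fieldType) (v : Om -> rat) (kk : Om -> Prop).
Hypothesis CF : coeff_field v kk.
Let vV := cf_val CF.
Let Kf := cf_kk CF.

Definition res (x : Om) : Om :=
  match pselect (vge v 0 x) with
  | left h => projT1 (cid2 (cf_res CF h))
  | right _ => 0
  end.

Lemma resP x : vge v 0 x -> kk (res x) /\ vgt v 0 (x - res x).
Proof.
rewrite /res; case: pselect => // h _.
by case: cid2 => c kc hc /=.
Qed.

Lemma kk_small c : kk c -> vgt v 0 c -> c = 0.
Proof.
move=> kc h; apply/eqP/negP => /negP c0; have := h c0.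
by rewrite (cf_unit CF) // ltxx.
Qed.

Lemma res_uniq x c : kk c -> vgt v 0 (x - c) -> res x = c.
Proof.
move=> kc hc; have hx : vge v 0 x.
  have -> : x = (x - c) + c by ring.
  by apply: (vgeD vV); [exact: vgtW|exact: (kk_int CF)].
have [kr hr] := resP hx; apply/eqP; rewrite -subr_eq0; apply/eqP/kk_small.
  exact: (subfldB Kf).
have -> : res x - c = (x - c) - (x - res x) by ring.
exact: (vgtB vV).
Qed.

Lemma resM x y : vge v 0 x -> vge v 0 y -> res (x * y) = res x * res y.
Proof.
move=> hx hy; have [kx hrx] := resP hx; have [ky hry] := resP hy.
apply: res_uniq; first exact: (subfldM Kf).
have -> : x * y - res x * res y = x * (y - res y) + res y * (x - res x) by ring.
apply: (vgtD vV); rewrite -(addr0 0); apply: (vgtM vV) => //.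
exact: (kk_int CF).
Qed.

Lemma resD x y : vge v 0 x -> vge v 0 y -> res (x + y) = res x + res y.
Proof.
move=> hx hy; have [kx hrx] := resP hx; have [ky hry] := resP hy.
apply: res_uniq; first exact: (subfldD Kf).
have -> : x + y - (res x + res y) = (x - res x) + (y - res y) by ring.
exact: (vgtD vV).
Qed.

Lemma res_kk c : kk c -> res c = c.
Proof. by move=> kc; apply: res_uniq => //; rewrite subrr; apply: vgt0. Qed.

Lemma res_eq0 x : vge v 0 x -> res x = 0 <-> vgt v 0 x.
Proof.
move=> hx; split=> [r0|h]; first by have [_] := resP hx; rewrite r0 subr0.
by apply: res_uniq; [exact: (subfld0 Kf)|rewrite subr0].
Qed.

Lemma res_eq x y : vge v 0 x -> vgt v 0 (x - y) -> res x = res y.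
Proof.
move=> hx h; have [kx hr] := resP hx; symmetry; apply: res_uniq => //.
have -> : y - res x = (x - res x) - (x - y) by ring.
exact: (vgtB vV).
Qed.

End Residue.

Section Graded.

Variables (Om : fieldType) (v : Om -> rat) (kk : Om -> Prop).
Hypothesis CF : coeff_field v kk.
Let vV := cf_val CF.
Let Kf := cf_kk CF.
Variables (X : finGroupType) (G : {group X}) (act : X -> {rmorphism Om -> Om}).
Variables (L : Om -> Prop) (pi : Om).
Hypothesis T : tot v kk G act L pi.
Let Lf := tot_L T.
Let pi0 := tot_pi0 T.
Let Lpi := tot_pi T.
Let vpi := tot_vpi T.
Local Notation res := (res CF).
Local Notation ram := (ram v G act pi).

Lemma res_act g x : g \in G -> L x -> vge v 0 x -> res (act g x) = res x.
Proof.
move=> Gg Lx hx; have [kx hr] := resP CF hx; apply: res_uniq => //.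
rewrite -{1}(tot_c T Gg kx) -rmorphB /vgt fmorph_eq0 (tot_v T) //.
by apply: (subfldB Lf) => //; exact: (tot_kk T).
Qed.

Lemma gpi_neq0 g : act g pi != 0. Proof. by rewrite fmorph_eq0. Qed.

Lemma gpi_quoL g : g \in G -> L (act g pi / pi).
Proof. by move=> Gg; apply: (subfld_div Lf) => //; apply: (tot_stab T). Qed.

Lemma gpi_quov g : g \in G -> v (act g pi / pi) = 0.
Proof. by move=> Gg; rewrite (vl_div vV) ?gpi_neq0 // (tot_v T) // subrr. Qed.

Lemma gpi_quo_int g : g \in G -> vge v 0 (act g pi / pi).
Proof. by move=> Gg _; rewrite gpi_quov. Qed.

(** The tame character, with values in the multiplicative group of [kk] and kernel [G_1]. *)
Definition theta g := res (act g pi / pi).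

Lemma thetaM g h : g \in G -> h \in G -> theta (g * h)%g = theta g * theta h.
Proof.
move=> Gg Gh; rewrite /theta (tot_M T) //.
have -> : act g (act h pi) / pi = (act g pi / pi) * act g (act h pi / pi).
  by rewrite fmorph_div /=; field; rewrite gpi_neq0 pi0.
rewrite (resM CF); first last.
- by apply: (act_int T) => //; [exact: gpi_quoL|exact: gpi_quo_int].
- exact: gpi_quo_int.
by rewrite (res_act Gg) //; [exact: gpi_quoL|exact: gpi_quo_int].
Qed.

Lemma theta_kk g : g \in G -> kk (theta g).
Proof. by move=> Gg; have [] := resP CF (gpi_quo_int Gg). Qed.

Lemma theta_ram1 g : g \in G -> theta g = 1 <-> g \in ram 1.
Proof.
move=> Gg; have [kc hc] := resP CF (gpi_quo_int Gg).
rewrite (ramP CF T _ Gg) mul1r.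
have L1 : L (act g pi / pi - 1) by apply: (subfldB Lf); [exact: gpi_quoL|exact: (subfld1 Lf)].
split=> [t1|h].
  move: hc; rewrite -/(theta g) t1 => hc n0.
  have [n vn] := tot_nat T L1 (vgtW hc) n0.
  have := hc n0; rewrite vn pmulr_lgt0 // ltr0n => n_gt0.
  by rewrite ler_peMl ?ler1n //; exact: ltW.
by apply: res_uniq; [exact: (subfld1 Kf)|exact: vge_gt h].
Qed.

Lemma theta_neq0 g : g \in G -> theta g != 0.
Proof.
move=> Gg; apply/eqP => t0; have [_] := resP CF (gpi_quo_int Gg).
rewrite -/(theta g) t0 subr0 /vgt gpi_quov // ltxx => /(_ _).
by rewrite mulf_neq0 ?gpi_neq0 ?invr_eq0 // => /(_ isT).
Qed.

Lemma thetaX g n : g \in G -> theta (g ^+ n)%g = theta g ^+ n.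
Proof.
move=> Gg; elim: n => [|n IH].
  by rewrite expg0 expr0; apply/theta_ram1; rewrite ?inE ?group1 ?eqxx.
by rewrite expgS exprS thetaM ?groupX // IH.
Qed.

Lemma theta1 : theta 1%g = 1.
Proof. by apply/theta_ram1; rewrite ?inE ?group1 ?eqxx. Qed.

Lemma thetaV g : g \in G -> theta g^-1%g = (theta g)^-1.
Proof.
move=> Gg; apply: (mulfI (theta_neq0 Gg)).
by rewrite -thetaM ?groupV // mulgV theta1 divff // theta_neq0.
Qed.

(** For [i > 0], the embedding of [G_i / G_(i+1)] into the additive group of [kk]. *)
Definition grd i g := res ((act g pi / pi - 1) / pi ^+ i).

Lemma ramG i g : g \in ram i -> g \in G.
Proof. by rewrite inE => /andP[]. Qed.

Lemma ramM i g h : g \in ram i -> h \in ram i -> (g * h)%g \in ram i.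
Proof. exact: (@groupM _ (ram_group CF T i)). Qed.

Lemma ramX i g n : g \in ram i -> (g ^+ n)%g \in ram i.
Proof. exact: (@groupX _ (ram_group CF T i)). Qed.

Lemma ramV i g : g \in ram i -> g^-1%g \in ram i.
Proof. by move=> gi; rewrite (@groupV _ (ram_group CF T i)). Qed.

Lemma ram_1 i : 1%g \in ram i.
Proof. exact: (@group1 _ (ram_group CF T i)). Qed.

Lemma grd_L i g : g \in G -> L ((act g pi / pi - 1) / pi ^+ i).
Proof.
move=> Gg; apply: (subfld_div Lf); last exact: (subfldX Lf).
by apply: (subfldB Lf); [exact: gpi_quoL|exact: (subfld1 Lf)].
Qed.

Lemma vge_divX r i x : vge v r x -> vge v (r - i%:R * v pi) (x / pi ^+ i).
Proof.
move=> h; apply: (vgeM vV) => //.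
by move=> _; rewrite (vl_inv vV) ?expf_neq0 // (vlX vV).
Qed.

Lemma grd_int i g : g \in ram i -> vge v 0 ((act g pi / pi - 1) / pi ^+ i).
Proof.
move=> gi; have Gg := ramG gi; rewrite -(subrr (i%:R * v pi)).
by apply: vge_divX; apply/(ramP CF T).
Qed.

Lemma ram_act_ge i g x : g \in ram i -> L x -> vge v 0 x ->
  vge v (i.+1%:R * v pi) (act g x - x).
Proof.
move=> gi Lx hx; have Gg := ramG gi; apply: (act_sub_ge CF T) => //.
have -> : act g pi - pi = (act g pi / pi - 1) * pi by field.
rewrite -addn1 natrD mulrDl mul1r; apply: (vgeM vV) => //.
exact/(ramP CF T).
Qed.

Lemma grd_eq0 i g : g \in ram i -> grd i g = 0 <-> g \in ram i.+1.
Proof.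
move=> gi; have Gg := ramG gi; rewrite /grd res_eq0; last exact: grd_int.
rewrite (ramP CF T _ Gg); split=> [h n0|h].
  have n0' : (act g pi / pi - 1) / pi ^+ i != 0 by rewrite mulf_neq0 ?invr_eq0 ?expf_neq0.
  have [n vn] := tot_nat T (grd_L i Gg) (vgtW h) n0'.
  have := h n0'; rewrite vn pmulr_lgt0 // ltr0n => n_gt0.
  move: vn; rewrite (vl_div vV) ?expf_neq0 // (vlX vV) // => /eqP.
  rewrite subr_eq => /eqP ->; rewrite -mulrDl ler_pM2r // -natrD ler_nat.
  by rewrite addnC -addn1 leq_add2l.
have := @vge_divX _ i _ h; rewrite -addn1 natrD mulrDl mul1r addrAC subrr add0r.
exact: vge_gt.
Qed.

(** The defect of additivity is a sum of two terms, of order at least [i + 1] and [2 i] in [pi]; the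
    second is negligible because [i] is positive. *)
Lemma grdM i g h : (0 < i)%N -> g \in ram i -> h \in ram i ->
  grd i (g * h)%g = grd i g + grd i h.
Proof.
move=> i_gt0 gi hi; have Gg := ramG gi; have Gh := ramG hi.
rewrite /grd -(resD CF); [|exact: grd_int|exact: grd_int].
apply: (res_eq CF); first by apply: grd_int; exact: ramM.
rewrite (tot_M T) //.
set a := act h pi / pi.
have ha : oneu v (i%:R * v pi) a by apply: (ram_oneu CF T).
have La : L a by apply: gpi_quoL.
have -> : (act g (act h pi) / pi - 1) / pi ^+ i - ((act g pi / pi - 1) / pi ^+ i + (act h pi / pi - 1) / pi ^+ i)
  = ((act g pi / pi) * (act g a - a) + (act g pi / pi - 1) * (a - 1)) / pi ^+ i.
  rewrite /a fmorph_div /=; field; rewrite pi0 gpi_neq0 /=.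
  by rewrite expf_neq0.
have [a0 va ha1] := ha.
apply: (@vge_gt _ _ (i.+1%:R * v pi - i%:R * v pi)).
  by rewrite -mulrBl -natrB // subSnn mul1r.
apply: vge_divX; apply: (vgeD vV).
  apply: (vgeM0 vV); first exact: gpi_quo_int.
  by apply: ram_act_ge => //; apply: vge_unit.
apply: (@vgeW _ _ (i%:R * v pi + i%:R * v pi)).
  by rewrite -mulrDl ler_pM2r // -natrD ler_nat -addn1 leq_add2l.
by apply: (vgeM vV) => //; apply/(ramP CF T).
Qed.

Lemma grdX i g n : (0 < i)%N -> g \in ram i -> grd i (g ^+ n)%g = grd i g *+ n.
Proof.
move=> i_gt0 gi; elim: n => [|n IH].
  by rewrite expg0 mulr0n; apply/grd_eq0; exact: ram_1.
by rewrite expgS mulrS grdM ?IH //; exact: ramX.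
Qed.

Lemma grd1 i : grd i 1%g = 0.
Proof. by apply/grd_eq0; exact: ram_1. Qed.

Lemma grdV i g : (0 < i)%N -> g \in ram i -> grd i g^-1%g = - grd i g.
Proof.
move=> i_gt0 gi; apply/eqP; rewrite -addr_eq0 -grdM ?mulVg ?grd1 //; exact: ramV.
Qed.

Lemma act_conj c g : c \in G -> g \in G ->
  act (c * g * c^-1)%g pi / pi - 1 = act c (act g (act c^-1%g pi) / act c^-1%g pi - 1).
Proof.
move=> Gc Gg; have LV : L (act c^-1%g pi) by apply: (tot_stab T); rewrite ?groupV.
have GV : c^-1%g \in G by rewrite groupV.
rewrite (tot_M T) ?groupM // (tot_M T) //.
by rewrite rmorphB rmorph1 fmorph_div /= -(tot_M T Gc GV Lpi) mulgV (tot1 T).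
Qed.

Lemma ramJ i c g : c \in G -> g \in ram i -> (c * g * c^-1)%g \in ram i.
Proof.
move=> Gc gi; have Gg := ramG gi; apply/(ramP CF T); rewrite ?groupM ?groupV //.
have LV : L (act c^-1%g pi) by apply: (tot_stab T); rewrite ?groupV.
have [_ _ h] := ram_oneu CF T gi LV (gpi_neq0 _).
rewrite act_conj // /vge fmorph_eq0 (tot_v T) //.
apply: (subfldB Lf); last exact: (subfld1 Lf).
by apply: (subfld_div Lf) => //; apply: (tot_stab T).
Qed.

(** The conjugate moves [pi] as [g] moves the uniformiser [b = c^-1 pi], up to [act c], which is
    trivial on residues. Replacing [b ^+ i] by [pi ^+ i] produces the factor [theta c ^+ i]. *)
Lemma grdJ i c g : (0 < i)%N -> c \in G -> g \in ram i ->
  grd i (c * g * c^-1)%g = theta c ^+ i * grd i g.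
Proof.
move=> i_gt0 Gc gi; have Gg := ramG gi; rewrite /grd act_conj //.
set b := act c^-1%g pi.
have Lb : L b by apply: (tot_stab T); rewrite ?groupV.
have b0 : b != 0 by exact: gpi_neq0.
have vb : v b = v pi by rewrite (tot_v T) ?groupV.
have cb : act c b = pi by rewrite -(tot_M T) ?groupV // mulgV (tot1 T).
set e := b / pi; have Le : L e by apply: (subfld_div Lf).
have ve : v e = 0 by rewrite (vl_div vV) // vb subrr.
have e0 : e != 0 by rewrite mulf_neq0 ?invr_eq0.
have ->: res (act c (act g b / b - 1) / pi ^+ i) =
   res (act c ((act g b / b - 1) / b ^+ i)).
  by rewrite !fmorph_div rmorphXn /= cb.
have hgb : vge v (i%:R * v pi) (act g b / b - 1) by have [] := ram_oneu CF T gi Lb b0.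
have LL : L ((act g b / b - 1) / b ^+ i).
  apply: (subfld_div Lf); last exact: (subfldX Lf).
  apply: (subfldB Lf); last exact: (subfld1 Lf).
  by apply: (subfld_div Lf) => //; apply: (tot_stab T).
have hi : vge v 0 ((act g b / b - 1) / b ^+ i).
  rewrite -(subrr (i%:R * v pi)); apply: (vgeM vV) => // _.
  by rewrite (vl_inv vV) ?expf_neq0 // (vlX vV) // vb.
rewrite (res_act Gc) //.
(* In the numerator the uniformiser may be changed freely: [e = b / pi] is a unit, which [g] moves
   only to order [i + 1]. *)
have sc : vgt v 0 ((act g b / b - 1) / b ^+ i - (act g pi / pi - 1) / b ^+ i).
  have -> : (act g b / b - 1) / b ^+ i - (act g pi / pi - 1) / b ^+ i =
    (act g pi / pi) * (e^-1 * (act g e - e)) / b ^+ i.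
    have bi0 : b ^+ i != 0 by rewrite expf_neq0.
    have gb0 : act g b != 0 by rewrite fmorph_eq0.
    rewrite /e fmorph_div /=; move: (act g b) (act g pi) (gpi_neq0 g) (b ^+ i) bi0 gb0.
    by move=> x y y0 z z0 x0; field; rewrite ?y0 ?z0 ?pi0 ?b0.
  apply: (@vge_gt _ _ (i.+1%:R * v pi - i%:R * v pi)).
    by rewrite -mulrBl -natrB // subSnn mul1r.
  apply: (vgeM vV); last first.
    by move=> _; rewrite (vl_inv vV) ?expf_neq0 // (vlX vV) // vb.
  apply: (vgeM0 vV); first exact: gpi_quo_int.
  apply: (vgeM0 vV); first by move=> _; rewrite (vl_inv vV) // ve oppr0.
  by apply: ram_act_ge => //; apply: vge_unit.
rewrite (res_eq CF hi sc).
have -> : (act g pi / pi - 1) / b ^+ i = (act c pi / pi) ^+ i * ((act g pi / pi - 1) / pi ^+ i)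
   + ((act g pi / pi - 1) / pi ^+ i) * ((pi / b) ^+ i - (act c pi / pi) ^+ i).
  have h1 : pi ^+ i != 0 by rewrite expf_neq0.
  have h2 : b ^+ i != 0 by rewrite expf_neq0.
  rewrite !expr_div_n; field.
  by rewrite h1 h2.
have hcp : vge v 0 (act c pi / pi) by exact: gpi_quo_int.
have hpb : vge v 0 (pi / b) by move=> _; rewrite (vl_div vV) // vb subrr.
have close : vgt v 0 ((pi / b) - (act c pi / pi)).
  (* [pi / b] maps to [act c pi / pi] under [act c], which is trivial on residues *)
  have Lpb : L (pi / b) by apply: (subfld_div Lf).
  have [kr hr] := resP CF hpb; have [kr' hr'] := resP CF hcp.
  have e1 : res (pi / b) = res (act c pi / pi).
    by rewrite -(res_act Gc Lpb hpb) fmorph_div /= cb.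
  have -> : pi / b - act c pi / pi = (pi / b - res (pi / b)) - (act c pi / pi - res (act c pi / pi)).
    by rewrite e1; ring.
  exact: (vgtB vV).
have closeX : vgt v 0 ((pi / b) ^+ i - (act c pi / pi) ^+ i).
  rewrite subrXX -(addr0 0) mulrC; apply: (vgtM vV) => //.
  apply: (vge_sum vV) => j _; apply: (vgeM0 vV); exact: (vgeX vV).
have hsg := grd_int gi.
rewrite (resD CF); first last.
- by apply: (vgeM0 vV) => //; apply: vgtW.
- by apply: (vgeM0 vV) => //; exact: (vgeX vV).
have -> : res ((act g pi / pi - 1) / pi ^+ i * ((pi / b) ^+ i - (act c pi / pi) ^+ i)) = 0.
  apply/res_eq0; first by apply: (vgeM0 vV) => //; apply: vgtW.
  by rewrite -(addr0 0); apply: (vgtM vV).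
rewrite addr0 (resM CF) //; last exact: (vgeX vV).
congr (_ * _); elim: (i) => [|j IH]; first by rewrite !expr0 (res_kk CF) //; exact: (subfld1 Kf).
by rewrite !exprS (resM CF) ?IH //; exact: (vgeX vV).
Qed.

End Graded.

Lemma coset_reprX (gT : finGroupType) (H : {group gT}) (x : coset_of H) n :
  coset H (repr x ^+ n)%g = (x ^+ n)%g.
Proof.
have Nx : repr x \in 'N(H)%g by exact: repr_coset_norm.
elim: n => [|n IH]; first by rewrite !expg0 morph1.
by rewrite !expgS coset_morphM ?groupX // IH coset_reprK.
Qed.

(** * Wild and tame inertia; divisibility by the tame index *)

Section RamGroups.

Variables (Om : fieldType) (v : Om -> rat) (kk : Om -> Prop).
Hypothesis CF : coeff_field v kk.
Variables (p : nat) (Hp : p \in [pchar Om]).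
Variables (X : finGroupType) (G : {group X}) (act : X -> {rmorphism Om -> Om}).
Variables (L : Om -> Prop) (pi : Om).
Hypothesis T : tot v kk G act L pi.
Local Notation ram := (ram v G act pi).
Local Notation rg := (ram_group CF T).
Local Notation theta := (theta CF act pi).
Local Notation grd := (grd CF act pi).

Let p_pr : prime p := pcharf_prime Hp.

Lemma ram_normal i : (rg i <| G)%g.
Proof.
rewrite /normal ram_sub; apply/subsetP => c Gc.
rewrite inE; apply/subsetP => _ /imsetP[g gi ->].
rewrite conjgE mulgA -{2}(invgK c); apply: (ramJ CF T) => //; first by rewrite groupV.
Qed.

Lemma ram_trivial : exists B, ram B = 1%g.
Proof.
exists (\max_(g in G) ram_w v act pi g).+1; apply/eqP.
rewrite eqEsubset sub1set (ram_1 CF T) andbT.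
apply/subsetP => g; rewrite !inE => /andP[Gg /orP[//|]].
by rewrite ltnNge (leq_bigmax_cond (F := ram_w v act pi)).
Qed.

Lemma ram_Xp i g : (0 < i)%N -> g \in ram i -> (g ^+ p)%g \in ram i.+1.
Proof.
move=> i_gt0 gi; apply: (iffLR (grd_eq0 CF T (ramX CF T p gi))).
by rewrite (grdX CF T) // -mulr_natr (pcharf0 Hp) mulr0.
Qed.

(** Taking [p]-th powers climbs the filtration, as the graded pieces are killed by [p]. *)
Lemma ram1_pgroup : (p.-group (rg 1))%g.
Proof.
apply/pgroupP => q q_pr qd; have [x xr ox] := Cauchy q_pr qd.
have xn n : (x ^+ (p ^ n))%g \in ram n.+1.
  elim: n => [|n IH]; first by rewrite expn0 expg1.
  by rewrite expnSr expgM; apply: ram_Xp.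
have [B rB] := ram_trivial.
have : (x ^+ (p ^ B))%g \in ram B.
  by apply: (subsetP _ _ (xn B)); apply: ram_le.
rewrite rB => /set1P/eqP; rewrite -order_dvdn ox Euclid_dvdX // dvdn_prime2 //.
by case/andP=> /eqP -> _; rewrite inE.
Qed.

Lemma repr_quo (H : {group X}) x : H \subset G -> x \in (G / H)%g -> repr x \in G.
Proof.
move=> sHG /morphimP[g Ng Gg ->]; rewrite val_coset //.
have /rcosetP[h Hh ->] := mem_repr_rcoset H g.
by rewrite groupM // (subsetP sHG).
Qed.

(** [theta] embeds the quotient in the multiplicative group of a field. *)
Lemma tame_cyclic : cyclic (G / rg 1).
Proof.
have nR := ram_normal 1; have sR := normal_sub nR.
pose f (x : coset_of (rg 1)) := theta (repr x).
have fM : {in (G / rg 1)%g &, {morph f : x y / (x * y)%g >-> x * y}}.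
  move=> x y Gx Gy; pose z : coset_of (rg 1) := (x * y)%g; rewrite -/z /f.
  have rx := repr_quo sR Gx; have ry := repr_quo sR Gy.
  have rxy := repr_quo sR (groupM Gx Gy : z \in (G / rg 1)%g).
  rewrite -(thetaM CF T) //.
  have Nx := subsetP (normal_norm nR) _ rx.
  have Ny := subsetP (normal_norm nR) _ ry.
  have Nxy := subsetP (normal_norm nR) _ rxy.
  have E : coset (rg 1) (repr z) = coset (rg 1) (repr x * repr y)%g.
    by rewrite (coset_morphM Nx Ny) !coset_reprK.
  have [h hr ->] : exists2 h, h \in rg 1 & repr z = (h * (repr x * repr y))%g.
    have := introT (rcoset_kercosetP Nxy (groupM Nx Ny)) E.
    by case/rcosetP => h; exists h.
  rewrite (thetaM CF T) ?groupM //; last exact: (subsetP sR).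
  suff -> : theta h = 1 by rewrite mul1r.
  by apply/(theta_ram1 CF T) => //; exact: (subsetP sR).
apply: (field_mul_group_cyclic fM) => x Gx; rewrite /f.
have rx := repr_quo sR Gx.
rewrite (theta_ram1 CF T rx); split=> [h|->].
  by rewrite -(coset_reprK x); apply/coset_id.
by rewrite repr_coset1 (ram_1 CF T).
Qed.

(** In characteristic [p] the only [p]-th root of unity is 1. *)
Lemma tame_coprime : coprime p #|G : rg 1|%g.
Proof.
have nR := ram_normal 1; have sR := normal_sub nR.
rewrite prime_coprime // -card_quotient ?normal_norm //; apply/negP => pd.
have [x Gx ox] := Cauchy p_pr pd.
have rx := repr_quo sR Gx.
have Nx := subsetP (normal_norm nR) _ rx.
have : coset (rg 1) (repr x ^+ p)%g = 1%g.
  by rewrite coset_reprX -ox expg_order.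
move/coset_idr => /(_ (groupX _ Nx)) /= h.
have : theta (repr x ^+ p)%g = 1 by apply/(theta_ram1 CF T) => //; exact: groupX.
rewrite (thetaX CF T) // => h1.
have : (theta (repr x) - 1) ^+ p = 0.
  by rewrite -(pFrobenius_autE Hp) pFrobenius_autB_comm ?pFrobenius_autE ?h1 ?expr1n ?subrr //; exact: commr1.
move/eqP; rewrite expf_eq0 subr_eq0 => /andP[_ /eqP /(theta_ram1 CF T rx) h2].
have : x = 1%g by rewrite -(coset_reprK x); apply/coset_id.
by move=> x1; move: ox; rewrite x1 order1 => p1; move: p_pr; rewrite -p1.
Qed.

(** The kernel of the character by which [G] acts on the [i]-th graded piece ([grdJ]). *)
Definition ker_thetaX i : {set X} := [set g in G | theta g ^+ i == 1].

Lemma ker_thetaX_group_set i : group_set (ker_thetaX i).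
Proof.
apply/group_setP; split; first by rewrite inE group1 (theta1 CF T) expr1n eqxx.
move=> g h; rewrite !inE => /andP[Gg /eqP gi] /andP[Gh /eqP hi].
by rewrite groupM // (thetaM CF T) // exprMn gi hi mulr1 eqxx.
Qed.
Canonical ker_thetaX_group i := Group (ker_thetaX_group_set i).
Local Notation ktg := ker_thetaX_group.

Lemma ker_thetaX_normal i : (ktg i <| G)%g.
Proof.
have sK : ktg i \subset G by apply/subsetP => g; rewrite inE => /andP[].
rewrite /normal sK; apply/subsetP => c Gc.
rewrite inE; apply/subsetP => _ /imsetP[g + ->].
rewrite !inE => /andP[Gg /eqP gi]; rewrite groupJ //= conjgE.
rewrite !(thetaM CF T) ?groupM ?groupV // (thetaV CF T) //.
by rewrite mulrC -mulrA divff ?(theta_neq0 CF T) // mulr1 gi.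
Qed.

(** The order of the cyclic group [theta(G)] divides [i] times the order of its image under [i]-th
    powers. *)
Lemma tame_dvd_ker i : (#|G : rg 1|%g %| i * #|G : ktg i|%g)%N.
Proof.
have nR := ram_normal 1; have sR := normal_sub nR.
have /cyclicP[x Gx] := tame_cyclic.
rewrite -card_quotient ?normal_norm // Gx.
have xG : x \in (G / rg 1)%g by rewrite Gx cycle_id.
have rx := repr_quo sR xG.
have Nx := subsetP (normal_norm nR) _ rx.
have nK := ker_thetaX_normal i.
have NKx := subsetP (normal_norm nK) _ rx.
have : (repr x ^+ #|G : ktg i|)%g \in ktg i.
  apply: coset_idr; first exact: groupX.
  rewrite morphX // -card_quotient ?normal_norm //.
  by apply: expg_cardG; apply: mem_quotient.
rewrite inE => /andP[_]; rewrite (thetaX CF T) // -exprM mulnC => /eqP.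
rewrite -(thetaX CF T) // => /(theta_ram1 CF T (groupX _ rx)) h.
change (#[x]%g %| i * #|G : ktg i|%g)%N; rewrite order_dvdn; apply/eqP.
rewrite -coset_reprX; apply/coset_id; exact: h.
Qed.

(** [G] acts by conjugation on the difference set. By [grdJ] a stabiliser lies in the kernel of
    [theta^i], since multiplication by [theta c ^+ i] fixes a nonzero graded value, so each orbit
    has length divisible by the index. *)
Lemma ker_index_dvd i : (0 < i)%N -> (#|G : ktg i|%g %| #|ram i| - #|ram i.+1|)%N.
Proof.
move=> i_gt0.
have sub : ram i.+1 \subset ram i by exact: ram_le.
rewrite -cardsDS //.
have actsD : [acts G, on ram i :\: ram i.+1 | 'J].
  apply/actsP => c Gc g; rewrite /= !inE.
  have E j : ((g ^ c)%g \in rg j) = (g \in rg j).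
    by apply: memJ_norm; apply: (subsetP (normal_norm (ram_normal j))).
  by have := E i; have := E i.+1; rewrite !inE => -> ->.
rewrite -(acts_sum_card_orbit actsD).
apply: dvdn_sum => _ /imsetP[g gD ->]; rewrite card_orbit.
have sC : 'C_G[g | 'J]%g \subset ktg i.
  apply/subsetP => c; rewrite astab1J => /setIP[Gc /cent1P cg].
  move: gD; rewrite inE => /andP[ng gi].
  rewrite inE Gc /=.
  have := grdJ CF T i_gt0 Gc gi.
  have -> : (c * g * c^-1)%g = g by rewrite cg mulgK.
  have s0 : grd i g != 0.
    by apply: contraNneq ng => s0; exact: (iffLR (grd_eq0 CF T gi)).
  by rewrite -{1}(mul1r (grd i g)) => /(mulIf s0) ->.
by rewrite -(Lagrange_index (normal_sub (ker_thetaX_normal i)) sC) dvdn_mulr.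
Qed.

(** [|G| phi(k)], where phi is Herbrand's function. *)
Definition ramsum (k : nat) : nat := (\sum_(1 <= i < k.+1) #|ram i|)%N.

(** Summation by parts: [ramsum k - k |G_k|] is the sum over [i < k] of [i (|G_i| - |G_(i+1)|)], and
    each term is a multiple of the tame index by [tame_dvd_ker] and [ker_index_dvd]. *)
Lemma ramsum_tame k : exists c, ramsum k = (c * #|G : rg 1|%g + k * #|ram k|)%N.
Proof.
rewrite /ramsum; elim: k => [|k [c IH]]; first by exists 0%N; rewrite big_geq.
rewrite big_nat_recr //= IH.
have [k0|k_gt0] := posnP k.
  by exists c; rewrite k0 mul0n mul1n addn0.
have /dvdnP[d dE] : (#|G : rg 1|%g %| k * (#|ram k| - #|ram k.+1|))%N.
  by apply: (dvdn_trans (tame_dvd_ker k)); apply: dvdn_mul => //; exact: ker_index_dvd.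
have le : (#|ram k.+1| <= #|ram k|)%N by apply/subset_leq_card/ram_le.
exists (c + d)%N; rewrite mulnDl -dE mulnBr mulSn.
have := leq_mul (leqnn k) le.
by move: (c * _)%N (k * #|ram k|)%N (k * #|ram k.+1|)%N (#|ram k.+1|) => x y z w; lia.
Qed.

(** The index of the kernel of [theta^k] supplies what the remaining term [k * #|ram k|] lacks. In
    [local_bound_irr] this index divides the number of isotypic components. *)
Lemma ramsum_dvd k : (#|G : rg 1|%g %| #|G : ktg k|%g * ramsum k)%N.
Proof.
have [c ->] := ramsum_tame k; rewrite mulnDr dvdn_add //.
  by rewrite mulnA dvdn_mull.
by rewrite mulnA (mulnC _ k) dvdn_mulr // tame_dvd_ker.
Qed.

Lemma card_tame : (#|G| = #|G : rg 1|%g * #|rg 1|)%N.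
Proof. by rewrite mulnC Lagrange //; apply: ram_sub. Qed.

End RamGroups.

(** * Fixed fields: uniformisers, displacements of norms, quotient actions *)

Section DividedDifference.

Variables (Om : fieldType) (v : Om -> rat) (vV : valuation v).

(** The [d]-th divided difference of a monic polynomial of degree [d] is 1, and each of the [d]
    divisions by a difference of points costs at most [B]. *)
Lemma monic_small_values (B r : rat) d (q : {poly Om}) (s : seq Om) :
  q \is monic -> size q = d.+1 -> size s = d.+1 -> uniq s ->
  (forall x y, x \in s -> y \in s -> x != y -> v (x - y) <= B) ->
  (forall x, x \in s -> vge v r q.[x]) -> r <= d%:R * B.
Proof.
elim: d q s r => [|d IH] q s r mq sq ss us hB hq.
  case: s ss us hB hq => [//|x s] _ _ _ /(_ x (mem_head _ _)).
  have -> : q = 1 by rewrite (size1_polyC (eq_leq sq)); move: mq; rewrite qualifE /= /lead_coef sq => /eqP ->.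
  by rewrite hornerE mul0r /vge (vl1 vV) oner_neq0 => /(_ isT).
case: s ss us hB hq => [//|x s] [ss] /andP[xs us] hB hq.
have /factor_theorem[q1 Eq] : root (q - q.[x]%:P) x by rewrite rootE !hornerE subrr.
have szC : (size (- q.[x]%:P) < size q)%N.
  by rewrite size_polyN (leq_ltn_trans (size_polyC_leq1 _)) // sq.
have mqq : q - q.[x]%:P \is monic by rewrite qualifE /= lead_coefDl.
have sqq : size (q - q.[x]%:P) = d.+2 by rewrite size_polyDl.
have mq1 : q1 \is monic.
  by move: mqq; rewrite Eq monicMr // monicXsubC.
have sq1 : size q1 = d.+1.
  have := sqq; rewrite Eq size_Mmonic ?monic_neq0 ?monicXsubC // size_XsubC addn2.
  by case.
have sub y : y \in s -> y \in x :: s by rewrite inE => ->; rewrite orbT.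
suff : r - B <= d%:R * B by rewrite -natr1 mulrDl mul1r lerBlDr.
apply: (IH q1 s) => // [y z ys zs|y ys].
- by apply: hB; apply: sub.
- have yx0 : y - x != 0 by rewrite subr_eq0; apply: contraNneq xs => <-.
  have E : q.[y] - q.[x] = q1.[y] * (y - x).
    by have := congr1 (fun f => f.[y]) Eq; rewrite !hornerE.
  have -> : q1.[y] = (q.[y] - q.[x]) / (y - x) by rewrite E mulfK.
  apply: (vgeM vV).
    by apply: (vgeB vV); apply: hq; rewrite ?mem_head // sub.
  move=> _; rewrite (vl_inv vV) // lerN2; apply: hB; rewrite ?mem_head ?sub //.
  by rewrite -subr_eq0.
Qed.

End DividedDifference.

Section FixedField.

Variables (Om : fieldType) (v : Om -> rat) (kk : Om -> Prop).
Hypothesis CF : coeff_field v kk.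
Let vV := cf_val CF.
Let Kf := cf_kk CF.
Variables (X : finGroupType) (G : {group X}) (act : X -> {rmorphism Om -> Om}).
Variables (L : Om -> Prop) (pi : Om).
Hypothesis T : tot v kk G act L pi.
Let Lf := tot_L T.
Let pi0 := tot_pi0 T.
Let Lpi := tot_pi T.
Let vpi := tot_vpi T.

Lemma tot_subgroup (H : {group X}) : H \subset G -> tot v kk H act L pi.
Proof.
move=> /subsetP sHG; case: T => *; split=> //; eauto.
Qed.

Lemma act_pi_inj : {in G &, injective (fun g => act g pi)}.
Proof.
move=> g h Gg Gh /= E; have GV : (h^-1 * g)%g \in G by rewrite groupM ?groupV.
suff /eqP : (h^-1 * g)%g = 1%g by rewrite -eq_mulVg1 => /eqP.
apply: (tot_pi_faith CF T) => //.
by rewrite (tot_M T) ?groupV // E -(tot_M T) ?groupV // mulVg (tot1 T).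
Qed.

Lemma orbit_gap : exists B : rat, forall g h, g \in G -> h \in G -> act g pi != act h pi ->
  v (act g pi - act h pi) <= B.
Proof.
exists (\sum_(x in G) \sum_(y in G) `|v (act x pi - act y pi)|) => g h Gg Gh _.
rewrite (bigD1 g) //= (bigD1 h) //=.
apply: (le_trans (ler_norm _)); rewrite -addrA lerDl addr_ge0 ?sumr_ge0 //.
by move=> i _; apply: sumr_ge0.
Qed.

Section FixedGap.

Variables (y : Om) (w : nat).
Hypotheses (Ly : L y) (y0 : y != 0) (w_gt0 : (0 < w)%N).
Hypothesis fy : forall g, g \in G -> act g y = y.
Hypothesis vy : v y = w%:R * v pi.

(* A monic polynomial of degree [w], with coefficients in [kk[y]], which is
   arbitrarily small at [pi]: this plays the role of the minimal polynomial. *)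
Lemma fixed_approx (M : nat) : exists q : {poly Om},
  [/\ q \is monic, size q = w.+1, forall i, L q`_i,
      forall g i, g \in G -> act g q`_i = q`_i & vge v ((w + M)%:R * v pi) q.[pi]].
Proof.
elim: M => [|M [q [mq sq Lq fq hq]]].
  exists 'X^w; split; rewrite ?monicXn ?size_polyXn //.
  - move=> i; rewrite coefXn; case: eqP => _; [exact: (subfld1 Lf)|exact: (subfld0 Lf)].
  - by move=> g i Gg; rewrite coefXn; case: eqP => _; rewrite ?rmorph0 ?rmorph1.
  - by rewrite hornerXn addn0 => _; rewrite (vlX vV).
(* [z] has exactly the value to be cancelled, and its exponent in [pi] is below [w], so the
   correction leaves the polynomial monic of degree [w]. *)
pose a := ((w + M) %/ w)%N; pose b := ((w + M) %% w)%N.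
pose z := pi ^+ b * y ^+ a.
have z0 : z != 0 by rewrite mulf_neq0 ?expf_neq0.
have vz : v z = (w + M)%:R * v pi.
  rewrite (vlM vV) ?expf_neq0 // !(vlX vV) // vy mulrA -natrM -mulrDl -natrD.
  by rewrite addnC -divn_eq.
have Lz : L z by apply: (subfldM Lf); apply: (subfldX Lf).
have Lqpi : L q.[pi] by apply: (subfld_horner Lf).
have hz : vge v 0 (q.[pi] / z).
  rewrite /vge mulf_eq0 negb_or => /andP[n0 _].
  by rewrite (vl_div vV) // vz subr_ge0; apply: hq.
have [c kc hc] := cf_res CF hz.
have lt_b : (b < w)%N by rewrite ltn_mod.
have szc : (size (- ((c * y ^+ a)%:P * 'X^b)) < size q)%N.
  rewrite size_polyN sq; apply: (leq_ltn_trans (size_polyMleq _ _)).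
  rewrite size_polyXn addnS /=; apply: (@leq_ltn_trans (1 + b)); last by rewrite add1n ltnS.
  by rewrite leq_add2r size_polyC_leq1.
exists (q - (c * y ^+ a)%:P * 'X^b); split.
- by rewrite qualifE /= lead_coefDl.
- by rewrite size_polyDl.
- move=> i; rewrite coefB coefCM coefXn; apply: (subfldB Lf) => //.
  apply: (subfldM Lf).
    by apply: (subfldM Lf); [exact: (tot_kk T)|exact: (subfldX Lf)].
  by case: eqP => _; [exact: (subfld1 Lf)|exact: (subfld0 Lf)].
- move=> g i Gg; rewrite coefB coefCM coefXn rmorphB /= fq // !rmorphM /= (tot_c T) //.
  by rewrite rmorphXn /= fy // rmorph_nat.
rewrite !hornerE.
have -> : q.[pi] - c * y ^+ a * pi ^+ b = (q.[pi] / z - c) * z.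
  by rewrite mulrBl divfK // /z; ring.
rewrite /vge mulf_eq0 negb_or => /andP[d0 _].
have Ld : L (q.[pi] / z - c).
  by apply: (subfldB Lf); [exact: (subfld_div Lf)|exact: (tot_kk T)].
rewrite (vlM vV) // vz addnS -nat1r mulrDl mul1r lerD2r.
have [n vn] := tot_nat T Ld (vgtW hc) d0.
have := hc d0; rewrite vn pmulr_lgt0 // ltr0n => n0.
by rewrite ler_peMl ?ler1n //; exact: ltW.
Qed.

(** An element fixed by [G] has value at least [|G| v(pi)]. Otherwise the polynomials of
    [fixed_approx], whose coefficients are fixed, would be as small as desired at [w + 1] distinct
    conjugates of [pi], against [monic_small_values]. *)
Lemma fixed_val_ge : (#|G| <= w)%N.
Proof.
rewrite leqNgt; apply/negP => ltwG.
have [B hB] := orbit_gap.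
have [M hM] := big_mult T (w%:R * B + 1).
have [q [mq sq Lq fq hq]] := fixed_approx M.
pose s := take w.+1 [seq act g pi | g <- enum G].
have sG x : x \in s -> exists2 g, g \in G & x = act g pi.
  by move/mem_take/mapP => [g]; rewrite mem_enum => Gg ->; exists g.
have : (w + M)%:R * v pi <= w%:R * B.
  apply: (monic_small_values vV mq sq (s := s)).
  - by rewrite size_takel // size_map -cardE.
  - apply: take_uniq; rewrite map_inj_in_uniq ?enum_uniq // => g h.
    by rewrite !mem_enum; apply: act_pi_inj.
  - by move=> _ _ /sG[g Gg ->] /sG[h Gh ->]; apply: hB.
  - move=> _ /sG[g Gg ->].
    have -> : q.[act g pi] = act g q.[pi].
      rewrite -horner_map; congr horner; apply/polyP => i.
      by rewrite coef_map /= fq.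
    by rewrite /vge fmorph_eq0 (tot_v T) //; exact: (subfld_horner Lf).
apply/negP; rewrite -ltNge; apply: (@lt_le_trans _ _ (M%:R * v pi)).
  by apply: lt_le_trans hM; lra.
by rewrite ler_pM2r // ler_nat leq_addl.
Qed.

End FixedGap.

End FixedField.

Section Subgroup.

Variables (Om : fieldType) (v : Om -> rat) (kk : Om -> Prop).
Hypothesis CF : coeff_field v kk.
Let vV := cf_val CF.
Let Kf := cf_kk CF.
Variables (X : finGroupType) (G : {group X}) (act : X -> {rmorphism Om -> Om}).
Variables (L : Om -> Prop) (pi : Om).
Hypothesis T : tot v kk G act L pi.
Let Lf := tot_L T.
Let pi0 := tot_pi0 T.
Let Lpi := tot_pi T.
Let vpi := tot_vpi T.

Variable H : {group X}.
Hypothesis sHG : H \subset G.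
Let HG h : h \in H -> h \in G := subsetP sHG h.

Definition fixL (x : Om) : Prop := L x /\ forall h, h \in H -> act h x = x.
(** The norm of [pi], which is a uniformiser of the fixed field ([fixL_unif]). *)
Definition npi : Om := \prod_(h in H) act h pi.

Lemma fixL_subfld : subfld fixL.
Proof.
split.
- by split; [exact: (subfld1 Lf)|move=> h _; rewrite rmorph1].
- move=> x y [Lx fx] [Ly fy]; split; first exact: (subfldB Lf).
  by move=> h Hh; rewrite rmorphB /= fx ?fy.
- move=> x y [Lx fx] [Ly fy]; split; first exact: (subfldM Lf).
  by move=> h Hh; rewrite rmorphM /= fx ?fy.
- move=> x [Lx fx]; split; first exact: (subfldV Lf).
  by move=> h Hh; rewrite fmorphV /= fx.
Qed.

Lemma fixL_kk c : kk c -> fixL c.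
Proof.
by move=> kc; split; [exact: (tot_kk T)|move=> h Hh; rewrite (tot_c T) ?HG].
Qed.

Lemma npi_neq0 : npi != 0.
Proof. by apply/prodf_neq0 => h _; rewrite fmorph_eq0. Qed.

Lemma vnpi : v npi = #|H|%:R * v pi.
Proof.
rewrite /npi (vlY vV); last by move=> h _; rewrite fmorph_eq0.
rewrite (eq_bigr (fun=> v pi)); last by move=> h Hh; rewrite (tot_v T) ?HG.
by rewrite sumr_const mulr_natl.
Qed.

Lemma act_reindex (R : Type) (idx : R) (op : Monoid.com_law idx) (h : X) (F : X -> R) : h \in H ->
  \big[op/idx]_(x in H) F (h * x)%g = \big[op/idx]_(x in H) F x.
Proof.
move=> Hh; rewrite [RHS](reindex_inj (mulgI h)) /=.
by apply: eq_bigl => x; rewrite groupMl.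
Qed.

Lemma fixL_npi : fixL npi.
Proof.
split; first by apply: (subfld_prod Lf) => h Hh; apply: (tot_stab T); rewrite ?HG.
move=> h Hh; rewrite rmorph_prod /= -[RHS](act_reindex _ (fun x => act x pi) Hh).
by apply: eq_bigr => x Hx; rewrite (tot_M T) ?HG.
Qed.

(** By Bezout, a monomial in [x] and the norm has value the gcd of the two; [fixed_val_ge] shows
    that this gcd is already [|H|]. *)
Lemma fixL_unif x : fixL x -> x != 0 -> exists z : int, v x = z%:~R * v npi.
Proof.
move=> Fx x0; have [n vn] := tot_unif T (proj1 Fx) x0.
have [a [b Eab]] := Bezoutz n #|H|.
pose y := x ^ a * npi ^ b.
have y0 : y != 0 by rewrite mulf_neq0 ?expfz_neq0 ?npi_neq0.
have Fy : fixL y.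
  by apply: (subfldM fixL_subfld); apply: (subfldXz fixL_subfld) => //; exact: fixL_npi.
have vy : v y = (gcdn `|n| #|H|)%:R * v pi.
  rewrite (vlM vV) ?expfz_neq0 ?npi_neq0 // !(vlXz vV) ?npi_neq0 // vn vnpi.
  have := congr1 (fun z : int => z%:~R : rat) Eab; rewrite rmorphD !rmorphM /=.
  by move=> E; rewrite -[(gcdn _ _)%:R]E; ring.
have g0 : (0 < gcdn `|n| #|H|)%N by rewrite gcdn_gt0 cardG_gt0 orbT.
have le := fixed_val_ge CF (tot_subgroup T sHG) (proj1 Fy) y0 g0 (proj2 Fy) vy.
have : (#|H| %| `|n|)%N.
  have -> : #|H| = gcdn `|n| #|H|.
    by apply/eqP; rewrite eqn_leq le dvdn_leq ?cardG_gt0 // dvdn_gcdr.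
  exact: dvdn_gcdl.
move=> /dvdnP[k Ek].
exists (sgz n * k%:Z); rewrite vn vnpi mulrA; congr (_ * _).
by rewrite {1}[n]intEsg Ek PoszM mulrA intrM.
Qed.

Lemma vnpi_gt0 : 0 < v npi.
Proof. by rewrite vnpi mulr_gt0 // ltr0n cardG_gt0. Qed.

(** With the trivial group the record only provides [npi]-adic expansions in the fixed field; they
    are needed before the quotient is known to act faithfully. *)
Lemma tot_fixL1 : tot v kk (1%G : {group X}) act fixL npi.
Proof.
have G1 g : g \in (1%G : {group X}) -> g \in G by move=> /set1P ->; exact: group1.
split.
- exact: fixL_subfld.
- exact: fixL_kk.
- by move=> g x /set1P -> Fx; rewrite (tot1 T) //; case: Fx.
- by move=> g h x g1 h1 [Lx _]; rewrite (tot_M T) ?G1.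
- by move=> g x g1 [Lx _]; rewrite (tot_v T) ?G1.
- by move=> g c g1 kc; rewrite (tot_c T) ?G1.
- exact: fixL_npi.
- exact: npi_neq0.
- exact: vnpi_gt0.
- exact: fixL_unif.
- by move=> g /set1P ->.
Qed.

Lemma npi_int : vge v 0 npi.
Proof. by move=> _; apply: ltW; exact: vnpi_gt0. Qed.

(** Same argument as [act_sub_ge]; [g] need not normalise [H], so [act g] may leave the fixed
    field. *)
Lemma fixL_sub_ge r g x : g \in G -> vge v r (act g npi - npi) -> fixL x ->
  vge v 0 x -> vge v r (act g x - x).
Proof.
move=> Gg hr Fx hx; have [M hM] := big_mult tot_fixL1 r.
have [q kq hq] := tot_approx CF tot_fixL1 M Fx hx.
have Lq : L q.[npi].
  by apply: (subfld_horner Lf) => [i|]; [apply: (tot_kk T)|case: fixL_npi].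
have -> : act g x - x = act g (x - q.[npi]) - (x - q.[npi]) + (act g q.[npi] - q.[npi]).
  by rewrite rmorphB /=; ring.
have Lx : L x by case: Fx.
apply: (vgeD vV); [apply: (vgeB vV)|].
- rewrite /vge fmorph_eq0 (tot_v T) //; last exact: (subfldB Lf).
  exact: (vgeW hM hq).
- exact: vgeW hM hq.
rewrite (act_horner T) //; apply: (vge_horner_sub vV) => //.
- exact: (kk_intpoly CF).
- by apply: (act_int T) => //; [case: fixL_npi|exact: npi_int].
- exact: npi_int.
Qed.

Let f : {poly Om} := \prod_(h in H) ('X - (act h pi)%:P).

Lemma charpoly_fix h : h \in H -> map_poly (act h) f = f.
Proof.
move=> Hh; rewrite /f rmorph_prod /= -[RHS](act_reindex _ (fun x => 'X - (act x pi)%:P) Hh).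
apply: eq_bigr => x Hx; rewrite rmorphB /= map_polyX map_polyC /=.
by rewrite (tot_M T) ?HG.
Qed.

Lemma charpoly_fixL i : fixL f`_i.
Proof.
split; last by move=> h Hh; rewrite -{2}(charpoly_fix Hh) coef_map.
move: i; rewrite /f.
apply: (big_ind (fun q : {poly Om} => forall i, L q`_i)) => [j|q1 q2 h1 h2 j|h Hh j].
- by rewrite coef1; case: eqP => _; [exact: (subfld1 Lf)|exact: (subfld0 Lf)].
- by rewrite coefM; apply: (subfld_sum Lf) => k _; apply: (subfldM Lf).
rewrite coefB coefX coefC; apply: (subfldB Lf).
  by case: eqP => _; [exact: (subfld1 Lf)|exact: (subfld0 Lf)].
case: eqP => _; last exact: (subfld0 Lf).
by apply: (tot_stab T); rewrite ?HG.
Qed.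

Lemma charpoly_int : intpoly v f.
Proof.
rewrite /f; apply: (big_ind (intpoly v)) => [j|q1 q2 h1 h2 j|h Hh j].
- by rewrite coef1; case: eqP => _; [exact: (vge01 vV)|exact: vge0].
- by rewrite coefM; apply: (vge_sum vV) => k _; apply: (vgeM0 vV).
rewrite coefB coefX coefC; apply: (vgeB vV).
  by case: eqP => _; [exact: (vge01 vV)|exact: vge0].
case: eqP => _; last exact: vge0.
by apply: (act_int T); rewrite ?HG //; exact: (pi_int T).
Qed.

(** If [g] fixes the norm, it fixes by density the coefficients of the polynomial [f] with roots
    [h pi], hence permutes these roots; so [g pi = h pi] for some [h] in [H]. *)
Lemma npi_moved g : g \in G -> g \notin H -> act g npi != npi.
Proof.
move=> Gg nHg; apply/negP => /eqP gn.
have gf : map_poly (act g) f = f.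
  apply/polyP => i; rewrite coef_map /=; apply/eqP; rewrite -subr_eq0; apply/eqP.
  apply: (vge_all0 (v := v)) => n; apply: fixL_sub_ge => //.
  - by rewrite gn subrr; exact: vge0.
  - exact: charpoly_fixL.
  - exact: charpoly_int.
have : root f (act g pi).
  rewrite -gf /root horner_map fmorph_eq0 /f horner_prod (bigD1 1%g) //=.
  by rewrite !hornerE (tot1 T) // subrr mul0r.
rewrite /root /f horner_prod => /prodf_eq0[h Hh].
rewrite !hornerE subr_eq0 => /eqP /(act_pi_inj CF T Gg (HG Hh)) gh.
by move: nHg; rewrite gh Hh.
Qed.

(** Apply [g] to the coefficients of [f] and evaluate at [pi]: the result is the product of the
    [pi - g h pi]. Subtracting [f.[pi] = 0], it is also a sum dominated by its constant term, which
    is the displacement of the norm up to sign. *)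
Lemma npi_sub g : g \in G -> g \notin H ->
  v (act g npi - npi) = \sum_(h in H) v (act (g * h)%g pi - pi).
Proof.
move=> Gg nHg; set A := v _.
have A0 : act g npi - npi != 0 by rewrite subr_eq0 npi_moved.
have gf : map_poly (act g) f = \prod_(h in H) ('X - (act (g * h)%g pi)%:P).
  rewrite /f rmorph_prod /=; apply: eq_bigr => h Hh.
  by rewrite rmorphB /= map_polyX map_polyC /= (tot_M T Gg (HG Hh) Lpi).
have gh_neq h : h \in H -> pi - act (g * h)%g pi != 0.
  move=> Hh; rewrite subr_eq0 eq_sym; apply: contraNneq nHg => E.
  have := tot_pi_faith CF T (groupM Gg (HG Hh)) E => gh1.
  by rewrite -(groupMr _ Hh) gh1 group1.
have -> : \sum_(h in H) v (act (g * h)%g pi - pi) = v (map_poly (act g) f).[pi].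
  rewrite gf horner_prod (vlY vV); last by move=> h Hh; rewrite !hornerE; apply: gh_neq.
  by apply: eq_bigr => h Hh; rewrite -(vlN vV) opprB !hornerE.
have fpi : f.[pi] = 0.
  rewrite /f horner_prod (bigD1 1%g) //=.
  by rewrite !hornerE (tot1 T) // subrr mul0r.
have Egf : (map_poly (act g) f).[pi] = \sum_(i < size f) (act g f`_i - f`_i) * pi ^+ i.
  transitivity ((map_poly (act g) f).[pi] - f.[pi]); first by rewrite fpi subr0.
  rewrite (horner_coef_wide (n := size f)) ?size_map_poly //.
  rewrite [X in _ - X]horner_coef -sumrB; apply: eq_bigr => i _.
  by rewrite coef_map mulrBl.
have sf : (0 < size f)%N.
  rewrite lt0n size_poly_eq0; apply: monic_neq0; apply: monic_prod => h _.
  exact: monicXsubC.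
have f0 : f`_0 = (-1) ^+ #|H| * npi.
  rewrite -horner_coef0 /f horner_prod -prodr_const -big_split /=.
  by apply: eq_bigr => h _; rewrite !hornerE mulN1r ?sub0r.
have g0 : act g f`_0 - f`_0 = (-1) ^+ #|H| * (act g npi - npi).
  by rewrite f0 rmorphM rmorphXn rmorphN1 /= mulrBr.
have sg0 : (-1) ^+ #|H| != 0 :> Om by rewrite expf_neq0 // oppr_eq0 oner_neq0.
have vsg : v ((-1) ^+ #|H|) = 0 by rewrite (vlX vV) ?oppr_eq0 ?oner_neq0 // (vlN vV) (vl1 vV) mulr0.
rewrite Egf; case E : (size f) sf => [//|n] _; rewrite big_ord_recl expr0 mulr1.
set x0 := act g _ - _; have x00 : x0 != 0 by rewrite /x0 g0 mulf_neq0.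
have vx0 : v x0 = A by rewrite /x0 g0 (vlM vV) // vsg add0r.
suff h : vgt v (v x0) (\sum_(i < n) (act g f`_(lift ord0 i) - f`_(lift ord0 i)) * pi ^+ lift ord0 i).
  by have [_ ->] := vl_dom vV x00 h; rewrite vx0.
apply: (vgt_sum vV) => i _; rewrite vx0 -(addr0 A); apply: (vgtM vV).
  apply: fixL_sub_ge => //; [exact: charpoly_fixL|exact: charpoly_int].
by move=> _; rewrite (vlX vV) // mulr_gt0 // ltr0n.
Qed.

End Subgroup.

Section Quotient.

Variables (Om : fieldType) (v : Om -> rat) (kk : Om -> Prop).
Hypothesis CF : coeff_field v kk.
Variables (X : finGroupType) (G : {group X}) (act : X -> {rmorphism Om -> Om}).
Variables (L : Om -> Prop) (pi : Om).
Hypothesis T : tot v kk G act L pi.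
Variable H : {group X}.
Hypothesis nHG : (H <| G)%g.
Let sHG := normal_sub nHG.
Let HG h : h \in H -> h \in G := subsetP sHG h.

Definition quo_act (x : coset_of H) : {rmorphism Om -> Om} := act (repr x).

Lemma quo_actE g x : g \in G -> fixL act L H x -> quo_act (coset H g) x = act g x.
Proof.
move=> Gg [Lx fx]; have Ng := subsetP (normal_norm nHG) _ Gg.
rewrite /quo_act val_coset //.
have := mem_repr_rcoset H g; rewrite (norm_rlcoset Ng) => /lcosetP[h Hh ->].
by rewrite (tot_M T Gg (HG Hh) Lx) fx.
Qed.

Lemma fixL_stab g x : g \in G -> fixL act L H x -> fixL act L H (act g x).
Proof.
move=> Gg [Lx fx]; split=> [|h Hh]; first exact: (tot_stab T).
have Ng := subsetP (normal_norm nHG) _ Gg.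
rewrite -(tot_M T (HG Hh) Gg Lx) (_ : (h * g)%g = (g * h ^ g)%g); last by rewrite conjgE !mulgA mulgV mul1g.
have Hhg : (h ^ g)%g \in H by rewrite memJ_norm.
by rewrite (tot_M T Gg (HG Hhg) Lx) fx.
Qed.

(** Faithfulness is [npi_moved], the uniformiser is [fixL_unif]; results on all [tot] actions thus
    pass to quotients. *)
Lemma tot_quotient : tot v kk (G / H)%G quo_act (fixL act L H) (npi act pi H).
Proof.
have RG x : x \in (G / H)%g -> repr x \in G by exact: repr_quo.
split.
- exact: (fixL_subfld T H).
- exact: (fixL_kk T sHG).
- by move=> x y Gx Fy; apply: fixL_stab => //; exact: RG.
- move=> x y z /morphimP[g Ng Gg ->] /morphimP[h Nh Gh ->] Fz /=.
  rewrite -coset_morphM // !quo_actE ?groupM //; last exact: fixL_stab.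
  by rewrite (tot_M T) //; case: Fz.
- by move=> x y Gx [Ly _]; rewrite (tot_v T) ?RG.
- by move=> x c Gx kc; rewrite (tot_c T) ?RG.
- exact: (fixL_npi T sHG).
- exact: (npi_neq0 T).
- exact: (vnpi_gt0 CF T sHG).
- exact: (fixL_unif CF T sHG).
- move=> _ /morphimP[g Ng Gg ->] h; apply: coset_id; apply/negPn/negP => nHg.
  have := npi_moved CF T sHG Gg nHg.
  by rewrite -(quo_actE Gg (fixL_npi T sHG)) h ?eqxx //; exact: (fixL_npi T sHG).
Qed.

End Quotient.

(** * Herbrand's theorem for the lower numbering *)

Section CosetSums.

Lemma sum_cosets (X : finGroupType) (G H : {group X}) (V : nmodType) (F : X -> V) :
  (H <| G)%g ->
  \sum_(g in G) F g = \sum_(x in (G / H)%g) \sum_(h in H) F (repr x * h)%g.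
Proof.
move=> nHG; have sHG := normal_sub nHG; have nG := normal_norm nHG.
rewrite (partition_big (coset H) (mem (G / H)%g)) /=; last first.
  by move=> g Gg; apply: mem_quotient.
apply: eq_bigr => x Gx; have rx := repr_quo sHG Gx.
rewrite (reindex_inj (mulgI (repr x))) /=; apply: eq_bigl => g.
rewrite groupMl //; apply/andP/idP => [[Gg /eqP E]|Hg].
  have Ng := subsetP nG _ Gg; have Nx := subsetP nG _ rx.
  have := E; rewrite coset_morphM // coset_reprK => /(canRL (mulKg _)).
  by rewrite mulVg => /coset_idr; apply.
have Gg := subsetP sHG _ Hg; split=> //; apply/eqP.
have Ng := subsetP nG _ Gg; have Nx := subsetP nG _ rx.
by rewrite coset_morphM // coset_reprK coset_id // mulg1.
Qed.

Variables (X : finGroupType) (G H : {group X}) (b : X -> rat).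
Hypothesis sHG : H \subset G.
Hypothesis bM : {in G &, forall g h, Num.min (b g) (b h) <= b (g * h)%g}.
Hypothesis bV : {in G, forall g, b g^-1%g = b g}.

Lemma best_in_coset g : g \in G -> exists2 h, h \in H &
  forall h', h' \in H -> b (g * h')%g <= b (g * h)%g.
Proof.
move=> Gg; have [h Hh hm] := @Order.TotalTheory.arg_maxP _ _ _ 1%g (mem H) (fun h => b (g * h)%g) (group1 H).
by exists h.
Qed.

(** [b] behaves as an ultrametric valuation, so only the case [b g = b h] could give a strict
    inequality, and there the maximality of [b g] excludes it. *)
Lemma best_coset_val g h : g \in G -> h \in H ->
  (forall h', h' \in H -> b (g * h')%g <= b g) ->
  b (g * h)%g = Num.min (b g) (b h).
Proof.
move=> Gg Hh best; have Gh := subsetP sHG _ Hh.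
apply/le_anti/andP; split; last exact: bM.
rewrite le_min best //= leNgt; apply/negP => lt.
have := bM (groupVr Gg) (groupM Gg Gh); rewrite mulKg bV // => le.
have : Num.min (b g) (b (g * h)%g) <= b h by [].
rewrite leNgt lt_min lt /= andbT; move/negP; apply.
exact: lt_le_trans lt (best _ Hh).
Qed.

(** With [g] replaced by the best element of its coset, every term is a minimum with some [b h], and
    the claim becomes the monotonicity of the sum over [h] of [min (j, b h)] in [j]. *)
Lemma coset_sum_min g s : g \in G -> s \in G ->
  (forall h, h \in H -> b (s * h)%g <= b s) ->
  \sum_(h in H) Num.min (b (g * h)%g) (b s) =
  Num.min (\sum_(h in H) b (g * h)%g) (\sum_(h in H) b (s * h)%g).
Proof.
move=> Gg Gs bests.
have [h0 Hh0 best0] := best_in_coset Gg; pose g0 := (g * h0)%g.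
have Gg0 : g0 \in G by rewrite groupM // (subsetP sHG).
have best1 h : h \in H -> b (g0 * h)%g <= b g0.
  by move=> Hh; rewrite -mulgA; apply: best0; rewrite groupM.
have re (F : X -> rat) : \sum_(h in H) F (g * h)%g = \sum_(h in H) F (g0 * h)%g.
  rewrite [LHS](reindex_inj (mulgI h0)) /=; apply: eq_big => h.
    by rewrite groupMl.
  by rewrite mulgA.
rewrite (re (fun x => Num.min (b x) (b s))) (re b).
rewrite (eq_bigr (fun h => Num.min (Num.min (b g0) (b h)) (b s))); last first.
  by move=> h Hh; rewrite (best_coset_val Gg0 Hh).
rewrite [X in Num.min X _](eq_bigr (fun h => Num.min (b g0) (b h))); last first.
  by move=> h Hh; apply: best_coset_val.
rewrite [X in Num.min _ X](eq_bigr (fun h => Num.min (b s) (b h))); last first.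
  by move=> h Hh; apply: best_coset_val.
have mono j j' : j <= j' ->
    \sum_(h in H) Num.min j (b h) <= \sum_(h in H) Num.min j' (b h).
  by move=> jj; apply: ler_sum => h _; rewrite le_min2.
have [le|/ltW le] := lerP (b g0) (b s).
  rewrite min_l ?mono //; apply: eq_bigr => h _.
  by rewrite min_l // ge_min le.
rewrite min_r ?mono //; apply: eq_bigr => h _.
rewrite minC minA; congr (Num.min _ _).
by rewrite min_l.
Qed.

End CosetSums.

Section Herbrand.

Variables (Om : fieldType) (v : Om -> rat).

(** When [|G| v(pi) = 1] and [s = act g pi], this is 1 plus the upper number of [g], in the form
    used by [upper_ramification]. The argument is the image of [pi] and not [g], so that different
    groups can be compared. *)
Definition herb (X : finGroupType) (G : {group X}) (act : X -> {rmorphism Om -> Om})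
    (pi : Om) (s : Om) : rat :=
  v (s - pi) + \sum_(g in G | g != 1%g) Num.min (v (act g pi - pi)) (v (s - pi)).

Lemma herb_le (X : finGroupType) (G : {group X}) (act : X -> {rmorphism Om -> Om})
    (pi s s' : Om) : v (s - pi) <= v (s' - pi) ->
  herb G act pi s <= herb G act pi s'.
Proof.
by move=> le; apply: lerD => //; apply: ler_sum => g _; rewrite le_min2.
Qed.

Variable kk : Om -> Prop.
Hypothesis CF : coeff_field v kk.
Let vV := cf_val CF.
Variables (X : finGroupType) (G : {group X}) (act : X -> {rmorphism Om -> Om}).
Variables (L : Om -> Prop) (pi : Om).
Hypothesis T : tot v kk G act L pi.
Let Lf := tot_L T.
Let Lpi := tot_pi T.

(** A finite substitute for the value +oo of [b] at the identity. *)
Let big : rat := 1 + \sum_(g in G) `|v (act g pi - pi)|.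
Let b (g : X) : rat := if g == 1%g then big else v (act g pi - pi).

Lemma gpi_sub_neq0 g : g \in G -> g != 1%g -> act g pi - pi != 0.
Proof.
by move=> Gg g1; rewrite subr_eq0; apply: contraNneq g1 => /(tot_pi_faith CF T Gg) ->.
Qed.

Let b_big g : g \in G -> b g <= big.
Proof.
move=> Gg; rewrite /b; case: eqP => // _; rewrite /big (bigD1 g) //=.
apply: (le_trans (ler_norm _)); rewrite addrCA lerDl addr_ge0 ?sumr_ge0 //.
Qed.

Let vV_sym g : g \in G -> v (act g^-1%g pi - pi) = v (act g pi - pi).
Proof.
move=> Gg; have GV := groupVr Gg.
rewrite -(tot_v T Gg); last by apply: (subfldB Lf) => //; exact: (tot_stab T).
by rewrite rmorphB /= -(tot_M T) // mulgV (tot1 T) // -(vlN vV) opprB.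
Qed.

Let bV : {in G, forall g, b g^-1%g = b g}.
Proof. by move=> g Gg; rewrite /b invg_eq1; case: eqP => // _; apply: vV_sym. Qed.

Let bM : {in G &, forall g h, Num.min (b g) (b h) <= b (g * h)%g}.
Proof.
move=> g h Gg Gh.
have [->|g1] := eqVneq g 1%g; first by rewrite mul1g ge_min lexx orbT.
have [->|h1] := eqVneq h 1%g; first by rewrite mulg1 ge_min lexx.
have [gh|gh1] := eqVneq (g * h)%g 1%g.
  by rewrite {3}/b gh eqxx ge_min b_big.
rewrite /b (negbTE g1) (negbTE h1) (negbTE gh1) (tot_M T) //.
have E : act g (act h pi) - pi = act g (act h pi - pi) + (act g pi - pi).
  by rewrite rmorphB /=; ring.
have n0 : act g (act h pi) - pi != 0.
  by rewrite -(tot_M T) // gpi_sub_neq0 // groupM.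
have n1 := n0; rewrite E in n1; rewrite E.
apply: (vgeD vV) n1.
  rewrite /vge fmorph_eq0 (tot_v T) //; last by apply: (subfldB Lf) => //; exact: (tot_stab T).
  by move=> _; rewrite ge_min lexx orbT.
by move=> _; rewrite ge_min lexx.
Qed.

Lemma herb_big s : s \in G -> s != 1%g -> herb G act pi (act s pi) = \sum_(g in G) Num.min (b g) (b s).
Proof.
move=> Gs s1; rewrite (bigD1 1%g) //= /herb; congr (_ + _).
  by rewrite {1}/b eqxx min_r ?b_big // /b (negbTE s1).
by apply: eq_bigr => g /andP[_ g1]; rewrite /b (negbTE g1) (negbTE s1).
Qed.

Variable H : {group X}.
Hypothesis nHG : (H <| G)%g.
Let sHG := normal_sub nHG.

(** Herbrand's theorem, for a representative nearest to 1 in its coset: split the sum over the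
    cosets of [H], move the minimum outside by [coset_sum_min], and recognise displacements of the
    norm by [npi_sub]. *)
Lemma herb_quotient s : s \in G -> s \notin H ->
  (forall h, h \in H -> v (act (s * h)%g pi - pi) <= v (act s pi - pi)) ->
  herb G act pi (act s pi) =
  herb (G / H)%G (quo_act act (H := H)) (npi act pi H) (act s (npi act pi H)).
Proof.
move=> Gs nHs best.
have b_notin g h : g \in G -> g \notin H -> h \in H -> b (g * h)%g = v (act (g * h)%g pi - pi).
  move=> Gg nHg Hh; rewrite /b; case: eqP => // gh.
  by move: nHg; rewrite -(groupMr _ Hh) gh group1.
have s1 : s != 1%g by apply: contraNneq nHs => ->; exact: group1.
have bests h : h \in H -> b (s * h)%g <= b s.
  by move=> Hh; rewrite b_notin // /b (negbTE s1); apply: best.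
rewrite herb_big // (sum_cosets _ nHG).
have Es : \sum_(h in H) b (s * h)%g = v (act s (npi act pi H) - npi act pi H).
  rewrite (npi_sub CF T sHG Gs nHs); apply: eq_bigr => h Hh.
  exact: b_notin.
rewrite (bigD1 1%g) ?group1 //= /herb; congr (_ + _).
  rewrite repr_coset1 (coset_sum_min sHG bM bV (group1 G) Gs bests) min_r; first exact: Es.
  apply: ler_sum => h Hh; rewrite mul1g.
  rewrite (best_coset_val sHG bM bV Gs Hh bests) ge_min lexx orbT //.
apply: eq_bigr => x /andP[Gx x1].
have rx := repr_quo sHG Gx.
have nHx : repr x \notin H.
  by apply: contraNN x1 => Hx; rewrite -(coset_reprK x) coset_id.
rewrite (coset_sum_min sHG bM bV rx Gs bests) Es; congr (Num.min _ _).
rewrite (npi_sub CF T sHG rx nHx); apply: eq_bigr => h Hh.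
exact: b_notin.
Qed.


Lemma herb_best_lift s : s \in G -> exists2 h, h \in H &
  forall h', h' \in H -> v (act (s * h * h')%g pi - pi) <= v (act (s * h)%g pi - pi).
Proof.
move=> Gs.
have [h Hh best] := best_in_coset H (fun g => v (act g pi - pi)) Gs.
exists h => // h' Hh'; rewrite -mulgA; apply: best; exact: groupM.
Qed.

Lemma npi_sub_le s g : s \in G -> s \notin H -> g \in G -> g \notin H ->
  (forall h, h \in H -> v (act (s * h)%g pi - pi) <= v (act s pi - pi)) ->
  (forall h, h \in H -> v (act (g * h)%g pi - pi) <= v (act s pi - pi)) ->
  v (act g (npi act pi H) - npi act pi H) <= v (act s (npi act pi H) - npi act pi H).
Proof.
move=> Gs nHs Gg nHg bests leg.
have b_notin x h : x \in G -> x \notin H -> h \in H -> b (x * h)%g = v (act (x * h)%g pi - pi).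
  move=> Gx nHx Hh; rewrite /b; case: eqP => // xh.
  by move: nHx; rewrite -(groupMr _ Hh) xh group1.
have bs : b s = v (act s pi - pi) by rewrite -[s]mulg1 b_notin // group1.
have bests' h : h \in H -> b (s * h)%g <= b s by move=> Hh; rewrite b_notin // bs bests.
rewrite (npi_sub CF T sHG Gg nHg) (npi_sub CF T sHG Gs nHs).
rewrite -(eq_bigr _ (fun h => b_notin g h Gg nHg)) -(eq_bigr _ (fun h => b_notin s h Gs nHs)).
have := coset_sum_min sHG bM bV Gg Gs bests'.
rewrite (eq_bigr (fun h => b (g * h)%g)) => [->|h Hh]; first by rewrite ge_min lexx orbT.
by rewrite min_l // b_notin // bs leg.
Qed.

End Herbrand.

(** * Traces and the different *)

Section Lagrange.

Variables (F : fieldType) (I : finType) (A : {pred I}) (x : I -> F).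
Hypothesis x_inj : {in A &, injective x}.

(** Compare leading coefficients in Lagrange's interpolation formula. At the conjugates of [pi] this
    is Euler's formula for the trace form. *)
Lemma lagrange_coef (r : {poly F}) : (size r <= #|A|)%N -> (0 < #|A|)%N ->
  r`_(#|A|.-1) = \sum_(g in A) r.[x g] / \prod_(h in A | h != g) (x g - x h).
Proof.
move=> sr A_gt0; pose l g := \prod_(h in A | h != g) ('X - (x h)%:P).
pose d g := \prod_(h in A | h != g) (x g - x h).
have d0 g : g \in A -> d g != 0.
  move=> Ag; apply/prodf_neq0 => h /andP[Ah hg]; rewrite subr_eq0.
  by apply: contraNneq hg => /x_inj ->.
have ml g : l g \is monic by apply: monic_prod => h _; exact: monicXsubC.
have sl g : g \in A -> size (l g) = #|A|.
  move=> Ag; rewrite /l -big_filter size_prod_XsubC.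
  rewrite -(eq_filter (a1 := [pred h | (h \in A) && (h != g)])) //.
  rewrite size_filter -sum1_count big_mkcond /=.
  have := cardD1 g A; rewrite Ag add1n => ->; congr _.+1.
  rewrite -sum1_card [RHS]big_mkcond /=.
  rewrite -big_enum /= enumT; apply: eq_bigr => h _.
  by rewrite !inE andbC.
pose R := \sum_(g in A) (r.[x g] / d g) *: l g.
have sR : (size R <= #|A|)%N.
  apply: (leq_trans (size_sum _ _ _)); apply/bigmax_leqP => g Ag.
  by rewrite (leq_trans (size_scale_leq _ _)) // sl.
have Rx g : g \in A -> R.[x g] = r.[x g].
  move=> Ag; rewrite /R horner_sum (bigD1 g) //= [X in _ + X]big1 ?addr0.
    rewrite hornerZ /l horner_prod (eq_bigr (fun h => x g - x h)); last first.
      by move=> h _; rewrite hornerXsubC.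
    by rewrite -/(d g) divfK // d0.
  move=> h /andP[Ah hg]; have gh : (g \in A) && (g != h) by rewrite Ag eq_sym.
  rewrite hornerZ /l horner_prod (bigD1 g gh) /= hornerXsubC subrr.
  by rewrite mul0r mulr0.
have rR : r = R.
  apply/eqP; rewrite -subr_eq0; apply: contraT => n0.
  have ur : uniq [seq x g | g <- enum A].
    by rewrite map_inj_in_uniq ?enum_uniq // => g h; rewrite !mem_enum; exact: x_inj.
  have rr : all (root (r - R)) [seq x g | g <- enum A].
    apply/allP => y /mapP[g]; rewrite mem_enum => Ag Ey.
    by rewrite Ey rootE !hornerE Rx // subrr.
  have := max_poly_roots n0 rr ur; rewrite size_map -cardE ltnNge => /negP[].
  apply: (leq_trans (size_polyD _ _)); rewrite size_polyN.
  by rewrite geq_max sr sR.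
rewrite {1}rR /R coef_sum; apply: eq_bigr => g Ag.
rewrite coefZ; have := ml g; rewrite qualifE /= /lead_coef sl // => /eqP ->.
by rewrite mulr1.
Qed.

End Lagrange.

Section MonicDivision.

Variables (F : nzRingType).

(** Two predicates allow the dividend to have coefficients in an ideal of the ring containing those
    of [f]: quotient and remainder then stay in the ideal. *)
Lemma monic_division (P : F -> Prop) (Q : F -> Prop) (f : {poly F}) :
  P 0 -> (forall x y, P x -> P y -> P (x - y)) ->
  (forall x y, P x -> Q y -> P (x * y)) ->
  f \is monic -> (forall i, Q f`_i) ->
  forall q : {poly F}, (forall i, P q`_i) ->
  exists s r : {poly F}, [/\ q = s * f + r, (size r < size f)%N,
    forall i, P r`_i & forall i, P s`_i].
Proof.
move=> P0 PB PQ mf Qf q.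
have PN x : P x -> P (- x) by move=> Px; rewrite -sub0r; apply: PB.
have PD x y : P x -> P y -> P (x + y) by move=> Px Py; rewrite -(opprK y); apply/PB/PN.
have sf : (0 < size f)%N by rewrite lt0n size_poly_eq0 monic_neq0.
move: {2}(size q) (leqnn (size q)) => n; elim: n q => [|n IH] q sq Pq.
  exists 0, 0; split=> //; [|by rewrite size_poly0|move=> i|move=> i]; rewrite ?coef0 //.
  by rewrite mul0r addr0; apply/eqP; rewrite -size_poly_leq0.
have [lt|le] := ltnP (size q) (size f).
  by exists 0, q; split=> // [|i]; rewrite ?mul0r ?add0r // coef0.
pose a := lead_coef q; pose k := (size q - size f)%N.
have Pa : P a by exact: Pq.
pose q1 := q - (a%:P * 'X^k) * f.
have q0 : (0 < size q)%N by exact: leq_trans le.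
have E1 i : ((a%:P * 'X^k) * f)`_i = if (i < k)%N then 0 else a * f`_(i - k).
  by rewrite -mulrA coefCM coefXnM; case: ltnP; rewrite ?mulr0.
have Pq1 i : P q1`_i.
  by rewrite coefB E1; apply: PB => //; case: ltnP => // _; apply: PQ.
have sq1 : (size q1 <= n)%N.
  apply/leq_sizeP => j nj; rewrite coefB E1.
  have [e|ne] := eqVneq j (size q).-1.
    rewrite ltnNge e; have kq : (k <= (size q).-1)%N by rewrite /k; lia.
    rewrite kq /=; have -> : ((size q).-1 - k = (size f).-1)%N by rewrite /k; lia.
    move: mf; rewrite qualifE /= /lead_coef => /eqP ->; rewrite mulr1.
    by rewrite subrr.
  have jq : (size q <= j)%N.
    by move/eqP: ne => ne; move: sq nj q0 ne; clear; move: (size q) => m; lia.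
  rewrite (nth_default _ jq) sub0r; case: ltnP => [|kj]; first by rewrite oppr0.
  have fj : (size f <= j - k)%N.
    by rewrite /k; move: le jq; clear; move: (size f) (size q) => b c; lia.
  by rewrite (nth_default _ fj) mulr0 oppr0.
have [s [r [E sr Pr Ps]]] := IH q1 sq1 Pq1.
exists (s + a%:P * 'X^k), r; split=> //.
  by rewrite mulrDl addrAC -E /q1 subrK.
move=> i; rewrite coefD; apply: PD => //; rewrite coefCM coefXn.
by case: eqP => _; rewrite ?mulr0 // mulr1.
Qed.

End MonicDivision.

Section Trace.

Variables (Om : fieldType) (v : Om -> rat) (kk : Om -> Prop).
Hypothesis CF : coeff_field v kk.
Let vV := cf_val CF.
Let Kf := cf_kk CF.

Lemma prod_XsubC_small (s : seq Om) : (forall a, a \in s -> vgt v 0 a) ->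
  forall i, vgt v 0 (\prod_(a <- s) ('X - a%:P) - 'X^(size s))`_i.
Proof.
elim: s => [|a s IH] hs i.
  by rewrite big_nil subrr coef0; exact: vgt0.
rewrite big_cons exprS.
have -> : ('X - a%:P) * \prod_(b <- s) ('X - b%:P) - 'X * 'X^(size s) =
  (\prod_(b <- s) ('X - b%:P) - 'X^(size s)) * 'X - a%:P * \prod_(b <- s) ('X - b%:P) by ring.
rewrite coefB coefMX coefCM.
have hs' b : b \in s -> vgt v 0 b by move=> bs; apply: hs; rewrite inE bs orbT.
apply: (vgtB vV).
  by case: eqP => _; [exact: vgt0|exact: IH].
rewrite mulrC -(addr0 0); apply: (vgtM vV); last by apply: hs; exact: mem_head.
have -> : (\prod_(b <- s) ('X - b%:P))`_i =
  (\prod_(b <- s) ('X - b%:P) - 'X^(size s))`_i + ('X^(size s))`_i by rewrite coefB subrK.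
apply: (vgeD vV); first by apply: vgtW; exact: IH.
by rewrite coefXn; case: eqP => _; [exact: (vge01 vV)|exact: vge0].
Qed.

Variables (X : finGroupType) (G : {group X}) (act : X -> {rmorphism Om -> Om}).
Variables (L : Om -> Prop) (pi : Om).
Hypothesis T : tot v kk G act L pi.
Let Lf := tot_L T.
Let pi0 := tot_pi0 T.
Let Lpi := tot_pi T.
Let vpi := tot_vpi T.

(** The derivative at [pi] of its characteristic polynomial, a generator of the different. *)
Definition difft : Om := \prod_(h in G | h != 1%g) (pi - act h pi).
Let f : {poly Om} := \prod_(h in G) ('X - (act h pi)%:P).

Lemma difft_neq0 : difft != 0.
Proof.
apply/prodf_neq0 => h /andP[Gh h1].
by rewrite -oppr_eq0 opprB; apply: (gpi_sub_neq0 CF T).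
Qed.

Lemma difft_L : L difft.
Proof.
apply: (subfld_prod Lf) => h /andP[Gh _]; apply: (subfldB Lf) => //.
exact: (tot_stab T).
Qed.

Lemma v_difft : v difft = \sum_(h in G | h != 1%g) v (act h pi - pi).
Proof.
rewrite /difft (vlY vV).
  by apply: eq_bigr => h _; rewrite -(vlN vV) opprB.
move=> h /andP[Gh h1]; rewrite -oppr_eq0 opprB; exact: (gpi_sub_neq0 CF T).
Qed.

Lemma act_difft g : g \in G ->
  act g difft = \prod_(h in G | h != g) (act g pi - act h pi).
Proof.
move=> Gg; rewrite /difft rmorph_prod /= [RHS](reindex_inj (mulgI g)) /=.
apply: eq_big => h; first by rewrite groupMl // -{2}(mulg1 g) (inj_eq (mulgI g)).
by move=> /andP[Gh _]; rewrite rmorphB /= (tot_M T).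
Qed.

Lemma f_root g : g \in G -> f.[act g pi] = 0.
Proof.
by move=> Gg; rewrite /f horner_prod (bigD1 g Gg) /= hornerXsubC subrr mul0r.
Qed.

Lemma f_monic : f \is monic.
Proof. by apply: monic_prod => h _; exact: monicXsubC. Qed.

Lemma f_size : size f = #|G|.+1.
Proof. by rewrite /f -big_enum /= size_prod_XsubC -cardE. Qed.

Lemma trace_poly (q s r : {poly Om}) : (forall i, kk q`_i) ->
  q = s * f + r -> (size r <= #|G|)%N ->
  \sum_(g in G) act g (q.[pi] / difft) = r`_(#|G|.-1).
Proof.
move=> kq E sr; rewrite (lagrange_coef (act_pi_inj CF T) sr (cardG_gt0 G)).
apply: eq_bigr => g Gg; rewrite fmorph_div /= act_difft // (act_horner T) //.
by rewrite E !hornerE f_root // mulr0 add0r.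
Qed.

Lemma f_small i : vgt v 0 (f - 'X^#|G|)`_i.
Proof.
have := @prod_XsubC_small [seq act h pi | h <- enum G].
rewrite size_map -cardE big_map big_enum => H; apply: H => a /mapP[h].
rewrite mem_enum => Gh ->; rewrite /vgt (tot_v T) // => _; exact: vpi.
Qed.

(** Write [y difft = c pi^(n-1) + pi^n w2] with [c] a nonzero constant. By Euler's formula the first
    term contributes the trace [c]; since [f] is [X^n] modulo the maximal ideal, the second
    contributes an element of the maximal ideal. *)
Lemma trace_neq0 y : L y -> y != 0 -> v y = #|G|.-1%:R * v pi - v difft ->
  \sum_(g in G) act g y != 0.
Proof.
move=> Ly y0 vy; set n := #|G|.
have n_gt0 : (0 < n)%N by exact: cardG_gt0.
pose w := y * difft; have D0 := difft_neq0.
have Lw : L w by apply: (subfldM Lf) => //; exact: difft_L.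
have vw : v w = n.-1%:R * v pi by rewrite (vlM vV) // vy subrK.
have w0 : w != 0 by rewrite mulf_neq0.
have pn0 : pi ^+ n.-1 != 0 by rewrite expf_neq0.
have pn0' : pi ^+ n != 0 by rewrite expf_neq0.
pose e := w / pi ^+ n.-1.
have ve : v e = 0 by rewrite (vl_div vV) // vw (vlX vV) // subrr.
have Le : L e by apply: (subfld_div Lf) => //; exact: (subfldX Lf).
have e0 : e != 0 by rewrite mulf_neq0 ?invr_eq0.
have [c kc hc] := cf_res CF (vge_unit e0 ve).
have c0 : c != 0.
  apply/eqP => c0; have := hc; rewrite c0 subr0 => /(_ e0); by rewrite ve ltxx.
have Lc := tot_kk T kc.
have hec : vge v (v pi) (e - c).
  move=> n0; have Lec : L (e - c) by exact: (subfldB Lf).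
  have [m vm] := tot_nat T Lec (vgtW hc) n0.
  have := hc n0; rewrite vm pmulr_lgt0 // ltr0n => m0.
  by rewrite ler_peMl ?ler1n //; exact: ltW.
pose w2 := (e - c) / pi.
have hw2 : vge v 0 w2.
  rewrite -(subrr (v pi)); apply: (vgeM vV) => //.
  by move=> _; rewrite (vl_inv vV).
have Lw2 : L w2 by apply: (subfld_div Lf) => //; exact: (subfldB Lf).
have Ew : w = c * pi ^+ n.-1 + pi ^+ n * w2.
  rewrite /w2 -{2}(prednK n_gt0) exprS.
  transitivity (e * pi ^+ n.-1); first by rewrite /e divfK.
  by field.
(* The precision must survive the division by [difft]. *)
have [M hM] := big_mult T (v difft + 1).
have [q kq hq] := tot_approx CF T M Lw2 hw2.
have Ey : y = ((c%:P * 'X^(n.-1)).[pi] / difft) + (('X^n * q).[pi] / difft)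
   + pi ^+ n * (w2 - q.[pi]) / difft.
  rewrite !hornerE -!mulrDl; apply: (mulIf D0); rewrite divfK // -/w Ew.
  by ring.
have kq1 i : kk (c%:P * 'X^(n.-1))`_i.
  rewrite coefCM coefXn; apply: (subfldM Kf) => //.
  by case: eqP => _; [exact: (subfld1 Kf)|exact: (subfld0 Kf)].
have kq2 i : kk ('X^n * q)`_i.
  by rewrite coefXnM; case: ltnP => // _; exact: (subfld0 Kf).
have T1 : \sum_(g in G) act g ((c%:P * 'X^(n.-1)).[pi] / difft) = c.
  rewrite (trace_poly (s := 0) (r := c%:P * 'X^(n.-1)) kq1) ?mul0r ?add0r //.
    by rewrite coefCM coefXn eqxx mulr1.
  by rewrite (leq_trans (size_polyMleq _ _)) // size_polyXn prednK // size_polyC c0 add1n.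
have T2 : vgt v 0 (\sum_(g in G) act g (('X^n * q).[pi] / difft)).
  have P0 : vgt v 0 (0 : Om) by exact: vgt0.
  have hf i : vge v 0 f`_i.
    have -> : f`_i = (f - 'X^n)`_i + ('X^n)`_i by rewrite coefB subrK.
    apply: (vgeD vV); first by apply: vgtW; exact: f_small.
    by rewrite coefXn; case: eqP => _; [exact: (vge01 vV)|exact: vge0].
  have PQ x z : vgt v 0 x -> vge v 0 z -> vgt v 0 (x * z).
    by move=> hx hz; rewrite mulrC -(addr0 0); apply: (vgtM vV).
  have he i : vgt v 0 ((f - 'X^n) * q)`_i.
    rewrite coefM; apply: (vgt_sum vV) => j _; apply: PQ; first exact: f_small.
    exact: (kk_int CF).
  have PB := @vgtB _ _ vV 0.
  have [s [r [E sr Pr _]]] := monic_division P0 PB PQ f_monic hf he.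
  rewrite f_size ltnS in sr.
  rewrite (trace_poly (s := q - s) (r := - r) kq2) ?size_polyN //.
    by rewrite coefN; apply: (vgtN vV).
  have -> : 'X^n * q = q * f - (f - 'X^n) * q by ring.
  by rewrite E; ring.
have T3 : vgt v 0 (\sum_(g in G) act g (pi ^+ n * (w2 - q.[pi]) / difft)).
  apply: (vgt_sum vV) => g Gg.
  have LL : L (pi ^+ n * (w2 - q.[pi]) / difft).
    apply: (subfld_div Lf); last exact: difft_L.
    apply: (subfldM Lf); first exact: (subfldX Lf).
    apply: (subfldB Lf) => //; apply: (subfld_horner Lf) => // i.
    exact: (tot_kk T).
  rewrite /vgt fmorph_eq0 (tot_v T) // -/(vgt v 0 _) .
  apply: (@vge_gt _ _ (v difft + 1 - v difft)); first by lra.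
  apply: (vgeM vV); last by move=> _; rewrite (vl_inv vV).
  apply: (vgeM0 vV); first by apply: (vgeX vV); exact: (pi_int T).
  exact: vgeW hM hq.
apply/eqP => tr0; have : vgt v 0 c.
  have -> : c = - (\sum_(g in G) act g (('X^n * q).[pi] / difft) +
     \sum_(g in G) act g (pi ^+ n * (w2 - q.[pi]) / difft)).
    apply/eqP; rewrite -addr_eq0 -{1}T1 addrA -!big_split /= -[X in _ == X]tr0.
    by apply/eqP; apply: eq_bigr => g _; rewrite [in RHS]Ey !rmorphD.
  by apply: (vgtN vV); apply: (vgtD vV).
by move/(kk_small CF kc)/eqP; rewrite (negbTE c0).
Qed.

(* Values of elements of trace zero avoid one class modulo [#|G|]. *)
Lemma trace_zero_val y (m : nat) : L y -> y != 0 -> v y = m%:R * v pi ->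
  \sum_(g in G) act g y = 0 ->
  ~~ (#|G| %| m + \sum_(g in G | g != 1%g) ram_w v act pi g)%N.
Proof.
move=> Ly y0 vy tr0; set S := (\sum_(g in G | _) _)%N.
apply/negP => /dvdnP[k Ek].
have vD : v difft = (S + #|G|.-1)%:R * v pi.
  rewrite v_difft (eq_bigr (fun g => (ram_w v act pi g).+1%:R * v pi)).
    rewrite -mulr_suml natrD; congr (_ * _).
    rewrite (eq_bigr (fun g => (ram_w v act pi g)%:R + 1)).
      rewrite big_split /= -natr_sum; congr (_ + _).
      rewrite sumr_const; congr (_%:R).
      rewrite (cardD1 1%g G) group1 /=; apply: eq_card => g.
      by rewrite !inE andbC.
    by move=> g _; rewrite -natr1.
  move=> g /andP[Gg g1]; rewrite -natr1 mulrDl mul1r.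
  have -> : act g pi - pi = (act g pi / pi - 1) * pi by rewrite mulrBl divfK // mul1r.
  rewrite (vlM vV) ?(ram_wP CF T Gg g1) //.
  have := gpi_sub_neq0 CF T Gg g1.
  have -> : act g pi - pi = (act g pi / pi - 1) * pi by rewrite mulrBl divfK // mul1r.
  by rewrite mulf_eq0 negb_or => /andP[].
have sGG : G \subset G by [].
have [Lnpi fnpi] := fixL_npi T sGG.
have npi0 : npi act pi G != 0 by exact: (npi_neq0 T).
(* Dividing by a power of the norm of [pi], which [G] fixes, keeps the trace zero and brings the
   value to the one treated in [trace_neq0]. *)
pose z := npi act pi G ^+ k; have z0 : z != 0 by rewrite expf_neq0.
have n_gt0 := cardG_gt0 G.
have Lz : L z by exact: (subfldX Lf).
have : \sum_(g in G) act g (y / z) != 0.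
  apply: trace_neq0; [exact: (subfld_div Lf)|by rewrite mulf_neq0 ?invr_eq0|].
  rewrite (vl_div vV) // (vlX vV) // (vnpi CF T sGG) vD vy.
  have /(congr1 (fun i : nat => i%:R : rat)) := Ek; rewrite natrD natrM => Er.
  have -> : m%:R = k%:R * #|G|%:R - S%:R :> rat by rewrite -Er addrK.
  by rewrite natrD; ring.
apply/negP; rewrite negbK.
rewrite (eq_bigr (fun g => act g y / z)); first by rewrite -mulr_suml tr0 mul0r.
by move=> g Gg; rewrite fmorph_div /= /z rmorphXn /= fnpi.
Qed.

End Trace.

(** * Sen's theorem and the Hasse-Arf theorem for cyclic groups *)

Section Arithmetic.

Variable p : nat.
Hypothesis p_pr : prime p.

Lemma logn_dvd_addl N b c : (p ^ N %| c)%N -> ~~ (p ^ N %| b)%N ->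
  logn p (c + b) = logn p b.
Proof.
move=> dc nb.
have b_gt0 : (0 < b)%N by rewrite lt0n; apply: contraNneq nb => ->; exact: dvdn0.
have cb_gt0 : (0 < c + b)%N by rewrite addn_gt0 b_gt0 orbT.
have lt x : (0 < x)%N -> ~~ (p ^ N %| x)%N -> (logn p x < N)%N.
  by move=> x0; rewrite pfactor_dvdn // -ltnNge.
have ncb : ~~ (p ^ N %| c + b)%N by rewrite dvdn_addr.
have H k : (k <= N)%N -> (k <= logn p (c + b))%N = (k <= logn p b)%N.
  move=> kN; rewrite -!pfactor_dvdn // dvdn_addr //.
  by apply: (dvdn_trans _ dc); exact: dvdn_exp2l.
have l1 := lt _ b_gt0 nb; have l2 := lt _ cb_gt0 ncb.
by apply/eqP; rewrite eqn_leq -H ?(ltnW l2) // leqnn /= H ?leqnn // ltnW.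
Qed.

Variable i : nat -> nat.

(** If [i k] is the lower number of [s^(p^k)], for a generator [s] of a cyclic group of order
    [p ^ N], this is the sum of the lower numbers of all nontrivial elements. *)
Definition pow_sum N : nat := (\sum_(1 <= m < p ^ N) i (logn p m))%N.

(** Cut the range into [p] blocks of length [p ^ N]. Translation by a multiple of [p ^ N] does not
    change [logn p] inside a block, and the [p - 1] block ends contribute [i N] each. *)
Lemma pow_sumS N : pow_sum N.+1 = (p * pow_sum N + p.-1 * i N)%N.
Proof.
have p_gt0 := prime_gt0 p_pr; have pN : (0 < p ^ N)%N by rewrite expn_gt0 p_gt0.
suff H a : (0 < a)%N -> (a <= p)%N ->
    (\sum_(1 <= m < a * p ^ N) i (logn p m) = a * pow_sum N + a.-1 * i N)%N.
  by rewrite /pow_sum expnS H.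
elim: a => [//|[_ _ _|a IH _ ap]]; first by rewrite !mul1n mul0n addn0.
have a1p : (0 < a.+1 * p ^ N)%N by rewrite muln_gt0.
rewrite (big_cat_nat (n := a.+1 * p ^ N)) //=; last by rewrite leq_mul2r leqnSn orbT.
rewrite IH //; last exact: ltnW.
rewrite -{1}[(a.+1 * p ^ N)%N]add0n big_addn.
have -> : (a.+2 * p ^ N - a.+1 * p ^ N = p ^ N)%N by rewrite -mulnBl subSnn mul1n.
rewrite big_ltn // add0n.
have -> : logn p (a.+1 * p ^ N) = N.
  rewrite lognM ?expn_gt0 ?p_gt0 // pfactorK // logn_coprime //.
  by rewrite prime_coprime // gtnNdvd.
rewrite (eq_big_nat _ _ (F2 := fun m => i (logn p m))).
  by rewrite -/(pow_sum N) /= !mulSn; lia.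
move=> m /andP[m0 mN]; rewrite addnC (@logn_dvd_addl N) ?dvdn_mull //.
by rewrite gtnNdvd.
Qed.

Hypothesis i_mono : forall k, (i k <= i k.+1)%N.

Lemma i_le j k : (j <= k)%N -> (i j <= i k)%N.
Proof.
move=> /subnK <-; elim: (k - j)%N => [|n IH]; first by rewrite add0n.
by rewrite addSn (leq_trans IH).
Qed.

(** The recursion rewrites the sum as [p] times the previous one plus [p (i N.+1 - i N)]: Sen's
    congruences imply Hasse-Arf. *)
Lemma pow_sum_dvd N : (forall k, (k < N)%N -> (p ^ k.+1 %| i k.+1 - i k)%N) ->
  (p ^ N.+1 %| pow_sum N.+1 + i N)%N.
Proof.
elim: N => [|N IH] h.
  rewrite expn1 pow_sumS /pow_sum expn0 big_geq // muln0 add0n -{2}[i 0%N]mul1n -mulnDl.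
  by rewrite addn1 prednK ?prime_gt0 // dvdn_mulr.
have {}IH := IH (fun k kN => h k (ltnW kN)).
have := h N (ltnSn N) => hN; have le := i_mono N.
rewrite pow_sumS.
have -> : (p * pow_sum N.+1 + p.-1 * i N.+1 + i N.+1 =
   p * ((pow_sum N.+1 + i N) + (i N.+1 - i N)))%N.
  have := prime_gt0 p_pr; case: (p) => [//|q] _ /=.
  rewrite -(addnA _ (i N)) subnKC // !mulnDr; ring.
by rewrite [(p ^ N.+2)%N]expnS dvdn_pmul2l ?prime_gt0 // dvdn_add.
Qed.

Lemma sen_diff N a : (forall k, (k < N)%N -> (p ^ k.+1 %| i k.+1 - i k)%N) ->
  (a <= N)%N -> (p ^ a.+1 %| i N - i a)%N.
Proof.
move=> h /subnK; move: (N - a)%N => n; elim: n N h => [|n IH] N h E; subst N.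
  by rewrite add0n subnn dvdn0.
rewrite addSn in h *.
have le1 : (i a <= i (n + a))%N by apply: i_le; exact: leq_addl.
have -> : (i (n + a).+1 - i a = (i (n + a).+1 - i (n + a)) + (i (n + a) - i a))%N.
  by have := i_mono (n + a); lia.
apply: dvdn_add.
  apply: (dvdn_trans _ (h (n + a)%N (ltnSn _))); apply: dvdn_exp2l.
  by rewrite ltnS leq_addl.
by apply: IH => // k kn; apply: h; exact: ltnW.
Qed.

(* The class avoided by the values of trace-zero elements must be [i N.+1]
   modulo [p ^ N.+1], and this is the congruence for the last jump. *)
Lemma sen_step N :
  (forall k, (k < N)%N -> (p ^ k.+1 %| i k.+1 - i k)%N) ->
  (forall m, ~~ (p ^ N.+2 %| m)%N ->
     ~~ (p ^ N.+2 %| m + i (logn p m) + pow_sum N.+2)%N) ->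
  (p ^ N.+1 %| i N.+1 - i N)%N.
Proof.
move=> h miss; apply/negPn/negP => nd.
have p_gt0 := prime_gt0 p_pr.
set S := pow_sum N.+2 in miss.
have ES : (S + i N = p * (pow_sum N.+1 + i N) + p.-1 * (i N.+1 - i N))%N.
  rewrite /S pow_sumS; have := i_mono N; have := p_gt0; case: (p) => [//|q] _ /= le.
  have -> : i N.+1 = (i N + (i N.+1 - i N))%N by rewrite subnKC.
  rewrite addKn; ring.
have ndS : ~~ (p ^ N.+1 %| S + i N)%N.
  rewrite ES dvdn_addr; last by rewrite dvdn_mull // pow_sum_dvd.
  rewrite Gauss_dvdr // coprime_sym coprimeXr // coprime_sym prime_coprime //.
  have := prime_gt1 p_pr; case: (p) => [//|[//|q]] _ /=; by rewrite gtnNdvd.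
have s_gt0 : (0 < S + i N)%N by rewrite lt0n; apply: contraNneq ndS => ->; exact: dvdn0.
pose a := logn p (S + i N).
have aN : (a <= N)%N by move: ndS; rewrite pfactor_dvdn // -ltnNge ltnS.
have da := sen_diff h aN; have le_ai := i_le aN.
(* [m] is a positive integer congruent to [- c]. Its [p]-adic valuation is [a], so
   [m + i (logn p m) + S] is divisible by [p ^ N.+2], which [miss] forbids. *)
pose c := (i a + S)%N; pose m := (p ^ N.+2 * c.+1 - c)%N.
have cm : (c + m = p ^ N.+2 * c.+1)%N.
  rewrite subnKC //; apply: leq_trans (leqnSn c) _.
  by apply: leq_pmull; rewrite expn_gt0 p_gt0.
have dvd_cm k : (k <= N.+2)%N -> (p ^ k %| c + m)%N.
  by move=> kN; rewrite cm dvdn_mulr // dvdn_exp2l.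
have dvd_cs k : (k <= a.+1)%N -> (p ^ k %| c)%N = (p ^ k %| S + i N)%N.
  move=> ka; have -> : (S + i N = c + (i N - i a))%N by rewrite /c; lia.
  by rewrite dvdn_addl //; apply: (dvdn_trans _ da); exact: dvdn_exp2l.
have dvd_mc k : (k <= N.+2)%N -> (p ^ k %| m)%N = (p ^ k %| c)%N.
  move=> kN; have := dvd_cm k kN => d.
  by apply/idP/idP => d'; [rewrite -(dvdn_addl _ d')|rewrite -(dvdn_addr _ d')].
have nm : ~~ (p ^ a.+1 %| m)%N.
  rewrite dvd_mc ?dvd_cs // ?pfactor_dvdn // ?ltnn //.
  by rewrite ltnS (leq_trans aN).
have dm : (p ^ a %| m)%N.
  rewrite dvd_mc ?dvd_cs // ?pfactor_dvdn //.
  by rewrite (leq_trans aN) // (leq_trans (leqnSn _)).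
have m_gt0 : (0 < m)%N by rewrite lt0n; apply: contraNneq nm => ->; exact: dvdn0.
have lm : logn p m = a.
  by apply/eqP; rewrite eqn_leq -ltnS ltnNge -!pfactor_dvdn // nm dm.
have nm2 : ~~ (p ^ N.+2 %| m)%N.
  apply: contraNN nm; apply: dvdn_trans; apply: dvdn_exp2l.
  by rewrite ltnS (leq_trans aN).
have := miss m nm2; rewrite lm -addnA -/c addnC cm dvdn_mulr //.
Qed.

End Arithmetic.

Section CyclicSums.

Lemma sum_cycle (X : finGroupType) (x : X) (F : X -> nat) :
  (\sum_(g in <[x]>%g | g != 1%g) F g = \sum_(1 <= m < #[x]%g) F (x ^+ m)%g)%N.
Proof.
have o_gt0 : (0 < #[x]%g)%N by exact: order_gt0.
apply: (@addnI (F 1%g)).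
rewrite -(bigD1 1%g) ?group1 //= -{1}(expg0 x) -(big_ltn (F := fun m => F (x ^+ m)%g)) //.
rewrite -(big_map (fun m => x ^+ m)%g xpredT F) -big_enum /=.
apply: perm_big; apply: uniq_perm; first exact: enum_uniq.
  rewrite map_inj_in_uniq ?iota_uniq // => i j; rewrite !mem_index_iota /= => li lj /eqP.
  by rewrite eq_expg_mod_order !modn_small // => /eqP.
move=> g; rewrite mem_enum; apply/idP/mapP => [/cyclePmin[i li ->]|[i _ ->]].
  by exists i => //; rewrite mem_index_iota.
exact: mem_cycle.
Qed.

End CyclicSums.

Section Sen.

Variables (Om : fieldType) (v : Om -> rat) (kk : Om -> Prop).
Hypothesis CF : coeff_field v kk.
Let vV := cf_val CF.
Variables (p : nat) (Hp : p \in [pchar Om]).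
Let p_pr : prime p := pcharf_prime Hp.

Section OneCyclic.

Variables (X : finGroupType) (G : {group X}) (act : X -> {rmorphism Om -> Om}).
Variables (L : Om -> Prop) (pi : Om).
Hypothesis T : tot v kk G act L pi.
Let Lf := tot_L T.
Let pi0 := tot_pi0 T.
Let Lpi := tot_pi T.
Let vpi := tot_vpi T.
Local Notation w := (ram_w v act pi).

Variables (s : X) (N : nat).
Hypothesis Gs : G :=: <[s]>%g.
Hypothesis oG : #|G| = (p ^ N)%N.

Let sG : s \in G. Proof. by rewrite Gs cycle_id. Qed.
Let os : #[s]%g = (p ^ N)%N. Proof. by rewrite /order -Gs. Qed.

Lemma ram_w_le g h : g \in G -> g != 1%g -> h != 1%g -> h \in <[g]>%g -> (w g <= w h)%N.
Proof.
move=> Gg g1 h1 hg.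
have gr : g \in ram_group CF T (w g) by rewrite inE Gg leqnn orbT.
have : h \in ram_group CF T (w g) by apply: (subsetP _ _ hg); rewrite cycle_subG.
by rewrite inE (negbTE h1) /= => /andP[].
Qed.

Definition cyc_jump k := w (s ^+ (p ^ k))%g.

Lemma pow_neq1 m : (s ^+ m != 1)%g = ~~ (p ^ N %| m)%N.
Proof. by rewrite -order_dvdn os. Qed.

(** [s ^+ m] and [s ^+ (p ^ logn p m)] generate the same subgroup, and the lower number only depends
    on that subgroup. *)
Lemma ram_w_pow m : ~~ (p ^ N %| m)%N -> w (s ^+ m)%g = cyc_jump (logn p m).
Proof.
move=> nm; have m_gt0 : (0 < m)%N by rewrite lt0n; apply: contraNneq nm => ->; exact: dvdn0.
have [m' cm Em] := pfactor_coprime p_pr m_gt0.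
set k := logn p m; set x := (s ^+ (p ^ k))%g.
have Ex : (s ^+ m)%g = (x ^+ m')%g by rewrite /x -expgM mulnC -Em.
have x1 : x != 1%g.
  rewrite pow_neq1; apply: contraNN nm => d; apply: dvdn_trans d _.
  by rewrite [X in (_ %| X)%N]Em dvdn_mull.
have sm1 : (s ^+ m != 1)%g by rewrite pow_neq1.
have Gx : x \in G by exact: groupX.
have Gm : (s ^+ m)%g \in G by exact: groupX.
have ox : p.-nat #[x]%g.
  by apply: pnat_dvd (orderXdvd _ _) _; rewrite os pnatX pnat_id.
have gen : <[x]>%g = <[(s ^+ m)%g]>%g.
  apply/eqP; rewrite Ex; change (generator <[x]>%g (x ^+ m')%g).
  rewrite generator_coprime; apply: (pnat_coprime ox).
  by rewrite p'natE // -prime_coprime.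
apply/eqP; rewrite eqn_leq /cyc_jump -/x !ram_w_le //.
  by rewrite gen cycle_id.
by rewrite -gen cycle_id.
Qed.

Lemma ram1_all g : g \in G -> g != 1%g -> (0 < w g)%N.
Proof.
move=> Gg g1; have : g \in ram_group CF T 1.
  have := tame_coprime CF Hp T; rewrite coprime_sym => co.
  have : (#|G : ram_group CF T 1|%g %| p ^ N)%N by rewrite -oG dvdn_indexg.
  have co2 : coprime #|G : ram_group CF T 1|%g (p ^ N) by apply: coprimeXr.
  by rewrite -[X in (_ %| X)%N]muln1 (Gauss_dvdr _ co2) dvdn1 indexg_eq1 => /subsetP; apply.
by rewrite inE (negbTE g1) => /andP[].
Qed.

(** An element of value [m v(pi)] on which [s] acts by a telescoping quotient: [s] multiplies it by
    [act (s ^+ m) pi / pi]. *)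
Definition cyc_prod m : Om := \prod_(j < m) act (s ^+ j)%g pi.

Lemma cyc_prod_L m : L (cyc_prod m).
Proof. by apply: (subfld_prod Lf) => j _; apply: (tot_stab T) => //; exact: groupX. Qed.

Lemma cyc_prod_neq0 m : cyc_prod m != 0.
Proof. by apply/prodf_neq0 => j _; rewrite fmorph_eq0. Qed.

Lemma v_cyc_prod m : v (cyc_prod m) = m%:R * v pi.
Proof.
rewrite /cyc_prod (vlY vV); last by move=> j _; rewrite fmorph_eq0.
rewrite (eq_bigr (fun=> v pi)).
  by rewrite sumr_const card_ord mulr_natl.
by move=> j _; rewrite (tot_v T) // groupX.
Qed.

Lemma act_cyc_prod m : act s (cyc_prod m) - cyc_prod m =
  cyc_prod m * (act (s ^+ m)%g pi / pi - 1).
Proof.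
rewrite mulrBr mulr1; congr (_ - _).
rewrite mulrA; apply: (canRL (mulfK pi0)).
have -> : cyc_prod m * act (s ^+ m)%g pi = \prod_(j < m.+1) act (s ^+ j)%g pi.
  by rewrite big_ord_recr.
rewrite /cyc_prod rmorph_prod /= big_ord_recl expg0 (tot1 T) // mulrC.
congr (_ * _); apply: eq_bigr => j _.
by rewrite /= /bump leq0n add1n expgS (tot_M T) // groupX.
Qed.

(** [s - 1] applied to [cyc_prod m] has trace zero and value [m] plus the lower number of [s ^+ m],
    so [trace_zero_val] applies to it. *)
Lemma missing_class m : ~~ (p ^ N %| m)%N ->
  ~~ (p ^ N %| m + cyc_jump (logn p m) + pow_sum p cyc_jump N)%N.
Proof.
move=> nm; pose y := act s (cyc_prod m) - cyc_prod m.
have sm1 : (s ^+ m != 1)%g by rewrite pow_neq1.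
have Gm : (s ^+ m)%g \in G by exact: groupX.
have d0 : act (s ^+ m)%g pi / pi - 1 != 0.
  rewrite subr_eq0; apply: contraNneq sm1 => h; apply/eqP.
  apply: (tot_pi_faith CF T Gm).
  by rewrite -[LHS](divfK pi0) h mul1r.
have y0 : y != 0 by rewrite /y act_cyc_prod mulf_neq0 // cyc_prod_neq0.
have Ly : L y.
  by apply: (subfldB Lf); [apply: (tot_stab T) => //|]; exact: cyc_prod_L.
have vy : v y = (m + cyc_jump (logn p m))%:R * v pi.
  rewrite /y act_cyc_prod (vlM vV) ?cyc_prod_neq0 // v_cyc_prod.
  by rewrite (ram_wP CF T Gm sm1) ram_w_pow // natrD mulrDl.
have try : \sum_(g in G) act g y = 0.
  rewrite (eq_bigr (fun g => act g (act s (cyc_prod m)) - act g (cyc_prod m))); last first.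
    by move=> g _; rewrite rmorphB.
  rewrite sumrB; apply/eqP; rewrite subr_eq0; apply/eqP.
  rewrite [RHS](reindex_inj (mulIg s)) /=; apply: eq_big => g.
    by rewrite groupMr.
  by move=> Gg; rewrite (tot_M T) //; exact: cyc_prod_L.
have := trace_zero_val CF T Ly y0 vy try; rewrite oG.
congr (~~ (_ %| _ + _)%N); rewrite /pow_sum -os.
rewrite (eq_bigl (fun g => (g \in <[s]>%g) && (g != 1%g))); last by move=> g; rewrite Gs.
rewrite sum_cycle; apply: eq_big_nat => j /andP[j0 jN].
by apply: ram_w_pow; rewrite gtnNdvd // -os.
Qed.

Lemma cyc_jump_mono k : (k.+1 < N)%N -> (cyc_jump k <= cyc_jump k.+1)%N.
Proof.
move=> kN; have lt1 := prime_gt1 p_pr; apply: ram_w_le.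
- exact: groupX.
- by rewrite pow_neq1 dvdn_Pexp2l // -ltnNge ltnW.
- by rewrite pow_neq1 dvdn_Pexp2l // -ltnNge.
- by rewrite expnSr expgM mem_cycle.
Qed.

End OneCyclic.

Section LastQuotient.

Variables (X : finGroupType) (G : {group X}) (act : X -> {rmorphism Om -> Om}).
Variables (L : Om -> Prop) (pi : Om).
Hypothesis T : tot v kk G act L pi.
Local Notation w := (ram_w v act pi).

(* The lower numbering is not affected when the quotient is by a subgroup
   whose translations do not change [w]. *)
Lemma ram_w_quotient (H : {group X}) (nHG : (H <| G)%g) g :
  g \in G -> g \notin H -> (forall h, h \in H -> w (g * h)%g = w g) ->
  ram_w v (quo_act act (H := H)) (npi act pi H) (coset H g) = w g.
Proof.
move=> Gg nHg wH; have sHG := normal_sub nHG.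
have TQ := tot_quotient CF T nHG.
have Ng := subsetP (normal_norm nHG) _ Gg.
have Gq : coset H g \in (G / H)%G by apply: mem_quotient.
have q1 : coset H g != 1%g.
  by apply: contraNneq nHg => /(coset_idr Ng).
have Hh h : h \in H -> v (act (g * h)%g pi - pi) = (w g).+1%:R * v pi.
  move=> Hh; have Gh := subsetP sHG _ Hh; have Ggh := groupM Gg Gh.
  have gh1 : (g * h != 1)%g.
    by apply: contraNneq nHg => gh; rewrite -(groupMr _ Hh) gh group1.
  have pi0 := tot_pi0 T.
  have E : act (g * h)%g pi - pi = (act (g * h)%g pi / pi - 1) * pi.
    by rewrite mulrBl divfK // mul1r.
  have := gpi_sub_neq0 CF T Ggh gh1; rewrite E mulf_eq0 negb_or => /andP[n0 _].
  by rewrite (vlM vV) // (ram_wP CF T Ggh gh1) wH // -natr1 mulrDl mul1r.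
have n0 := npi_neq0 T H.
have vn := vnpi CF T sHG.
have vpos : v (npi act pi H) != 0 by rewrite lt0r_neq0 // (vnpi_gt0 CF T sHG).
have E1 : v (act g (npi act pi H) - npi act pi H) = (w g).+1%:R * v (npi act pi H).
  rewrite (npi_sub CF T sHG Gg nHg) (eq_bigr _ Hh) sumr_const -mulr_natl vn.
  by ring.
have := ram_wP CF TQ Gq q1; rewrite (quo_actE T nHG Gg (fixL_npi T sHG)).
set z := act g _ / _ - 1.
have Ez : act g (npi act pi H) - npi act pi H = z * npi act pi H.
  by rewrite /z mulrBl divfK // mul1r.
have z0 : z != 0.
  have := npi_moved CF T sHG Gg nHg; rewrite -subr_eq0 Ez mulf_eq0 negb_or.
  by case/andP.
move=> vz; move: E1; rewrite Ez (vlM vV) // vz.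
rewrite -[X in _ + X]mul1r -mulrDl => /(mulIf vpos)/eqP.
by rewrite natr1 eqr_nat eqSS => /eqP.
Qed.

End LastQuotient.

(** [sen_step] asks for jumps increasing at all indices, but those beyond the order of [s] are junk;
    truncation repairs this without changing the sum. *)
Lemma trunc_pow_sum (i : nat -> nat) N :
  pow_sum p (fun k => i (minn k N)) N.+1 = pow_sum p i N.+1.
Proof.
rewrite /pow_sum; apply: eq_big_nat => m /andP[m0 mN].
rewrite (minn_idPl _) //; rewrite -ltnS ltnNge -pfactor_dvdn //.
by apply/negP => /(dvdn_leq m0); rewrite leqNgt mN.
Qed.

(** Induction on [N]: the quotient by the subgroup of order [p] has the same jumps except the last
    one, which gives all congruences but the last; that one is [sen_step], fed by
    [missing_class]. *)
Theorem sen N (X : finGroupType) (G : {group X}) (act : X -> {rmorphism Om -> Om})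
    (L : Om -> Prop) (pi : Om) (T : tot v kk G act L pi) (s : X) :
  G :=: <[s]>%g -> #|G| = (p ^ N)%N -> forall k, (k.+1 < N)%N ->
  (p ^ k.+1 %| cyc_jump act pi s k.+1 - cyc_jump act pi s k)%N.
Proof.
elim: N X G act L pi T s => [//|N IH] X G act L pi T s Gs oG k kN.
have sG : s \in G by rewrite Gs cycle_id.
have os : #[s]%g = (p ^ N.+1)%N by rewrite /order -Gs.
have p_gt1 := prime_gt1 p_pr; have p_gt0 := prime_gt0 p_pr.
pose H := <[(s ^+ (p ^ N))%g]>%G.
have nHG : (H <| G)%g.
  have sHG : H \subset G by rewrite cycle_subG groupX.
  by rewrite /normal sHG (sub_abelian_norm _ sHG) // Gs cycle_abelian.
have oH : #|H| = p.
  by rewrite -orderE orderXdiv os ?expnSr ?dvdn_mulr // mulKn // expn_gt0 p_gt0.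
have Ns := subsetP (normal_norm nHG) _ sG.
have GqE : (G / H)%G :=: <[coset H s]>%g by rewrite /= Gs quotient_cycle.
have oGq : #|(G / H)%G| = (p ^ N)%N.
  by rewrite /= card_quotient ?normal_norm // -divgS ?normal_sub // oG oH expnSr mulnK.
have notH m : ~~ (p ^ N %| m)%N -> (s ^+ m)%g \notin H.
  apply: contraNN => /cycleP[l]; rewrite -expgM => /eqP.
  rewrite eq_expg_mod_order os => /eqP E.
  have : (m %% p ^ N.+1 = 0 %[mod p ^ N])%N.
    by rewrite E modn_dvdm ?dvdn_exp2l // modnMr mod0n.
  by rewrite modn_dvdm ?dvdn_exp2l // mod0n => /eqP.
have jumpE j : (j < N)%N ->
    cyc_jump (quo_act act (H := H)) (npi act pi H) (coset H s) j = cyc_jump act pi s j.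
  move=> jN; rewrite /cyc_jump -[X in ram_w _ _ _ X](_ : coset H (s ^+ (p ^ j))%g = _).
  have nj : ~~ (p ^ N %| p ^ j)%N by rewrite dvdn_Pexp2l // -ltnNge.
  apply: (ram_w_quotient T nHG); [exact: groupX|exact: notH|].
  move=> h /cycleP[l ->]; rewrite -expgM -expgD.
  have nd c : (p ^ N %| c)%N -> ~~ (p ^ N.+1 %| c + p ^ j)%N.
    move=> dc; apply: contraNN nj => d.
    by rewrite -(dvdn_addr _ dc); apply: dvdn_trans d; exact: dvdn_exp2l.
  rewrite addnC !(ram_w_pow T Gs oG) ?nd ?dvdn_mulr //; last by have := nd 0 (dvdn0 _).
  by rewrite (logn_dvd_addl p_pr _ nj) // dvdn_mulr.
  by rewrite morphX.
have h j : (j.+1 < N)%N -> (p ^ j.+1 %| cyc_jump act pi s j.+1 - cyc_jump act pi s j)%N.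
  by move=> jN; rewrite -!jumpE //; [apply: (IH _ _ _ _ _ (tot_quotient CF T nHG))|exact: ltnW].
have [|Nk] := ltnP k.+1 N; first exact: h.
have Ek : N = k.+1 by move: kN Nk; clear; lia.
move: oG os h; rewrite Ek => oG os h.
pose i := fun j => cyc_jump act pi s (minn j k.+1).
have i_mono j : (i j <= i j.+1)%N.
  rewrite /i; have [jk|kj] := ltnP j k.+1.
    rewrite (minn_idPl jk).
    exact: (cyc_jump_mono T Gs oG).
  by rewrite (minn_idPr (leqW kj)).
have hi j : (j < k)%N -> (p ^ j.+1 %| i j.+1 - i j)%N.
  by move=> jk; rewrite /i !(minn_idPl _) ?h // ltnW // ltnW.
have := sen_step p_pr i_mono hi.
have -> : i k.+1 = cyc_jump act pi s k.+1 by rewrite /i minnn.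
have -> : i k = cyc_jump act pi s k by rewrite /i (minn_idPl (leqnSn k)).
apply=> m nm; have := missing_class T Gs oG nm.
rewrite /i trunc_pow_sum (minn_idPl _) //.
by rewrite -ltnS ltnNge -pfactor_dvdn // lt0n; apply: contraNneq nm => ->; exact: dvdn0.
Qed.

(** The largest lower number is the last jump, so this is [pow_sum_dvd]; the quotient is the value
    of Herbrand's function at that jump. *)
Theorem hasse_arf_cyclic (X : finGroupType) (G : {group X})
    (act : X -> {rmorphism Om -> Om}) (L : Om -> Prop) (pi : Om)
    (T : tot v kk G act L pi) (x : X) :
  cyclic G -> (p.-group G)%g -> x \in G -> x != 1%g ->
  (forall g, g \in G -> g != 1%g -> (ram_w v act pi g <= ram_w v act pi x)%N) ->
  (#|G| %| \sum_(g in G | g != 1%g) ram_w v act pi g + ram_w v act pi x)%N.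
Proof.
move=> /cyclicP[s Gs] pG Gx x1 xmax.
have [N oG] := p_natP pG.
have os : #[s]%g = (p ^ N)%N by rewrite /order -Gs.
have p_gt1 := prime_gt1 p_pr.
case: N oG os => [|N] oG os.
  by move: x1; have /eqP := oG; rewrite expn0 -trivg_card1 => /eqP G1; move: Gx; rewrite G1 => /set1P ->; rewrite eqxx.
pose i := fun j => cyc_jump act pi s (minn j N).
have i_mono j : (i j <= i j.+1)%N.
  rewrite /i; have [jk|kj] := ltnP j N.
    rewrite (minn_idPl jk).
    exact: (cyc_jump_mono T Gs oG).
  by rewrite (minn_idPr (leqW kj)).
have hi j : (j < N)%N -> (p ^ j.+1 %| i j.+1 - i j)%N.
  by move=> jk; rewrite /i !(minn_idPl _) ?(ltnW jk) //; apply: (sen T Gs oG).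
have := pow_sum_dvd p_pr i_mono hi; rewrite oG /i trunc_pow_sum minnn.
congr (_ %| _ + _)%N.
  rewrite /pow_sum -os.
  rewrite [RHS](eq_bigl (fun g => (g \in <[s]>%g) && (g != 1%g))); last by move=> g; rewrite Gs.
  rewrite sum_cycle; apply: eq_big_nat => j /andP[j0 jN].
  by rewrite (ram_w_pow T Gs oG) // gtnNdvd // -os.
have sN : (s ^+ (p ^ N))%g != 1%g by rewrite -order_dvdn os dvdn_Pexp2l // -ltnNge.
have sG : s \in G by rewrite Gs cycle_id.
apply/eqP; rewrite eqn_leq xmax ?groupX //=.
have := Gx; rewrite Gs => /cycleP[m Ex].
have nm : ~~ (p ^ N.+1 %| m)%N by rewrite -os order_dvdn -Ex.
rewrite Ex (ram_w_pow T Gs oG nm).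
have -> : cyc_jump act pi s N = i N by rewrite /i minnn.
have lm : (logn p m <= N)%N.
  by rewrite -ltnS ltnNge -pfactor_dvdn // lt0n; apply: contraNneq nm => ->; exact: dvdn0.
have -> : cyc_jump act pi s (logn p m) = i (logn p m) by rewrite /i (minn_idPl lm).
exact: i_le.
Qed.

End Sen.

(** * Hasse-Arf for a p-subgroup with a cyclic quotient *)

Section RamSum.

Variables (Om : fieldType) (v : Om -> rat) (kk : Om -> Prop).
Hypothesis CF : coeff_field v kk.
Let vV := cf_val CF.
Variables (p : nat) (Hp : p \in [pchar Om]).
Variables (X : finGroupType) (G : {group X}) (act : X -> {rmorphism Om -> Om}).
Variables (L : Om -> Prop) (pi : Om).
Hypothesis T : tot v kk G act L pi.
Let Lf := tot_L T.
Let pi0 := tot_pi0 T.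
Let Lpi := tot_pi T.
Let vpi := tot_vpi T.
Local Notation w := (ram_w v act pi).
Local Notation ram := (ram v G act pi).

Lemma gpi_subE g : g \in G -> g != 1%g -> v (act g pi - pi) = (w g).+1%:R * v pi.
Proof.
move=> Gg g1; have n0 := gpi_sub_neq0 CF T Gg g1.
have E : act g pi - pi = (act g pi / pi - 1) * pi by rewrite mulrBl divfK // mul1r.
move: n0; rewrite E mulf_eq0 negb_or => /andP[n1 _].
by rewrite (vlM vV) // (ram_wP CF T Gg g1) -natr1 mulrDl mul1r.
Qed.

Lemma herbE x : x \in G -> x != 1%g ->
  herb v G act pi (act x pi) =
  (w x + \sum_(g in G | g != 1%g) minn (w g) (w x) + #|G|)%:R * v pi.
Proof.
move=> Gx x1; rewrite /herb gpi_subE //.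
rewrite (eq_bigr (fun g => (minn (w g) (w x) + 1)%:R * v pi)); last first.
  move=> g /andP[Gg g1]; rewrite gpi_subE // addn1.
  have [le|/ltnW le] := leqP (w g) (w x).
    by rewrite min_l // ler_pM2r // ler_nat ltnS.
  by rewrite min_r // ler_pM2r // ler_nat ltnS.
rewrite -mulr_suml -mulrDl -natr_sum -natrD big_split /=; congr (_%:R * _).
have -> : #|G| = (\sum_(g in G | g != 1%g) 1).+1.
  by rewrite -sum1_card (bigD1 1%g) //= add1n.
by rewrite addnS addnA addSn.
Qed.

(** Double counting of the pairs [(i, g)] with [g] in [G_i]. *)
Lemma ramsumE k : ramsum v G act pi k = (k + \sum_(g in G | g != 1%g) minn (w g) k)%N.
Proof.
rewrite /ramsum (eq_bigr (fun i => \sum_(g in G) ((g == 1%g) || (i <= w g)%N)))%N; last first.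
  move=> i _; rewrite -sum1_card big_mkcond [RHS]big_mkcond /=.
  by apply: eq_bigr => g _; rewrite inE; case: (g \in G) => //=; case: orb.
rewrite exchange_big /= (bigD1 1%g) //= eqxx /=; congr (_ + _)%N.
  by rewrite sum_nat_const_nat muln1 subSS subn0.
apply: eq_bigr => g /andP[_ /negbTE ->] /=.
elim: k => [|k IH]; first by rewrite big_geq // minn0.
by rewrite big_nat_recr //= IH; have [le|lt] := leqP k.+1 (w g); clear IH; [move: le|move: lt]; clear; lia.
Qed.

End RamSum.

Section HasseArf.

Variables (Om : fieldType) (v : Om -> rat) (kk : Om -> Prop).
Hypothesis CF : coeff_field v kk.
Let vV := cf_val CF.
Variables (p : nat) (Hp : p \in [pchar Om]).
Variables (X : finGroupType) (G : {group X}) (act : X -> {rmorphism Om -> Om}).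
Variables (L : Om -> Prop) (pi : Om).
Hypothesis T : tot v kk G act L pi.
Let Lf := tot_L T.
Let pi0 := tot_pi0 T.
Let Lpi := tot_pi T.
Let vpi := tot_vpi T.
Local Notation w := (ram_w v act pi).
Local Notation ram := (ram v G act pi).

Section Complement.

Variable A : {group X}.
Hypothesis sAG : A \subset G.

Let rep (g : X) : X := repr (g *: A)%g.

Let rep_coset g : g \in G -> exists2 a, a \in A & rep g = (g * a)%g.
Proof.
move=> Gg; rewrite /rep; have : (g * 1)%g \in (g *: A)%g by rewrite mem_lcoset mulKg group1.
by move/mem_repr => /lcosetP[a Aa ->]; exists a.
Qed.

Let rep_eq g a : a \in A -> rep (g * a)%g = rep g.
Proof. by move=> Aa; rewrite /rep lcosetM lcoset_id. Qed.

Let repG g : g \in G -> rep g \in G.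
Proof. by move=> Gg; have [a Aa ->] := rep_coset Gg; rewrite groupM // (subsetP sAG). Qed.

Let rep_rep g : g \in G -> rep (rep g) = rep g.
Proof. by move=> Gg; have [a Aa E] := rep_coset Gg; rewrite {1}E rep_eq. Qed.

Let repA g : g \in G -> (rep g \in A) = (g \in A).
Proof. by move=> Gg; have [a Aa ->] := rep_coset Gg; rewrite groupMr. Qed.

Let TA := tot_subgroup T sAG.

Let D : Om := \prod_(t in G | (t \notin A) && (rep t == t))
  (act t (npi act pi A) - npi act pi A).

(** [D] is a product of displacements of the norm of [pi], one for each nontrivial coset of [A], so
    its value is the sum of [w g + 1] outside [A]. As [A] permutes the cosets, [D] lies in the fixed
    field, where values are multiples of [|A| v(pi)]. *)
Lemma complement_dvd : (#|A| %| \sum_(g in G | g \notin A) w g)%N.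
Proof.
have D0 : D != 0.
  apply/prodf_neq0 => t /and3P[Gt nAt _].
  by rewrite subr_eq0 (npi_moved CF T sAG).
have [LN fN] := fixL_npi T sAG.
have act_rep g : g \in G -> act (rep g) (npi act pi A) = act g (npi act pi A).
  move=> Gg; have [a Aa ->] := rep_coset Gg.
  by rewrite (tot_M T Gg (subsetP sAG _ Aa) LN) fN.
have fD : fixL act L A D.
  split.
    apply: (subfld_prod Lf) => t /and3P[Gt _ _].
    by apply: (subfldB Lf) => //; apply: (tot_stab T).
  move=> a Aa; have Ga := subsetP sAG _ Aa; have AV := groupVr Aa; have GV := subsetP sAG _ AV.
  rewrite /D rmorph_prod /=.
  rewrite [RHS](reindex_onto (fun t => rep (a * t)%g) (fun t => rep (a^-1 * t)%g)) /=; last first.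
    move=> t /and3P[Gt nAt /eqP rt]; have [b Ab ->] := rep_coset (groupM GV Gt).
    by rewrite !mulgA mulgV mul1g rep_eq.
  apply: eq_big => t.
    apply/and3P/idP => [[Gt nAt /eqP rt]|].
      have Gat := groupM Ga Gt.
      rewrite repG // repA // groupMl // nAt rep_rep // eqxx /=.
      have [b Ab ->] := rep_coset Gat.
      by rewrite -mulgA mulKg rep_eq // rt.
    case/andP=> /and3P[Gr nAr _] /eqP Et.
    have Gt : t \in G by rewrite -Et repG // groupM.
    have Gat := groupM Ga Gt.
    split=> //; first by move: nAr; rewrite repA // groupMl.
    by rewrite -Et rep_rep // groupM.
  case/and3P=> Gt _ _; rewrite rmorphB /= (fN a Aa) act_rep ?groupM //.
  by rewrite (tot_M T Ga Gt LN).
have [z vz] := fixL_unif CF T sAG fD D0.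
have E : v D = (\sum_(g in G | g \notin A) (w g).+1)%:R * v pi.
  rewrite /D (vlY vV); last first.
    move=> t /and3P[Gt nAt _].
    by rewrite subr_eq0 (npi_moved CF T sAG).
  rewrite natr_sum mulr_suml.
  rewrite [RHS](partition_big rep (fun t => [&& t \in G, t \notin A & rep t == t])) /=; last first.
    by move=> g /andP[Gg nAg]; rewrite repG // repA // nAg rep_rep // eqxx.
  apply: eq_bigr => t /and3P[Gt nAt /eqP rt].
  rewrite (npi_sub CF T sAG Gt nAt) [RHS](reindex_inj (mulgI t)) /=.
  apply: eq_big => a; last first.
    move=> Aa; rewrite (gpi_subE CF T) //; first by rewrite groupM // (subsetP sAG).
    by apply: contraNneq nAt => ta; rewrite -(groupMr _ Aa) ta group1.
  apply/idP/idP => [Aa|/andP[/andP[Gta nAta] /eqP Er]].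
    have Ga := subsetP sAG _ Aa.
    by rewrite groupM // groupMr // nAt rep_eq // rt eqxx.
  have [b Ab] := rep_coset Gta; rewrite Er -mulgA => /eqP.
  rewrite -{1}(mulg1 t) (inj_eq (mulgI t)) eq_sym => /eqP ab.
  by rewrite -(groupMr _ Ab) ab group1.
have {}E : (\sum_(g in G | g \notin A) (w g).+1)%:R = (z * #|A|%:Z)%:~R :> rat.
  have vpi0 : v pi != 0 by rewrite lt0r_neq0.
  apply: (mulIf vpi0); rewrite -E vz (vnpi CF T sAG) mulrA; congr (_ * _).
  by rewrite intrM.
have : (#|A| %| \sum_(g in G | g \notin A) (w g).+1)%N.
  have {}E : ((\sum_(g in G | g \notin A) (w g).+1)%N : int) = z * #|A|%:Z.
    by apply/eqP; rewrite -(eqr_int rat) -E.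
  by have := dvdz_mull z (dvdzz #|A|%:Z); rewrite -E.
rewrite (eq_bigr (fun g => w g + 1)%N); last by move=> g _; rewrite addn1.
rewrite big_split /= dvdn_addl // sum1_card.
have -> : #|[pred g in G | g \notin A]| = (#|G| - #|A|)%N.
  rewrite -cardsDS // -[RHS]cardsE; apply: eq_card => g.
  by rewrite !inE andbC.
by rewrite dvdn_sub // cardSg.
Qed.

End Complement.

(** An element [s] of [G_k] outside [B] has lower number [k], the largest one outside [B], so
    Herbrand's theorem carries the part of [ramsum] coming from [A] to the last jump of the cyclic
    group [A / B], treated by [hasse_arf_cyclic]. The part outside [A] is [complement_dvd]. *)
Lemma hasse_arf (A B : {group X}) (k : nat) :
  A \subset G -> (p.-group A)%g -> (B <| A)%g -> cyclic (A / B) ->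
  ram k \subset A -> ~~ (ram k \subset B) -> ram k.+1 \subset B ->
  (#|A| %| ramsum v G act pi k)%N.
Proof.
move=> sAG pA nBA cAB kA /subsetPn[s sk nBs] k1B.
have TA := tot_subgroup T sAG; have sBA := normal_sub nBA.
have As := subsetP kA _ sk; have Gs := subsetP sAG _ As.
have s1 : s != 1%g by apply: contraNneq nBs => ->; exact: group1.
have notB g : g \in G -> g \notin B -> g != 1%g /\ (w g <= k)%N.
  move=> Gg nBg; have g1 : g != 1%g by apply: contraNneq nBg => ->; exact: group1.
  split=> //; rewrite leqNgt; apply: contraNN nBg => kg.
  by apply: (subsetP k1B); rewrite inE Gg kg orbT.
have ws : w s = k.
  apply/eqP; rewrite eqn_leq (notB _ Gs nBs).2 /=.
  by move: sk; rewrite inE (negbTE s1) /= => /andP[].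
have GB h : h \in B -> h \in G by move=> Bh; apply: (subsetP sAG); exact: (subsetP sBA).
have le g h : g \in G -> g \notin B -> h \in B -> v (act (g * h)%g pi - pi) <= v (act s pi - pi).
  move=> Gg nBg Bh; have Ggh := groupM Gg (GB _ Bh).
  have nBgh : (g * h)%g \notin B by rewrite groupMr.
  have [gh1 wgh] := notB _ Ggh nBgh.
  by rewrite !(gpi_subE CF T) // ler_pM2r // ler_nat ltnS ws.
pose N := npi act pi B.
have TQ := tot_quotient CF TA nBA.
have NA := normal_norm nBA.
pose x := coset B s.
have Qx : x \in (A / B)%G by apply: mem_quotient.
have notQ g : g \in A -> coset B g != 1%g -> g \notin B.
  by move=> Ag; apply: contraNN => Bg; rewrite coset_id.
have x1 : x != 1%g.
  by apply: contraNneq nBs => /coset_idr; apply; exact: (subsetP NA).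
have fixN : fixL act L B N by exact: (fixL_npi TA sBA).
pose wq := ram_w v (quo_act act (H := B)) N.
have wq_max y : y \in (A / B)%G -> y != 1%g -> (wq y <= wq x)%N.
  case/morphimP=> g Ng Ag -> y1; have Gg := subsetP sAG _ Ag.
  have nBg := notQ _ Ag y1.
  have := npi_sub_le CF TA nBA As nBs Ag nBg (fun h => le s h Gs nBs) (fun h => le g h Gg nBg).
  have vN : 0 < v N by exact: (vnpi_gt0 CF TA sBA).
  have E z : z \in A -> coset B z != 1%g -> v (act z N - N) = (wq (coset B z)).+1%:R * v N.
    move=> Az z1; rewrite -(quo_actE TA nBA Az fixN).
    by rewrite (gpi_subE CF TQ) //; apply: mem_quotient.
  by rewrite -/N !E // ler_pM2r // ler_nat ltnS.
have HA : (#|(A / B)%G| %| \sum_(g in (A / B)%G | g != 1%g) wq g + wq x)%N.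
  by apply: (hasse_arf_cyclic CF Hp TQ) => //; exact: quotient_pgroup.
have := herb_quotient CF TA nBA As nBs (fun h => le s h Gs nBs).
rewrite (herbE CF TA As s1) -(quo_actE TA nBA As fixN) (herbE CF TQ Qx x1).
rewrite (vnpi CF TA sBA) mulrA -natrM => /(mulIf (lt0r_neq0 vpi))/eqP.
rewrite eqr_nat ws => /eqP Eh.
have EA : #|A| = (#|(A / B)%G| * #|B|)%N.
  by rewrite /= card_quotient // mulnC Lagrange.
have Sq : (\sum_(g in (A / B)%G | g != 1%g) minn (wq g) (wq x) = \sum_(g in (A / B)%G | g != 1%g) wq g)%N.
  by apply: eq_bigr => g /andP[Qg g1]; apply/minn_idPl/wq_max.
rewrite ramsumE (bigID (mem A)) /= addnA dvdn_add //; last first.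
  have := complement_dvd sAG; congr (_ %| _)%N.
  apply: eq_big => g.
    rewrite -andbA; congr andb; apply/idP/andP => [nAg|[]] //; split=> //.
    by apply: contraNneq nAg => ->; exact: group1.
  move=> /andP[Gg nAg]; apply/esym/minn_idPl; apply: (notB g Gg _).2.
  by apply: contraNN nAg => /(subsetP sBA).
rewrite -(dvdn_addl _ (dvdnn #|A|)).
have -> : (k + \sum_(g | (g \in G) && (g != 1%g) && (g \in A)) minn (w g) k)%N =
    (k + \sum_(g in A | g != 1%g) minn (w g) k)%N.
  congr (_ + _)%N; apply: eq_bigl => g.
  by case Ag : (g \in A); rewrite ?andbF // (subsetP sAG _ Ag) ?andbT.
by rewrite Eh {1}EA dvdn_pmul2r ?cardG_gt0 // dvdn_addl // Sq addnC.
Qed.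

End HasseArf.

(** * Representations of p-groups and Clifford theory *)

Section ComponentScalar.

Variables (F : closedFieldType) (gT : finGroupType) (G : {group gT}).
Variables (n : nat) (rG : mx_representation F G n).

Lemma exists_eigenvalue (m : nat) (f : 'M[F]_m) : (0 < m)%N -> exists a, eigenvalue f a.
Proof.
case: m f => [//|m] f _.
have [a ra] : exists a, root (char_poly f) a.
  by apply/closed_rootP; rewrite size_char_poly.
by exists a; rewrite eigenvalue_root_char.
Qed.

(* If [rG x] is central in the enveloping algebra, it is scalar on simple
   modules, hence on isotypic components. *)
Lemma component_scalar (M : 'M[F]_n) x : mxsimple rG M -> x \in G ->
  {in G, forall g, rG g *m rG x = rG x *m rG g} ->
  exists a : F, forall m (U : 'M[F]_(m, n)), (U <= component_mx rG M)%MS -> U *m rG x = a *: U.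
Proof.
move=> simM Gx cx; have [modM nzM minM] := simM.
pose f := in_submod M (M *m rG x).
have [a Ea] : exists a, exists2 u : 'rV[F]_n, (u <= M)%MS & u != 0 /\ u *m rG x = a *: u.
  have sr : (0 < \rank M)%N by rewrite lt0n mxrank_eq0.
  have [a /eigenvalueP[u Eu u0]] := exists_eigenvalue (submod_mx modM x) sr.
  exists a, (val_submod u); first exact: val_submodP.
  by rewrite val_submod_eq0 u0 -(val_submodJ modM) // -linearZ /= Eu.
have [u uM [u0 ux]] := Ea.
pose E := (M :&: kermx (rG x - a%:M))%MS.
have modE : mxmodule rG E.
  apply/mxmoduleP => g Gg; rewrite sub_capmx.
  rewrite (submx_trans (submxMr _ (capmxSl _ _)) (mxmoduleP modM g Gg)) /=.
  apply/sub_kermxP; rewrite -mulmxA mulmxBr cx // scalar_mxC -mulmxBl mulmxA.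
  by have /sub_kermxP -> := capmxSr M (kermx (rG x - a%:M)); rewrite mul0mx.
have nzE : E != 0.
  apply: contraNneq u0 => E0; rewrite -submx0 -E0 sub_capmx uM /=.
  by apply/sub_kermxP; rewrite mulmxBr ux mul_mx_scalar subrr.
have sME := minM E modE (capmxSl _ _) nzE.
exists a => m U; have [I [W isoW ->]] := component_mx_def simM => sU.
suff /(submx_trans sU)/sub_kermxP : (\sum_i W i <= kermx (rG x - a%:M))%MS.
  by rewrite mulmxBr mul_mx_scalar => /eqP; rewrite subr_eq0 => /eqP.
apply/sumsmx_subP => i _; have [g injg homg <-] := isoW i.
apply/sub_kermxP; rewrite mulmxBr mul_mx_scalar -(hom_mxP homg) //.
have /sub_kermxP : (M <= kermx (rG x - a%:M))%MS by exact: submx_trans sME (capmxSr _ _).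
rewrite mulmxBr mul_mx_scalar => /eqP; rewrite subr_eq0 => /eqP ->.
by rewrite -scalemxAl subrr.
Qed.

End ComponentScalar.

Section PGroup.

Variables (F : closedFieldType) (p : nat).
Hypothesis Fp : p \notin [pchar F].

Definition eigenline (gT : finGroupType) (G A : {group gT}) n
    (rG : mx_representation F G n) (u : 'rV[F]_n) : Prop :=
  u != 0 /\ {in A, forall a, exists c : F, u *m rG a = c *: u}.

Lemma pchar'_pgroup (gT : finGroupType) (P : {group gT}) : prime p ->
  (p.-group P)%g -> ([pchar F]^'.-group P)%g.
Proof.
move=> p_pr; apply: sub_pgroup => q; rewrite !inE => /eqP ->.
exact: Fp.
Qed.

(* A noncommutative irreducible image has a normal abelian nonscalar subgroup. *)
Lemma irr_pgroup_normal_abelian (gT : finGroupType) (P : {group gT}) n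
    (rP : mx_representation F P n) :
  (p.-group P)%g -> mx_irreducible rP -> (1 < n)%N ->
  exists2 B : {group gT}, (B <| P)%g &
   {in B &, forall a b, rP a *m rP b = rP b *m rP a} /\
   (exists2 b, b \in B & ~~ is_scalar_mx (rP b)).
Proof.
move=> pP irrP n_gt1; pose K := rker rP.
have nKP : P \subset 'N(K)%g := rker_norm rP.
have pQ : (p.-group (P / K))%g by exact: quotient_pgroup.
have ab1 : (abelian [1 (coset_of K)])%g := abelian1 _.
(* A maximal normal abelian subgroup of a [p]-group is self-centralising. [B] is its preimage, so
   [B] commutes only through its action. *)
have [C maxC _] := maxgroup_exists (gP := fun C : {group coset_of K} => (C <| (P / K)%g)%g && abelian C)
   (introT andP (conj (normal1 _) ab1)).
have /SCN_P[nCQ cenC] := max_SCN pQ maxC.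
have cC : abelian C by have /maxgroupp/andP[] := maxC.
pose B0 := [set b in P | coset K b \in C].
have gB0 : group_set B0.
  apply/group_setP; split; first by rewrite inE group1 coset_id ?group1.
  move=> x y; rewrite !inE => /andP[Px Cx] /andP[Py Cy].
  by rewrite groupM //= coset_morphM ?groupM // (subsetP nKP).
pose B := Group gB0.
have BP b : b \in B -> b \in P by rewrite inE => /andP[].
have Bq b : b \in B -> coset K b \in C by rewrite inE => /andP[].
have cosetJ x y : x \in P -> y \in P -> coset K (x ^ y)%g = (coset K x ^ coset K y)%g.
  move=> Px Py; have Nx := subsetP nKP _ Px; have Ny := subsetP nKP _ Py.
  by rewrite morphJ.
have kerE x y : x \in P -> y \in P -> coset K x = coset K y -> rP x = rP y.
  move=> Px Py E; have Nx := subsetP nKP _ Px; have Ny := subsetP nKP _ Py.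
  have := introT (rcoset_kercosetP Nx Ny) E => /rcosetP[k Kk ->].
  have [Pk rk] := rkerP Kk.
  by rewrite repr_mxM // rk mul1mx.
exists B.
  rewrite /normal; apply/andP; split; first by apply/subsetP => b /BP.
  apply/subsetP => x Px; rewrite inE.
  apply/subsetP => _ /imsetP[b Bb ->]; have Pb := BP _ Bb.
  have Pbx : (b ^ x)%g \in P by rewrite groupJ.
  rewrite inE Pbx /= cosetJ // memJ_norm ?Bq //.
  by apply: (subsetP (normal_norm nCQ)); apply: mem_quotient.
split.
  move=> a b Ba Bb; have Pa := BP _ Ba; have Pb := BP _ Bb.
  rewrite -!repr_mxM //; apply: kerE; rewrite ?groupM //.
  have Na := subsetP nKP _ Pa; have Nb := subsetP nKP _ Pb.
  by rewrite !coset_morphM //; apply: (centsP cC); exact: Bq.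
apply/exists_inP; apply: contraT => /exists_inPn scal.
(* If [B] acted by scalars, the image of [P] would centralise [C], hence lie in it, and all of [P]
   would act by scalars. *)
have Pcomm : {in P &, forall x y, rP x *m rP y = rP y *m rP x}.
  have PB x : x \in P -> x \in B.
    move=> Px; have Nx := subsetP nKP _ Px.
    rewrite inE Px /= -cenC inE mem_quotient //=.
    apply/centP => z Cz; have Qz := subsetP (normal_sub nCQ) _ Cz.
    case/morphimP: Qz Cz => b Nb Pb -> Cz.
    have Bb : b \in B by rewrite inE Pb /=.
    rewrite /commute -!coset_morphM //.
    have : rP (x * b)%g = rP (b * x)%g.
      rewrite !repr_mxM //; have /is_scalar_mxP[c ->] := negPn (scal b Bb).
      by rewrite scalar_mxC.
    move=> E; have Pxb := groupM Px Pb; have Pbx := groupM Pb Px.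
    apply/(rcoset_kercosetP (subsetP nKP _ Pxb) (subsetP nKP _ Pbx)).
    rewrite mem_rcoset; apply/rkerP; split; first by rewrite groupM ?groupV.
    by rewrite repr_mxM ?groupV // E -repr_mxM ?groupV // mulgV repr_mx1.
  move=> x y Px Py; have /is_scalar_mxP[c ->] := negPn (scal x (PB x Px)).
  by rewrite scalar_mxC.
have [_ nz minP] := irrP.
have n_gt0 : (0 < n)%N by exact: ltnW.
pose u : 'rV[F]_n := delta_mx 0 (Ordinal n_gt0).
have u0 : u != 0.
  apply/eqP => /matrixP/(_ 0 (Ordinal n_gt0)); rewrite !mxE !eqxx /=.
  by move/eqP; rewrite oner_eq0.
have modu : mxmodule rP u.
  apply/mxmoduleP => x Px.
  have [c Ec] := component_scalar irrP Px (fun g Pg => Pcomm g x Pg Px).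
  rewrite Ec ?scalemx_sub //; apply: submx_trans (component_mx_id irrP).
  exact: submx1.
have := minP <<u>>%MS; rewrite (eqmx_module _ (genmxE u)) => /(_ modu (submx1 _)).
rewrite -mxrank_eq0 genmxE mxrank_eq0 => /(_ u0) /mxrankS.
by rewrite mxrank1 genmxE => le; have := leq_trans n_gt1 (leq_trans le (rank_leq_row _)).
Qed.

(** Orbit-stabiliser for the transitive action on the isotypic components. *)
Lemma Clifford_index (gT : finGroupType) (G H : {group gT}) n
    (rG : mx_representation F G n) (nsHG : (H <| G)%g)
    (sH : socleType (subg_repr rG (normal_sub nsHG))) (W : sH) :
  mx_irreducible rG -> #|G : rstabs rG W|%g = #|sH|.
Proof.
move=> irrG; have := atransPin (subxx G) (Clifford_atrans irrG sH) (in_setT W).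
move/(congr1 (fun A : {set sH} => #|A|)); rewrite cardsT card_orbit_in //.
move=> <-; rewrite -(Clifford_astab1 W); congr #|_ : _|%g; apply/esym/setIidPr.
by rewrite Clifford_astab1 rstabs_sub.
Qed.

(** Monomiality, used as a descent. By Maschke the module may be taken simple; if its rank exceeds
    1, a normal subgroup [B] acting by commuting, not all scalar, matrices cuts it into several
    isotypic components. The stabiliser of one component has their number as index and acts on a
    smaller rank. The descent ends with eigenlines, that is with characters of subgroups. *)
Lemma pgroup_rep_dvd (Y : nat) : prime p ->
  forall d (gT : finGroupType) (P : {group gT}) n (rP : mx_representation F P n) (U : 'M[F]_n),
  (p.-group P)%g -> (\rank U <= d)%N -> mxmodule rP U ->
  (forall (A : {group gT}) u, A \subset P -> (u <= U)%MS -> eigenline A rP u ->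
     (#|A| %| Y)%N) ->
  (#|P| %| \rank U * Y)%N.
Proof.
move=> p_pr; elim=> [|d IH] gT P n rP U pP rU modU HY.
  by move: rU; rewrite leqn0 => /eqP ->.
have [->|nzU] := eqVneq U 0; first by rewrite mxrank0 mul0n.
have [simU|nsimU] := pselect (mxsimple rP U); last first.
  have [V /and4P[modV sVU nzV ltV]] : mxnonsimple rP U.
    by apply: contrapT => ns; apply: nsimU; apply/mxsimpleP; split.
  have [W modW eqW dxW] := mx_reducibleS modU (submx1 U)
    (mx_Maschke_pchar rP (pchar'_pgroup p_pr pP)) modV sVU.
  have sWU : (W <= U)%MS by rewrite -eqW addsmxSr.
  have rE : \rank U = (\rank V + \rank W)%N.
    by rewrite -eqW (mxrank_disjoint_sum (mxdirect_addsP dxW)).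
  have rV_gt0 : (0 < \rank V)%N by rewrite lt0n mxrank_eq0.
  have rVd : (\rank V <= d)%N by rewrite -ltnS (leq_trans ltV).
  have rWd : (\rank W <= d)%N.
    by rewrite -ltnS (leq_trans _ rU) // rE -addn1 addnC leq_add2r.
  rewrite rE mulnDl; apply: dvdn_add.
    by apply: (IH _ _ _ rP) => // A u sAP uV; apply: HY => //; exact: submx_trans sVU.
  by apply: (IH _ _ _ rP) => // A u sAP uW; apply: HY => //; exact: submx_trans sWU.
have r_gt0 : (0 < \rank U)%N by rewrite lt0n mxrank_eq0.
have [r1|r_gt1] := leqP (\rank U) 1.
  have rU1 : \rank U = 1%N by apply/eqP; rewrite eqn_leq r1.
  have /rowV0Pn[u uU u0] := nzU.
  rewrite rU1 mul1n; apply: (HY P u) => //; split=> // a Pa.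
  have eqU : (u :=: U)%MS.
    apply/eqmxP; rewrite -(geq_leqif (mxrank_leqif_eq uU)) rU1.
    by rewrite lt0n mxrank_eq0.
  have := mxmoduleP modU a Pa; rewrite -(eqmxMr _ eqU) -eqU => /sub_rVP[c Ec].
  by exists c.
pose rU' := submod_repr modU.
have irrU : mx_irreducible rU' by apply/submod_mx_irr.
have [B nsB [cB [b Bb nsb]]] := irr_pgroup_normal_abelian pP irrU r_gt1.
have Pb := subsetP (normal_sub nsB) _ Bb.
pose sB : socleType (subg_repr rU' (normal_sub nsB)) := DecSocleType _.
have [W _] : exists W : sB, True.
  have := Clifford_atrans irrU sB => /imsetP[W _ _]; by exists W.
have rkW := Clifford_rank_components irrU W.
have ixW := Clifford_index W irrU.
have sB_gt1 : (1 < #|sB|)%N.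
  rewrite ltnNge; apply: contra nsb => le1.
  have sB1 : #|sB| = 1%N.
    by apply/eqP; rewrite eqn_leq le1; apply/card_gt0P; exists W.
  move: rkW; rewrite sB1 mul1n => rkW.
  have sW : (1%:M <= W)%MS by rewrite sub1mx /row_full rkW.
  have [a Ea] := component_scalar (socle_simple W) Bb (fun g Bg => cB g b Bg Bb).
  by have := Ea _ _ sW; rewrite mul1mx scalemx1 => ->; exact: scalar_mx_is_scalar.
pose Q := [group of rstabs rU' W].
have sQP : Q \subset P by exact: rstabs_sub.
pose W' : 'M[F]_n := <<val_submod (W : 'M_(\rank U))>>%MS.
have rkW' : \rank W' = \rank W.
  rewrite /W' genmxE val_submodE mxrankMfree //.
  by rewrite /row_free val_submod1.
have modW' : mxmodule (subg_repr rP sQP) W'.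
  rewrite (eqmx_module _ (genmxE _)); apply/mxmoduleP => x Qx; rewrite /=.
  have Px := subsetP sQP _ Qx.
  rewrite -(val_submodJ modU) // val_submodS.
  by move: Qx; rewrite inE Px.
have sWU : (W' <= U)%MS by rewrite genmxE val_submodP.
have QY : (#|Q| %| \rank W' * Y)%N.
  apply: (IH _ Q n (subg_repr rP sQP) W') => //; first exact: pgroupS pP.
    have W_gt0 : (0 < \rank W)%N.
      by rewrite lt0n mxrank_eq0 nz_socle.
    have : (1 * \rank W < #|sB| * \rank W)%N by rewrite ltn_pmul2r.
    by rewrite mul1n rkW rkW' => lt; rewrite -ltnS (leq_trans lt).
  move=> A u sAQ uW' [u0 eu]; apply: (HY A u).
  - exact: (subset_trans sAQ sQP).
  - exact: (submx_trans uW' sWU).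
  - by split.
have -> : \rank U = (#|sB| * \rank W')%N by rewrite rkW' rkW.
by rewrite -(Lagrange sQP) ixW mulnC -mulnA dvdn_pmul2l // ltnW.
Qed.

End PGroup.

Section LinearCharacter.

Variables (F : fieldType) (gT : finGroupType) (G : {group gT}) (chi : gT -> F).
Hypothesis chiM : {in G &, {morph chi : x y / (x * y)%g >-> x * y}}.
Hypothesis chi1 : chi 1%g = 1.

Definition char_ker : {set gT} := [set x in G | chi x == 1].

Lemma char_ker_group_set : group_set char_ker.
Proof.
apply/group_setP; split; first by rewrite inE group1 chi1 eqxx.
move=> x y; rewrite !inE => /andP[Gx /eqP hx] /andP[Gy /eqP hy].
by rewrite groupM // chiM // hx hy mulr1 eqxx.
Qed.
Canonical char_ker_group := Group char_ker_group_set.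

Lemma char_ker_normal : (char_ker <| G)%g.
Proof.
have sK : char_ker \subset G by apply/subsetP => x; rewrite inE => /andP[].
rewrite /normal sK; apply/subsetP => x Gx.
rewrite inE; apply/subsetP => _ /imsetP[y + ->].
rewrite !inE => /andP[Gy /eqP hy]; rewrite groupJ //= conjgE.
rewrite !chiM ?groupM ?groupV // hy mul1r -chiM ?groupV // mulVg chi1 //.
Qed.

Lemma char_ker_cyclic : cyclic (G / char_ker).
Proof.
have nK := char_ker_normal; have sK := normal_sub nK.
pose K := char_ker_group; pose f (x : coset_of K) := chi (repr x).
have same x y : x \in G -> y \in G -> coset K x = coset K y -> chi x = chi y.
  move=> Gx Gy E; have Nx := subsetP (normal_norm nK) _ Gx.
  have Ny := subsetP (normal_norm nK) _ Gy.
  have := introT (rcoset_kercosetP Nx Ny) E => /rcosetP[k Kk ->].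
  rewrite chiM //; last exact: (subsetP sK).
  by move: Kk; rewrite inE => /andP[_ /eqP ->]; rewrite mul1r.
apply: (field_mul_group_cyclic (f := f)) => [x y Gx Gy|x Gx].
  have rx := repr_quo sK Gx; have ry := repr_quo sK Gy.
  pose z : coset_of K := (x * y)%g.
  have rz : repr z \in G by apply: repr_quo sK _; exact: groupM.
  rewrite /f -chiM //; apply: same; rewrite ?groupM //.
  rewrite (coset_morphM (subsetP (normal_norm nK) _ rx) (subsetP (normal_norm nK) _ ry)).
  by rewrite !coset_reprK.
have rx := repr_quo sK Gx; rewrite /f; split=> [h|->].
  by rewrite -(coset_reprK x); apply: coset_id; rewrite inE rx h eqxx.
by rewrite repr_coset1.
Qed.

End LinearCharacter.

(** * Integrality of the Swan conductor and the local bound *)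

Section LocalBound.

Variables (Om : fieldType) (v : Om -> rat) (kk : Om -> Prop).
Hypothesis CF : coeff_field v kk.
Variables (p : nat) (Hp : p \in [pchar Om]).
Let p_pr : prime p := pcharf_prime Hp.
Variables (X : finGroupType) (G : {group X}) (act : X -> {rmorphism Om -> Om}).
Variables (L : Om -> Prop) (pi : Om).
Hypothesis T : tot v kk G act L pi.
Local Notation w := (ram_w v act pi).
Local Notation ram := (ram v G act pi).
Local Notation rg := (ram_group CF T).
Local Notation theta := (theta CF act pi).
Local Notation grd := (grd CF act pi).
Variable F : closedFieldType.
Hypothesis Fp : p \notin [pchar F].

Section Irreducible.

Variables (r : nat) (rM : mx_representation F G r) (k : nat).
Hypothesis irrM : mx_irreducible rM.
Hypothesis k_gt0 : (0 < k)%N.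
Hypothesis noinv : forall u : 'rV[F]_r, {in ram k, forall g, u *m rM g = u} -> u = 0.
Hypothesis triv : {in ram k.+1, forall g, rM g = 1%:M}.

Let P := rg 1.
Let nsP : (P <| G)%g := ram_normal CF T 1.
Let sPG := normal_sub nsP.
Let ramP1 g : g \in ram k -> g \in P := subsetP (ram_le v G act pi k_gt0) g.
Let NG g : g \in ram k -> g \in G. Proof. by move/ramP1/(subsetP sPG). Qed.

(** If conjugation by [c] fixes the graded class of [g], their commutator lies in [G_(k+1)], which
    acts trivially. *)
Lemma repr_conj_ram c g : c \in G -> g \in ram k ->
  grd k (c * g * c^-1)%g = grd k g -> rM c *m rM g = rM g *m rM c.
Proof.
move=> Gc gk E; have Gg := NG gk.
have ck : (c * g * c^-1)%g \in ram k by apply: (ramJ CF T).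
have z : (c * g * c^-1 * g^-1)%g \in ram k.+1.
  apply: (iffLR (grd_eq0 CF T (ramM CF T ck (ramV CF T gk)))).
  by rewrite (grdM CF T) ?(grdV CF T) ?E ?subrr //; exact: (ramV CF T).
have := triv z; rewrite -!repr_mxM //.
rewrite -{2}(mulgKV c (c * g)%g) -{2}(mulgKV g (c * g * c^-1)%g).
move=> h; rewrite (repr_mxM _ (_ : (c * g * c^-1 * g^-1 * g)%g \in G) Gc); last first.
  by rewrite !groupM ?groupV.
rewrite (repr_mxM _ (_ : (c * g * c^-1 * g^-1)%g \in G) Gg); last first.
  by rewrite !groupM ?groupV.
by rewrite h mul1mx repr_mxM.
Qed.

Lemma repr_ram_comm c g : c \in P -> g \in ram k -> rM c *m rM g = rM g *m rM c.
Proof.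
move=> Pc gk; have Gc := subsetP sPG _ Pc.
apply: repr_conj_ram => //; rewrite (grdJ CF T) //.
by rewrite (iffRL (theta_ram1 CF T Gc) Pc) expr1n mul1r.
Qed.

Variable sP : socleType (subg_repr rM (normal_sub nsP)).
Variable W : sP.

Lemma ram_scalar g : g \in ram k ->
  exists a : F, forall m (U : 'M[F]_(m, r)), (U <= W)%MS -> U *m rM g = a *: U.
Proof.
move=> gk; apply: (component_scalar (socle_simple W) (ramP1 gk)) => c Pc /=.
exact: repr_ram_comm.
Qed.

(** [G_k] acts by scalars on [W], so the eigenline is one for [A G_k] too and defines a character.
    [hasse_arf] applies to its kernel [B]: [noinv] keeps [G_k] outside [B], and [triv] puts
    [G_(k+1)] inside. *)
Lemma eigenline_dvd (A : {group X}) (u : 'rV[F]_r) : A \subset P -> (u <= W)%MS ->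
  eigenline A rM u -> (#|A| %| ramsum v G act pi k)%N.
Proof.
move=> sAP uW [u0 eu]; pose A' := (A <*> rg k)%G.
have nN : (A \subset 'N(rg k))%g.
  by apply: subset_trans (normal_norm (ram_normal CF T k)); apply: subset_trans sPG.
have A'E : A' :=: (A * rg k)%g by rewrite /= (norm_joinEl nN).
have sAA' : A \subset A' by exact: joing_subl.
have skA' : ram k \subset A' by exact: joing_subr.
have sA'P : A' \subset P.
  by rewrite join_subG sAP /=; apply: ram_le.
have sA'G := subset_trans sA'P sPG.
have [i ui] : exists i, u 0 i != 0.
  apply/existsP; apply: contraNT u0 => /existsPn h; apply/eqP/rowP => i.
  by rewrite mxE; have := h i; rewrite negbK => /eqP.
have eu' x : x \in A' -> exists c, u *m rM x = c *: u.
  rewrite A'E => /mulsgP[a g Aa gk ->].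
  have [c Ec] := eu a Aa; have [c' Ec'] := ram_scalar gk.
  have Ga : a \in G by apply: (subsetP sPG); apply: (subsetP sAP).
  exists (c * c'); rewrite repr_mxM ?(NG gk) // mulmxA Ec -scalemxAl Ec' //.
  by rewrite scalerA.
pose chi x := (u *m rM x) 0 i / u 0 i.
have chiE x : x \in A' -> u *m rM x = chi x *: u.
  by move=> /eu'[c Ec]; rewrite /chi Ec mxE mulfK.
have chiM : {in A' &, {morph chi : x y / (x * y)%g >-> x * y}}.
  move=> x y Ax Ay; have Gx := subsetP sA'G _ Ax; have Gy := subsetP sA'G _ Ay.
  rewrite {1}/chi repr_mxM // mulmxA chiE // -scalemxAl chiE // !mxE.
  by rewrite mulrA mulfK.
have chi1 : chi 1%g = 1 by rewrite /chi repr_mx1 mulmx1 divff.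
have dA := cardSg sAA'; apply: (dvdn_trans dA).
pose B := char_ker_group chiM chi1.
apply: (hasse_arf CF Hp T (B := B)) => //.
- exact: pgroupS sA'P (ram1_pgroup CF Hp T).
- exact: (char_ker_normal chiM chi1).
- exact: (char_ker_cyclic chiM chi1).
- apply: contraNN u0 => skB; apply/eqP/noinv => g gk.
  have /setIdP[Ag /eqP hg] := subsetP skB _ gk.
  by rewrite chiE // hg scale1r.
apply/subsetP => g gk1; rewrite inE.
have gk : g \in ram k by apply: (subsetP (ram_le v G act pi (leqnSn k))).
by rewrite (subsetP skA' _ gk) /= /chi triv // mulmx1 divff.
Qed.

(* [g |-> c g c^-1 g^-1] is bijective on [ram k / ram k.+1] when
   [theta c ^+ k != 1], so that a [c]-invariant character of it is trivial. *)
Lemma stab_sub_ker : rstabs rM W \subset ker_thetaX CF G act pi k.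
Proof.
apply/subsetP => c cW; have Gc := subsetP (rstabs_sub _ _) _ cW.
rewrite inE Gc /=; apply: contraT => nt.
have /rowV0Pn[u uW u0] : (W : 'M_r) != 0 by exact: nz_socle.
case/eqP: u0; apply: noinv => n nk; have Gn := NG nk.
pose phi g := (c * g * c^-1 * g^-1)%g.
have phik g : g \in ram k -> phi g \in ram k.
  by move=> gk; apply: (ramM CF T); [apply: (ramJ CF T)|apply: (ramV CF T)].
pose z := theta c ^+ k - 1; have z0 : z != 0 by rewrite subr_eq0.
have grd_phi g : g \in ram k -> grd k (phi g) = z * grd k g.
  move=> gk; rewrite (grdM CF T) ?(grdV CF T) ?(grdJ CF T) //.
  - by rewrite mulrBl mul1r.
  - exact: (ramJ CF T).
  - exact: (ramV CF T).
have phi_inv g (y : 'rV_r) : g \in ram k -> (y <= W)%MS -> y *m rM (phi g) = y.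
  move=> gk yW; have Gg := NG gk.
  have [a Ea] := ram_scalar gk; have [b Eb] := ram_scalar (ramV CF T gk).
  have [a' Ea'] := ram_scalar (ramJ CF T Gc gk).
  have ab : y *m rM g *m rM g^-1%g = y.
    by rewrite -mulmxA -repr_mxM ?groupV // mulgV repr_mx1 mulmx1.
  have ycW : (y *m rM c <= W)%MS.
    have := cW; rewrite inE Gc /= => h; apply: submx_trans h; exact: submxMr.
  have E1 : y *m rM (c * g * c^-1)%g *m rM c = y *m rM c *m rM g.
    by rewrite -!mulmxA -!repr_mxM ?groupM ?groupV // mulgKV.
  have E2 : a' *: (y *m rM c) = a *: (y *m rM c).
    by rewrite -(Ea _ _ ycW) -E1 Ea' // scalemxAl.
  have E3 : a' *: y = a *: y.
    have := congr1 (fun M => M *m rM c^-1%g) E2; rewrite -!scalemxAl -!mulmxA.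
    by rewrite -!repr_mxM ?groupV // mulgV repr_mx1 mulmx1.
  rewrite /phi repr_mxM ?groupM ?groupV // mulmxA Ea' // E3 -Ea //.
(* Multiplication by [z] is injective on the finite set of graded values, hence onto it. *)
have [g gk Eg] : exists2 g, g \in ram k & grd k n = z * grd k g.
  pose S := undup [seq grd k g | g <- enum (ram k)].
  have inS x : x \in S -> exists2 g, g \in ram k & x = grd k g.
    by rewrite mem_undup => /mapP[g]; rewrite mem_enum => gk ->; exists g.
  have Sin g : g \in ram k -> grd k g \in S.
    by move=> gk; rewrite mem_undup map_f // mem_enum.
  pose S' := [seq z * x | x <- S].
  have uS' : uniq S' by rewrite map_inj_uniq ?undup_uniq //; exact: mulfI.
  have sub : {subset S' <= S}.
    by move=> _ /mapP[x /inS[g gk ->] ->]; rewrite -grd_phi //; apply/Sin/phik.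
  have [_ eqS] := uniq_min_size uS' sub (eq_leq (esym (size_map _ _))).
  have : grd k n \in S' by rewrite eqS Sin.
  by case/mapP => x /inS[g gk ->] ->; exists g.
have : (phi g * n^-1)%g \in ram k.+1.
  apply: (iffLR (grd_eq0 CF T (ramM CF T (phik g gk) (ramV CF T nk)))).
  rewrite (grdM CF T) ?(grdV CF T) ?grd_phi ?Eg ?subrr //; first exact: phik.
  exact: (ramV CF T).
move/triv => E; have pk := phik g gk.
have : u *m rM (phi g * n^-1 * n)%g = u *m rM n.
  have Gz : (phi g * n^-1)%g \in G by rewrite groupM ?groupV // (NG pk).
  by rewrite (repr_mxM rM Gz Gn) E mul1mx.
by rewrite mulgKV phi_inv.
Qed.

(** [dim * phi(k)] is an integer, one prime set at a time: [|P|] divides by [pgroup_rep_dvd], and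
    the tame index by [ramsum_dvd], since by [stab_sub_ker] the number of isotypic components is a
    multiple of the index of the kernel of [theta^k]. Being positive, the integer is at least 1. *)
Lemma local_bound_irr : (#|G| <= r * ramsum v G act pi k)%N.
Proof.
have rkW := Clifford_rank_components irrM W.
have ixW := Clifford_index W irrM.
set Y := ramsum v G act pi k.
have dP : (#|P| %| \rank W * Y)%N.
  apply: (pgroup_rep_dvd Fp p_pr (d := \rank W) (rP := subg_repr rM sPG)) => //.
  - exact: (ram1_pgroup CF Hp T).
  - exact: component_mx_module.
  move=> A u sAP uW eu; exact: (eigenline_dvd sAP uW).
have dT : (#|G : P|%g %| r * Y)%N.
  apply: (dvdn_trans (ramsum_dvd CF Hp T k)); rewrite -rkW -ixW -mulnA.
  apply: dvdn_mul; last by rewrite dvdn_mull.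
  apply: indexgS; exact: stab_sub_ker.
have co : coprime #|G : P|%g #|P|.
  have [n ->] := p_natP (ram1_pgroup CF Hp T).
  by rewrite coprime_sym coprimeXl // (tame_coprime CF Hp T).
have : (#|G| %| r * Y)%N.
  rewrite (card_tame CF T) Gauss_dvd // dT /= -rkW -mulnA.
  by rewrite dvdn_mull.
apply: dvdn_leq; rewrite muln_gt0; apply/andP; split.
  have [_ nz _] := irrM; move: nz; rewrite -mxrank_eq0 mxrank1 -lt0n //.
rewrite /Y /ramsum (big_nat_recr k) //= addn_gt0; apply/orP; right.
by apply/card_gt0P; exists 1%g; exact: (ram_1 CF T).
Qed.

End Irreducible.

Lemma pgroup_card_neq0 (H : {group X}) : (p.-group H)%g -> #|H|%:R != 0 :> F.
Proof.
move=> pH; have [n ->] := p_natP pH; rewrite natrX expf_neq0 //.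
by apply: contraNneq Fp => p0; rewrite inE p_pr p0 eqxx.
Qed.

(** [k] is the last index at which the representation is nontrivial. The part without
    [G_k]-invariants is nonzero and stable; a simple submodule of it satisfies the hypotheses of
    [local_bound_irr]. *)
Theorem local_bound d (rV : mx_representation F G d) :
  (exists2 g, g \in ram 1 & rV g != 1%:M) ->
  exists k, [/\ (0 < k)%N, exists2 g, g \in ram k & rV g != 1%:M
    & (#|G| <= (d - \rank (rfix_mx rV G)) * ramsum v G act pi k)%N].
Proof.
case=> g1 g1r ng1; pose Q k := [exists g in ram k, rV g != 1%:M].
have Q1 : Q 1%N by apply/exists_inP; exists g1.
have [B rB] := ram_trivial CF T.
have Qle k : Q k -> (k <= B)%N.
  move=> /exists_inP[g gk ng]; rewrite leqNgt; apply: contra ng => Bk.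
  have : g \in ram B by apply: (subsetP (ram_le v G act pi (ltnW Bk))).
  by rewrite rB => /set1P ->; rewrite repr_mx1.
have [k Qk kmax] := ex_maxnP (ex_intro _ 1%N Q1) Qle.
have k_gt0 : (0 < k)%N by exact: kmax.
exists k; split=> //; first by apply/exists_inP.
have triv : {in ram k.+1, forall g, rV g = 1%:M}.
  move=> g gk; apply/eqP; apply: contraT => ng.
  by have := kmax k.+1; rewrite ltnn; apply; apply/exists_inP; exists g.
pose N := rg k; have nsN : (N <| G)%g := ram_normal CF T k.
have sNG := normal_sub nsN.
have N0 : #|N|%:R != 0 :> F.
  apply: pgroup_card_neq0; apply: pgroupS (ram1_pgroup CF Hp T).
  exact: ram_le.
(* Up to the factor [|N|], [e] projects onto the [N]-invariants, which contain the [G]-invariants;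
   this bounds the rank of its kernel. *)
pose e := \sum_(g in N) rV g.
have efix m (U : 'M_(m, d)) : {in N, forall g, U *m rV g = U} -> U *m e = #|N|%:R *: U.
  move=> fU; rewrite mulmx_sumr (eq_bigr (fun=> U)); last by move=> g; apply: fU.
  by rewrite sumr_const scaler_nat.
have rke : (\rank (rfix_mx rV G) <= \rank e)%N.
  apply: mxrankS; have /rfix_mxP fG := submx_refl (rfix_mx rV G).
  rewrite -[rfix_mx _ _](scalerK N0) -efix; first by rewrite scalemx_sub // submxMl.
  by move=> g Ng; apply: fG; apply: (subsetP sNG).
pose V' := kermx e.
have modV : mxmodule rV V'.
  apply/mxmoduleP => x Gx; apply/sub_kermxP.
  have ce : rV x *m e = e *m rV x.
    rewrite mulmx_sumr mulmx_suml.
    rewrite [RHS](reindex_inj (conjg_inj x^-1%g)) /=; apply: eq_big => g.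
      by rewrite memJ_norm // (subsetP (normal_norm nsN)) // groupV.
    move=> Ng; have Gg := subsetP sNG _ Ng.
    rewrite -!repr_mxM ?groupJ ?groupV // conjgE invgK; congr (rV _).
    by rewrite mulgA mulgKV.
  by rewrite -mulmxA ce mulmxA mulmx_ker mul0mx.
have nzV : V' != 0.
  apply/negP => /eqP V0; have [g Ng /negP[]] := exists_inP Qk; apply/eqP.
  have ue : row_free e by rewrite -kermx_eq0 -/V' V0.
  apply: (row_free_inj ue); rewrite mul1mx /e mulmx_sumr [RHS](reindex_inj (mulgI g)) /=.
  apply: eq_big => h; first by rewrite (groupMl _ (Ng : g \in N)).
  by move=> Nh; rewrite repr_mxM // (subsetP sNG).
apply: (mxsimple_exists modV nzV) => -[M simM sMV].
have modM := mxsimple_module simM; pose rM := submod_repr modM.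
have irrM : mx_irreducible rM by apply/submod_mx_irr.
have rM_le : (\rank M <= d - \rank (rfix_mx rV G))%N.
  apply: leq_trans (mxrankS sMV) _; rewrite mxrank_ker.
  exact: leq_sub2l.
apply: leq_trans (leq_mul rM_le (leqnn _)).
have noinv (u : 'rV_(\rank M)) : {in ram k, forall g, u *m rM g = u} -> u = 0.
  move=> fu; apply/eqP; rewrite -(val_submod_eq0 u); apply/eqP.
  have : val_submod u *m e = #|N|%:R *: val_submod u.
    by apply: efix => g Ng; rewrite -(val_submodJ modM) ?(subsetP sNG) // fu.
  have /sub_kermxP -> : (val_submod u <= kermx e)%MS.
    exact: (submx_trans (val_submodP u) sMV).
  by move/eqP; rewrite eq_sym scaler_eq0 (negbTE N0) => /eqP.
have trivM : {in ram k.+1, forall g, rM g = 1%:M}.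
  move=> g gk; have Gg : g \in G by move: gk; rewrite inE => /andP[].
  apply: val_submod_inj; rewrite -[rM g]mul1mx (val_submodJ modM) //.
  by rewrite triv // mulmx1.
pose sP : socleType (subg_repr rM (normal_sub (ram_normal CF T 1))) := DecSocleType _.
have [W _] : exists W : sP, True.
  by have := Clifford_atrans irrM sP => /imsetP[W _ _]; exists W.
exact: (local_bound_irr irrM k_gt0 noinv trivM W).
Qed.

End LocalBound.

(** * Elements algebraic over F_p *)

Section FiniteFields.

Variables (p : nat) (Om : fieldType) (Hp : p \in [pchar Om]).
Let p_pr : prime p := pcharf_prime Hp.
Local Notation kk := (in_Fpbar p (Om := Om)).

Lemma roots_list (P : {poly Om}) : P != 0 -> exists s : seq Om, forall x, root P x -> x \in s.
Proof.
move: {2}(size P) (leqnn (size P)) => n; elim: n P => [|n IH] P sP P0.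
  by move: P0; rewrite -size_poly_eq0 -leqn0 sP.
have [[a ra]|nr] := pselect (exists a, root P a); last first.
  by exists [::] => x rx; case: nr; exists x.
have [Q E] := factor_theorem _ _ ra.
have Q0 : Q != 0 by apply: contraNneq P0; rewrite E => ->; rewrite mul0r.
have [|s hs] := IH Q _ Q0.
  by have := sP; rewrite E size_Mmonic ?monicXsubC // size_XsubC addn2.
exists (a :: s) => x; rewrite E rootM root_XsubC inE => /orP[/hs ->|->] //.
by rewrite orbT.
Qed.

Lemma pow_pfix n k (x : Om) : x ^+ (p ^ n) = x -> x ^+ (p ^ (n * k)) = x.
Proof.
move=> h; elim: k => [|k IH]; first by rewrite muln0 expn0 expr1.
by rewrite mulnS expnD exprM h.
Qed.

Lemma exprD_ppow n (x y : Om) : (x + y) ^+ (p ^ n) = x ^+ (p ^ n) + y ^+ (p ^ n).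
Proof. by rewrite exprDn_pchar // pnatX pnatE // Hp. Qed.

Lemma pfixB n (x y : Om) : x ^+ (p ^ n) = x -> y ^+ (p ^ n) = y ->
  (x - y) ^+ (p ^ n) = x - y.
Proof.
move=> hx hy; have := exprD_ppow n (x - y) y; rewrite subrK hx hy.
by move/eqP; rewrite -subr_eq => /eqP.
Qed.

Lemma in_Fpbar_subfld : subfld kk.
Proof.
have two x y : kk x -> kk y -> exists2 n, (0 < n)%N & x ^+ (p ^ n) = x /\ y ^+ (p ^ n) = y.
  move=> [n n0 hx] [m m0 hy]; exists (n * m)%N; first by rewrite muln_gt0 n0.
  by split; [exact: pow_pfix|rewrite mulnC; exact: pow_pfix].
split.
- by exists 1%N; rewrite ?expr1n.
- by move=> x y /two h /h[n n0 [hx hy]]; exists n; rewrite ?pfixB.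
- by move=> x y /two h /h[n n0 [hx hy]]; exists n; rewrite ?exprMn ?hx ?hy.
- by move=> x [n n0 hx]; exists n; rewrite ?exprVn ?hx.
Qed.

Lemma common_pfix (P : {poly Om}) : (forall i, kk P`_i) ->
  exists2 n, (0 < n)%N & forall i, P`_i ^+ (p ^ n) = P`_i.
Proof.
elim/poly_ind: P => [|P c IH] hP; first by exists 1%N => // i; rewrite coef0 expr0n expn1 eqn0Ngt prime_gt0.
have hP' i : kk P`_i by have := hP i.+1; rewrite coefD coefMX coefC /= addr0.
have [m m0 hc] : kk c by have := hP 0; rewrite coefD coefMX coefC /= add0r.
have [n n0 hn] := IH hP'; exists (n * m)%N; first by rewrite muln_gt0 n0.
move=> i; rewrite coefD coefMX coefC; case: i => [|i] /=.
  by rewrite add0r mulnC pow_pfix.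
by rewrite addr0 pow_pfix.
Qed.

(* An element which is algebraic over F_pbar modulo a prime ideal [I] of a
   ring [O] is congruent to its image by a power of Frobenius. *)
Lemma algebraic_frobenius (O I : Om -> Prop) (x : Om) (P : {poly Om}) :
  O 1 -> (forall x y, O x -> O y -> O (x - y)) -> (forall x y, O x -> O y -> O (x * y)) ->
  (forall c, kk c -> O c) ->
  I 0 -> (forall x y, I x -> I y -> I (x - y)) -> (forall x y, O x -> I y -> I (x * y)) ->
  (forall x y, O x -> O y -> I (x * y) -> I x \/ I y) ->
  P != 0 -> (forall i, kk P`_i) -> O x -> I P.[x] ->
  exists2 s, (0 < s)%N & I (x ^+ (p ^ s) - x).
Proof.
move=> O1 OB OM Ok I0 IB IM Ipr P0 kP Ox IPx.
have Kf := in_Fpbar_subfld.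
have OX y n : O y -> O (y ^+ n).
  by move=> Oy; elim: n => [|n IH]; rewrite ?expr0 // exprS; apply: (OM).
have lc0 : lead_coef P != 0 by rewrite lead_coef_eq0.
have klc : kk (lead_coef P)^-1 by apply: (subfldV Kf); exact: kP.
pose Q := (lead_coef P)^-1 *: P.
have mQ : Q \is monic by rewrite qualifE /= lead_coefZ mulVf.
have kQ i : kk Q`_i by rewrite coefZ; apply: (subfldM Kf).
have IQx : I Q.[x].
  by rewrite hornerZ; apply: (IM) => //; exact: (Ok).
have [n n0 hn] := common_pfix kQ.
pose q := (p ^ n)%N; have q_gt1 : (1 < q)%N.
  by rewrite -(expn0 p) ltn_exp2l // prime_gt1.
pose fixq (c : Om) := c ^+ q = c.
have [S hS] : exists S : seq Om, forall c, fixq c -> c \in S.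
  have [|S hS] := @roots_list ('X^q - 'X).
    by rewrite -size_poly_eq0 size_polyDl size_polyXn // size_polyN size_polyX ltnS.
  exists S => c hc; apply: hS; rewrite rootE !hornerE hc subrr //.
(* Modulo the monic [Q], powers of [x] become polynomials of bounded degree over the field of [q]
   elements. There are finitely many, so two powers of [x] agree modulo [I]. *)
have red i : exists r : {poly Om}, [/\ (size r < size Q)%N, forall j, fixq r`_j & I (x ^+ i - r.[x])].
  have f0 : fixq 0 by rewrite /fixq expr0n gtn_eqF // ltnW.
  have f1 : fixq 1 by rewrite /fixq expr1n.
  have fB a b : fixq a -> fixq b -> fixq (a - b) by exact: pfixB.
  have fM a b : fixq a -> fixq b -> fixq (a * b) by rewrite /fixq exprMn => -> ->.
  have hXi j : fixq ('X^i)`_j by rewrite coefXn; case: eqP.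
  have [s [r [E sr fr fs]]] := monic_division f0 fB fM mQ hn hXi.
  exists r; split=> //.
  have -> : x ^+ i - r.[x] = s.[x] * Q.[x].
    by have := congr1 (fun f => f.[x]) E; rewrite !hornerE => ->; rewrite addrK.
  apply: (IM) => //; rewrite horner_coef.
  have O0 : O 0 by rewrite -(subrr 1); apply: (OB).
  have OD y z : O y -> O z -> O (y + z).
    by move=> Oy Oz; rewrite -(opprK z); apply: (OB) => //; rewrite -sub0r; apply: (OB).
  apply: (big_ind O O0 OD) => j _; apply: (OM); last exact: OX.
  by apply: (Ok); exists n => //; exact: fs.
pose r_ i := projT1 (cid (red i)).
have r_P i := projT2 (cid (red i)).
have fS i j : (r_ i)`_j \in S by apply: hS; have [_ h _] := r_P i.
pose code i : {ffun 'I_(size Q) -> seq_sub S} := [ffun j : 'I__ => SeqSub (fS i j)].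
pose M := #|{ffun 'I_(size Q) -> seq_sub S}|.
have [i [j [ij Eij]]] : exists i j : 'I_M.+1, i != j /\ code i = code j.
  apply: contrapT => h.
  have inj : injective (fun i : 'I_M.+1 => code i).
    by move=> i j E; apply/eqP; apply: contrapT => /negP ne; apply: h; exists i, j.
  by have := leq_card _ inj; rewrite card_ord ltnn.
have Erij : r_ i = r_ j.
  apply/polyP => k; have [lt|ge] := ltnP k (size Q); last first.
    have [si _ _] := r_P i; have [sj _ _] := r_P j.
    by rewrite !nth_default // ltnW // (leq_trans _ ge).
  have := congr1 (fun f : {ffun _ -> _} => ssval (f (Ordinal lt))) Eij.
  by rewrite !ffunE.
have Iij : I (x ^+ i - x ^+ j).
  have [_ _ hi] := r_P i; have [_ _ hj] := r_P j.
  have -> : x ^+ i - x ^+ j = (x ^+ i - (r_ i).[x]) - (x ^+ j - (r_ i).[x]) by ring.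
  by apply: (IB) => //; rewrite Erij.
have Iprod k : I (x ^+ k) -> I x \/ I 1.
  elim: k => [|k IH]; rewrite ?expr0; first by right.
  by rewrite exprS => /(Ipr _ _ Ox (OX _ _ Ox))[|/IH]; [left|].
have I1 y : I 1 -> O y -> I y by move=> h Oy; rewrite -(mulr1 y); apply: (IM).
wlog lt : i j ij Iij {Eij Erij} / (i < j)%N.
  move=> W; have [lt|lt|E] := ltngtP i j; first exact: (W i j).
    apply: (W j i) => //; first by rewrite eq_sym.
    by rewrite -opprB -sub0r; apply: (IB).
  by move: ij; rewrite -val_eqE /= E eqxx.
have Oxp k : O (x ^+ k - x) by apply: (OB) => //; exact: OX.
have : I (x ^+ i * (x ^+ (j - i) - 1)).
  rewrite mulrBr mulr1 -exprD subnKC ?(ltnW lt) // -opprB -sub0r.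
  exact: IB.
have Ox1 k : O (x ^+ k - 1) by apply: (OB) => //; exact: OX.
case/(Ipr _ _ (OX _ _ Ox) (Ox1 _)) => [/Iprod[Ix|h]|].
- exists 1%N => //; rewrite expn1; have := prime_gt0 p_pr; case: (p) => [//|k] _.
  rewrite exprS (_ : x * x ^+ k - x = (x ^+ k - 1) * x); last by ring.
  by apply: (IM).
- by exists 1%N => //; apply: (I1).
set m := (j - i)%N => Im; have m_gt0 : (0 < m)%N by rewrite subn_gt0.
(* Now [x ^+ m] is 1 modulo [I]. The [p]-part of [m] can be removed since [I] is prime, and Euler's
   theorem gives [s] with [m'] dividing [p ^ s - 1]. *)
have [m' cop Em] := pfactor_coprime p_pr m_gt0.
have Im' : I (x ^+ m' - 1).
  have E : (x ^+ m' - 1) ^+ (p ^ logn p m) = x ^+ m - 1.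
    apply/eqP; rewrite -(inj_eq (addIr 1)) subrK; apply/eqP.
    rewrite -[X in _ + X](expr1n _ (p ^ logn p m)) -exprD_ppow subrK -exprM.
    by rewrite -Em.
  move: Im; rewrite -E; elim: (p ^ _)%N => [|k IH]; first by rewrite expr0 => h; apply: (I1).
  by rewrite exprS => /(Ipr _ _ (Ox1 _) (OX _ _ (Ox1 _)))[|/IH].
have m'_gt0 : (0 < m')%N by move: m_gt0; rewrite Em muln_gt0 => /andP[].
exists (totient m'); first by rewrite totient_gt0.
have := Euler_exp_totient cop => /eqP.
rewrite eqn_mod_dvd ?expn_gt0 ?prime_gt0 // => /dvdnP[l El].
have -> : (p ^ totient m')%N = (l * m').+1.
  by rewrite -El subn1 prednK // expn_gt0 prime_gt0.
rewrite exprS (_ : x * x ^+ (l * m') - x = x * (x ^+ (l * m') - 1)); last by ring.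
apply: (IM) => //.
rewrite mulnC exprM subrX1 mulrC; apply: (IM) => //.
have O0 : O 0 by rewrite -(subrr 1); apply: (OB).
apply: (big_ind O O0) => [y z Oy Oz|k _]; last exact/OX/OX.
by rewrite -(opprK z); apply: (OB) => //; rewrite -sub0r; apply: (OB).
Qed.

Lemma algebraic_Fpbar (x : Om) (P : {poly Om}) : P != 0 -> (forall i, kk P`_i) ->
  P.[x] = 0 -> kk x.
Proof.
move=> P0 kP Px; have [|||||||||s s0 E] := @algebraic_frobenius (fun=> True) (fun y => y = 0) x P _ _ _ _ _ _ _ _ P0 kP _ Px => //.
- by move=> ? ? -> ->; rewrite subrr.
- by move=> ? ? _ ->; rewrite mulr0.
- move=> y z _ _ /eqP; rewrite mulf_eq0 => /orP[]/eqP; by [left|right].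
by exists s => //; apply/eqP; rewrite -subr_eq0 E.
Qed.

End FiniteFields.

(** * Existence of a place at infinity *)

Lemma zorn_sets (T : Type) (P : (T -> Prop) -> Prop) :
  (forall F : (T -> Prop) -> Prop, (forall X, F X -> P X) ->
     (forall X Y, F X -> F Y -> (forall x, X x -> Y x) \/ (forall x, Y x -> X x)) ->
     P (fun x => exists2 X, F X & X x)) ->
  exists2 A, P A & forall B, P B -> (forall x, A x -> B x) -> forall x, B x -> A x.
Proof.
move=> chain; have [A [PA maxA]] := @classical_sets.Zorn_bigcup T P chain.
exists A => // B PB AB x Bx; apply: contrapT => nAx.
by apply: (maxA B) => //; split=> // h; apply: nAx; exact: h.
Qed.

Section Place.

Variables (p : nat) (Om : fieldType) (t : Om).
Hypothesis HOm : sepclosure_Fpbar_t p t.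
Let Hp := sepclosure_char HOm.
Local Notation kk := (in_Fpbar p (Om := Om)).
Let Kf : subfld kk := in_Fpbar_subfld Hp.

Lemma t_neq0 : t != 0.
Proof.
apply/eqP => t0; apply: (sepclosure_trans HOm); rewrite t0.
exact: (subfld0 Kf).
Qed.

Lemma t_transcendental (P : {poly Om}) : (forall i, kk P`_i) -> P.[t] = 0 -> P = 0.
Proof.
move=> kP Pt; apply/eqP; apply: contrapT => /negP P0.
by apply: (sepclosure_trans HOm); exact: (algebraic_Fpbar Hp P0 kP Pt).
Qed.

Let u := t^-1.
Let u0 : u != 0. Proof. by rewrite invr_eq0 t_neq0. Qed.
Let ut : u * t = 1. Proof. by rewrite mulVf // t_neq0. Qed.

(** Subrings in which 1/t is not invertible; a maximal one is a valuation ring centred at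
    infinity. *)
Record good (A : Om -> Prop) : Prop := Good {
  good1 : A 1;
  goodB : forall x y, A x -> A y -> A (x - y);
  goodM : forall x y, A x -> A y -> A (x * y);
  good_kk : forall c, kk c -> A c;
  good_u : A u;
  good_t : ~ A t }.

Lemma good_base : good (fun x => exists2 P : {poly Om}, (forall i, kk P`_i) & x = P.[u]).
Proof.
split.
- exists 1; last by rewrite hornerE.
  by move=> i; rewrite coef1; case: eqP => _; [exact: (subfld1 Kf)|exact: (subfld0 Kf)].
- move=> _ _ [P kP ->] [Q kQ ->]; exists (P - Q); last by rewrite !hornerE.
  by move=> i; rewrite coefB; apply: (subfldB Kf).
- move=> _ _ [P kP ->] [Q kQ ->]; exists (P * Q); last by rewrite !hornerE.
  by move=> i; rewrite coefM; apply: (subfld_sum Kf) => j _; apply: (subfldM Kf).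
- move=> c kc; exists c%:P; last by rewrite hornerC.
  by move=> i; rewrite coefC; case: eqP => _ //; exact: (subfld0 Kf).
- exists 'X; last by rewrite hornerX.
  by move=> i; rewrite coefX; case: eqP => _; [exact: (subfld1 Kf)|exact: (subfld0 Kf)].
case=> P kP tP; pose n := size P.
(* Clearing denominators in [t = P.[1/t]] yields a monic equation for the transcendental [t]. *)
pose Q := 'X^(n.+1) - \sum_(i < n) P`_i *: 'X^(n - i) : {poly Om}.
have kQ i : kk Q`_i.
  rewrite coefB coefXn coef_sum; apply: (subfldB Kf).
    by case: eqP => _; [exact: (subfld1 Kf)|exact: (subfld0 Kf)].
  apply: (subfld_sum Kf) => j _; rewrite coefZ coefXn; apply: (subfldM Kf) => //.
  by case: eqP => _; [exact: (subfld1 Kf)|exact: (subfld0 Kf)].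
have Qt : Q.[t] = 0.
  rewrite hornerD hornerN hornerXn horner_sum exprS {1}tP horner_coef mulr_suml.
  apply/eqP; rewrite subr_eq0; apply/eqP; apply: eq_bigr => i _.
  rewrite hornerZ hornerXn -mulrA; congr (_ * _).
  have -> : t ^+ n = t ^+ (n - i) * t ^+ i by rewrite -exprD subnK // ltnW.
  by rewrite mulrCA -exprMn ut expr1n mulr1.
have := t_transcendental kQ Qt => /(congr1 (fun f : {poly Om} => f`_n.+1)).
rewrite coef0 coefB coefXn eqxx coef_sum big1 ?subr0 => [/eqP|i _].
  by rewrite oner_eq0.
by rewrite coefZ coefXn gtn_eqF ?mulr0 // ltnS leq_subr.
Qed.

Lemma exists_maximal : exists2 A, good A & forall B, good B -> (forall x, A x -> B x) ->
  forall x, B x -> A x.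
Proof.
have [A PA maxA] : exists2 A, (good A \/ forall x, ~ A x) &
    forall B, (good B \/ forall x, ~ B x) -> (forall x, A x -> B x) -> forall x, B x -> A x.
  apply: zorn_sets => F FP tot.
  have [[X FX gX]|noX] := pselect (exists2 X, F X & good X); last first.
    right=> x [X FX Xx]; have [gX|nX] := FP X FX; last exact: (nX x).
    by apply: noX; exists X.
  left; split.
  - by exists X => //; exact: (good1 gX).
  - move=> x y [Y FY Yx] [Z FZ Zy].
    have [YZ|ZY] := tot Y Z FY FZ.
      have [gZ|nZ] := FP Z FZ; last by case: (nZ y).
      by exists Z => //; apply: (goodB gZ) => //; exact: YZ.
    have [gY|nY] := FP Y FY; last by case: (nY x).
    by exists Y => //; apply: (goodB gY) => //; exact: ZY.
  - move=> x y [Y FY Yx] [Z FZ Zy].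
    have [YZ|ZY] := tot Y Z FY FZ.
      have [gZ|nZ] := FP Z FZ; last by case: (nZ y).
      by exists Z => //; apply: (goodM gZ) => //; exact: YZ.
    have [gY|nY] := FP Y FY; last by case: (nY x).
    by exists Y => //; apply: (goodM gY) => //; exact: ZY.
  - by move=> c kc; exists X => //; exact: (good_kk gX).
  - by exists X => //; exact: (good_u gX).
  - by case=> Y FY Yt; have [gY|nY] := FP Y FY; [exact: (good_t gY)|exact: (nY t)].
case: PA => [gA|nA].
  by exists A => // B gB; apply: maxA; left.
have gb := good_base.
have := maxA _ (or_introl gb) (fun x Ax => False_ind _ (nA x Ax)) 1 (good1 gb).
by move=> /nA.
Qed.

Section MaximalRing.

Variable A : Om -> Prop.
Hypothesis gA : good A.
Hypothesis maxA : forall B, good B -> (forall x, A x -> B x) -> forall x, B x -> A x.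

Let A1 := good1 gA.
Let AB := goodB gA.
Let AM := goodM gA.
Let A0 : A 0. Proof. by rewrite -(subrr 1); apply: (AB). Qed.
Let AN x : A x -> A (- x). Proof. by move=> Ax; rewrite -sub0r; apply: (AB). Qed.
Let AD x y : A x -> A y -> A (x + y).
Proof. by move=> Ax Ay; rewrite -(opprK y); apply: (AB) => //; exact: AN. Qed.
Let AX x n : A x -> A (x ^+ n).
Proof. by move=> Ax; elim: n => [|n IH]; rewrite ?expr0 // exprS; apply: (AM). Qed.
Let Asum (I : Type) (r : seq I) (P : pred I) (f : I -> Om) :
  (forall i, P i -> A (f i)) -> A (\sum_(i <- r | P i) f i).
Proof. by move=> h; apply: (big_ind A A0 AD). Qed.

Lemma max_adjoin y : ~ A y -> exists2 q : {poly Om}, (forall i, A q`_i) & t = q.[y].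
Proof.
move=> nAy; apply: contrapT => nt; apply: nAy.
pose B x := exists2 q : {poly Om}, (forall i, A q`_i) & x = q.[y].
have AC c i : A c -> A (c%:P)`_i by move=> Ac; rewrite coefC; case: eqP.
have AinB x : A x -> B x by move=> Ax; exists x%:P => [i|]; [exact: AC|rewrite hornerC].
apply: (maxA (B := B)) => //; last first.
  exists 'X; last by rewrite hornerX.
  by move=> i; rewrite coefX; case: eqP.
split=> //.
- exact: AinB.
- move=> _ _ [P kP ->] [Q kQ ->]; exists (P - Q); last by rewrite !hornerE.
  by move=> i; rewrite coefB; apply: (AB).
- move=> _ _ [P kP ->] [Q kQ ->]; exists (P * Q); last by rewrite !hornerE.
  by move=> i; rewrite coefM; apply: Asum => j _; apply: (AM).
- by move=> c kc; apply/AinB/(good_kk gA).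
- by apply: AinB; exact: (good_u gA).
Qed.

(** [u] lies in the Jacobson radical. If [z = 1 - u a] were not invertible, maximality would give [t
    = q.[z^-1]], so [t z^n] would be in [A] for a large [n]; as [z^n = 1 - u a'] with [a'] in [A],
    so would [t = t z^n + a']. *)
Lemma one_sub_unit a : A a -> 1 - u * a != 0 /\ A (1 - u * a)^-1.
Proof.
move=> Aa; have ne : 1 - u * a != 0.
  rewrite subr_eq0; apply/eqP => E; apply: (good_t gA).
  by rewrite -(mulr1 t) E mulrA (mulrC t) ut mul1r.
split=> //; apply: contrapT => /max_adjoin[q Aq tq].
set z := 1 - u * a in ne tq.
have Az : A z by apply: (AB) => //; apply: (AM) => //; exact: (good_u gA).
have Atz : A (t * z ^+ size q).
  rewrite tq horner_coef mulr_suml; apply: Asum => i _.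
  have -> : z ^+ size q = z ^+ (size q - i) * z ^+ i by rewrite -exprD subnK // ltnW.
  rewrite (mulrC (z ^+ _)) !mulrA -(mulrA q`_i) -exprMn mulVf // expr1n mulr1.
  by apply: (AM) => //; exact: AX.
have [a' Aa' Ez] : exists2 a', A a' & z ^+ size q = 1 - u * a'.
  elim: (size q) => [|n [a' Aa' E]]; first by exists 0; rewrite ?mulr0 ?subr0.
  exists (a' + a - u * a * a'); last by rewrite exprS E /z; ring.
  apply: (AB); first exact: AD.
  by apply: (AM) => //; apply: (AM) => //; exact: (good_u gA).
apply: (good_t gA); have -> : t = t * z ^+ size q + a'.
  by rewrite Ez mulrBr mulr1 mulrA (mulrC t) ut mul1r subrK.
exact: AD.
Qed.

(** Chevalley's argument: if [t] is a polynomial both in [x] and in [x^-1], the relation of smaller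
    degree, whose constant term can be inverted by [one_sub_unit], lowers the degree of the
    other. *)
Lemma max_no_relation (n : nat) (x : Om) (q r : {poly Om}) : x != 0 ->
  (size q + size r <= n)%N -> (forall i, A q`_i) -> (forall i, A r`_i) ->
  u * q.[x] = 1 -> u * r.[x^-1] = 1 -> False.
Proof.
elim: n x q r => [|n IH] x q r x0 sz Aq Ar Eq Er.
  have q0 : q = 0 by apply/eqP; rewrite -size_poly_eq0; move: sz; clear; lia.
  by move/eqP: Eq; rewrite q0 horner0 mulr0 eq_sym oner_eq0.
wlog le : x q r x0 sz Aq Ar Eq Er / (size r <= size q)%N.
  move=> W; have [le|/ltnW le] := leqP (size r) (size q); first exact: (W x q r).
  by apply: (W x^-1 r q) => //; rewrite ?invr_eq0 ?invrK // addnC.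
have [w0 Aw] := one_sub_unit (Ar 0%N).
set w := (1 - u * r`_0)^-1 in Aw.
have r_gt0 : (0 < size r)%N.
  rewrite lt0n size_poly_eq0; apply/eqP => r0.
  by move/eqP: Er; rewrite r0 horner0 mulr0 eq_sym oner_eq0.
have q_gt0 := leq_trans r_gt0 le.
pose m := (size r).-1; pose d := (size q).-1.
have sr : size r = m.+1 by rewrite prednK.
have sq : size q = d.+1 by rewrite prednK.
have md : (m <= d)%N by rewrite /m /d; move: le; clear; lia.
pose c j := u * w * r`_j.+1.
have Ac j : A (c j) by apply: (AM) => //; apply: (AM) => //; exact: (good_u gA).
have E1 : \sum_(j < m) c j * x^-1 ^+ j.+1 = 1.
  have : u * (r`_0 + \sum_(j < m) r`_j.+1 * x^-1 ^+ j.+1) = 1.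
    rewrite -[RHS]Er horner_coef sr; congr (_ * _).
    by rewrite big_ord_recl expr0 mulr1.
  rewrite mulrDr => /(canRL (addKr _)); rewrite addrC => E.
  have : w * (u * \sum_(j < m) r`_j.+1 * x^-1 ^+ j.+1) = 1 by rewrite E mulVf.
  move=> <-; rewrite !mulr_sumr; apply: eq_bigr => j _.
  by rewrite /c; ring.
have E2 : x ^+ d = \sum_(j < m) c j * x ^+ (d - j.+1).
  rewrite -[LHS]mul1r -E1 mulr_suml; apply: eq_bigr => j _; rewrite -mulrA; congr (_ * _).
  have jd : (j.+1 <= d)%N by apply: leq_trans md.
  have -> : x ^+ d = x ^+ j.+1 * x ^+ (d - j.+1) by rewrite -exprD subnKC.
  by rewrite mulrA -exprMn mulVf // expr1n mul1r.
pose q' := \poly_(i < d) q`_i + \sum_(j < m) (q`_d * c j) *: 'X^(d - j.+1).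
have Eq' : q'.[x] = q.[x].
  rewrite hornerD horner_poly horner_sum horner_coef sq big_ord_recr /=.
  congr (_ + _); rewrite E2 mulr_sumr; apply: eq_bigr => j _.
  by rewrite hornerZ hornerXn -(mulrA q`_d).
have sq' : (size q' <= d)%N.
  rewrite (leq_trans (size_polyD _ _)) // geq_max size_poly /=.
  apply: (leq_trans (size_sum _ _ _)); apply/bigmax_leqP => j _.
  rewrite (leq_trans (size_scale_leq _ _)) // size_polyXn.
  by have := ltn_ord j; move: md; clear; lia.
apply: (IH x q' r) => //.
- by rewrite -ltnS; apply: leq_trans sz; rewrite sq addSn ltnS leq_add2r.
- move=> i; rewrite coefD coef_poly coef_sum; apply: AD; first by case: ltnP.
  apply: Asum => j _; rewrite coefZ coefXn; apply: (AM); first exact: (AM).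
  by case: eqP.
- by rewrite Eq'.
Qed.

Lemma max_valuation_ring x : x != 0 -> A x \/ A x^-1.
Proof.
move=> x0; apply: contrapT => /not_orP[/max_adjoin[q Aq tq] /max_adjoin[r Ar tr]].
apply: (@max_no_relation _ x q r x0 (leqnn _) Aq Ar).
  by rewrite -tq.
by rewrite -tr.
Qed.

Definition runit x := [/\ x != 0, A x & A x^-1].

Lemma runitM x y : runit x -> runit y -> runit (x * y).
Proof.
case=> x0 Ax Ax' [y0 Ay Ay']; split; rewrite ?mulf_neq0 ?invfM //; exact: (AM).
Qed.

Lemma runitV x : runit x -> runit x^-1.
Proof. by case=> x0 Ax Ax'; split; rewrite ?invr_eq0 ?invrK. Qed.

Lemma runitX x n : runit x -> runit (x ^+ n).
Proof.
move=> h; elim: n => [|n IH]; last by rewrite exprS; apply: runitM.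
by split; rewrite ?expr0 ?invr1 ?oner_neq0.
Qed.

Lemma runitXz x (z : int) : runit x -> runit (x ^ z).
Proof.
by move=> h; case: z => n; rewrite ?NegzE -?exprnN; [|apply: runitV]; exact: runitX.
Qed.

Lemma nonunitD x y : A x -> A y -> x + y != 0 -> A (x + y)^-1 ->
  (x != 0 /\ A x^-1) \/ (y != 0 /\ A y^-1).
Proof.
move=> Ax Ay xy0 Axy.
have [x0|x0] := eqVneq x 0.
  by right; move: xy0 Axy; rewrite x0 add0r.
have [y0|y0] := eqVneq y 0.
  by left; split=> //; move: Axy; rewrite y0 addr0.
have [h|h] := max_valuation_ring (mulf_neq0 x0 (invr_neq0 y0)).
  right; split=> //; have -> : y^-1 = (x / y + 1) * (x + y)^-1.
    by rewrite mulrC; apply: (mulfI xy0); rewrite mulrA divff // mul1r; field.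
  by apply: (AM) => //; exact: AD.
left; split=> //; have -> : x^-1 = ((x / y)^-1 + 1) * (x + y)^-1.
  by apply: (mulIf xy0); rewrite divfK //; field; rewrite x0 y0.
by apply: (AM) => //; exact: AD.
Qed.

Lemma u_powers_unit (z : int) : runit (u ^ z) -> z = 0.
Proof.
have key n : ~ A (u ^+ n.+1)^-1.
  move=> h; apply: (good_t gA).
  have -> : t = (u ^+ n.+1)^-1 * u ^+ n.
    by rewrite exprS invfM -mulrA mulVf ?expf_neq0 // mulr1 invrK.
  by apply: (AM) => //; apply: AX; exact: (good_u gA).
case: z => [[|n]|n] //.
  by case=> _ _ h; case: (key n).
by rewrite NegzE -exprnN => -[_ h _]; case: (key n).
Qed.

Lemma poly_t_unit (P : {poly Om}) : (forall i, kk P`_i) -> P.[t] != 0 ->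
  runit (P.[t] * u ^+ (size P).-1).
Proof.
move=> kP Pt0; have P0 : P != 0 by apply: contraNneq Pt0 => ->; rewrite horner0.
set d := (size P).-1; have sP : size P = d.+1 by rewrite prednK // lt0n size_poly_eq0.
have klc : kk P`_d by exact: kP.
have lc0 : P`_d != 0 by rewrite -[P`_d]/(lead_coef P) lead_coef_eq0.
pose b := - \sum_(i < d) P`_i * u ^+ (d - i).-1.
have Ab : A b.
  apply: AN; apply: Asum => i _; apply: (AM); first exact: (good_kk gA).
  by apply: AX; exact: (good_u gA).
have E : P.[t] * u ^+ d = P`_d * (1 - u * (b / P`_d)).
  rewrite horner_coef sP big_ord_recr /= mulrDl -mulrA -exprMn (mulrC t) ut expr1n mulr1.
  rewrite mulrBr mulr1 mulrCA (mulrC P`_d) divfK // /b mulrN opprK addrC; congr (_ + _).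
  rewrite mulr_suml mulr_sumr; apply: eq_bigr => i _.
  have id' : (0 < d - i)%N by rewrite subn_gt0.
  rewrite mulrCA -exprS prednK // -mulrA; congr (_ * _).
  have -> : u ^+ d = u ^+ i * u ^+ (d - i) by rewrite -exprD subnKC // ltnW.
  by rewrite mulrA -exprMn (mulrC t) ut expr1n mul1r.
have Ak c : kk c -> A c by exact: (good_kk gA).
have [ne Ai] := one_sub_unit (AM Ab (Ak _ (subfldV Kf klc))).
rewrite E; apply: runitM; first by split=> //; apply: Ak => //; exact: (subfldV Kf).
split=> //; apply: (AB) => //; apply: (AM); first exact: (good_u gA).
by apply: (AM) => //; apply: Ak; exact: (subfldV Kf).
Qed.

End MaximalRing.

End Place.

Section PlaceExists.

Variables (p : nat) (Om : fieldType) (t : Om).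
Hypothesis HOm : sepclosure_Fpbar_t p t.
Let Hp := sepclosure_char HOm.
Local Notation kk := (in_Fpbar p (Om := Om)).
Let Kf : subfld kk := in_Fpbar_subfld Hp.

Lemma algebraic_kt x : exists P : {poly {poly Om}},
  let Pt := map_poly (fun c : {poly Om} => c.[t]) P in
  [/\ forall i j, kk P`_i`_j, Pt != 0, root Pt x & forall i, Pt`_i = (P`_i).[t]].
Proof.
have [P [kP rx dx]] := sepclosure_alg HOm x; exists P; split=> //.
  by apply: contraNneq dx => ->; rewrite deriv0 root0.
by move=> i; rewrite coef_map_id0 // horner0.
Qed.

Section MaximalRing.

Variable A : Om -> Prop.
Hypothesis gA : good p t A.
Hypothesis maxA : forall B, good p t B -> (forall x, A x -> B x) -> forall x, B x -> A x.

Let A1 := good1 gA.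
Let AM := goodM gA.
Let A0 : A 0. Proof. by rewrite -(subrr 1); apply: (goodB gA). Qed.
Let AN x : A x -> A (- x). Proof. by move=> Ax; rewrite -sub0r; apply: (goodB gA). Qed.
Let AD x y : A x -> A y -> A (x + y).
Proof. by move=> Ax Ay; rewrite -(opprK y); apply: (goodB gA) => //; exact: AN. Qed.
Let AX x n : A x -> A (x ^+ n).
Proof. by move=> Ax; elim: n => [|n IH]; rewrite ?expr0 // exprS; apply: (AM). Qed.

Let u := t^-1.
Let t0 : t != 0 := t_neq0 HOm.
Let u0 : u != 0. Proof. by rewrite invr_eq0. Qed.
Let Vr := max_valuation_ring HOm gA maxA.

Lemma minimal_term (s : seq Om) : all (fun y => y != 0) s -> s != [::] ->
  exists2 m, m \in s & forall y, y \in s -> A (y / m).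
Proof.
elim: s => // x s IH /= /andP[x0 s0] _.
have [->|sn] := eqVneq s [::].
  by exists x => [|y]; rewrite inE // => /eqP->; rewrite divff.
have [m ms Am] := IH s0 sn; have m0 := allP s0 m ms.
have [h|h] := Vr (mulf_neq0 x0 (invr_neq0 m0)).
  exists m; first by rewrite inE ms orbT.
  by move=> y /[!inE] /predU1P[->|/Am].
exists x; first by rewrite inE eqxx.
move=> y /[!inE] /predU1P[->|/Am h']; first by rewrite divff.
have -> : y / x = y / m * (x / m)^-1 by field; rewrite x0 m0.
exact: (AM).
Qed.

Let nonunit z := A z /\ (z != 0 -> ~ A z^-1).

Lemma nonunit_sum (I : Type) (r : seq I) (P : pred I) (f : I -> Om) :
  (forall i, P i -> nonunit (f i)) -> nonunit (\sum_(i <- r | P i) f i).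
Proof.
move=> h; apply: big_ind => //; first by split=> //; rewrite eqxx.
move=> x y [Ax nx] [Ay ny]; split; first exact: AD.
by move=> xy0 Axy; have [[]|[]] := nonunitD HOm gA maxA Ax Ay xy0 Axy.
Qed.

(** In an algebraic equation of [x] over kbar(t) two terms must have the same least value; comparing
    them, a power of [x] is a power of [u] up to a unit. Hence rational values. *)
Lemma commensurable x : x != 0 ->
  exists n (a : int), (0 < n)%N /\ runit A (x ^+ n * u ^ (- a)).
Proof.
move=> x0; have [P [kP P0 rx cE]] := algebraic_kt x.
set Pt := map_poly _ P in P0 rx cE.
pose y (i : 'I_(size Pt)) := Pt`_i * x ^+ i.
have sP : (0 < size Pt)%N by rewrite lt0n size_poly_eq0.
pose s := map y (filter (fun i : 'I_(size Pt) => Pt`_i != 0) (enum 'I_(size Pt))).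
have lt_d : ((size Pt).-1 < size Pt)%N by rewrite prednK.
have [||m /mapP[i]] := @minimal_term s.
- apply/allP=> _ /mapP[i /[!mem_filter] /andP[ci _] ->].
  by rewrite mulf_neq0 ?expf_neq0.
- suff: y (Ordinal lt_d) \in s by case: (s).
  by apply: map_f; rewrite mem_filter mem_enum andbT /= -/(lead_coef Pt) lead_coef_eq0.
rewrite mem_filter => /andP[ci _] {m}-> min.
have yi0 : y i != 0 by rewrite mulf_neq0 ?expf_neq0.
have [j [ji cj Aj]] : exists j, [/\ j != i, Pt`_j != 0 & A (y j / y i)^-1].
  apply: contrapT => no.
  have E : \sum_(j < size Pt | j != i) y j / y i = -1.
    have : \sum_(j < size Pt) y j / y i = 0.
      by rewrite -mulr_suml; move/rootP: rx; rewrite horner_coef => ->; rewrite mul0r.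
    by rewrite (bigD1 i) //= divff // => /(canRL (addKr _)); rewrite addr0.
  have [j ji|_] := @nonunit_sum _ (index_enum 'I_(size Pt)) (fun j => j != i) (fun j => y j / y i).
    have [cj|cj] := eqVneq Pt`_j 0.
      by rewrite /y cj !mul0r; split=> //; rewrite eqxx.
    split; first by apply: min; apply: map_f; rewrite mem_filter cj mem_enum.
    by move=> _ h; apply: no; exists j.
  by rewrite E; apply; [rewrite oppr_eq0 oner_eq0|rewrite invrN1; exact: AN].
have yj0 : y j != 0 by rewrite mulf_neq0 ?expf_neq0.
have U : runit A (y j / y i).
  split=> //; first by rewrite mulf_neq0 ?invr_eq0.
  apply: min.
  by apply: map_f; rewrite mem_filter cj mem_enum.
have cU k : Pt`_k != 0 -> exists d, runit A (Pt`_k * u ^+ d).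
  rewrite cE => ck; exists (size P`_k).-1; apply: (poly_t_unit HOm gA maxA) => //.
have [di Ui] := cU _ ci; have [dj Uj] := cU _ cj.
have W : runit A (x ^+ j / x ^+ i * u ^ (di%:Z - dj%:Z)).
  have -> : x ^+ j / x ^+ i * u ^ (di%:Z - dj%:Z) =
     y j / y i * ((Pt`_i * u ^+ di) * (Pt`_j * u ^+ dj)^-1).
    rewrite expfzDr // -exprnN /y -exprnP; field.
    by rewrite !expf_neq0 ?ci ?cj.
  by apply: (runitM gA) => //; apply: (runitM gA) => //; exact: runitV.
case: (ltngtP i j) ji => [ij|ij|/val_inj->]; last by rewrite eqxx.
- move=> _; exists (j - i)%N, (dj%:Z - di%:Z); rewrite subn_gt0 ij; split=> //.
  rewrite opprB; move: W; suff -> : x ^+ j / x ^+ i = x ^+ (j - i) by [].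
  by rewrite -[in LHS](subnK (ltnW ij)) exprD mulfK ?expf_neq0.
- move=> _; exists (i - j)%N, (di%:Z - dj%:Z); rewrite subn_gt0 ij; split=> //.
  move/(@runitV _ _): W; rewrite invfM -invr_expz; suff -> : (x ^+ j / x ^+ i)^-1 = x ^+ (i - j) by [].
  by rewrite -[in LHS](subnK (ltnW ij)) exprD invfM invrK mulrC mulfK ?expf_neq0.
Qed.

(** [v x = a / n] when [x ^+ n] is a unit times [u ^ a]; by [u_powers_unit] the ratio does not
    depend on the choice. *)
Lemma ring_place : exists v, place_at_infty t v.
Proof.
have ch x : exists r : rat, x != 0 -> exists n (a : int),
    [/\ (0 < n)%N, runit A (x ^+ n * u ^ (- a)) & r = a%:~R / n%:R].
  have [->|x0] := eqVneq x 0; first by exists 0.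
  by have [n [a [n0 h]]] := commensurable x0; exists (a%:~R / n%:R) => _; exists n, a.
pose v x := projT1 (cid (ch x)).
have vP x : x != 0 -> exists n (a : int),
    [/\ (0 < n)%N, runit A (x ^+ n * u ^ (- a)) & v x = a%:~R / n%:R].
  by move=> x0; rewrite /v; case: cid => r /= /(_ x0).
have vE x n (a : int) : x != 0 -> (0 < n)%N -> runit A (x ^+ n * u ^ (- a)) -> v x = a%:~R / n%:R.
  move=> x0 n0 h; have [n' [a' [n0' h' ->]]] := vP x x0.
  have : runit A (u ^ (a' * n%:Z - a * n'%:Z)).
    have -> : u ^ (a' * n%:Z - a * n'%:Z) =
        (x ^+ n * u ^ (- a)) ^+ n' / (x ^+ n' * u ^ (- a')) ^+ n.
      rewrite !exprMn invfM -!exprM (mulnC n') mulrACA divff ?expf_neq0 // mul1r.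
      rewrite !exprnP !exprz_exp invr_expz expfzDr // mulrC.
      by rewrite !mulNr opprK.
    by apply: (runitM gA) => //; [|apply: runitV => //]; apply: (runitX gA).
  move/(u_powers_unit HOm gA) => /eqP; rewrite subr_eq0 => /eqP E.
  have E' : (a'%:~R * n%:R = a%:~R * n'%:R :> rat).
    by have := congr1 (fun z : int => z%:~R : rat) E; rewrite !intrM.
  have nn : n%:R != 0 :> rat by rewrite pnatr_eq0 -lt0n.
  have nn' : n'%:R != 0 :> rat by rewrite pnatr_eq0 -lt0n.
  by apply: (mulIf nn); apply: (mulIf nn'); rewrite divfK // mulrAC divfK.
have vM x y : x != 0 -> y != 0 -> v (x * y) = v x + v y.
  move=> x0 y0; have [n [a [n0 h Ex]]] := vP x x0; have [n' [a' [n0' h' Ey]]] := vP y y0.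
  rewrite (@vE (x * y) (n * n')%N (a * n'%:Z + a' * n%:Z)) ?mulf_neq0 ?muln_gt0 ?n0 //.
    rewrite Ex Ey intrD !intrM natrM; field.
    by rewrite !pnatr_eq0 -!lt0n n0 n0'.
  have -> : (x * y) ^+ (n * n') * u ^ (- (a * n'%:Z + a' * n%:Z)) =
     (x ^+ n * u ^ (- a)) ^+ n' * (y ^+ n' * u ^ (- a')) ^+ n.
    rewrite !exprMn -!exprM (mulnC n' n) mulrACA; congr (_ * _).
    rewrite !exprnP !exprz_exp opprD expfzDr //.
    by rewrite !mulNr.
  by apply: (runitM gA) => //; apply: (runitX gA).
have vA x : x != 0 -> A x -> 0 <= v x.
  move=> x0 Ax; have [n [a [n0 h ->]]] := vP x x0.
  apply: divr_ge0; rewrite ?ler0n //; case: a h => k h; first by rewrite ler0n.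
  case: (good_t gA); case: h => _ _; rewrite NegzE opprK -exprnP => h.
  have -> : t = (x ^+ n * u ^+ k.+1)^-1 * (x ^+ n * u ^+ k).
    rewrite exprS !invfM invrK; field.
    by rewrite !expf_neq0.
  apply: (AM) => //; apply: (AM); first exact: AX.
  by apply: AX; exact: (good_u gA).
exists v; split; last first.
  rewrite (@vE t 1%N (-1)) //.
  rewrite opprK !expr1 -exprnP expr1 /u divff //.
  by split; rewrite ?invr1 ?oner_neq0.
split=> // r x y vx vy xy0.
have [x0|x0] := eqVneq x 0; first by move: xy0; rewrite x0 add0r => /vy.
have [y0|y0] := eqVneq y 0; first by move: xy0; rewrite y0 addr0 => /vx.
wlog h : x y vx vy xy0 x0 y0 / A (y / x).
  move=> W; have [h|h] := Vr (mulf_neq0 y0 (invr_neq0 x0)); first exact: W.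
  rewrite addrC; apply: W => //; first by rewrite addrC.
  by move: h; rewrite invfM invrK mulrC.
have E : x + y = x * (1 + y / x) by rewrite mulrDr mulr1 mulrCA divff // mulr1.
have n0 : 1 + y / x != 0 by apply: contraNneq xy0 => n0; rewrite E n0 mulr0.
rewrite E vM //; apply: le_trans (vx x0) _; rewrite lerDl; apply: vA => //.
exact: AD.
Qed.

End MaximalRing.

Lemma exists_place_at_infty : exists v, place_at_infty t v.
Proof. by have [A gA maxA] := exists_maximal HOm; exact: (ring_place gA maxA). Qed.

End PlaceExists.

(** * The residue field at infinity *)

Section PlaceCoeff.

Variables (p : nat) (Om : fieldType) (t : Om).
Hypothesis HOm : sepclosure_Fpbar_t p t.
Let Hp := sepclosure_char HOm.
Local Notation kk := (in_Fpbar p (Om := Om)).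
Let Kf : subfld kk := in_Fpbar_subfld Hp.
Variable v : Om -> rat.
Hypothesis Pv : place_at_infty t v.
Let vV : valuation v := Pv.1.
Let vt : v t = -1 := Pv.2.
Let t0 : t != 0 := t_neq0 HOm.

Lemma v_Fpbar c : kk c -> c != 0 -> v c = 0.
Proof.
case=> n n0 hc c0; have := vlX vV (p ^ n) c0; rewrite hc => /eqP.
rewrite -subr_eq0 -[X in X - _]mul1r -mulrBl mulf_eq0 => /orP[|/eqP//].
rewrite subr_eq0 -[1]/(1%:R) eqr_nat eq_sym gtn_eqF //.
by rewrite -(expn0 p) ltn_exp2l // prime_gt1 // (pcharf_prime Hp).
Qed.

Lemma v_tinv : v t^-1 = 1.
Proof. by rewrite (vl_inv vV) // vt opprK. Qed.

Lemma poly_t_lead (P : {poly Om}) d : (forall i, kk P`_i) -> (size P <= d.+1)%N ->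
  vgt v 0 (P.[t] * t^-1 ^+ d - P`_d).
Proof.
move=> kP sP; rewrite (horner_coef_wide _ sP) big_ord_recr /= mulrDl.
rewrite -mulrA -exprMn divff // expr1n mulr1 addrK mulr_suml.
apply: (vgt_sum vV) => i _.
have -> : t^-1 ^+ d = t^-1 ^+ i * t^-1 ^+ (d - i) by rewrite -exprD subnKC // ltnW.
rewrite mulrA -(mulrA P`_i) -exprMn divff // expr1n mulr1 -(addr0 0).
apply: (vgtM vV); first by move=> ?; rewrite v_Fpbar.
by move=> _; rewrite (vlX vV) ?invr_eq0 // v_tinv mulr1 ltr0n subn_gt0.
Qed.

(** Divide an equation of [x] over kbar[t] by [t^d], with [d] the largest degree of its
    coefficients: what survives modulo the maximal ideal is a nonzero equation [Q] over kbar. Then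
    [algebraic_frobenius] applies. *)
Lemma residue_frobenius x : vge v 0 x ->
  exists2 s, (0 < s)%N & vgt v 0 (x ^+ (p ^ s) - x).
Proof.
move=> hx; have [P [kP P0 rx cE]] := algebraic_kt HOm x; set Pt := map_poly _ P in P0 rx cE.
pose d := \max_(i < size P) (size (P`_i)%R).-1.
have sd i : (size (P`_i)%R <= d.+1)%N.
  have [lt|ge] := ltnP i (size P); last by rewrite nth_default ?size_poly0.
  apply: leq_trans (leqSpred _) _; rewrite ltnS.
  exact: (leq_bigmax (Ordinal lt)).
pose Q := \poly_(i < size P) P`_i`_d.
have Q0 : Q != 0.
  have P00 : P != 0 by apply: contraNneq P0 => P00; rewrite /Pt P00 map_poly0.
  have sP : (0 < size P)%N by rewrite lt0n size_poly_eq0.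
  have [i iE] : exists i : 'I_(size P), P`_i`_d != 0.
    have [d0|d0] := posnP d.
      have lt : ((size P).-1 < size P)%N by rewrite prednK.
      exists (Ordinal lt) => /=; rewrite d0.
      have nz : P`_(size P).-1 != 0 by rewrite -/(lead_coef P) lead_coef_eq0.
      have := sd (size P).-1; rewrite d0 => /size1_polyC E.
      by apply: contra_neq nz => E0; rewrite E E0.
    have cI : (0 < #|'I_(size P)|)%N by rewrite card_ord.
    have [i Ei] := @bigop.eq_bigmax 'I_(size P) (fun i => (size (P`_(val i))).-1) cI.
    exists i; rewrite -/d in Ei; rewrite Ei -/(lead_coef _) lead_coef_eq0 -size_poly_eq0 -lt0n.
    by move: d0; rewrite Ei; case: size.
  apply: contraNneq iE => /(congr1 (fun f : {poly Om} => f`_i)).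
  by rewrite coef_poly ltn_ord coef0 => ->.
have kQ i : kk Q`_i by rewrite coef_poly; case: ltnP => // _; exact: (subfld0 Kf).
have key : vgt v 0 Q.[x].
  have -> : Q.[x] = - \sum_(i < size P) ((P`_i).[t] * t^-1 ^+ d - P`_i`_d) * x ^+ i.
    have E : \sum_(i < size P) (P`_i).[t] * x ^+ i = 0.
      move/rootP: rx; rewrite (@horner_coef_wide _ (size P) Pt) ?size_poly // => E0.
      by rewrite -[RHS]E0; apply: eq_bigr => i _; rewrite cE.
    transitivity (Q.[x] - t^-1 ^+ d * \sum_(i < size P) (P`_i).[t] * x ^+ i).
      by rewrite E mulr0 subr0.
    rewrite horner_poly -sumrN mulr_sumr -sumrB; apply: eq_bigr => i _.
    by ring.
  apply: (vgtN vV); apply: (vgt_sum vV) => i _; rewrite mulrC -(addr0 0).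
  by apply: (vgtM vV); [exact: (vgeX vV)|exact: poly_t_lead].
apply: (@algebraic_frobenius _ _ Hp (vge v 0) (vgt v 0) x Q) => //.
- exact: (vge01 vV).
- by move=> y z; exact: (vgeB vV).
- by move=> y z; exact: (vgeM0 vV).
- by move=> c kc c0; rewrite v_Fpbar.
- exact: vgt0.
- by move=> y z; exact: (vgtB vV).
- by move=> y z hy hz; rewrite -(addr0 0); exact: (vgtM vV).
move=> y z hy hz h; have [y0|y0] := eqVneq y 0; first by left; rewrite y0; exact: vgt0.
have [z0|z0] := eqVneq z 0; first by right; rewrite z0; exact: vgt0.
have := h (mulf_neq0 y0 z0); rewrite (vlM vV) //.
have := hy y0; rewrite le_eqVlt => /orP[/eqP<-|hy' _]; last by left.
by rewrite add0r => hz'; right.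
Qed.

Lemma sep_split (P : {poly Om}) : P \is monic -> separable_poly P ->
  exists s : seq Om, P = \prod_(c <- s) ('X - c%:P).
Proof.
move: {2}(size P) (leqnn (size P)) => n; elim: n P => [|n IH] P sP mP sepP.
  by move: (monic_neq0 mP); rewrite -size_poly_eq0 -leqn0 sP.
have [s1|s1] := leqP (size P) 1.
  exists [::]; rewrite big_nil; move: mP; rewrite (size1_polyC s1) monicE lead_coefC.
  by move/eqP=> ->.
have [a /factor_theorem[Q E]] := sepclosure_closed HOm s1 sepP.
have mQ : Q \is monic by move: mP; rewrite E monicMr // monicXsubC.
have [|||s Es] := IH Q _ _ _ => //.
- by have := sP; rewrite E size_Mmonic ?monicXsubC ?monic_neq0 // size_XsubC addn2.
- by move: sepP; rewrite E separable_mul => /and3P[].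
by exists (rcons s a); rewrite -cats1 big_cat big_seq1 /= -Es.
Qed.

(** [x^q - x] has positive value and is the product of the [x - c] over the field of [q] elements,
    so one factor has positive value. *)
Lemma coeff_field_infty : coeff_field v kk.
Proof.
split=> //; first exact: v_Fpbar.
move=> x hx; have [s s0 hs] := residue_frobenius hx.
set q := (p ^ s)%N in hs.
have q1 : (1 < q)%N by rewrite -(expn0 p) ltn_exp2l // prime_gt1 // (pcharf_prime Hp).
have qp : (q%:R = 0 :> Om).
  by rewrite natrX (pcharf0 Hp) expr0n gtn_eqF.
have m : 'X^q - 'X \is @monic Om.
  by rewrite monicE lead_coefDl ?lead_coefXn // size_polyN size_polyX size_polyXn ltnS.
have sp : separable_poly ('X^q - 'X : {poly Om}).
  rewrite unlock derivB derivXn derivX -mulr_natl.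
  rewrite -polyC_natr qp mul0r sub0r -(scaleN1r (1 : {poly Om})).
  by rewrite coprimepZr ?oppr_eq0 ?oner_neq0 // coprimep1.
have [S ES] := sep_split m sp.
have kS c : c \in S -> kk c.
  move=> cS; exists s => //; apply/eqP; rewrite -subr_eq0.
  have : root ('X^q - 'X) c by rewrite ES root_prod_XsubC.
  by rewrite rootE !hornerE.
have E : x ^+ q - x = \prod_(c <- S) (x - c).
  have := congr1 (fun f : {poly Om} => f.[x]) ES; rewrite !hornerE => ->.
  by rewrite horner_prod; apply: eq_bigr => c _; rewrite !hornerE.
apply: contrapT => no; have nu c : c \in S -> x - c != 0 /\ v (x - c) = 0.
  move=> cS; have nv : ~ vgt v 0 (x - c) by move=> h; apply: no; exists c => //; exact: kS.
  have ge : vge v 0 (x - c) by apply: (vgeB vV) => // c0; rewrite v_Fpbar //; exact: kS.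
  have n0 : x - c != 0 by apply: contra_notN nv => /eqP->; exact: vgt0.
  split=> //; apply/eqP; rewrite eq_le ge // andbT leNgt; apply/negP => h.
  exact: nv.
have [] : x ^+ q - x != 0 /\ v (x ^+ q - x) = 0.
  rewrite E; elim: (S) nu => [|c s' IH] nu; first by rewrite big_nil oner_neq0 (vl1 vV).
  have [|h1 h2] := IH; first by move=> c' c's; apply: nu; rewrite inE c's orbT.
  have [h3 h4] := nu c (mem_head _ _); rewrite big_cons mulf_neq0 // (vlM vV) //.
  by rewrite h2 h4 addr0.
by move=> h1 h2; have := hs h1; rewrite h2 ltxx.
Qed.

End PlaceCoeff.

(** * Extension of automorphisms over kbar(t) *)

Lemma rmorphism_of (R S : nzRingType) (f : R -> S) : f 1 = 1 ->
  (forall x y, f (x - y) = f x - f y) -> (forall x y, f (x * y) = f x * f y) ->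
  exists s : {rmorphism R -> S}, s =1 f.
Proof.
move=> f1 fB fM.
pose fA := GRing.isZmodMorphism.Build R S f fB.
pose fR := GRing.isMonoidMorphism.Build R S f (f1, fM).
pose s : {rmorphism R -> S} := HB.pack f fA fR.
by exists s.
Qed.

Section Automorphisms.

Variables (p : nat) (Om : fieldType) (t : Om).
Hypothesis HOm : sepclosure_Fpbar_t p t.
Let Hp := sepclosure_char HOm.
Local Notation kk := (in_Fpbar p (Om := Om)).
Let Kf : subfld kk := in_Fpbar_subfld Hp.

Definition kt (x : Om) := exists P Q : {poly Om},
  [/\ forall i, kk P`_i, forall i, kk Q`_i, Q.[t] != 0 & x = P.[t] / Q.[t]].

Definition kkpoly (P : {poly Om}) := forall i, kk P`_i.

Lemma kkpolyB P Q : kkpoly P -> kkpoly Q -> kkpoly (P - Q).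
Proof. by move=> kP kQ i; rewrite coefB; apply: (subfldB Kf). Qed.

Lemma kkpolyM P Q : kkpoly P -> kkpoly Q -> kkpoly (P * Q).
Proof.
by move=> kP kQ i; rewrite coefM; apply: (subfld_sum Kf) => j _; apply: (subfldM Kf).
Qed.

Lemma kkpolyC c : kk c -> kkpoly c%:P.
Proof. by move=> kc i; rewrite coefC; case: eqP => // _; exact: (subfld0 Kf). Qed.

Lemma kt_poly P : kkpoly P -> kt P.[t].
Proof.
move=> kP; exists P, 1; rewrite hornerC divr1 oner_neq0; split=> //.
exact: (kkpolyC (subfld1 Kf)).
Qed.

Lemma kt_subfld : subfld kt.
Proof.
have m0 (P Q : {poly Om}) : P.[t] != 0 -> Q.[t] != 0 -> (P * Q).[t] != 0.
  by move=> P0 Q0; rewrite hornerM mulf_neq0.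
split.
- by rewrite -[1](hornerC 1 t); apply/kt_poly/kkpolyC/(subfld1 Kf).
- move=> _ _ [P [Q [kP kQ Q0 ->]]] [P' [Q' [kP' kQ' Q0' ->]]].
  exists (P * Q' - P' * Q), (Q * Q'); split; first by apply: kkpolyB; apply: kkpolyM.
  + exact: kkpolyM.
  + exact: m0.
  by rewrite !hornerE; field; rewrite Q0 Q0'.
- move=> _ _ [P [Q [kP kQ Q0 ->]]] [P' [Q' [kP' kQ' Q0' ->]]].
  exists (P * P'), (Q * Q'); split; try exact: kkpolyM.
    exact: m0.
  by rewrite !hornerM mulf_div.
- move=> _ [P [Q [kP kQ Q0 ->]]].
  have [P0|P0] := eqVneq P.[t] 0.
    by exists P, Q; rewrite P0 mul0r invr0.
  by exists Q, P; rewrite invfM invrK mulrC.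
Qed.

Lemma kt_t : kt t.
Proof.
rewrite -[t in kt t]hornerX; apply: kt_poly => i; rewrite coefX.
by case: eqP => _; [exact: (subfld1 Kf)|exact: (subfld0 Kf)].
Qed.

Lemma kt_kk c : kk c -> kt c.
Proof. by move=> kc; rewrite -[c](hornerC c t); apply/kt_poly/kkpolyC. Qed.

Lemma kt_int v x : place_at_infty t v -> kt x -> x != 0 -> exists z : int, v x = z%:~R.
Proof.
move=> Pv [P [Q [kP kQ Q0 ->]]]; have vV := Pv.1 => x0.
have P0 : P.[t] != 0 by apply: contraNneq x0 => ->; rewrite mul0r.
have vP (R : {poly Om}) : kkpoly R -> R.[t] != 0 -> v R.[t] = - ((size R).-1)%:R.
  move=> kR R0; have nR : R != 0 by apply: contraNneq R0 => ->; rewrite horner0.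
  have sR : (size R <= (size R).-1.+1)%N by rewrite prednK // lt0n size_poly_eq0.
  have := poly_t_lead HOm Pv kR sR; rewrite -/(lead_coef R).
  set d := (size R).-1 => h.
  have t0 : t^-1 ^+ d != 0 by rewrite expf_neq0 // invr_eq0 (t_neq0 HOm).
  have l0 : lead_coef R != 0 by rewrite lead_coef_eq0.
  have vl : v (lead_coef R) = 0 by apply: (v_Fpbar HOm Pv) => //; exact: kR.
  have := vl_dom vV l0; rewrite vl => /(_ _ h) []; rewrite addrC subrK => _.
  rewrite (vlM vV) // (vlX vV) ?invr_eq0 ?(t_neq0 HOm) // (v_tinv HOm Pv) mulr1.
  by move/eqP; rewrite addr_eq0 => /eqP.
rewrite (vl_div vV) // !vP //; exists ((size Q).-1%:Z - (size P).-1%:Z).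
by rewrite rmorphB /= opprK addrC.
Qed.

(** A partial homomorphism is given by its graph, a subring of [Om * Om]: a polynomial over the
    graph carries a polynomial over the domain together with its transform. *)
Record partial_aut (W : Om * Om -> Prop) : Prop := PartialAut {
  paB : forall x y, W x -> W y -> W (x - y);
  paM : forall x y, W x -> W y -> W (x * y);
  pa_kt : forall c, kt c -> W (c, c);
  pa_fun : forall y, W (0, y) -> y = 0 }.

Lemma diag_partial_aut : partial_aut (fun x => kt x.1 /\ x.1 = x.2).
Proof.
have Kt := kt_subfld.
split=> //.
- by move=> [x x'] [y y'] /= [kx <-] [ky <-]; split=> //; exact: (subfldB Kt).
- by move=> [x x'] [y y'] /= [kx <-] [ky <-]; split=> //; exact: (subfldM Kt).
- by move=> y [_ /= <-].
Qed.

Local Notation p1 := (map_poly fst).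
Local Notation p2 := (map_poly snd).

Section Extension.

Variable W : Om * Om -> Prop.
Hypothesis PW : partial_aut W.

Let WB := paB PW.
Let WM := paM PW.
Let W1 : W 1. Proof. by apply: (pa_kt PW (c := 1)); exact: (subfld1 kt_subfld). Qed.
Let W0 : W 0. Proof. by rewrite -(subrr 1); apply: (WB). Qed.
Let WN x : W x -> W (- x). Proof. by move=> Wx; rewrite -sub0r; apply: (WB). Qed.
Let WD x y : W x -> W y -> W (x + y).
Proof. by move=> Wx Wy; rewrite -(opprK y); apply: (WB) => //; exact: WN. Qed.

Definition Wpoly (f : {poly Om * Om}) := forall i, W f`_i.

Let WpB f g : Wpoly f -> Wpoly g -> Wpoly (f - g).
Proof. by move=> Wf Wg i; rewrite coefB; apply: (WB). Qed.
Let WpN f : Wpoly f -> Wpoly (- f).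
Proof. by move=> Wf i; rewrite coefN; apply: WN. Qed.
Let WpD f g : Wpoly f -> Wpoly g -> Wpoly (f + g).
Proof. by move=> Wf Wg i; rewrite coefD; apply: WD. Qed.
Let WpM f g : Wpoly f -> Wpoly g -> Wpoly (f * g).
Proof.
by move=> Wf Wg i; rewrite coefM; apply: (big_ind W W0 WD) => j _; apply: (WM).
Qed.
Let WpC c : W c -> Wpoly c%:P.
Proof. by move=> Wc i; rewrite coefC; case: eqP. Qed.
Let WpX : Wpoly 'X.
Proof. by move=> i; rewrite coefX; case: eqP. Qed.

Lemma Wpoly_fst0 f : Wpoly f -> p1 f = 0 -> f = 0.
Proof.
move=> Wf E; apply/polyP => i; rewrite coef0.
have := Wf i; have := congr1 (fun g : {poly Om} => g`_i) E.
rewrite coef_map coef0; case: (f`_i) => a b /= ->.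
by move/(pa_fun PW) => ->.
Qed.

Lemma diag_poly (P : {poly Om}) : (forall i, kt P`_i) ->
  exists f, [/\ Wpoly f, p1 f = P & p2 f = P].
Proof.
move=> kP; exists (\poly_(i < size P) (P`_i, P`_i)); split.
- by move=> i; rewrite coef_poly; case: ltnP => // _; exact: (pa_kt PW).
- apply/polyP => i; rewrite coef_map coef_poly; case: ltnP => //= h.
  by rewrite nth_default.
- apply/polyP => i; rewrite coef_map coef_poly; case: ltnP => //= h.
  by rewrite nth_default.
Qed.

Lemma Wpoly_root x : exists2 f, Wpoly f & p1 f != 0 /\ root (p1 f) x.
Proof.
have [P [kP P0 rx cE]] := algebraic_kt HOm x.
have [i|f [Wf f1 f2]] := @diag_poly (map_poly (fun c : {poly Om} => c.[t]) P).
  by rewrite cE; apply: kt_poly; exact: kP.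
by exists f => //; rewrite f1.
Qed.

Lemma kt_inverse x : x != 0 -> exists2 g : {poly Om}, (forall i, kt g`_i) & x * g.[x] = 1.
Proof.
move=> x0; have [P [kP P0 rx cE]] := algebraic_kt HOm x.
have Kt := kt_subfld.
set Q := map_poly _ P in P0 rx cE.
have kQ i : kt Q`_i by rewrite cE; apply: kt_poly; exact: kP.
clearbody Q; clear kP cE; elim/poly_ind: Q P0 rx kQ => [|Q c IH]; first by rewrite eqxx.
move=> nz rx kQ.
have kc : kt c by have := kQ 0%N; rewrite coefD coefMX coefC /= add0r.
have kQ' i : kt Q`_i by have := kQ i.+1; rewrite coefD coefMX coefC /= addr0.
have [c0|c0] := eqVneq c 0.
  apply: IH => //; first by apply: contraNneq nz => ->; rewrite c0 mul0r addr0.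
  by move: rx; rewrite c0 addr0 rootM rootX (negPf x0) orbF.
exists ((- c^-1) *: Q).
  by move=> i; rewrite coefZ; apply: (subfldM Kt) => //; apply/(subfldN Kt)/(subfldV Kt).
have E : Q.[x] * x = - c.
  by move/rootP: rx; rewrite !hornerE => /eqP; rewrite addr_eq0 => /eqP.
by rewrite hornerZ mulrCA (mulrC x) E mulrNN mulVf.
Qed.

(** Inverses are polynomial expressions over kbar(t), so the domain of the graph is a field. *)
Lemma Wfst_inverse x : W x -> x.1 != 0 -> exists2 y, W y & x * y = 1.
Proof.
move=> Wx x0; have [g kg E] := kt_inverse x0.
have [f [Wf f1 f2]] := diag_poly kg.
have Wy : W f.[x].
  rewrite horner_coef; apply: (big_ind W W0 WD) => i _; apply: (WM) => //.
  by elim: (i : nat) => [|n IH]; rewrite ?expr0 // exprS; apply: (WM).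
exists f.[x] => //; have Wxy := WM Wx Wy.
have E1 : (x * f.[x]).1 = 1.
  rewrite -[RHS]E -f1; congr (_ * _).
  exact: esym (horner_map (fst : {rmorphism Om * Om -> Om}) f x).
have : W (x * f.[x] - 1) by apply: (WB).
case: (x * f.[x]) E1 => a b /= ->.
have -> : (1, b) - 1 = (0, b - 1) :> Om * Om by congr pair; rewrite subrr.
by move/(pa_fun PW)/eqP; rewrite subr_eq0 => /eqP->.
Qed.

Section Root.

Variables (z : Om) (f : {poly Om * Om}).
Hypotheses (Wf : Wpoly f) (mf : f \is monic) (rf : root (p1 f) z).
Hypothesis minf : forall g, Wpoly g -> root (p1 g) z -> (size g < size f)%N -> g = 0.

Lemma W_division g : Wpoly g -> exists q r,
  [/\ g = q * f + r, (size r < size f)%N, Wpoly r & Wpoly q].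
Proof. by apply: (@monic_division _ W W) => //; exact: WM. Qed.

(** Euclid's algorithm over the graph: leading coefficients can be inverted, and [f] is irreducible
    by minimality. The identity can then be read in either coordinate. *)
Lemma W_bezout g : Wpoly g -> g != 0 -> (size g < size f)%N ->
  exists S U, [/\ Wpoly S, Wpoly U & g * S + f * U = 1].
Proof.
move: {2}(size g) (leqnn (size g)) => n; elim: n g => [|n IH] g sn Wg g0 sg.
  by move: g0; rewrite -size_poly_eq0 -leqn0 sn.
have l0 : (lead_coef g).1 != 0.
  apply: contraNneq g0 => l0; rewrite -lead_coef_eq0.
  have := Wg (size g).-1; rewrite -/(lead_coef g).
  by case: (lead_coef g) l0 => a b /= ->; move/(pa_fun PW)=> ->.
have [b Wb Eb] := Wfst_inverse (Wg _) l0.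
pose h := g * b%:P.
have Wh : Wpoly h by apply: WpM => //; apply: WpC.
have sh : size h = size g.
  rewrite /h mulrC mul_polyC; apply/eqP; rewrite eqn_leq size_scale_leq /=.
  have {1}-> : g = (lead_coef g) *: (b *: g) by rewrite scalerA Eb scale1r.
  exact: size_scale_leq.
have mh : h \is monic.
  by rewrite monicE /lead_coef sh /h coefMC -/(lead_coef g) Eb.
have [Q [C [E sC WC WQ]]] := @monic_division _ W W h W0 WB WM mh Wh f Wf.
have [C0|C0] := eqVneq C 0; last first.
  have [||||S [U [WS WU E']]] := IH C => //.
    by rewrite -ltnS; apply: leq_trans sn; rewrite -sh.
    by apply: leq_ltn_trans (ltnW sC) _; rewrite sh.
  exists (- (b%:P * Q * S)), (S + U); split.
  - by apply: WpN; apply: (WpM) => //; apply: (WpM) => //; apply: WpC.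
  - exact: WpD.
  rewrite -[RHS]E'; have -> : C = f - Q * (g * b%:P) by rewrite {1}E -/h addrC addKr.
  by ring.
have [sh1|sh1] := leqP (size h) 1.
  exists b%:P, 0; split; first exact: WpC.
    by move=> i; rewrite coef0.
  have E0 := size1_polyC sh1.
  have h0 : h`_0 = 1 by rewrite -(monicP mh) [in RHS]E0 lead_coefC.
  by rewrite mulr0 addr0 -/h E0 h0.
have Q0 : Q != 0.
  by apply: contraNneq (monic_neq0 mf) => Q0; rewrite E C0 Q0 mul0r addr0.
have sf : size f = (size Q + size h).-1 by rewrite E C0 addr0 size_Mmonic.
have : root (p1 Q) z || root (p1 h) z by rewrite -rootM -rmorphM /= -[Q * h]addr0 -C0 -E.
case/orP=> [rQ|rh].
  have sQ : (0 < size Q)%N by rewrite lt0n size_poly_eq0.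
  have ltQ : (size Q < size f)%N.
    by rewrite sf -(prednK (ltnW sh1)) addnS /= -[X in (X < _)%N]addn0 ltn_add2l -ltnS prednK ?(ltnW sh1).
  by move: Q0; rewrite (minf WQ rQ ltQ) eqxx.
have : h = 0 by apply: minf; rewrite ?sh.
by move=> h0; move: (monic_neq0 mh); rewrite h0 eqxx.
Qed.

(** [f] divides an equation having [z] as a simple root, so its derivative is nonzero; the Bezout
    identity between the two is transported by the second projection. *)
Lemma W_separable : separable_poly (p2 f).
Proof.
have [P [kP rx dx]] := sepclosure_alg HOm z.
have kt0 i : kt (map_poly (fun c : {poly Om} => c.[t]) P)`_i.
  by rewrite coef_map_id0 ?horner0 //; apply: kt_poly; exact: kP.
have [g [Wg g1 g2]] := diag_poly kt0.
have [q [r [E sr Wr Wq]]] := W_division Wg.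
have r0 : r = 0.
  apply: minf => //; move: rx; rewrite -g1 E rmorphD rmorphM /= !rootE !hornerE.
  by rewrite (rootP rf) mulr0 add0r.
have d0 : f^`() != 0.
  apply: contraNneq dx => d0; rewrite -g1 E r0 addr0 rmorphM derivM rootE !hornerE /=.
  by rewrite (rootP rf) mulr0 add0r deriv_map d0 rmorph0 horner0 mulr0.
have sd : (size f^`() < size f)%N by rewrite lt_size_deriv // monic_neq0.
have Wd : Wpoly f^`().
  move=> i; rewrite coef_deriv -mulr_natl; apply: (WM) => //.
  by elim: (i.+1) => [|n IH]; rewrite ?mulr0n // mulrS; apply: WD.
have [S [U [WS WU Eb]]] := W_bezout Wd d0 sd.
rewrite unlock; apply/Bezout_coprimepP; exists (p2 U, p2 S) => /=.
rewrite deriv_map -!rmorphM -rmorphD /= mulrC [S * _]mulrC addrC Eb rmorph1.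
exact: eqpxx.
Qed.

Lemma size_p2 : size (p2 f) = size f.
Proof.
by rewrite (size_map_poly_id0 (f := snd)) // (monicP mf) oner_neq0.
Qed.

Lemma monic_p2 : p2 f \is monic.
Proof. by rewrite monicE /lead_coef size_p2 coef_map -/(lead_coef f) (monicP mf). Qed.

(** Evaluation at [(z, z')] of polynomials over the graph. It remains a function because [f] divides
    every polynomial vanishing at [z]. *)
Lemma W_extend z' : root (p2 f) z' -> exists W', [/\ partial_aut W',
  forall x, W x -> W' x & W' (z, z')].
Proof.
move=> rz'.
exists (fun x => exists2 g, Wpoly g & x = ((p1 g).[z], (p2 g).[z'])); split.
- split.
  + move=> _ _ [g Wg ->] [h Wh ->]; exists (g - h); first exact: WpB.
    by rewrite !rmorphB !hornerE.
  + move=> _ _ [g Wg ->] [h Wh ->]; exists (g * h); first exact: WpM.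
    by rewrite !rmorphM !hornerE.
  + move=> c kc; exists (c, c)%:P; first by apply: WpC; exact: (pa_kt PW).
    by rewrite !map_polyC !hornerC.
  + move=> y [g Wg [E1 E2]]; have [q [r [E sr Wr Wq]]] := W_division Wg.
    have r0 : r = 0.
      apply: minf => //; apply/rootP; have := esym E1; rewrite E rmorphD rmorphM !hornerE /=.
      by rewrite (rootP rf) mulr0 add0r.
    by rewrite E2 E r0 addr0 rmorphM !hornerE /= (rootP rz') mulr0.
- move=> x Wx; exists x%:P; first exact: WpC.
  by rewrite !map_polyC !hornerC; case: (x).
- by exists 'X => //; rewrite !map_polyX !hornerX.
Qed.

End Root.

Lemma minimal_Wpoly z : exists f, [/\ Wpoly f, f \is monic, root (p1 f) z &
  forall g, Wpoly g -> root (p1 g) z -> (size g < size f)%N -> g = 0].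
Proof.
have [f0 Wf0 [nz r0]] := Wpoly_root z.
pose Q n := `[< exists f, [/\ Wpoly f, f != 0, root (p1 f) z & size f = n] >].
have exQ : exists n, Q n.
  exists (size f0); apply/asboolP; exists f0; split=> //.
  by apply: contraNneq nz => ->; rewrite rmorph0.
case: (ex_minnP exQ) => n /asboolP[f [Wf f0' rf <-]] minn.
have l0 : (lead_coef f).1 != 0.
  apply: contraNneq f0' => l0; rewrite -lead_coef_eq0.
  have := Wf (size f).-1; rewrite -/(lead_coef f).
  by case: (lead_coef f) l0 => a b /= ->; move/(pa_fun PW)=> ->.
have [b Wb Eb] := Wfst_inverse (Wf _) l0.
have sh : size (f * b%:P) = size f.
  rewrite mulrC mul_polyC; apply/eqP; rewrite eqn_leq size_scale_leq /=.
  have {1}-> : f = (lead_coef f) *: (b *: f) by rewrite scalerA Eb scale1r.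
  exact: size_scale_leq.
exists (f * b%:P); split.
- by apply: (WpM) => //; apply: WpC.
- by rewrite monicE /lead_coef sh coefMC -/(lead_coef f) Eb.
- by rewrite rmorphM rootM rf.
move=> g Wg rg; rewrite sh => lt; apply/eqP; apply: contraLR lt => g0.
by rewrite -leqNgt; apply: minn; apply/asboolP; exists g.
Qed.

Lemma W_extend_to z : exists W', [/\ partial_aut W', forall x, W x -> W' x &
  exists z', W' (z, z')].
Proof.
have [f [Wf mf rf minf]] := minimal_Wpoly z.
have s1 : (1 < size (p2 f))%N.
  rewrite size_p2 // ltnNge; apply/negP => s1; move: rf; move/monicP: mf.
  by rewrite (size1_polyC s1) lead_coefC => ->; rewrite map_polyC /= rootC oner_eq0.
have [z' rz'] := sepclosure_closed HOm s1 (W_separable Wf mf rf minf).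
have [W' [PW' sW Wz]] := W_extend Wf mf rf minf rz'.
by exists W'; split=> //; exists z'.
Qed.

End Extension.

Lemma extend_aut W : partial_aut W -> exists2 s : {rmorphism Om -> Om},
  Gal_geom p t s & forall x y, W (x, y) -> s x = y.
Proof.
move=> PW.
have [M [PM sWM] maxM] : exists2 M, (partial_aut M /\ forall x, W x -> M x) &
    forall B, (partial_aut B /\ forall x, W x -> B x) -> (forall x, M x -> B x) ->
      forall x, B x -> M x.
  (* As for [exists_maximal], the empty graph takes care of the empty chain. *)
  pose P M := (partial_aut M /\ forall x, W x -> M x) \/ forall x, ~ M x.
  have [M PM maxM] : exists2 M, P M & forall B, P B -> (forall x, M x -> B x) ->
      forall x, B x -> M x.
    apply: zorn_sets => F FP tot.
    have [[X FX gX]|noX] := pselect (exists2 X, F X & exists x, X x); last first.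
      by right=> x [X FX Xx]; apply: noX; exists X => //; exists x.
    have gP Y : F Y -> (exists x, Y x) -> partial_aut Y /\ forall x, W x -> Y x.
      by move=> FY [y Yy]; have [//|/(_ y)] := FP Y FY.
    left; split; last by move=> x Wx; exists X => //; exact: (gP X FX gX).2.
    have two x y : (exists2 Y, F Y & Y x) -> (exists2 Y, F Y & Y y) ->
        exists Y, [/\ F Y, partial_aut Y, Y x & Y y].
      move=> [Y FY Yx] [Z FZ Zy]; have [YZ|ZY] := tot Y Z FY FZ.
        exists Z; split=> //; last exact: YZ.
        by apply: (proj1 (gP Z FZ _)); exists y.
      exists Y; split=> //; last exact: ZY.
      by apply: (proj1 (gP Y FY _)); exists x.
    split.
    - move=> x y hx hy; have [Y [FY pY Yx Yy]] := two _ _ hx hy.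
      by exists Y => //; exact: (paB pY).
    - move=> x y hx hy; have [Y [FY pY Yx Yy]] := two _ _ hx hy.
      by exists Y => //; exact: (paM pY).
    - move=> c kc; exists X => //; exact: (pa_kt (gP X FX gX).1).
    - by move=> y [Y FY Yy]; apply: (pa_fun (proj1 (gP Y FY (ex_intro _ _ Yy)))).
  exists M; last by move=> B PB; apply: maxM; left.
  case: PM => // nM; have PW' : P W by left; split.
  case: (nM 1); apply: (maxM W PW') => [x /nM//|].
  by apply: (pa_kt PW (c := 1)); exact: (subfld1 kt_subfld).
have totM x : exists y, M (x, y).
  have [W' [PW' sM [y Wy]]] := W_extend_to PM x.
  exists y; apply: (maxM W') => //; split=> // x' Wx'; apply: sM; exact: sWM.
have funM x y y' : M (x, y) -> M (x, y') -> y = y'.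
  move=> h h'; apply/eqP; rewrite -subr_eq0; apply/eqP; apply: (pa_fun PM).
  have -> : (0, y - y') = (x, y) - (x, y') :> Om * Om by congr pair; rewrite subrr.
  exact: (paB PM).
pose f x := projT1 (cid (totM x)).
have fM x : M (x, f x) by exact: (projT2 (cid (totM x))).
have [|||s hs] := @rmorphism_of Om Om f.
- by apply: (funM 1 _ _ (fM 1)); apply: (pa_kt PM); exact: (subfld1 kt_subfld).
- by move=> x y; apply: (funM (x - y) _ _ (fM _)); exact: (paB PM (fM x) (fM y)).
- by move=> x y; apply: (funM (x * y) _ _ (fM _)); exact: (paM PM (fM x) (fM y)).
exists s; last by move=> x y /sWM h; rewrite hs; exact: (funM x _ _ (fM x)).
have fix_kt c : kt c -> s c = c.
  by move=> kc; rewrite hs; apply: (funM c _ _ (fM c)); exact: (pa_kt PM).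
by split=> [|c kc]; apply: fix_kt; [exact: kt_t|exact: kt_kk].
Qed.

(** Each root of the minimal polynomial is the image of [x] under some automorphism, hence equal to
    [x]; by separability the degree is 1. *)
Lemma fixed_kt x : (forall s, Gal_geom p t s -> s x = x) -> kt x.
Proof.
move=> fx; have PW := diag_partial_aut.
have [f [Wf mf rf minf]] := minimal_Wpoly PW x.
have p2f := W_separable PW Wf mf rf minf.
have s1 : (1 < size (p2 f))%N.
  rewrite size_p2 // ltnNge; apply/negP => s1; move: rf; move/monicP: mf.
  by rewrite (size1_polyC s1) lead_coefC => ->; rewrite map_polyC /= rootC oner_eq0.
have mp2 := monic_p2 mf.
have [s Es] := sep_split HOm mp2 p2f.
have us : uniq s by move: p2f; rewrite Es separable_prod_XsubC.
have all_x c : c \in s -> c = x.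
  move=> cs; have rc : root (p2 f) c by rewrite Es root_prod_XsubC.
  have [W' [PW' sW Wc]] := W_extend PW Wf mf rf minf rc.
  have [g Gg gE] := extend_aut PW'.
  by rewrite -(gE _ _ Wc) fx.
have ss : size s = 1%N.
  have := s1; rewrite Es size_prod_XsubC ltnS; case: (s) us all_x => [|a [|b r]] //=.
  rewrite inE => /andP[/norP[ab _] _] h _.
  have ha : a = x by apply: h; rewrite mem_head.
  have hb : b = x by apply: h; rewrite inE mem_head orbT.
  by rewrite ha hb eqxx in ab.
case: s Es us all_x ss => [|c []] // Es _ all_x _.
have [k0 E0] := Wf 0%N; have : (p2 f)`_0 = - c.
  by rewrite Es big_seq1 coefB coefX coefC sub0r.
rewrite coef_map /= -E0 -(all_x c (mem_head _ _)) => h.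
by rewrite -(opprK c) -h; apply: (subfldN kt_subfld).
Qed.

End Automorphisms.

(** * Compactness and finite levels of the Galois group *)

Section GaloisGroups.

Variables (p : nat) (Om : fieldType) (t : Om).
Hypothesis HOm : sepclosure_Fpbar_t p t.
Let Hp := sepclosure_char HOm.
Local Notation kk := (in_Fpbar p (Om := Om)).
Local Notation Gal := (Gal_geom p t).
Local Notation End := {rmorphism Om -> Om}.

Definition gal_stable (s : seq Om) := forall g, Gal g -> forall x, x \in s -> g x \in s.

Lemma Gal_id : Gal (idfun : End).
Proof. by []. Qed.

Lemma Gal_comp (g h : End) : Gal g -> Gal h -> Gal (g \o h : End).
Proof. by case=> gt gc [ht hc]; split=> [|c kc] /=; rewrite ?ht ?gt ?hc ?gc. Qed.

Lemma Gal_kt (g : End) x : Gal g -> kt p t x -> g x = x.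
Proof.
move=> [gt gc] [P [Q [kP kQ Q0 ->]]].
have h (R : {poly Om}) : (forall i, kk R`_i) -> g R.[t] = R.[t].
  move=> kR; rewrite -horner_map gt; congr horner.
  by apply/polyP => i; rewrite coef_map /= gc.
by rewrite fmorph_div !h.
Qed.

Lemma orbit_list x : exists o : seq Om, forall y, y \in o <-> exists2 g : End, Gal g & g x = y.
Proof.
have [P [kP P0 rx cE]] := algebraic_kt HOm x.
have [o ho] := roots_list P0.
exists [seq y <- o | `[< exists2 g : End, Gal g & g x = y >]] => y.
rewrite mem_filter; split=> [/andP[/asboolP]//|h]; rewrite asboolT //=.
case: h => g Gg <-; apply: ho; set Pt := map_poly _ P in rx cE *.
have -> : Pt = map_poly g Pt.
  by apply/polyP => i; rewrite coef_map /= cE Gal_kt //; apply: (kt_poly HOm) => j; exact: kP.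
by rewrite rootE horner_map (rootP rx) rmorph0.
Qed.

Lemma stable_hull (xs : seq Om) : exists s : seq Om,
  [/\ uniq s, {subset xs <= s} & gal_stable s].
Proof.
suff [s [sxs ss]] : exists s : seq Om, {subset xs <= s} /\ gal_stable s.
  exists (undup s); split; first exact: undup_uniq.
    by move=> x /sxs; rewrite mem_undup.
  by move=> g Gg x; rewrite !mem_undup; exact: ss.
elim: xs => [|x xs [s [sxs ss]]]; first by exists [::].
have [o ho] := orbit_list x; exists (o ++ s); split.
  move=> y; rewrite inE mem_cat => /predU1P[->|/sxs->]; last by rewrite orbT.
  by apply/orP; left; apply/ho; exists idfun.
move=> g Gg y; rewrite !mem_cat => /orP[/ho[h Gh <-]|/(ss g Gg)->]; last by rewrite orbT.
by apply/orP; left; apply/ho; exists (g \o h : End) => //; exact: Gal_comp.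
Qed.

(** Every element lies in a finite stable set, which an injective map permutes. *)
Lemma Gal_inverse (g : End) : Gal g -> exists2 g' : End, Gal g' & cancel g g' /\ cancel g' g.
Proof.
move=> Gg.
have sur x : exists y, g y = x.
  have [s [us xs ss]] := stable_hull [:: x].
  have mapE : map g s =i s.
    apply: (uniq_min_size _ _ _).2 => //; rewrite ?map_inj_uniq ?size_map //.
      exact: fmorph_inj.
    by move=> y /mapP[z zs ->]; exact: ss.
  have /mapP[y _ ->] : x \in map g s by rewrite mapE xs // mem_head.
  by exists y.
pose f x := projT1 (cid (sur x)).
have fP x : g (f x) = x by exact: (projT2 (cid (sur x))).
have fE x y : g y = x -> f x = y by move=> <-; apply: (fmorph_inj g); rewrite fP.
have [|||g' hg'] := @rmorphism_of Om Om f.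
- by apply: fE; rewrite rmorph1.
- by move=> x y; apply: fE; rewrite rmorphB !fP.
- by move=> x y; apply: fE; rewrite rmorphM !fP.
exists g'; last by split=> x; rewrite hg' //; apply: fE.
by case: Gg => gt gc; split=> [|c kc]; rewrite hg'; apply: fE; rewrite ?gt ?gc.
Qed.

(* The Galois group is compact: a condition on automorphisms is satisfiable as
   soon as all its finite levels [Q s] are. *)
Lemma Gal_compact (Q : seq Om -> End -> Prop) :
  (forall s (g g' : End), Gal g -> Gal g' -> {in s, g =1 g'} -> Q s g -> Q s g') ->
  (forall s s' g, Gal g -> {subset s <= s'} -> Q s' g -> Q s g) ->
  (forall s, exists2 g, Gal g & Q s g) ->
  exists2 g, Gal g & forall s, Q s g.
Proof.
move=> Qext Qmon Qex.
(* Zorn's lemma on partial graphs each finite part of which is compatible with every condition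
   [Q s]. *)
pose P (X : Om * Om -> Prop) := forall (l : seq (Om * Om)) s,
  (forall z, z \in l -> X z) ->
  exists2 g : End, Gal g & Q s g /\ forall z, z \in l -> g z.1 = z.2.
have [A PA maxA] : exists2 A, P A & forall B, P B -> (forall x, A x -> B x) ->
    forall x, B x -> A x.
  apply: zorn_sets => F FP tot l s hl.
  have [l0|[X FX hX]] : l = [::] \/ exists2 X, F X & forall z, z \in l -> X z.
    elim: l hl => [|z l IH] hl; [by left|right].
    have [X FX Xz] := hl z (mem_head _ _).
    have [|l0|[Y FY hY]] := IH; first by move=> y yl; apply: hl; rewrite inE yl orbT.
      by exists X => // y; rewrite l0 inE => /eqP->.
    have [XY|YX] := tot X Y FX FY.
      by exists Y => // y /[!inE] /predU1P[->|/hY//]; exact: XY.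
    by exists X => // y /[!inE] /predU1P[->//|/hY]; exact: YX.
    by have [g Gg Qg] := Qex s; exists g => //; split=> // z; rewrite l0.
  exact: FP FX l s hX.
have totA x : exists y, A (x, y).
  (* If no value at [x] were admissible, the obstructions for its finitely many conjugates would
     combine into one finite condition that no automorphism satisfies. *)
  apply: contrapT => no; have [o ho] := orbit_list x.
  have bad y : exists (l : seq (Om * Om)) (s : seq Om), (forall z, z \in l -> A z) /\
      forall g : End, Gal g -> Q s g -> (forall z, z \in l -> g z.1 = z.2) -> g x <> y.
    apply: contrapT => nb; apply: no; exists y.
    apply: (maxA (fun z => A z \/ z = (x, y))); [|by left|by right].
    move=> l s hl; apply: contrapT => ng; apply: nb.
    pose l' : seq (Om * Om)%type := filter (predC1 ((x, y) : (Om * Om)%type)) l.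
    exists l', s; split.
      by move=> z; rewrite mem_filter /= => /andP[ne /hl[//|E]]; move: ne; rewrite E eqxx.
    move=> g Gg Qg hg gx; apply: ng; exists g => //; split=> // z zl.
    have [->//|ne] := eqVneq z (x, y).
    by apply: hg; rewrite mem_filter /= ne.
  have [l [s [hl nx]]] : exists (l : seq (Om * Om)) (s : seq Om), (forall z, z \in l -> A z) /\
      forall g : End, Gal g -> Q s g -> (forall z, z \in l -> g z.1 = z.2) -> g x \notin o.
    elim: (o) => [|y o' [l [s [hl IH]]]]; first by exists [::], [::].
    have [l' [s' [hl' ny]]] := bad y; exists (l ++ l'), (s ++ s'); split.
      by move=> z; rewrite mem_cat => /orP[/hl|/hl'].
    move=> g Gg Qg hg; rewrite inE negb_or; apply/andP; split.
      apply/eqP/ny => //; last by move=> z zl; apply: hg; rewrite mem_cat zl orbT.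
      by apply: Qmon Qg => // z zs; rewrite mem_cat zs orbT.
    apply: IH => //; last by move=> z zl; apply: hg; rewrite mem_cat zl.
    by apply: Qmon Qg => // z zs; rewrite mem_cat zs.
  have [g Gg [Qg hg]] := PA l s hl.
  by have := nx g Gg Qg hg; apply/negP/negPn/ho; exists g.
pose f x := projT1 (cid (totA x)).
have fA x : A (x, f x) by exact: (projT2 (cid (totA x))).
have fin (l : seq Om) s : exists2 g : End, Gal g & Q s g /\ {in l, g =1 f}.
  have [|g Gg [Qg hg]] := PA [seq (x, f x) | x <- l] s; first by move=> z /mapP[x _ ->].
  by exists g => //; split=> // x xl; apply: (hg (x, f x)); apply: map_f.
have [|||g hg] := @rmorphism_of Om Om f.
- by have [g _ [_ E]] := fin [:: 1] [::]; rewrite -E ?mem_head ?rmorph1.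
- move=> x y; have [g _ [_ E]] := fin [:: x; y; x - y] [::].
  by rewrite -!E ?inE ?eqxx ?orbT // rmorphB.
- move=> x y; have [g _ [_ E]] := fin [:: x; y; x * y] [::].
  by rewrite -!E ?inE ?eqxx ?orbT // rmorphM.
have Gg : Gal g.
  split=> [|c kc]; rewrite hg.
    by have [h [ht _] [_ E]] := fin [:: t] [::]; rewrite -E ?mem_head.
  by have [h [_ hc] [_ E]] := fin [:: c] [::]; rewrite -E ?mem_head // hc.
exists g => // s; have [h Gh [Qh E]] := fin s s.
by apply: Qext Qh => // x xs; rewrite hg E.
Qed.

Definition fixed_by_stab (s : seq Om) (x : Om) :=
  forall g : End, Gal g -> {in s, forall y, g y = y} -> g x = x.

(** [G] is the Galois group of the level field, and [act] chooses lifts of its elements to [Om]; it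
    is multiplicative only on that field. *)
Record galois_level (s : seq Om) (X : finGroupType) (G : {group X})
    (act : X -> End) : Prop := GaloisLevel {
  gl_act : forall g, g \in G -> Gal (act g);
  gl_sur : forall g : End, Gal g -> exists2 h, h \in G &
    forall x, fixed_by_stab s x -> act h x = g x;
  gl_M : forall g h x, g \in G -> h \in G -> fixed_by_stab s x ->
    act (g * h)%g x = act g (act h x);
  gl_faith : forall g, g \in G -> (forall x, fixed_by_stab s x -> act g x = x) -> g = 1%g }.

Section Level.

Variable s : seq Om.
Hypothesis ss : gal_stable s.
Local Notation L := (fixed_by_stab s).

Lemma level_subfld : subfld L.
Proof.
split.
- by move=> g _ _; rewrite rmorph1.
- by move=> x y Lx Ly g Gg hg; rewrite rmorphB Lx ?Ly.
- by move=> x y Lx Ly g Gg hg; rewrite rmorphM Lx ?Ly.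
- by move=> x Lx g Gg hg; rewrite fmorphV Lx.
Qed.

Lemma level_mem x : x \in s -> L x.
Proof. by move=> xs g _; exact. Qed.

Lemma level_kt x : kt p t x -> L x.
Proof. by move=> kx g Gg _; exact: Gal_kt. Qed.

Lemma level_stable (g : End) x : Gal g -> L x -> L (g x).
Proof.
move=> Gg Lx h Gh hs; have [g' Gg' [gK g'K]] := Gal_inverse Gg.
have := Lx (g' \o (h \o g) : End) (Gal_comp Gg' (Gal_comp Gh Gg)).
rewrite /= => E; rewrite -[LHS]g'K E // => y ys.
by rewrite hs ?gK //; exact: ss.
Qed.

Lemma level_eq (g g' : End) : Gal g -> Gal g' -> {in s, g =1 g'} ->
  forall x, L x -> g x = g' x.
Proof.
move=> Gg Gg' E x Lx; have [h Gh [hK Kh]] := Gal_inverse Gg'.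
have := Lx (h \o g : End) (Gal_comp Gh Gg).
rewrite /= => H; rewrite -[LHS]Kh H // => y ys.
by rewrite E.
Qed.

Lemma exists_level : exists (X : finGroupType) (G : {group X}) (act : X -> End),
  galois_level s G act.
Proof.
pose T := seq_sub s.
(* Permutations multiply in the order opposite to the composition of maps, so [g] corresponds to the
   permutation induced by its inverse. *)
pose ind (a : {perm T}) (g : End) := Gal g /\ forall x : T, g (ssval (a x)) = ssval x.
have ind1 : ind 1%g idfun by split=> // x; rewrite perm1.
have indM a b g h : ind a g -> ind b h -> ind (a * b)%g (g \o h : End).
  by move=> [Gg ga] [Gh hb]; split; [exact: Gal_comp|move=> x /=; rewrite permM hb ga].
have ind_ex g : Gal g -> exists a, ind a g.
  move=> Gg; have [g' Gg' [gK g'K]] := Gal_inverse Gg.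
  have g's (x : T) : g' (ssval x) \in s by apply: ss => //; exact: ssvalP.
  have inj : injective (fun x : T => SeqSub (g's x)).
    by move=> x y [] /(can_inj g'K) E; exact: val_inj.
  by exists (perm inj); split=> // x; rewrite permE /= g'K.
have ind_inj a b g h : ind a g -> ind b h -> {in s, g =1 h} -> a = b.
  move=> [Gg ga] [Gh hb] E; apply/permP => x; apply: val_inj => /=.
  by apply: (fmorph_inj g); rewrite ga E ?hb //; exact: ssvalP.
pose G0 := [set a : {perm T} | `[< exists g, ind a g >]].
have gG0 : group_set G0.
  apply/group_setP; split; first by rewrite inE; apply/asboolP; exists idfun.
  move=> a b /[!inE] /asboolP[g ag] /asboolP[h bh]; apply/asboolP.
  by exists (g \o h : End); exact: indM.
pose act a : End := if pselect (exists g, ind a g) is left e then projT1 (cid e) else idfun.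
have actP a : a \in G0 -> ind a (act a).
  rewrite inE => /asboolP h; rewrite /act; case: pselect => // e.
  exact: (projT2 (cid e)).
have same a g h : ind a g -> ind a h -> {in s, g =1 h}.
  move=> [Gg ga] [Gh ha] y ys; pose x := SeqSub ys : T.
  by have := ga ((a^-1)%g x); rewrite permKV => ->; have := ha ((a^-1)%g x); rewrite permKV => ->.
exists {perm T}, (Group gG0), act; split=> /=.
- by move=> a /actP[].
- move=> g Gg; have [a ag] := ind_ex g Gg; exists a.
    by rewrite inE; apply/asboolP; exists g.
  have aG : a \in G0 by rewrite inE; apply/asboolP; exists g.
  move=> x Lx; apply: level_eq => //; first by have [] := actP _ aG.
  exact: same (actP _ aG) ag.
- move=> a b x aG bG Lx; have abG : (a * b)%g \in G0 by move/group_setP: gG0 => [_]; exact.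
  have [Ga _] := actP _ aG; have [Gb _] := actP _ bG; have [Gab _] := actP _ abG.
  apply: (@level_eq _ (act a \o act b : End)) => //; first exact: Gal_comp.
  exact: same (actP _ abG) (indM _ _ _ _ (actP _ aG) (actP _ bG)).
- move=> a aG h; apply: (ind_inj _ _ _ _ (actP _ aG) ind1) => y ys /=.
  by apply: h; exact: level_mem.
Qed.

End Level.

End GaloisGroups.

(** * Weak approximation *)

Section WeakApproximation.

Variables (Om : fieldType) (v : Om -> rat) (kk L : Om -> Prop) (u : Om).
Hypotheses (CF : coeff_field v kk) (Lf : subfld L).
Hypotheses (Lkk : forall c, kk c -> L c) (Lu : L u) (u0 : u != 0) (vu : v u = 1).
Let vV := cf_val CF.

Variables (I : eqType) (w : I -> Om -> rat).
Hypotheses (wV : forall i, valuation (w i)) (wu : forall i, w i u = 1).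
Hypothesis (wk : forall i c, kk c -> c != 0 -> w i c = 0).

Lemma val_1D_neg (v' : Om -> rat) y : valuation v' -> y != 0 -> v' y < 0 ->
  1 + y != 0 /\ v' (1 + y) = v' y.
Proof. by move=> vV' y0 hy; rewrite addrC; apply: vl_dom => // _; rewrite (vl1 vV'). Qed.

Lemma val_1D_pos (v' : Om -> rat) y : valuation v' -> vgt v' 0 y ->
  1 + y != 0 /\ v' (1 + y) = 0.
Proof.
move=> vV' hy; have := @vl_dom _ _ vV' 1 y (oner_neq0 _).
by rewrite (vl1 vV'); apply.
Qed.

Lemma archi_seq (r : seq I) (a b : I -> rat) : (forall i, i \in r -> 0 < a i) ->
  exists N : nat, forall n i, (N <= n)%N -> i \in r -> 0 < n%:R * a i + b i.
Proof.
elim: r => [|i r IH] ha; first by exists 0%N.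
have [|N hN] := IH; first by move=> j jr; apply: ha; rewrite inE jr orbT.
have ai : 0 < a i by apply: ha; rewrite mem_head.
pose M := Num.bound `|b i / a i|.
have hM : `|b i / a i| < M%:R by apply: archi_boundP; exact: normr_ge0.
exists (maxn N M) => n j; rewrite geq_max inE => /andP[Nn Mn] /predU1P[->|/hN]; last exact.
have : - (b i / a i) < n%:R.
  apply: le_lt_trans (lt_le_trans hM _); last by rewrite ler_nat.
  by rewrite -normrN ler_norm.
rewrite -subr_gt0 opprK => h; rewrite (_ : _ + _ = (n%:R + b i / a i) * a i).
  exact: mulr_gt0.
by rewrite mulrDl divfK // gt_eqF.
Qed.

(** A monomial in [x] and [u] gives a [v]-unit [z] with nonzero, hence positive up to inversion,
    value at [w i]. If [c] is the residue of [z] at [v], then [z / (z - c)] has a pole at [v] and a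
    zero at [w i]. *)
Lemma separate_one i : (exists x, [/\ L x, x != 0 & w i x != v x]) ->
  exists A, [/\ L A, A != 0, v A < 0 & 0 < w i A].
Proof.
case=> x [Lx x0 ne]; have wVi := wV i.
have vk c : kk c -> c != 0 -> v c = 0 by exact: (cf_unit CF).
have [z [Lz z0 vz wz]] : exists z, [/\ L z, z != 0, v z = 0 & 0 < w i z].
  pose n := `|denq (v x)|%N; pose a := numq (v x).
  have n0 : n%:R != 0 :> rat by rewrite pnatr_eq0 absz_eq0 denq_neq0.
  have vx : v x = a%:~R / n%:R.
    by rewrite -[LHS]divq_num_den /n pmulrn gez0_abs // ltW.
  pose z0 := x ^+ n * u ^ (- a).
  have z00 : z0 != 0 by rewrite mulf_neq0 ?expf_neq0 ?expfz_neq0.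
  have vz0 : v z0 = 0.
    rewrite (vlM vV) ?expf_neq0 ?expfz_neq0 // (vlX vV) // (vlXz vV) // vu vx.
    by rewrite mulrCA divff // !mulr1 rmorphN /= subrr.
  have wz0 : w i z0 = n%:R * (w i x - v x).
    rewrite (vlM wVi) ?expf_neq0 ?expfz_neq0 // (vlX wVi) // (vlXz wVi) // wu vx.
    by rewrite mulrBr mulrCA divff // !mulr1 rmorphN.
  have Lz0 : L z0 by apply: (subfldM Lf); [exact: (subfldX Lf)|exact: (subfldXz Lf)].
  have : w i z0 != 0 by rewrite wz0 mulf_neq0 // subr_eq0.
  rewrite neq_lt => /orP[lt|gt]; last by exists z0.
  exists z0^-1; split; first exact: (subfldV Lf).
  - by rewrite invr_eq0.
  - by rewrite (vl_inv vV) // vz0 oppr0.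
  - by rewrite (vl_inv wVi) // oppr_gt0.
have [c kc hc] := cf_res CF (vge_unit z0 vz).
have c0 : c != 0.
  by apply/eqP => c0; move: hc; rewrite c0 subr0 => /(_ z0); rewrite vz ltxx.
have [zc0 wzc] : z - c != 0 /\ w i (z - c) = 0.
  have := @vl_dom _ _ wVi (- c) z; rewrite oppr_eq0 (vlN wVi) wk // addrC.
  by apply.
exists (z / (z - c)); split.
- by apply: (subfldM Lf) => //; apply/(subfldV Lf)/(subfldB Lf) => //; exact: Lkk.
- by rewrite mulf_neq0 ?invr_eq0.
- by rewrite (vl_div vV) // vz sub0r oppr_lt0; apply: hc.
- by rewrite (vl_div wVi) // wzc subr0.
Qed.

Lemma separate_all (r : seq I) :
  (forall i, i \in r -> exists x, [/\ L x, x != 0 & w i x != v x]) ->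
  exists A, [/\ L A, A != 0, v A < 0 & forall i, i \in r -> 0 < w i A].
Proof.
elim: r => [|n r IH] hr.
  exists u^-1; split=> //; rewrite ?invr_eq0 ?(vl_inv vV) ?vu //.
  exact: (subfldV Lf).
have [|A [LA A0 vA wA]] := IH; first by move=> i ir; apply: hr; rewrite inE ir orbT.
have [B [LB B0 vB wB]] := separate_one (hr n (mem_head _ _)).
have [N0 hN0] := @archi_seq r (fun i => w i A) (fun i => w i B) wA.
pose N := maxn N0 1; have N_gt0 : (0 < N)%N by rewrite leq_max orbT.
have hN i : i \in r -> 0 < N%:R * w i A + w i B by apply: hN0; exact: leq_maxl.
have AN0 : A ^+ N != 0 by rewrite expf_neq0.
have LAN : L (A ^+ N) by exact: (subfldX Lf).
have Nq : 0 < N%:R :> rat by rewrite ltr0n.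
have [wnA|wnA] := lerP 0 (w n A).
  exists (A ^+ N * B); split; first exact: (subfldM Lf).
  - by rewrite mulf_neq0.
  - by rewrite (vlM vV) // (vlX vV) // addrC ltr_wnDr // mulr_ge0_le0 ?ltW.
  move=> i /predU1P[->|ir]; rewrite (vlM (wV _)) // (vlX (wV _)) //; last exact: hN.
  by apply: ltr_wpDl => //; apply: mulr_ge0 => //; exact: ltW.
have [vn0 vN] : 1 + A ^+ N != 0 /\ v (1 + A ^+ N) = v (A ^+ N).
  by apply: val_1D_neg => //; rewrite (vlX vV) // pmulr_rlt0.
exists (B * (A ^+ N / (1 + A ^+ N))); split.
- apply: (subfldM Lf) => //; apply: (subfldM Lf) => //; apply: (subfldV Lf).
  by apply: (subfldD Lf) => //; exact: (subfld1 Lf).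
- by rewrite !mulf_neq0 // invr_eq0.
- by rewrite (vlM vV) ?mulf_neq0 ?invr_eq0 // (vl_div vV) // vN subrr addr0.
move=> i /predU1P[->|ir]; rewrite (vlM (wV _)) ?mulf_neq0 ?invr_eq0 // (vl_div (wV _)) //.
  have [_ ->] : 1 + A ^+ N != 0 /\ w n (1 + A ^+ N) = w n (A ^+ N).
    by apply: val_1D_neg => //; rewrite (vlX (wV _)) // pmulr_rlt0.
  by rewrite subrr addr0.
have [_ ->] : 1 + A ^+ N != 0 /\ w i (1 + A ^+ N) = 0.
  apply: val_1D_pos => // _; rewrite (vlX (wV _)) //; apply: mulr_gt0 => //; exact: wA.
by rewrite subr0 (vlX (wV _)) // addrC; exact: hN.
Qed.

(** For large [N] the quotient [(1 + x A^N) / (1 + A^N)] is like [x] where [A] has a pole and like 1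
    where [A] has a zero. *)
Lemma weak_approximation (r : seq I) x :
  (forall i, i \in r -> exists x, [/\ L x, x != 0 & w i x != v x]) ->
  L x -> x != 0 ->
  exists y, [/\ L y, y != 0, v y = v x & forall i, i \in r -> w i y = 0].
Proof.
move=> hr Lx x0; have [A [LA A0 vA wA]] := separate_all hr.
have [N1 h1] := @archi_seq r (fun i => w i A) (fun i => w i x) wA.
pose M := Num.bound `|v x / v A|.
have hM : `|v x / v A| < M%:R by apply: archi_boundP; exact: normr_ge0.
pose N := maxn (maxn N1 M) 1.
have N_gt0 : (0 < N)%N by rewrite leq_max orbT.
have Nq : 0 < N%:R :> rat by rewrite ltr0n.
have AN0 : A ^+ N != 0 by rewrite expf_neq0.
have LAN : L (A ^+ N) by exact: (subfldX Lf).
have xAN0 : x * A ^+ N != 0 by rewrite mulf_neq0.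
have v1 : v (x * A ^+ N) < 0.
  rewrite (vlM vV) // (vlX vV) //.
  have : - (v x / v A) < N%:R.
    apply: le_lt_trans (lt_le_trans hM _); first by rewrite -normrN ler_norm.
    by rewrite ler_nat /N !leq_max leqnn orbT.
  rewrite -subr_gt0 opprK -(nmulr_llt0 _ vA) mulrDl divfK ?lt_eqF // addrC.
  exact.
have [n0 vn] := val_1D_neg vV xAN0 v1.
have [d0 vd] : 1 + A ^+ N != 0 /\ v (1 + A ^+ N) = v (A ^+ N).
  by apply: val_1D_neg => //; rewrite (vlX vV) // pmulr_rlt0.
exists ((1 + x * A ^+ N) / (1 + A ^+ N)); split.
- apply: (subfldM Lf); first by apply: (subfldD Lf); [exact: (subfld1 Lf)|exact: (subfldM Lf)].
  by apply/(subfldV Lf)/(subfldD Lf) => //; exact: (subfld1 Lf).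
- by rewrite mulf_neq0 ?invr_eq0.
- by rewrite (vl_div vV) // vn vd (vlM vV) // addrK.
move=> i ir; rewrite (vl_div (wV _)) //.
have [_ ->] : 1 + A ^+ N != 0 /\ w i (1 + A ^+ N) = 0.
  apply: val_1D_pos => // _; rewrite (vlX (wV _)) //; apply: mulr_gt0 => //; exact: wA.
have [_ ->] : 1 + x * A ^+ N != 0 /\ w i (1 + x * A ^+ N) = 0.
  apply: val_1D_pos => // _; rewrite (vlM (wV _)) // (vlX (wV _)) // addrC.
  by apply: h1 => //; rewrite /N !leq_max leqnn.
by rewrite subrr.
Qed.

End WeakApproximation.

(** * Decomposition groups at infinity *)

Section Decomposition.

Variables (p : nat) (Om : fieldType) (t : Om).
Hypothesis HOm : sepclosure_Fpbar_t p t.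
Let Hp := sepclosure_char HOm.
Local Notation kk := (in_Fpbar p (Om := Om)).
Local Notation Gal := (Gal_geom p t).
Local Notation End := {rmorphism Om -> Om}.
Local Notation Lv := (fixed_by_stab p t).
Variable v : Om -> rat.
Hypothesis Pv : place_at_infty t v.
Let vV : valuation v := Pv.1.
Let CF : coeff_field v kk := coeff_field_infty HOm Pv.
Let t0 : t != 0 := t_neq0 HOm.
Let u := t^-1.
Let u0 : u != 0. Proof. by rewrite invr_eq0. Qed.
Let vu : v u = 1 := v_tinv HOm Pv.

Definition preserves (s : seq Om) (g : End) := forall x, Lv s x -> v (g x) = v x.

Lemma kt_u : kt p t u.
Proof. exact: (subfldV (kt_subfld HOm) (kt_t HOm)). Qed.

(** Residues are represented by constants, which are fixed, so decomposition and inertia groups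
    coincide. *)
Lemma preserves_inertia (g : End) : Gal g -> (forall s, preserves s g) -> Defs.inertia p t v g.
Proof.
move=> Gg pg; split=> // x hx; have [c kc hc] := cf_res CF hx.
have [s [_ xs ss]] := stable_hull HOm [:: x].
have Lxc : Lv s (x - c).
  apply: (subfldB (level_subfld p t s)); first by apply: level_mem; exact/xs/mem_head.
  by apply: level_kt; apply: (kt_kk HOm).
have -> : g x - x = g (x - c) - (x - c).
  by rewrite rmorphB (Gg.2 c) // opprB addrA subrK.
by apply: (vgtB vV _ hc); rewrite /vgt (pg s _ Lxc) fmorph_eq0.
Qed.

Lemma val_comp (g : End) : valuation (v \o g).
Proof.
split=> [x y x0 y0|r x y hx hy xy0] /=.
  by rewrite rmorphM (vlM vV) // fmorph_eq0.
have h z : vge (v \o g) r z -> vge v r (g z) by rewrite /vge fmorph_eq0.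
by rewrite rmorphD; apply: (vgeD vV (h _ hx) (h _ hy)); rewrite -rmorphD fmorph_eq0.
Qed.

(** A power of [x] times a power of [u] is a unit; inertia sends it to a unit and fixes [u]. *)
Lemma inertia_preserves (g : End) x : Defs.inertia p t v g -> v (g x) = v x.
Proof.
case=> Gg ig; have [->|x0] := eqVneq x 0; first by rewrite rmorph0.
pose n := `|denq (v x)|%N; pose a := numq (v x).
have n0 : n%:R != 0 :> rat by rewrite pnatr_eq0 absz_eq0 denq_neq0.
have vx : v x = a%:~R / n%:R by rewrite -[LHS]divq_num_den /n pmulrn gez0_abs // ltW.
pose z := x ^+ n * u ^ (- a).
have z0 : z != 0 by rewrite mulf_neq0 ?expf_neq0 ?expfz_neq0.
have vz0 : v z = 0.
  rewrite (vlM vV) ?expf_neq0 ?expfz_neq0 // (vlX vV) // (vlXz vV) // vu vx.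
  by rewrite mulrCA divff // !mulr1 rmorphN /= subrr.
have : v (g z) = 0.
  have := @vl_dom _ _ vV z (g z - z) z0; rewrite (addrC z) subrK vz0 => h.
  by have [] := h (ig _ (vge_unit z0 vz0)).
have wV := val_comp g.
rewrite -[v (g z)]/((v \o g) z) (vlM wV) ?expf_neq0 ?expfz_neq0 // (vlX wV) // (vlXz wV) //=.
rewrite (Gal_kt Gg kt_u) vu mulr1 rmorphN /= => /eqP; rewrite subr_eq0 => /eqP E.
by apply: (mulfI n0); rewrite E vx mulrCA divff // mulr1.
Qed.

Section Level.

Variables (s : seq Om) (X : finGroupType) (G : {group X}) (act : X -> End).
Hypotheses (ss : gal_stable p t s) (GL : galois_level p t s G act).
Local Notation L := (Lv s).
Let Lf : subfld L := level_subfld p t s.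

Definition decomp := [set g in G | `[< preserves s (act g) >]].

Lemma group_set_decomp : group_set decomp.
Proof.
apply/group_setP; split.
  rewrite inE group1; apply/asboolP => x Lx; congr v.
  apply: (fmorph_inj (act 1%g)); rewrite -(gl_M GL) ?group1 ?mulg1 //.
move=> g h /[!inE] /andP[Gg /asboolP pg] /andP[Gh /asboolP ph].
rewrite groupM //; apply/asboolP => x Lx; rewrite (gl_M GL) // pg ?ph //.
by apply: (level_stable HOm ss) => //; exact: (gl_act GL).
Qed.

Canonical decomp_group := Group group_set_decomp.

Lemma level_fixed x : L x -> (forall g, g \in G -> act g x = x) -> kt p t x.
Proof.
move=> Lx fx; apply: (fixed_kt HOm) => g Gg.
by have [h Gh E] := gl_sur GL Gg; rewrite -E // fx.
Qed.

(** Choose [y] with the value of [x] at [v] and value 0 at the other conjugate places. Its norm lies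
    in kbar(t), so has an integral value, and only the decomposition group contributes to it. *)
Lemma decomp_integral x : L x -> x != 0 -> exists z : int, #|decomp|%:R * v x = z%:~R.
Proof.
move=> Lx x0.
have Lkk c : kk c -> L c by move=> kc; apply: level_kt; apply: (kt_kk HOm).
have Lu : L u by apply: level_kt; exact: kt_u.
have wu g : Gal g -> (v \o g) u = 1.
  by move=> Gg; rewrite /= (Gal_kt Gg kt_u).
have wk (g : End) c : Gal g -> kk c -> c != 0 -> (v \o g) c = 0.
  by move=> Gg kc c0; rewrite /= (Gg.2 c) // (cf_unit CF).
(* Outside G, [act] may take any value. *)
pose w g := if g \in G then v \o act g else v.
have wV g : valuation (w g) by rewrite /w; case: ifP => // _; exact: val_comp.
have [|||y [Ly y0 vy yr]] := weak_approximation CF Lf Lkk Lu u0 vu wV _ _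
    (r := enum (G :\: decomp)) _ Lx x0.
- by move=> g; rewrite /w; case: ifP => // Gg; apply: wu; exact: (gl_act GL).
- by move=> g c kc c0; rewrite /w; case: ifP => Gg; [apply: wk => //; exact: (gl_act GL)|exact: (cf_unit CF)].
- move=> g; rewrite mem_enum !inE => /andP[nd Gg]; rewrite Gg /= in nd.
  apply: contrapT => no; move/asboolP: nd; apply => z Lz.
  have [->|z0] := eqVneq z 0; first by rewrite rmorph0.
  by apply/eqP; apply: contrapT => /negP ne; apply: no; exists z; split=> //; rewrite /w Gg.
pose N := \prod_(g in G) act g y.
have Lg g : g \in G -> L (act g y).
  by move=> Gg; apply: (level_stable HOm ss) => //; exact: (gl_act GL).
have N0 : N != 0 by apply/prodf_neq0 => g _; rewrite fmorph_eq0.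
have kN : kt p t N.
  apply: level_fixed; first exact: (subfld_prod Lf).
  move=> h Gh; rewrite rmorph_prod [RHS](reindex_inj (mulgI h)) /=.
  apply: eq_big => g; first by rewrite groupMl.
  by move=> Gg; rewrite (gl_M GL).
have [z Ez] := kt_int HOm Pv kN N0; exists z; rewrite -Ez (vlY vV) => [|g _]; last by rewrite fmorph_eq0.
rewrite (bigID (mem decomp)) /= [X in _ + X]big1 ?addr0 => [|g /andP[Gg ng]].
  rewrite (eq_bigr (fun=> v x)) => [|g /andP[Gg]]; last first.
    by rewrite inE Gg /= => /asboolP ->.
  rewrite sumr_const mulr_natl; congr (_ *+ _); apply: eq_card => g.
  by rewrite [RHS]unfold_in /= !inE andbA andbb.
have := yr g; rewrite mem_enum in_setD ng Gg => /(_ isT).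
by rewrite /w Gg.
Qed.

(** The values are the multiples of [n / e], with [e] the order of the decomposition group. The
    fixed element [u] has value 1, which is [w] times the generator, so [e = w n]; [fixed_val_ge]
    gives [e <= w], hence [n = 1]. *)
Lemma exists_tot : exists2 pi, tot v kk decomp_group act L pi & #|decomp|%:R * v pi = 1.
Proof.
pose e := #|decomp|; have e_gt0 : (0 < e)%N by exact: (cardG_gt0 decomp_group).
have eq0 : e%:R != 0 :> rat by rewrite pnatr_eq0 -lt0n.
have Lkk c : kk c -> L c by move=> kc; apply: level_kt; apply: (kt_kk HOm).
have Lu : L u by apply: level_kt; exact: kt_u.
pose Q n := `[< (0 < n)%N /\ exists x, [/\ L x, x != 0 & e%:R * v x = n%:R] >].
have exQ : exists n, Q n.
  by exists e; apply/asboolP; split=> //; exists u; rewrite vu mulr1.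
case: (ex_minnP exQ) => n /asboolP[n_gt0 [pi [Lpi pi0 vpi]]] minn.
have nz : n%:Z != 0 by case: (n) n_gt0.
have dG g : g \in decomp -> g \in G by rewrite inE => /andP[].
have unif x : L x -> x != 0 -> exists z : int, v x = z%:~R * v pi.
  move=> Lx x0; have [z Ez] := decomp_integral Lx x0.
  exists (z %/ n)%Z; apply: (mulfI eq0); rewrite mulrCA vpi Ez.
  have Edz := divz_eq z n; pose r := `|(z %% n)%Z|%N.
  have rE : (z %% n)%Z = r%:Z by rewrite gez0_abs // modz_ge0.
  have r_lt : (r < n)%N by rewrite -ltz_nat -rE ltz_mod.
  case: (posnP r) => r0; last first.
    have : Q r.
      apply/asboolP; split=> //; exists (x * pi ^ (- (z %/ n)%Z)); split.
      - by apply: (subfldM Lf) => //; exact: (subfldXz Lf).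
      - by rewrite mulf_neq0 ?expfz_neq0.
      rewrite (vlM vV) ?expfz_neq0 // (vlXz vV) // mulrDr Ez mulrCA vpi.
      by rewrite {1}Edz rE rmorphD rmorphM rmorphN /= mulNr addrAC subrr add0r.
    by move/minn; rewrite leqNgt r_lt.
  by rewrite {1}Edz rE r0 addr0 rmorphM.
have T : tot v kk decomp_group act L pi.
  split=> //.
  - by move=> g x /dG Gg Lx; apply: (level_stable HOm ss) => //; exact: (gl_act GL).
  - by move=> g h x /dG Gg /dG Gh; exact: (gl_M GL).
  - by move=> g x; rewrite inE => /andP[_ /asboolP]; exact.
  - by move=> g c /dG /(gl_act GL)[_ gc]; exact: gc.
  - have : 0 < e%:R * v pi by rewrite vpi ltr0n.
    by rewrite pmulr_rgt0 // ltr0n.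
  - by move=> g /dG; exact: (gl_faith GL).
exists pi => //; rewrite vpi; apply/eqP; rewrite (eqr_nat _ n 1) eqn_leq n_gt0 andbT.
have [w Ew] : exists w : nat, v u = w%:R * v pi by apply: (tot_nat T Lu _ u0) => _; rewrite vu.
have w0 : (0 < w)%N by rewrite lt0n; apply: contra_eq_neq Ew => ->; rewrite mul0r vu oner_neq0.
have le : (e <= w)%N.
  apply: (fixed_val_ge CF T Lu u0 w0 _ Ew) => g /dG /(gl_act GL) Gg.
  exact: (Gal_kt Gg kt_u).
have : (e * 1 = w * n)%N.
  apply/eqP; rewrite -(eqr_nat rat) !natrM -vpi mulrCA -Ew vu !mulr1 //.
rewrite muln1 => E; rewrite -(leq_pmul2l w0) -E muln1 //.
Qed.

End Level.
End Decomposition.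

(** * Lifting from finite levels to inertia *)

Section InertiaLift.

Variables (p : nat) (Om : fieldType) (t : Om).
Hypothesis HOm : sepclosure_Fpbar_t p t.
Local Notation kk := (in_Fpbar p (Om := Om)).
Local Notation Gal := (Gal_geom p t).
Local Notation End := {rmorphism Om -> Om}.
Local Notation Lv := (fixed_by_stab p t).
Variable v : Om -> rat.
Hypothesis Pv : place_at_infty t v.
Let vV : valuation v := Pv.1.
Let CF : coeff_field v kk := coeff_field_infty HOm Pv.
Let t0 : t != 0 := t_neq0 HOm.
Let u := t^-1.
Let u0 : u != 0. Proof. by rewrite invr_eq0. Qed.
Let vu : v u = 1 := v_tinv HOm Pv.
Let ku : kt p t u := kt_u HOm.

Lemma level_sub s s' x : {subset s <= s'} -> Lv s x -> Lv s' x.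
Proof. by move=> sub Lx g Gg hg; apply: Lx => // y /sub; exact: hg. Qed.

Lemma preserves_sub s s' g : {subset s <= s'} -> preserves p t v s' g -> preserves p t v s g.
Proof. by move=> sub pg x Lx; apply: pg; exact: level_sub Lx. Qed.

Lemma preserves_eq s (g g' : End) : Gal g -> Gal g' -> {in s, g =1 g'} ->
  preserves p t v s g -> preserves p t v s g'.
Proof. by move=> Gg Gg' E pg x Lx; rewrite -(level_eq HOm Gg Gg' E Lx) pg. Qed.

(* The places of a level above a given place of a smaller one are conjugate. *)
Lemma preserves_extend s s' (g : End) : gal_stable p t s -> gal_stable p t s' ->
  {subset s <= s'} -> Gal g -> preserves p t v s g ->
  exists g' : End, [/\ Gal g', {in s, g' =1 g} & preserves p t v s' g'].
Proof.
move=> ss ss' sub Gg pg; apply: contrapT => no.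
have [X [G [act GL]]] := exists_level HOm ss'.
have Lf := level_subfld p t s'.
pose N0 := [set a in G | all (fun x => act a x == x) s].
have N0P a : a \in N0 -> a \in G /\ {in s, forall x, act a x = x}.
  by rewrite inE => /andP[Ga /allP h]; split=> // x /h/eqP.
have PN0 a : a \in G -> {in s, forall x, act a x = x} -> a \in N0.
  by move=> Ga h; rewrite inE Ga; apply/allP => x /h->.
have Lmem x : x \in s -> Lv s' x by move=> xs; apply: level_mem; exact: sub.
have act1 x : Lv s' x -> act 1%g x = x.
  by move=> Lx; apply: (fmorph_inj (act 1%g)); rewrite -(gl_M GL) ?group1 ?mulg1.
have gN : group_set N0.
  apply/group_setP; split; first by apply: PN0 => // x xs; apply: act1; exact: Lmem.
  move=> a b /N0P[Ga ha] /N0P[Gb hb]; apply: PN0; first exact: groupM.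
  by move=> x xs; rewrite (gl_M GL) ?hb ?ha //; exact: Lmem.
pose N := Group gN.
have NG a : a \in N -> a \in G by move=> /N0P[].
have GactN a : a \in N -> Gal (act a) by move=> /NG; exact: (gl_act GL).
have GactgN a : a \in N -> Gal (g \o act a : End).
  by move=> Na; apply: Gal_comp => //; exact: GactN.
pose w (i : X * bool) := if i.1 \in N then
  (if i.2 then v \o (g \o act i.1 : End) else v \o act i.1) else v.
have wV i : valuation (w i).
  by rewrite /w; case: ifP => // _; case: ifP => _; exact: (val_comp Pv).
have fixu (h : End) : Gal h -> h u = u by move=> Gh; exact: (Gal_kt Gh ku).
have wu i : w i u = 1.
  rewrite /w; case: ifP => // Ni; case: ifP => _ /=.
    by rewrite (fixu _ (GactN _ Ni)) fixu.
  by rewrite (fixu _ (GactN _ Ni)).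
have wk i c : kk c -> c != 0 -> w i c = 0.
  move=> kc c0; have vc := cf_unit CF kc c0.
  rewrite /w; case: ifP => // Ni; case: ifP => _ /=.
    by rewrite ((GactN _ Ni).2 c kc) (Gg.2 c kc).
  by rewrite ((GactN _ Ni).2 c kc).
have Lkk c : kk c -> Lv s' c by move=> kc; apply: level_kt; apply: (kt_kk HOm).
have Lu : Lv s' u by apply: level_kt.
(* No [g \o act a] preserves [v], so some [y] has value 1 at [v], 0 at all [v \o g \o act a], and a
   nonnegative value at all [v \o act a]. Its norm [M] over [N] lies in the level of [s]; it has
   positive value while [g M] has value 0, against [pg]. *)
pose r := [seq (a, true) | a <- enum N] ++
  [seq (a, false) | a <- enum N & ~~ `[< preserves p t v s' (act a) >]].
have npres (h : End) : ~ preserves p t v s' h ->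
    exists x, [/\ Lv s' x, x != 0 & v (h x) != v x].
  move=> np; apply: contrapT => nx; apply: np => x Lx.
  have [->|x0] := eqVneq x 0; first by rewrite rmorph0.
  by apply/eqP; apply: contrapT => /negP ne; apply: nx; exists x.
have [i|y [Ly y0 vy yr]] := weak_approximation CF Lf Lkk Lu u0 vu wV wu wk (r := r) _ Lu u0.
  rewrite mem_cat => /orP[] /mapP[a].
    rewrite mem_enum => Na ->; rewrite /w /= Na; apply: (npres (g \o act a : End)) => pa.
    apply: no; exists (g \o act a : End); split=> //; first exact: GactgN.
    by have [_ ha] := N0P _ Na; move=> x xs /=; rewrite ha.
  rewrite mem_filter mem_enum => /andP[/asboolP na Na] ->.
  by rewrite /w /= Na; exact: npres.
pose M := \prod_(a in N) act a y.
have Lact a : a \in N -> Lv s' (act a y).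
  by move=> /GactN Ga; exact: (level_stable HOm ss').
have LM : Lv s M.
  move=> h Gh hs; have [b Gb Eb] := gl_sur GL Gh.
  have Nb : b \in N by apply: PN0 => // x xs; rewrite Eb ?hs //; exact: Lmem.
  rewrite -Eb; last exact: (subfld_prod Lf).
  rewrite rmorph_prod [RHS](reindex_inj (mulgI b)).
  apply: eq_big => a; first exact: esym (groupMl a Nb).
  by move=> Na; rewrite -(gl_M GL) //; exact: NG.
have := pg _ LM; rewrite /M rmorph_prod !(vlY vV) => [|a _|a _]; rewrite ?fmorph_eq0 //.
rewrite big1 => [|a Na]; last first.
  have := yr (a, true); rewrite /w /= Na; apply; rewrite mem_cat map_f ?mem_enum //.
rewrite (bigD1 1%g) /=; last exact: (group1 N).
have v1 := etrans (congr1 v (act1 y Ly)) (etrans vy vu).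
have ge0 : 0 <= \sum_(a in N | a != 1%g) v (act a y).
  apply: sumr_ge0 => a /andP[Na _].
  have [pa|npa] := pselect (preserves p t v s' (act a)); first by rewrite pa // vy vu.
  have : w (a, false) y = 0.
    apply: yr; rewrite mem_cat orbC map_f // mem_filter mem_enum Na andbT.
    exact/asboolP.
  by rewrite /w /= Na /= => ->.
by move=> /esym/eqP; rewrite paddr_eq0 ?(eq_ind_r (>= 0) ler01 v1) // => /andP[/eqP E _]; have := oner_neq0 rat; rewrite -v1 E eqxx.
Qed.

(** The extra condition [C] lets one compactness argument serve both inertia ([inertia_surj]) and
    upper ramification groups ([upper_lift]). *)
Lemma inertia_lift s (g : End) (C : seq Om -> End -> Prop) :
  gal_stable p t s -> Gal g ->
  (forall s' (h h' : End), gal_stable p t s' -> Gal h -> Gal h' -> {in s', h =1 h'} ->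
     C s' h -> C s' h') ->
  (forall S, gal_stable p t S -> {subset s <= S} ->
     exists h : End, [/\ Gal h, {in s, h =1 g}, preserves p t v S h &
       forall s', gal_stable p t s' -> {subset s' <= S} -> C s' h]) ->
  exists h : End, [/\ Defs.inertia p t v h, {in s, h =1 g} &
    forall s', gal_stable p t s' -> C s' h].
Proof.
move=> ss Gg Cext Cex.
have [|||h Gh Qh] := @Gal_compact p Om t HOm (fun S h =>
   [/\ forall y, y \in s -> y \in S -> h y = g y, preserves p t v S h &
     forall s', gal_stable p t s' -> {subset s' <= S} -> C s' h]).
- move=> S h h' Gh Gh' E [h1 h2 h3]; split.
  + by move=> y ys yS; rewrite -E ?h1.
  + exact: preserves_eq h2.
  + move=> s' ss' sub; apply: (Cext s' h h') => //; last exact: h3.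
    by move=> y /sub; exact: E.
- move=> S S' h Gh sub [h1 h2 h3]; split.
  + by move=> y ys /sub; exact: h1.
  + exact: preserves_sub h2.
  + by move=> s' ss' sub'; apply: h3 => // y /sub'/sub.
- move=> S; have [S' [_ sub sS']] := stable_hull HOm (s ++ S).
  have [|h [Gh h1 h2 h3]] := Cex S' sS'; first by move=> y ys; apply: sub; rewrite mem_cat ys.
  have subS : {subset S <= S'} by move=> y yS; apply: sub; rewrite mem_cat yS orbT.
  exists h => //; split.
  + by move=> y ys _; exact: h1.
  + exact: preserves_sub h2.
  + by move=> s' ss' sub'; apply: h3 => // y /sub'/subS.
exists h; split.
- by apply: (preserves_inertia HOm Pv) => // S; have [] := Qh S.
- by move=> y ys; have [h1 _ _] := Qh s; exact: h1.
- by move=> s' ss'; have [_ _ h3] := Qh s'; exact: h3.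
Qed.

Lemma inertia_surj s (g : End) : gal_stable p t s -> Gal g -> preserves p t v s g ->
  exists2 h : End, Defs.inertia p t v h & {in s, h =1 g}.
Proof.
move=> ss Gg pg.
have [//|S sS sub|h [h1 h2 _]] := @inertia_lift s g (fun _ _ => True) ss Gg.
  by have [h [Gh h1 h2]] := preserves_extend ss sS sub Gg pg; exists h.
by exists h.
Qed.

End InertiaLift.

(** * Upper numbering: change of uniformiser and of level *)

Section Uniformisers.

Variables (Om : fieldType) (v : Om -> rat) (kk : Om -> Prop).
Hypothesis CF : coeff_field v kk.
Let vV := cf_val CF.
Variables (X : finGroupType) (G : {group X}) (act : X -> {rmorphism Om -> Om}).
Variables (L : Om -> Prop) (pi : Om).
Hypothesis T : tot v kk G act L pi.

Lemma tot_change x : L x -> x != 0 -> v x = v pi -> tot v kk G act L x.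
Proof.
move=> Lx x0 vx; split=> //; [exact: (tot_L T)|exact: (tot_kk T)|exact: (tot_stab T)|
  exact: (tot_M T)|exact: (tot_v T)|exact: (tot_c T)|by rewrite vx; exact: (tot_vpi T)|
  by move=> y; rewrite vx; exact: (tot_unif T)|exact: (tot_faith T)].
Qed.

Lemma act_moves g : g \in G -> g != 1%g -> act g pi - pi != 0.
Proof.
move=> Gg; apply: contra_neq => /eqP; rewrite subr_eq0 => /eqP.
exact: (tot_pi_faith CF T).
Qed.

End Uniformisers.

Section HerbChange.

Variables (Om : fieldType) (v : Om -> rat) (kk : Om -> Prop).
Hypothesis CF : coeff_field v kk.
Let vV := cf_val CF.
Variables (X : finGroupType) (G : {group X}) (act : X -> {rmorphism Om -> Om}).
Variables (L : Om -> Prop) (pi x : Om).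
Hypothesis T : tot v kk G act L pi.
Hypotheses (Lx : L x) (x0 : x != 0) (vx : v x = v pi).

Lemma displacement_change g : g \in G -> g != 1%g -> v (act g x - x) = v (act g pi - pi).
Proof.
move=> Gg g1; have T' := tot_change T Lx x0 vx.
apply/eqP; rewrite eq_le; apply/andP; split.
  apply: (act_sub_ge CF T' Gg (@vge_refl _ _ _) (tot_pi T) (pi_int T)).
  exact: (act_moves CF T).
apply: (act_sub_ge CF T Gg (@vge_refl _ _ _) Lx (pi_int T')).
exact: (act_moves CF T').
Qed.

Lemma herb_change g : g \in G -> g != 1%g ->
  herb v G act x (act g x) = herb v G act pi (act g pi).
Proof.
move=> Gg g1; rewrite /herb displacement_change //; congr (_ + _).
by apply: eq_bigr => h /andP[Gh h1]; rewrite displacement_change.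
Qed.

End HerbChange.

(** The expression in [upper_ramification], indexed by conjugates of [pi] instead of group
    elements. *)
Definition orbit_herb (Om : fieldType) (v : Om -> rat) (pi : Om) (c : seq Om) (x : Om) :=
  v (x - pi) + \sum_(y <- c | y != pi) Num.min (v (y - pi)) (v (x - pi)).

Lemma herb_orbit (Om : fieldType) (v : Om -> rat) (kk : Om -> Prop)
    (CF : coeff_field v kk) (X : finGroupType) (G : {group X})
    (act : X -> {rmorphism Om -> Om}) (L : Om -> Prop) (pi : Om)
    (T : tot v kk G act L pi) (c : seq Om) (x : Om) :
  uniq c -> (forall y, y \in c <-> exists2 g, g \in G & act g pi = y) ->
  herb v G act pi x = orbit_herb v pi c x.
Proof.
move=> uc cP; rewrite /herb /orbit_herb; congr (_ + _).
have inj : {in G &, injective (fun g => act g pi)}.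
  move=> g h Gg Gh E; apply/eqP; rewrite eq_mulVg1; apply/eqP.
  apply: (tot_pi_faith CF T); first by rewrite groupM ?groupV.
  rewrite (tot_M T) ?groupV // -?E -?(tot_M T) ?groupV // ?mulVg ?(tot1 T) //; exact: (tot_pi T).
have -> : \sum_(y <- c | y != pi) Num.min (v (y - pi)) (v (x - pi)) =
    \sum_(y <- [seq act g pi | g <- enum G] | y != pi) Num.min (v (y - pi)) (v (x - pi)).
  apply: perm_big; apply: uniq_perm => //.
    rewrite map_inj_in_uniq ?enum_uniq // => g h; rewrite !mem_enum; exact: inj.
  move=> y; apply/idP/mapP => [/cP[g Gg <-]|[g]]; first by exists g; rewrite ?mem_enum.
  by rewrite mem_enum => Gg ->; apply/cP; exists g.
rewrite big_map big_enum_cond; apply: eq_bigl => g; case Gg: (g \in G) => //=.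
apply/idP/idP; first by move/(act_moves CF T Gg); rewrite subr_eq0.
by apply: contraNneq => ->; rewrite (tot1 T) //; exact: (tot_pi T).
Qed.

Section UpperNumbering.

Variables (p : nat) (Om : fieldType) (t : Om).
Hypothesis HOm : sepclosure_Fpbar_t p t.
Local Notation kk := (in_Fpbar p (Om := Om)).
Local Notation Gal := (Gal_geom p t).
Local Notation End := {rmorphism Om -> Om}.
Local Notation Lv := (fixed_by_stab p t).
Variable v : Om -> rat.
Hypothesis Pv : place_at_infty t v.
Let vV : valuation v := Pv.1.
Let CF : coeff_field v kk := coeff_field_infty HOm Pv.

Section TwoLevels.

Variables (s S : seq Om).
Hypotheses (ss : gal_stable p t s) (sS : gal_stable p t S) (sub : {subset s <= S}).
Variables (X : finGroupType) (G : {group X}) (act : X -> End) (pi : Om).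
Hypothesis GL : galois_level p t s G act.
Local Notation Gam := (decomp_group HOm v ss GL).
Hypothesis T : tot v kk Gam act (Lv s) pi.
Hypothesis vpi : #|Gam|%:R * v pi = 1.
Variables (X' : finGroupType) (G' : {group X'}) (act' : X' -> End) (pi' : Om).
Hypothesis GL' : galois_level p t S G' act'.
Local Notation Gam' := (decomp_group HOm v sS GL').
Hypothesis T' : tot v kk Gam' act' (Lv S) pi'.
Hypothesis vpi' : #|Gam'|%:R * v pi' = 1.

Let LS x : Lv s x -> Lv S x. Proof. exact: level_sub. Qed.

Lemma decompP a : reflect (a \in G' /\ preserves p t v S (act' a)) (a \in Gam').
Proof. by rewrite inE; apply: (iffP andP) => -[Ga /asboolP]. Qed.

Definition level_ker := [set a in Gam' | all (fun x => act' a x == x) s].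

Lemma level_kerP a : a \in level_ker <-> a \in Gam' /\ forall x, Lv s x -> act' a x = x.
Proof.
split; last first.
  by move=> [Ga ha]; rewrite inE Ga; apply/allP => x xs; rewrite ha //; exact: level_mem.
rewrite inE => /andP[Ga /allP ha]; split=> // x Lx.
have [G'a _] := decompP _ Ga.
by apply: Lx => [|y /ha/eqP//]; exact: (gl_act GL').
Qed.

Lemma group_set_level_ker : group_set level_ker.
Proof.
apply/group_setP; split.
  by apply/level_kerP; split=> [|x /LS Lx]; [exact: group1|exact: (tot1 T')].
move=> a b /level_kerP[Ga ha] /level_kerP[Gb hb]; apply/level_kerP; split.
  exact: groupM.
by move=> x Lx; rewrite (tot_M T') ?hb ?ha //; exact: LS.
Qed.

Let H := Group group_set_level_ker.

Lemma level_ker_normal : (H <| Gam')%g.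
Proof.
have sHG : H \subset Gam' by apply/subsetP => a /level_kerP[].
apply/andP; split=> //; apply/subsetP => a Ga; rewrite inE; apply/subsetP => b.
rewrite mem_conjg => /level_kerP[Gb hb]; apply/level_kerP.
have Ga' : (a^-1 \in Gam')%g by rewrite groupV.
have Eb : b = (a^-1 * ((b ^ (a^-1)) * a))%g by rewrite conjgE !mulgA invgK mulVg mul1g mulgKV.
have Gb' : b \in Gam' by move: Gb; rewrite groupJr.
split=> //; have [Ga0 _] := decompP _ Ga; have Gact := gl_act GL' Ga0.
move=> x Lx; rewrite Eb (tot_M T') ?groupM ?groupV //; last exact: LS.
rewrite (tot_M T') //; last exact: LS.
rewrite hb; last exact: (level_stable HOm ss).
by rewrite -(tot_M T') ?groupV ?mulVg ?(tot1 T') //; exact: LS.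
Qed.

(* Gamma_S / H embeds in Gamma_s, whose order is known. *)
Lemma card_level_quotient : (#|(Gam' / H)%G| <= #|Gam|)%N.
Proof.
have ex (a : X') : exists g : X, a \in Gam' -> g \in Gam /\ forall x, Lv s x -> act g x = act' a x.
  have [Ga|] := boolP (a \in Gam'); last by exists 1%g.
  have [G'a pa] := decompP _ Ga.
  have [g Gg E] := gl_sur GL (gl_act GL' G'a); exists g => _; split=> //.
  by rewrite inE Gg; apply/asboolP => x Lx; rewrite E // pa //; exact: LS.
pose f a := projT1 (cid (ex a)).
have fP a : a \in Gam' -> f a \in Gam /\ forall x, Lv s x -> act (f a) x = act' a x.
  exact: (projT2 (cid (ex a))).
have nH := normal_sub level_ker_normal.
pose F (x : coset_of H) := f (repr x).
have rG x : x \in (Gam' / H)%g -> repr x \in Gam' by exact: repr_quo.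
have injF : {in (Gam' / H)%g &, injective F}.
  move=> x y Gx Gy E; have [_ hx] := fP _ (rG _ Gx); have [_ hy] := fP _ (rG _ Gy).
  have Kxy : ((repr x)^-1 * repr y)%g \in H.
    apply/level_kerP; split=> [|z Lz]; first by rewrite groupM ?groupV ?rG.
    have G'x := rG _ Gx; have Lsx := LS Lz.
    rewrite (tot_M T') ?groupV ?rG // -hy // -[f (repr y)]/(F y) -E /F hx //.
    by rewrite -(tot_M T') ?groupV // mulVg (tot1 T').
  rewrite -[x]coset_reprK -[y]coset_reprK -[repr y](mulKVg (repr x)).
  by rewrite coset_kerr.
rewrite -(card_in_imset injF); apply/subset_leq_card/subsetP => _ /imsetP[x Gx ->].
by have [] := fP _ (rG _ Gx).
Qed.

Lemma pi_level : fixL act' (Lv S) H pi.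
Proof.
split; first exact/LS/(tot_pi T).
by move=> a /level_kerP[_ ha]; apply: ha; exact: (tot_pi T).
Qed.

(** [pi] is fixed by [H], so its value is a multiple of that of the norm; comparison of the orders
    of the two groups leaves equality only. Thus [pi] can replace the norm as uniformiser of the
    fixed field of [H]. *)
Lemma v_npi_level : v pi = v (npi act' pi' H).
Proof.
have nH := level_ker_normal; have sH := normal_sub nH.
have TQ := tot_quotient CF T' nH.
have pi0 := tot_pi0 T.
have [n En] := tot_nat TQ pi_level (pi_int T) pi0.
have vn := vnpi CF T' sH.
have n0 : (0 < n)%N.
  by have := tot_vpi T; rewrite En; case: (n) => //; rewrite mul0r ltxx.
have cQ : (#|(Gam' / H)%G| * #|H|)%N = #|Gam'|.
  transitivity (#|Gam' : H|%g * #|H|)%N; last by rewrite mulnC Lagrange.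
  by congr (_ * _)%N; exact: card_quotient (normal_norm nH).
have E1 : #|(Gam' / H)%G|%:R * v (npi act' pi' H) = 1.
  by rewrite vn mulrA -natrM cQ.
have g0 : 0 < v (npi act' pi' H) by exact: (tot_vpi TQ).
apply/eqP; rewrite eq_le; apply/andP; split; last first.
  by rewrite En; apply: ler_peMl; rewrite ?ler1n // ltW.
have c0 : 0 < #|Gam|%:R :> rat by rewrite ltr0n cardG_gt0.
have : #|(Gam' / H)%G|%:R * v (npi act' pi' H) <= #|Gam|%:R * v (npi act' pi' H).
  by rewrite ler_pM2r // ler_nat; exact: card_level_quotient.
by rewrite E1 -[leLHS]vpi ler_pM2l.
Qed.

(* Herbrand's theorem between the levels s and S. *)
Lemma herb_levels a : a \in Gam' -> act' a pi != pi -> exists h, [/\ h \in Gam',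
  forall x, Lv s x -> act' h x = x,
  herb v Gam' act' pi' (act' (a * h)%g pi') = herb v Gam act pi (act' a pi) &
  herb v Gam' act' pi' (act' a pi') <= herb v Gam act pi (act' a pi)].
Proof.
move=> Ga ne; have nH := level_ker_normal; have sH := normal_sub nH.
have TQ := tot_quotient CF T' nH; have fpi := pi_level.
have [h Hh best] := @herb_best_lift _ v _ Gam' act' pi' H a Ga.
have [Gh hs] := (level_kerP h).1 Hh.
have Gah : (a * h)%g \in Gam' by rewrite groupM.
have Eah : act' (a * h)%g pi = act' a pi.
  by rewrite (tot_M T') ?hs //; [exact: (tot_pi T)|exact/LS/(tot_pi T)].
have nah : (a * h)%g \notin H.
  apply: contra_neqN ne => /level_kerP[_ /(_ _ (tot_pi T))].
  by rewrite Eah.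
have Q1 : coset H (a * h) != 1%g.
  by apply: contraNneq nah => /coset_idr; apply; apply: (subsetP (normal_norm nH)).
have QG : coset H (a * h) \in (Gam' / H)%G by rewrite mem_quotient.
have E : herb v Gam' act' pi' (act' (a * h)%g pi') = herb v Gam act pi (act' a pi).
  rewrite (herb_quotient CF T' nH Gah nah best).
  rewrite -(quo_actE T' nH Gah (fixL_npi T' sH)).
  have pi0 := tot_pi0 T.
  rewrite -(herb_change CF TQ fpi pi0 v_npi_level QG Q1).
  have TQ' := tot_change TQ fpi pi0 v_npi_level.
  rewrite (quo_actE T' nH Gah fpi) Eah.
  (* Both groups have the same orbit of [pi]; one inclusion needs [preserves_extend]. *)
  pose c := undup [seq act g pi | g <- enum Gam].
  have cP y : y \in c <-> exists2 g, g \in Gam & act g pi = y.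
    rewrite mem_undup; split=> [/mapP[g]|[g Gg <-]].
      by rewrite mem_enum => Gg ->; exists g.
    by apply: map_f; rewrite mem_enum.
  rewrite (herb_orbit CF T (c := c)) ?undup_uniq //.
  rewrite (herb_orbit CF TQ' (c := c)) ?undup_uniq // => y; rewrite cP; split.
    case=> g Gg <-; have [Gg0 pg] : g \in G /\ preserves p t v s (act g).
      by move: Gg; rewrite inE => /andP[-> /asboolP].
    have [g' [Gg' E' pg']] := preserves_extend HOm Pv ss sS sub (gl_act GL Gg0) pg.
    have [b Gb Eb] := gl_sur GL' Gg'.
    have Gamb : b \in Gam'.
      by apply/decompP; split=> // x Lx; rewrite Eb ?pg'.
    exists (coset H b); first by rewrite mem_quotient.
    rewrite (quo_actE T' nH Gamb fpi) Eb; last exact/LS/(tot_pi T).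
    by apply: (level_eq HOm Gg' (gl_act GL Gg0) E'); exact: (tot_pi T).
  case=> xb /morphimP[b nb Gb ->] <-; rewrite (quo_actE T' nH Gb fpi).
  have [Gb0 pb] := decompP _ Gb.
  have [g Gg Eg] := gl_sur GL (gl_act GL' Gb0); exists g; last exact: (Eg _ (tot_pi T)).
  by rewrite inE Gg; apply/asboolP => x Lx; rewrite Eg // pb //; exact: LS.
exists h; split=> //; rewrite -E; apply: herb_le.
have Hh' : (h^-1)%g \in H by rewrite groupV.
by have := best _ Hh'; rewrite mulgK.
Qed.

End TwoLevels.
End UpperNumbering.

Section UpperLift.

Variables (p : nat) (Om : fieldType) (t : Om).
Hypothesis HOm : sepclosure_Fpbar_t p t.
Local Notation kk := (in_Fpbar p (Om := Om)).
Local Notation Gal := (Gal_geom p t).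
Local Notation End := {rmorphism Om -> Om}.
Local Notation Lv := (fixed_by_stab p t).
Variable v : Om -> rat.
Hypothesis Pv : place_at_infty t v.
Let vV : valuation v := Pv.1.
Let CF : coeff_field v kk := coeff_field_infty HOm Pv.

Section Level.

Variables (s : seq Om) (ss : gal_stable p t s).
Variables (X : finGroupType) (G : {group X}) (act : X -> End) (pi : Om).
Hypothesis GL : galois_level p t s G act.
Local Notation Gam := (decomp_group HOm v ss GL).
Hypothesis T : tot v kk Gam act (Lv s) pi.

Lemma decomp_sur (h : End) : Gal h -> preserves p t v s h -> exists2 a, a \in Gam &
  forall x, Lv s x -> act a x = h x.
Proof.
move=> Gh ph; have [a Ga E] := gl_sur GL Gh; exists a => //.
by rewrite inE Ga; apply/asboolP => x Lx; rewrite E ?ph.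
Qed.

Lemma decomp_Gal a : a \in Gam -> Gal (act a) /\ preserves p t v s (act a).
Proof. by rewrite inE => /andP[/(gl_act GL) Ga /asboolP]. Qed.

Lemma decomp_inertia a : a \in Gam -> exists2 h : End, Defs.inertia p t v h &
  forall x, Lv s x -> h x = act a x.
Proof.
move=> Ga; have [Gal_a pa] := decomp_Gal Ga.
have [h Ih E] := inertia_surj HOm Pv ss Gal_a pa; exists h => // x.
by apply: (level_eq HOm _ Gal_a E); exact: Ih.1.
Qed.

Lemma inertia_decomp h : Defs.inertia p t v h -> exists2 a, a \in Gam &
  forall x, Lv s x -> act a x = h x.
Proof.
move=> Ih; apply: decomp_sur; first exact: Ih.1.
by move=> x _; exact: (inertia_preserves HOm Pv).
Qed.

Lemma orbit_decomp x c : Lv s x -> inertia_orbit p t v x c ->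
  uniq c /\ forall y, y \in c <-> exists2 a, a \in Gam & act a x = y.
Proof.
move=> Lx [uc cP]; split=> // y; rewrite cP; split=> -[g].
  by move=> /inertia_decomp[a Ga E] <-; exists a; rewrite ?E.
by move=> /decomp_inertia[h Ih E] <-; exists h; rewrite ?E.
Qed.

Lemma uniformiser_tot x : uniformiser v (Lv s) x -> v x = v pi.
Proof.
case=> Lx x0 vx minx; have vpi := tot_vpi T.
have [n En] := tot_nat T Lx (fun _ => ltW vx) x0.
have le := minx _ (tot_pi T) (tot_pi0 T) vpi.
apply/eqP; rewrite eq_le le En; apply: ler_peMl; first exact: ltW.
by rewrite ler1n lt0n; apply: contraTneq vx => n0; rewrite En n0 mul0r ltxx.
Qed.

Lemma tot_uniformiser : uniformiser v (Lv s) pi.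
Proof.
split; [exact: (tot_pi T)|exact: (tot_pi0 T)|exact: (tot_vpi T)|].
move=> x Lx x0 vx; have [n En] := tot_nat T Lx (fun _ => ltW vx) x0.
rewrite En; apply: ler_peMl; first by apply: ltW; exact: (tot_vpi T).
by rewrite ler1n lt0n; apply: contraTneq vx => n0; rewrite En n0 mul0r ltxx.
Qed.

Definition orbit_cond (s' : seq Om) (r : rat) (h : End) :=
  forall x c, uniformiser v (Lv s') x -> inertia_orbit p t v x c -> h x != x ->
  r + 1 <= orbit_herb v x c (h x).

Lemma orbit_cond_herb r (h : End) a : a \in Gam -> (forall x, Lv s x -> act a x = h x) ->
  (act a pi != pi -> r + 1 <= herb v Gam act pi (act a pi)) -> orbit_cond s r h.
Proof.
move=> Ga E le x c ux ox hx; have [Lx x0 _ _] := ux.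
have vx := uniformiser_tot ux; have [uc cP] := orbit_decomp Lx ox.
have a1 : a != 1%g by apply: contraNneq hx => a1; rewrite -E // a1 (tot1 T).
rewrite -E // -(herb_orbit CF (tot_change T Lx x0 vx)) // (herb_change CF T Lx x0 vx Ga a1).
by apply: le; rewrite -subr_eq0; exact: (act_moves CF T).
Qed.

Lemma herb_orbit_cond r (h : End) a : a \in Gam -> (forall x, Lv s x -> act a x = h x) ->
  orbit_cond s r h -> act a pi != pi -> r + 1 <= herb v Gam act pi (act a pi).
Proof.
move=> Ga E cond ne; pose c := undup [seq act g pi | g <- enum Gam].
have Lpi := tot_pi T.
have oc : inertia_orbit p t v pi c.
  split=> [|y]; first exact: undup_uniq.
  rewrite mem_undup; split=> [/mapP[g]|[h' /inertia_decomp[g Gg Eg] <-]].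
    rewrite mem_enum => Gg ->; have [h' Ih' Eh'] := decomp_inertia Gg.
    by exists h'; rewrite ?Eh'.
  by rewrite -Eg //; apply: map_f; rewrite mem_enum.
have [uc cP] := orbit_decomp Lpi oc.
rewrite (herb_orbit CF T _ uc cP) E //; apply: cond => //; first exact: tot_uniformiser.
by rewrite -E.
Qed.

End Level.

Lemma upper_ramificationP r (h : End) : Defs.inertia p t v h ->
  upper_ramification p t v r h <-> forall s, gal_stable p t s -> orbit_cond s r h.
Proof.
move=> Ih; split=> [[_ up] s ss x c ux ox hx|up].
  by apply: (up (Lv s) x c) => //; exists s.
split=> // L x c [s [ss LE]] [Lx x0 vx minx] ox hx; apply: (up s) => //.
split=> //; first exact/LE.
by move=> y /LE; exact: minx.
Qed.

(** By compactness it suffices to lift to each larger level [S]. There [herb_levels] provides a lift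
    with the same upper number; upper numbers can only increase from [S] to an intermediate level,
    so the condition holds at all levels below [S]. *)
Lemma upper_lift (s : seq Om) (ss : gal_stable p t s) (X : finGroupType) (G : {group X})
    (act : X -> End) (pi : Om) (GL : galois_level p t s G act) :
  let Gam := decomp_group HOm v ss GL in
  tot v kk Gam act (Lv s) pi -> #|Gam|%:R * v pi = 1 -> forall a r,
  a \in Gam -> r + 1 <= herb v Gam act pi (act a pi) ->
  exists2 h : End, upper_ramification p t v r h & forall x, Lv s x -> h x = act a x.
Proof.
move=> Gam T vpi a r Ga le.
have [Gal_a pa] := decomp_Gal Ga.
have [|S sS sub|h [Ih hs hc]] := @inertia_lift p Om t HOm v Pv s (act a) (fun s' h => orbit_cond s' r h) ss Gal_a.
- move=> s' h h' ss' Gh Gh' E c1 x c ux ox hx; have [Lx _ _ _] := ux.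
  by move: hx; rewrite -(level_eq HOm Gh Gh' E Lx) => hx; exact: c1.
- have [X' [G' [act' GL']]] := exists_level HOm sS.
  have [pi' T' vpi'] := exists_tot HOm Pv sS GL'.
  have [g0 [Gg0 g0s pg0]] := preserves_extend HOm Pv ss sS sub Gal_a pa.
  have [b Gb Eb] := decomp_sur sS GL' Gg0 pg0.
  have LS x : Lv s x -> Lv S x by exact: level_sub.
  have Lpi := tot_pi T.
  have bs x : Lv s x -> act' b x = act a x.
    by move=> Lx; rewrite Eb ?(level_eq HOm Gg0 Gal_a g0s) //; exact: LS.
  have [c [Gc cs lec]] : exists c, [/\ c \in decomp_group HOm v sS GL',
      forall x, Lv s x -> act' c x = act a x &
      act' c pi' != pi' -> r + 1 <= herb v (decomp_group HOm v sS GL') act' pi' (act' c pi')].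
    have [E|ne] := eqVneq (act a pi) pi.
      exists 1%g; split=> //; rewrite ?group1 //.
        by move=> x Lx; rewrite (tot1 T' (LS _ Lx)) (tot_pi_faith CF T Ga E) (tot1 T).
      by rewrite (tot1 T') ?eqxx //; exact: (tot_pi T').
    have [|k [Gk ks Ek _]] := herb_levels Pv sub T vpi T' vpi' Gb; first by rewrite bs.
    exists (b * k)%g; split; first exact: groupM.
      by move=> x Lx; rewrite (tot_M T') ?ks ?bs //; exact: LS.
    by rewrite Ek bs.
  have [Gal_c pc] := decomp_Gal Gc.
  exists (act' c); split=> //; first by move=> x xs; apply: cs; exact: level_mem.
  move=> s' ss' sub'.
  have [Y [K [ac GK]]] := exists_level HOm ss'.
  have [rho TK vrho] := exists_tot HOm Pv ss' GK.
  have [d Gd Ed] := decomp_sur ss' GK Gal_c (preserves_sub sub' pc).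
  apply: (orbit_cond_herb TK Gd Ed) => ne.
  have Lrho := tot_pi TK.
  rewrite Ed // in ne *.
  have [k [_ _ _ le']] := herb_levels Pv sub' TK vrho T' vpi' Gc ne.
  apply: le_trans le'; apply: lec; apply: contra_neq ne => E.
  have c1 := tot_pi_faith CF T' Gc E.
  by rewrite c1 (tot1 T') //; exact: (level_sub sub').
exists h; first by apply/upper_ramificationP.
by move=> x Lx; rewrite (level_eq HOm Ih.1 Gal_a hs).
Qed.

(** An element of lower number 0 has [herb] equal to 1, that is upper number 0. *)
Lemma upper_wild r (h : End) : 0 < r -> upper_ramification p t v r h ->
  wild_inertia p t v h.
Proof.
move=> r0 up; have Ih := up.1; split=> // x x0.
have [s [_ xs ss]] := stable_hull HOm [:: x].
have Lx : Lv s x by apply: level_mem; exact/xs/mem_head.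
have [X [G [act GL]]] := exists_level HOm ss.
have [pi T vpi] := exists_tot HOm Pv ss GL.
have [a Ga Ea] := inertia_decomp ss GL Ih.
rewrite -Ea //; have [->|a1] := eqVneq a 1%g.
  by rewrite (tot1 T) // subrr; exact: vgt0.
have ne : act a pi != pi by rewrite -subr_eq0; exact: (act_moves CF T).
have := herb_orbit_cond T Ga Ea ((upper_ramificationP r Ih).1 up s ss) ne.
rewrite (herbE CF T Ga a1) => le.
have w0 : (0 < ram_w v act pi a)%N.
  rewrite lt0n; apply: contraTneq le => ->; rewrite big1 ?add0n => [|g _]; last exact: minn0.
  by rewrite vpi -ltNge ltrDr.
have := ram_wP CF T Ga a1; move=> Ew.
have gpi : vge v (v pi) (act a pi / pi - 1).
  move=> _; rewrite Ew; apply: ler_peMl; first by apply: ltW; exact: (tot_vpi T).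
  by rewrite ler1n.
have [n0 _ h1] := act_oneu CF T (ltW (tot_vpi T)) Ga gpi Lx x0.
have -> : act a x - x = x * (act a x / x - 1) by rewrite mulrBr mulr1 mulrCA divff // mulr1.
rewrite -[v x]addr0; apply: (vgtM vV); first exact: vge_refl.
by apply: (vge_gt _ h1); exact: (tot_vpi T).
Qed.

End UpperLift.

(** * Almost simple groups and the conjugation representation *)

Section AlmostSimple.

Local Open Scope group_scope.

(** Conjugation embeds [A] in Aut(S) and maps [S] onto the inner automorphisms, so
    [|R| |A : R| = |A| <= |S| |Out S|], while [|S| <= |R|]. *)
Lemma index_le_Out (gT : finGroupType) (S A R : {group gT}) :
  almost_simple S A -> S \subset R -> R \subset A -> (#|A : R|%g <= #|Out S|)%N.
Proof.
case=> simS nabS nSA CAS sSR sRA.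
have sSA := normal_sub nSA; have nSA' := normal_norm nSA.
have inj : 'injm (restrm nSA' (conj_aut S)).
  by rewrite ker_restrm ker_conj_aut CAS.
have cA : #|conj_aut S @* A| = #|A|.
  by rewrite -[LHS](congr1 (fun B : {set _} => #|B|) (im_restrm nSA' (conj_aut S))) card_injm.
have cS : #|conj_aut S @* S| = #|S|.
  have -> : conj_aut S @* S = restrm nSA' (conj_aut S) @* S.
    by rewrite morphim_restrm (setIidPr sSA).
  by rewrite card_injm.
have nI : Aut S \subset 'N(conj_aut S @* S).
  apply/subsetP => a Aa; rewrite inE; apply/subsetP => _ /imsetP[_ /morphimP[x Nx Sx ->] ->].
  have Sax : a x \in S by rewrite Aut_closed.
  have nS y : y \in S -> y \in 'N(S) by apply: subsetP (normG S) y.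
  suff -> : conj_aut S x ^ a = conj_aut S (a x) by apply: mem_morphim => //; exact: nS.
  have AI z : z \in S -> conj_aut S z \in Aut S.
    by move=> Sz; rewrite (subsetP (Aut_conj_aut S S)) // mem_morphim ?nS.
  apply: (eq_Aut (A := S)); [by rewrite groupJ ?AI|exact: AI|].
  move=> y Sy; have Sy' : a^-1 y \in S by rewrite Aut_closed ?groupV.
  rewrite conjgE !permM conj_autE // conj_autE // -!(autmE Aa) morphJ //=.
  by rewrite !autmE permKV.
have sI : conj_aut S @* S \subset Aut S by exact: Aut_conj_aut.
have E : #|Out S| = #|Aut S : conj_aut S @* S| by exact: card_quotient nI.
rewrite E -(leq_pmul2r (cardG_gt0 S)) -[in leqRHS]cS mulnC [leqRHS]mulnC Lagrange //.
apply: leq_trans (_ : (#|R| * #|A : R|%g <= _)%N).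
  by rewrite leq_mul2r subset_leq_card ?orbT.
rewrite Lagrange // -cA subset_leq_card //; exact: Aut_conj_aut.
Qed.

(** Otherwise [a] is in the core of [K]. A normal subgroup of [A] that meets [S] trivially
    centralises it, so is trivial; if it does not, it contains the simple group [S], and so would
    [K]. *)
Lemma almost_simple_moved (gT : finGroupType) (S A K : {group gT}) (a : gT) :
  almost_simple S A -> ~~ (S \subset K) -> a \in A -> a != 1 ->
  exists2 g, g \in A & a ^ g \notin K.
Proof.
case=> simS nabS nSA CAS nSK Aa a1; apply/exists_inP; apply: contraR a1.
rewrite negb_exists_in => /forall_inP h.
pose N := gcore K A.
have aN : a \in N.
  apply/bigcapP => x Ax; rewrite mem_conjg.
  by have := h x^-1; rewrite groupV negbK; apply.
have nNA : A \subset 'N(N) by exact: gcore_norm.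
have sNK : N \subset K by exact: gcore_sub.
have sSA := normal_sub nSA; have nSA' := normal_norm nSA.
pose M := N :&: A.
have nMA : A \subset 'N(M) by rewrite normsI ?normG.
have aM : a \in M by rewrite inE aN.
have [_ minS] := simpleP _ simS.
have [E|E] : S :&: M = 1 \/ S :&: M = S.
  apply: minS; rewrite /normal subsetIl /=.
  by rewrite normsI ?normG // (subset_trans sSA nMA).
  have cSM : M \subset 'C(S).
    rewrite centsC; apply/commG1P/trivgP; rewrite -E subsetI commg_subl commg_subr.
    by rewrite (subset_trans sSA nMA) (subset_trans (subsetIr _ _) nSA').
  by apply/eqP; have := subsetP cSM a aM => Ca; apply/set1P; rewrite -set1gE -CAS inE Aa.
case/negP: nSK; rewrite -E; apply: subset_trans sNK.
by rewrite setIA (subset_trans (subsetIl _ _)) // subsetIr.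
Qed.

End AlmostSimple.

Lemma comm_all_scalar (F : fieldType) n (A : 'M[F]_n) :
  (forall B : 'M_n, B *m A = A *m B) -> is_scalar_mx A.
Proof.
case: n A => [|n] A comm; first by rewrite /is_scalar_mx; case: insub => // -[].
apply/is_scalar_mxP; exists (A 0 0); apply/matrixP => i j; rewrite mxE.
have := congr1 (fun M : 'M_n.+1 => M 0 j) (comm (delta_mx 0 i)).
rewrite !mxE (bigD1 i) //= big1 ?addr0 => [|k ki]; last by rewrite !mxE (negPf ki) andbF mul0r.
rewrite (bigD1 0) //= big1 ?addr0 => [|k ki]; last by rewrite !mxE (negPf ki) mulr0.
rewrite !mxE !eqxx mul1r => ->; rewrite eq_sym.
by case: eqP => _; rewrite ?mulr1 ?mulr1n ?mulr0 ?mulr0n.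
Qed.

Lemma invmx_mul (F : fieldType) n (A B : 'M[F]_n) : A \in unitmx -> B \in unitmx ->
  invmx (A *m B) = invmx B *m invmx A.
Proof.
move=> UA UB; have UAB : A *m B \in unitmx by rewrite unitmx_mul UA.
apply: (can_inj (mulKmx UAB)); rewrite mulmxV // mulmxA -(mulmxA A) mulmxV //.
by rewrite mulmx1 mulmxV.
Qed.

Section ConjugationRepr.

Variables (F : fieldType) (gT : finGroupType) (R : {group gT}) (e : nat).
Variable Psi : gT -> 'M[F]_e.
Hypothesis PPsi : projective_repr R Psi.

(** Conjugation is insensitive to the scalar ambiguity of [Psi], so it gives a linear representation
    on row vectors [mxvec B]. *)
Definition conj_lin (x : gT) : 'M[F]_(e * e) :=
  lin_mx (mulmxr (Psi x) \o mulmx (invmx (Psi x))).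

Lemma conj_linE x B : mxvec B *m conj_lin x = mxvec (invmx (Psi x) *m B *m Psi x).
Proof. by rewrite mul_vec_lin. Qed.

Lemma conj_lin_repr : mx_repr R conj_lin.
Proof.
have [uP mP] := PPsi; split.
  apply/row_matrixP => i; rewrite !rowE mulmx1; set u := delta_mx 0 i.
  have [c c0 E] := mP _ _ (group1 R) (group1 R).
  have U1 := uP _ (group1 R); rewrite mulg1 in E.
  have E1 : Psi 1%g = (c^-1)%:M.
    have := congr1 (mulmx (invmx (Psi 1%g))) E.
    rewrite mulVmx // -scalemxAr mulmxA mulVmx // mul1mx => /(congr1 (fun M => c^-1 *: M)).
    by rewrite scalerA mulVf // scale1r scalemx1 => <-.
  rewrite -[u]vec_mxK conj_linE; congr mxvec.
  rewrite -mulmxA {2}E1 mul_mx_scalar -mul_scalar_mx -E1 mulmxA mulVmx // mul1mx //.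
move=> x y Rx Ry; apply/row_matrixP => i; rewrite !rowE mulmxA; set u := delta_mx 0 i.
rewrite -[u]vec_mxK !conj_linE; congr mxvec.
have [c c0 ->] := mP _ _ Rx Ry; have Ux := uP _ Rx; have Uy := uP _ Ry.
rewrite invmxZ ?unitmxZ ?unitmx_mul ?Ux ?Uy ?unitfE //.
rewrite invmx_mul // -!(scalemxAl, scalemxAr) scalerA mulVf // scale1r.
by rewrite !mulmxA.
Qed.

Definition conj_repr := MxRepresentation conj_lin_repr.

Lemma conj_repr_nontrivial x : x \in R -> ~~ is_scalar_mx (Psi x) -> conj_repr x != 1%:M.
Proof.
move=> Rx; apply: contraNneq => E; apply: comm_all_scalar => B.
have := conj_linE x B; rewrite -[conj_lin x]/(conj_repr x) E mulmx1.
move/(can_inj mxvecK)/(congr1 (mulmx (Psi x))).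
by rewrite !mulmxA mulmxV ?mul1mx //; exact: PPsi.1.
Qed.

(** The identity matrix is invariant; this accounts for the 1 in [e ^ 2 - 1]. *)
Lemma conj_repr_rfix : (0 < e)%N -> (0 < \rank (rfix_mx conj_repr R))%N.
Proof.
move=> e0; rewrite lt0n mxrank_eq0; apply: contraTneq e0 => E.
have : (mxvec (1%:M : 'M[F]_e) <= rfix_mx conj_repr R)%MS.
  apply/rfix_mxP => x Rx; rewrite conj_linE mulmx1 mulVmx //.
  exact: PPsi.1.
rewrite E submx0 mxvec_eq0 -leqNgt leqn0 => /eqP /(congr1 mxrank).
by rewrite mxrank1 mxrank0 => ->.
Qed.

End ConjugationRepr.

(** * Bounding W by representations of the inertia group *)

Section WildBound.

Variables (p : nat) (Om : fieldType) (Hp : p \in [pchar Om]).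
Variables (v : Om -> rat) (kk : Om -> Prop) (CF : coeff_field v kk).
Variables (X : finGroupType) (Gam : {group X}) (act : X -> {rmorphism Om -> Om}).
Variables (L : Om -> Prop) (pi : Om).
Hypothesis T : tot v kk Gam act L pi.
Hypothesis vpi : #|Gam|%:R * v pi = 1.
Local Notation ram := (ram v Gam act pi).
Local Notation rg := (ram_group CF T).

Variables (gT : finGroupType) (f : X -> gT) (W : nat).
Hypothesis fM : {in Gam &, {morph f : a b / (a * b)%g}}.
Hypothesis W_gt0 : (0 < W)%N.
(* The breaks of the kernel of [f] are at most 1/W. *)
Hypothesis breaks : forall a, a \in Gam -> f a != 1%g ->
  herb v Gam act pi (act a pi) <= W%:R^-1 + 1.

Let f1 : f 1%g = 1%g.
Proof. by apply: (mulgI (f 1%g)); rewrite -fM ?group1 // !mulg1. Qed.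

(** The inequality phi <= 1/W, with denominators cleared by [|Gam| v(pi) = 1]. *)
Lemma ramsum_break a : a \in Gam -> f a != 1%g ->
  (W * ramsum v Gam act pi (ram_w v act pi a) <= #|Gam|)%N.
Proof.
move=> Ga fa; have a1 : a != 1%g by apply: contraNneq fa => ->; rewrite f1.
have := breaks Ga fa; rewrite (herbE CF T Ga a1) -ramsumE natrD mulrDl vpi lerD2r.
have W0 : 0 < W%:R :> rat by rewrite ltr0n.
have g0 : 0 < #|Gam|%:R :> rat by rewrite ltr0n cardG_gt0.
move=> /(ler_wpM2l (ltW (mulr_gt0 W0 g0))).
by rewrite mulrACA vpi mulr1 mulrAC divff ?lt0r_neq0 // mul1r -natrM ler_nat.
Qed.

Lemma ramsum_sub (G' : {group X}) k : G' \subset Gam ->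
  (ramsum v G' act pi k <= ramsum v Gam act pi k)%N.
Proof.
move=> sG; apply: leq_sum => i _; apply/subset_leq_card/subsetP => g.
by rewrite !inE => /andP[/(subsetP sG) -> ->].
Qed.

Lemma ramsum_mono k k' : (k <= k')%N -> (ramsum v Gam act pi k <= ramsum v Gam act pi k')%N.
Proof.
move=> le; by rewrite /ramsum [leqRHS](big_cat_nat (n := k.+1)) //= leq_addr.
Qed.

(** Multiply [local_bound] for [G'] by [W]. Lower numbering restricts to subgroups, so [W ramsum k]
    for [G'] is at most [|Gam| = |G'| |Gam : G'|] by [ramsum_break]. *)
Lemma wild_bound (F : closedFieldType) (G' : {group X}) n (rV : mx_representation F G' n) :
  p \notin [pchar F] -> G' \subset Gam ->
  (forall a, a \in G' -> f a = 1%g -> rV a = 1%:M) ->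
  (exists2 a, a \in G' & a \in ram 1 /\ rV a != 1%:M) ->
  (W <= (n - \rank (rfix_mx rV G')) * #|Gam : G'|%g)%N.
Proof.
move=> Fp sG kf [a G'a [ra nta]].
have T' := tot_subgroup T sG.
have [|k [k0 [b rb ntb] le]] := local_bound CF Hp T' Fp (rV := rV).
  by exists a => //; move: ra; rewrite !inE G'a => /andP[_ ->].
move: rb; rewrite inE => /andP[G'b hb].
have Gb := subsetP sG _ G'b.
have fb : f b != 1%g by apply: contra_neq ntb => /(kf _ G'b).
have b1 : b != 1%g by apply: contra_neq fb => ->.
have kw : (k <= ram_w v act pi b)%N by move: hb; rewrite (negPf b1).
have le1 : (W * ramsum v G' act pi k <= #|Gam|)%N.
  apply: leq_trans (ramsum_break Gb fb); rewrite leq_mul2l orbC.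
  by rewrite (leq_trans (ramsum_sub k sG)) // ramsum_mono.
rewrite -(leq_pmul2r (cardG_gt0 G')) -mulnA [(#|Gam : G'|%g * _)%N]mulnC Lagrange //.
apply: (leq_trans (n := W * ((n - \rank (rfix_mx rV G')) * ramsum v G' act pi k)%N)).
  by rewrite leq_mul2l le orbT.
by rewrite mulnCA leq_mul2l le1 orbT.
Qed.

Variables (E : closedFieldType) (D : nat) (iota : gT -> 'M[E]_D).
Hypothesis D_gt0 : (0 < D)%N.
Hypothesis Ep : p \notin [pchar E].
Hypothesis iota1 : iota 1%g = 1%:M.
Hypothesis iotaM : forall x y, iota (x * y)%g = iota x *m iota y.
Hypothesis iota_inj : injective iota.
Hypothesis center_scalar : forall z, z \in 'Z([set: gT])%g -> is_scalar_mx (iota z).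
Hypothesis wild : exists2 b, b \in ram 1 & f b != 1%g.

Lemma sub_ram_Gam a i : a \in ram i -> a \in Gam.
Proof. by rewrite inE => /andP[]. Qed.

(* If wild inertia is central, the image of inertia is abelian. *)
Lemma central_wild_bound : (forall a, a \in ram 1 -> f a \in 'Z([set: gT])%g) -> (W <= 1)%N.
Proof.
move=> cP; have nR := ram_normal CF T 1.
have fX x n : x \in Gam -> f (x ^+ n)%g = (f x ^+ n)%g.
  by move=> Gx; elim: n => [|n IH]; rewrite ?expg0 // !expgS fM ?groupX // IH.
(* Tame inertia is cyclic and wild inertia central in the image, so the image is generated by one
   element and central ones. *)
have [x Gx genx] : exists2 x, x \in Gam &
    forall a, a \in Gam -> exists i z, z \in 'Z([set: gT])%g /\ f a = (f x ^+ i * z)%g.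
  have /cyclicP[xb Exb] := tame_cyclic CF T.
  have xbG : xb \in (Gam / rg 1)%g by rewrite Exb cycle_id.
  have Gx := repr_quo (normal_sub nR) xbG.
  exists (repr xb) => // a Ga.
  have : coset (rg 1) a \in <[xb]>%g by rewrite -Exb mem_quotient.
  case/cycleP => i Ei; exists i, (f ((repr xb) ^- i * a)%g).
  have Gxi : (repr xb ^+ i)%g \in Gam by rewrite groupX.
  split; last by rewrite -fX // -fM ?groupM ?groupV // mulKVg.
  apply: cP; have nG g : g \in Gam -> g \in 'N(rg 1)%g by apply: subsetP (normal_norm nR) g.
  apply: (@coset_idr _ (rg 1)); first by apply: nG; rewrite groupM ?groupV.
  have Nxi := nG _ Gxi; have Na := nG _ Ga.
  by rewrite morphM ?groupV // morphV //= coset_reprX Ei mulVg.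
have comm a b : a \in Gam -> b \in Gam -> (f a * f b = f b * f a)%g.
  move=> /genx[i [z [Zz ->]]] /genx[j [z' [Zz' ->]]].
  have cz y y' : y \in 'Z([set: gT])%g -> (y * y' = y' * y)%g.
    by move/centerP=> [_ h]; exact: h.
  rewrite !mulgA -(mulgA (f x ^+ i)%g) (cz z) // -(mulgA (f x ^+ j)%g z') (cz z') //.
  rewrite !mulgA -!expgD addnC -!mulgA; congr (_ * _)%g; exact: cz.
have rE : mx_repr Gam (iota \o f).
  by split=> [|a b Ga Gb] /=; rewrite ?f1 ?fM ?iotaM.
pose rV := MxRepresentation rE.
have [M simM] : exists M, mxsimple rV M.
  apply: contrapT => no.
  have n1 : (1%:M : 'M[E]_D) != 0 by rewrite -mxrank_eq0 mxrank1 -lt0n.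
  have : false by apply: (mxsimple_exists (mxmodule1 rV) n1) => -[M simM _]; case: no; exists M.
  by [].
have [modM nzM _] := simM; have /rowV0Pn[u uM u0] := nzM.
have ex (a : X) : exists c : E, a \in Gam -> u *m iota (f a) = c *: u.
  have [Ga|] := boolP (a \in Gam); last by exists 0.
  have [|c hc] := component_scalar simM Ga.
    by move=> g Gg /=; rewrite -!iotaM comm.
  exists c => _; apply: (hc _ u).
  by apply: submx_trans uM _; exact: component_mx_id.
pose lam a := projT1 (cid (ex a)).
have lamP a : a \in Gam -> u *m iota (f a) = lam a *: u.
  exact: (projT2 (cid (ex a))).
have inj_u c c' : c *: u = c' *: u -> c = c'.
  by move/eqP; rewrite -subr_eq0 -scalerBl scaler_eq0 (negPf u0) orbF subr_eq0 => /eqP.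
have rl : mx_repr Gam (fun a => (lam a)%:M : 'M[E]_1).
  split.
    congr (_%:M); apply: inj_u; rewrite -lamP ?group1 // f1 iota1 mulmx1 scale1r //.
  move=> a b Ga Gb; rewrite -scalar_mxM; congr (_%:M); apply: inj_u.
  by rewrite -lamP ?groupM // fM // iotaM mulmxA lamP // -scalemxAl lamP // scalerA.
pose rL := MxRepresentation rl.
have kerL a : a \in Gam -> f a = 1%g -> rL a = 1%:M.
  by move=> Ga fa; congr (_%:M); apply: inj_u; rewrite -lamP // fa iota1 mulmx1 scale1r.
have [b rb fb] := wild; have Gb := sub_ram_Gam rb.
(* On wild inertia [iota] is scalar and [lam] is that scalar, so [lam] is nontrivial there. *)
suff le : (W <= (1 - \rank (rfix_mx rL Gam)) * #|Gam : Gam|%g)%N.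
  by apply: leq_trans le _; rewrite indexgg muln1 leq_subr.
apply: (wild_bound Ep (subxx _) kerL).
exists b => //; split=> //; apply: contra_neq fb => E1.
have /is_scalar_mxP[c Ec] := center_scalar (cP _ rb).
have lb : lam b = c by apply: inj_u; rewrite -lamP // Ec mul_mx_scalar.
apply: iota_inj; rewrite iota1 Ec -lb.
by have := congr1 (fun M : 'M_1 => M 0 0) E1; rewrite !mxE eqxx !mulr1n => ->.
Qed.

Variables (S R : {group coset_of 'Z([set: gT])%g}).
Local Notation Gbar := ([set: gT] / 'Z([set: gT]))%G.
Hypotheses (simS : almost_simple S Gbar) (sSR : S \subset R) (nRG : (R <| Gbar)%g).

Theorem wild_dim_bound (F : closedFieldType) n (Phi : mx_representation F R n) :
  p \notin [pchar F] -> (exists2 x, x \in S & Phi x != 1%:M) ->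
  (W <= (n - \rank (rfix_mx Phi R)) * #|Gbar : R|%g)%N.
Proof.
move=> Fp [x0 Sx0 ntx0].
have sRG := normal_sub nRG; have nRG' := normal_norm nRG.
have Rx0 := subsetP sSR _ Sx0.
have cod_gt0 : (0 < n - \rank (rfix_mx Phi R))%N.
  rewrite subn_gt0 ltn_neqAle rank_leq_row andbT; apply: contra_neqN ntx0 => /eqP full.
  have /rfix_mxP/(_ _ Rx0) : (1%:M <= rfix_mx Phi R)%MS by rewrite sub1mx /row_full full.
  by rewrite mul1mx.
have idx_gt0 : (0 < #|Gbar : R|%g)%N by exact: indexg_gt0.
pose fb a := coset 'Z([set: gT])%g (f a).
have nZ (y : gT) : y \in 'N('Z([set: gT]))%g.
  exact: (subsetP (normal_norm (center_normal [set: gT]%G)) y (in_setT y)).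
have fbG a : fb a \in Gbar by rewrite mem_quotient ?inE.
have fbM : {in Gam &, {morph fb : a b / (a * b)%g}}.
  by move=> a b Ga Gb; rewrite /fb fM // morphM ?nZ.
pose h a := coset R (fb a).
have hM : {in Gam &, {morph h : a b / (a * b)%g}}.
  by move=> a b Ga Gb; rewrite /h fbM // morphM ?(subsetP nRG').
have hG a : h a \in (Gbar / R)%g by rewrite mem_quotient.
pose hm := Morphism hM.
(* Wild inertia not inside [R]: it acts nontrivially through the regular representation of
   [Gbar / R], of dimension the index. *)
have [[a ra nRa]|inR] := pselect (exists2 a, a \in ram 1 & fb a \notin R).
  have rQ : mx_repr Gam (regular_repr F (Gbar / R)%G \o h).
    split=> [|b c Gb Gc] /=.
      have -> : h 1%g = 1%g by rewrite -[h]/(hm : X -> _) morph1.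
      exact: repr_mx1.
    by rewrite hM // repr_mxM.
  apply: (leq_trans (wild_bound (rV := MxRepresentation rQ) Fp (subxx _) _ _)).
  - move=> b Gb fb1 /=; have -> : h b = 1%g by rewrite /h /fb fb1 !morph1.
    exact: repr_mx1.
  - exists a; first exact: sub_ram_Gam ra.
    split=> //=; apply: contra nRa => /eqP E1.
    apply: coset_idr; first exact: (subsetP nRG').
    apply: (mx_faithful_inj (regular_mx_faithful F (Gbar / R)%G) (hG a) (group1 _)).
    exact: etrans E1 (esym (repr_mx1 _)).
  - rewrite indexgg muln1; apply: leq_trans (leq_subr _ _) _.
    by rewrite -(card_quotient nRG'); exact: leq_pmull.
have {}inR a : a \in ram 1 -> fb a \in R.
  by move=> ra; apply: contrapT => /negP nRa; apply: inR; exists a.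
have [[a ra nta]|cP] := pselect (exists2 a, a \in ram 1 & fb a != 1%g); last first.
  have cP' a : a \in ram 1 -> f a \in 'Z([set: gT])%g.
    move=> ra; apply: coset_idr; first exact: nZ.
    by apply/eqP; apply: contrapT => /negP na; apply: cP; exists a.
  by apply: leq_trans (central_wild_bound cP') _; rewrite muln_gt0 cod_gt0.
have nSK : ~~ (S \subset rker Phi).
  apply: contra_neqN ntx0 => /subsetP/(_ _ Sx0); rewrite inE => /andP[_ /eqP].
  by rewrite mul1mx.
(* A wild element of [R] nontrivial in [Gbar] may act trivially under [Phi], but not under its
   conjugate by a suitable [g], which has invariants of the same dimension. *)
have [g Gg ng] := almost_simple_moved simS nSK (fbG a) nta.
have gN : g \in 'N(R)%g by exact: (subsetP nRG').
pose G0 := [set b in Gam | fb b \in R].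
have gG0 : group_set G0.
  apply/group_setP; split; first by rewrite inE group1 /fb f1 morph1 group1.
  by move=> b c /[!inE] /andP[Gb Rb] /andP[Gc Rc]; rewrite groupM // fbM ?groupM.
pose G' := Group gG0.
have G'P b : b \in G' -> b \in Gam /\ fb b \in R by rewrite inE => /andP[].
have sG' : G' \subset Gam by apply/subsetP => b /G'P[].
have RJ b : b \in G' -> (fb b ^ g)%g \in R by move=> /G'P[_ Rb]; rewrite memJ_norm.
have rV : mx_repr G' (fun b => Phi (fb b ^ g)%g).
  split; first by rewrite /fb f1 morph1 conj1g repr_mx1.
  move=> b c Gb Gc; have [Gb' _] := G'P _ Gb; have [Gc' _] := G'P _ Gc.
  by rewrite fbM // conjMg repr_mxM ?RJ.
apply: (leq_trans (wild_bound (rV := MxRepresentation rV) Fp sG' _ _)).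
- by move=> b Gb fb1 /=; rewrite /fb fb1 morph1 conj1g repr_mx1.
- have Ga' : a \in G' by rewrite inE (sub_ram_Gam ra) inR.
  exists a => //; split=> //=; apply: contraNneq ng => E1.
  by rewrite inE RJ //= mul1mx E1.
apply: leq_mul.
  apply: leq_sub2l; apply: mxrankS; apply/rfix_mxP => b Gb /=.
  by rewrite rfix_mx_id ?RJ.
(* [G'] is the kernel of the map to [Gbar / R], which bounds its index. *)
have kerh : ('ker hm = G')%g.
  apply/setP => b; rewrite 2!inE [in RHS]inE /=; case Gb: (b \in Gam) => //=.
  apply/set1P/idP => [E1|Rb]; last exact: coset_id.
  by apply: (@coset_idr _ R) => //; exact: (subsetP nRG').
have := card_morphim hm Gam; rewrite setIid kerh => <-.
rewrite -(card_quotient nRG'); apply/subset_leq_card/subsetP => _ /morphimP[b _ _ ->].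
exact: hG.
Qed.

End WildBound.

(** * The monodromy group of the hypergeometric sheaf *)

Section Monodromy.

Variables (p l : nat) (p_prime : prime p) (Om : fieldType) (t : Om).
Hypothesis HOm : sepclosure_Fpbar_t p t.
Variables (E : closedFieldType) (vE : E -> rat) (HE : Qlbar l vE) (D m : nat).
Hypothesis lt_mD : (m < D)%N.
Variable H : {rmorphism Om -> Om} -> 'M[E]_D.
Hypothesis hypH : hypergeometric p t vE D m H.
Variables (gT : finGroupType) (iota : gT -> 'M[E]_D).
Hypothesis finG : finite_matrix_group iota (geometric_monodromy p t H).
Local Notation Gal := (Gal_geom p t).
Local Notation End := {rmorphism Om -> Om}.
Local Notation Lv := (fixed_by_stab p t).
Local Notation kk := (in_Fpbar p (Om := Om)).

Let iota_inj : injective iota := let: And3 h _ _ := finG in h.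
Let iotaM x y : iota (x * y)%g = iota x *m iota y. Proof. by case: finG. Qed.

Lemma hyp_multiplicative :
  (forall g h : End, Gal g -> Gal h -> H (g \o h : End) = H g *m H h) /\
  forall r : rat, exists xs : seq Om, forall g : End, Gal g ->
    {in xs, forall x, g x = x} -> forall i j, vge vE r ((H g - 1%:M) i j).
Proof.
have [f [psi [chi [eta [rhoA [[f0 _] _ _ [KC _ _] HA]]]]]] := hyp_arith hypH.
have GA (g : End) : Gal g -> Gal_arith (p ^ f) t g.
  by case=> gt gc; split=> // c hc; apply: gc; exists f.
split=> [g h Gg Gh|r].
  rewrite !HA //; last exact: Gal_comp.
  by apply: (continuous_repM KC); exact: GA.
have [xs hxs] := continuous_repC KC r; exists xs => g Gg hg i j.
by rewrite HA //; apply: hxs => //; exact: GA.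
Qed.

Let HM := hyp_multiplicative.1.
Let HC := hyp_multiplicative.2.

(** A morphism can be the identity pointwise without being the term [idfun]; continuity at every
    precision shows that [H] does not see the difference. *)
Lemma hyp_identity (g : End) : Gal g -> (forall x, g x = x) -> H g = 1%:M.
Proof.
move=> Gg g1; apply/eqP; rewrite -subr_eq0; apply/eqP/matrixP => i j; rewrite [RHS]mxE.
apply: (vge_all0 (v := vE)) => n; have [xs hxs] := HC n%:R.
exact: (hxs g Gg (fun x _ => g1 x) i j).
Qed.

Lemma hyp_in_monodromy (g : End) : Gal g -> exists x, iota x = H g.
Proof.
move=> Gg; have [_ _ finM] := finG; apply/(finM (H g)); split; last first.
  by move=> P hP; apply: hP; exists g.
have [g' Gg' [gK _]] := Gal_inverse HOm Gg.
have E1 : H g' *m H g = 1%:M.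
  by rewrite -HM //; apply: hyp_identity; [exact: Gal_comp|exact: gK].
by have [] := mulmx1_unit E1.
Qed.

Lemma iota_one : iota 1%g = 1%:M.
Proof.
have [x Ex] := @hyp_in_monodromy idfun (@Gal_id p Om t).
have x1 : x = 1%g.
  apply: (mulgI x); rewrite mulg1; apply: iota_inj; rewrite iotaM Ex.
  by rewrite (@hyp_identity idfun) ?mulmx1 //; exact: Gal_id.
by rewrite -x1 Ex; apply: hyp_identity => //; exact: Gal_id.
Qed.

(** The image is finite, so its elements other than 1 stay away from 1, and continuity makes the
    kernel open. *)
Lemma hyp_open : exists xs : seq Om, forall g : End, Gal g -> {in xs, forall x, g x = x} ->
  H g = 1%:M.
Proof.
have sep (x : gT) : exists r : rat, (forall i j, vge vE r ((iota x - 1%:M) i j)) -> iota x = 1%:M.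
  have [E1|ne] := eqVneq (iota x) 1%:M; first by exists 0.
  have [i [j nz]] : exists i j, (iota x - 1%:M) i j != 0.
    apply: contrapT => no; move: ne; rewrite -subr_eq0 => /eqP; apply.
    apply/matrixP => i j; rewrite [RHS]mxE; apply/eqP; apply: contrapT => /negP h.
    by apply: no; exists i, j.
  exists (vE ((iota x - 1%:M) i j) + 1) => h.
  by have := h i j nz; rewrite gerDl ler10.
pose r_ x := projT1 (cid (sep x)).
have r_P x : (forall i j, vge vE (r_ x) ((iota x - 1%:M) i j)) -> iota x = 1%:M.
  exact: (projT2 (cid (sep x))).
have [xs hxs] := HC (\sum_x `|r_ x|); exists xs => g Gg hg.
have [x Ex] := hyp_in_monodromy Gg; rewrite -Ex; apply: r_P => i j.
rewrite Ex; apply: (vgeW _ (hxs g Gg hg i j)).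
rewrite (bigD1 x) //=; apply: le_trans (ler_norm _) _.
by rewrite lerDl sumr_ge0 // => y _; exact: normr_ge0.
Qed.

(** Schur's lemma: an eigenspace of [iota z] is stable under the irreducible [H]. *)
Lemma monodromy_center z : z \in 'Z([set: gT])%g -> is_scalar_mx (iota z).
Proof.
case/centerP => _ cz; have [D0 irr] := hyp_irreducible hypH.
have [c /eigenvalueP[u Eu u0]] := exists_eigenvalue (iota z)^T D0.
pose f : 'cV[E]_D -> 'cV[E]_D := fun x => iota z *m x - c *: x.
have fL : linear f.
  by move=> a x y; rewrite /f mulmxDr -scalemxAr !scalerDr scalerN !scalerA (mulrC c) opprD addrACA.
pose fA := GRing.isLinear.Build _ _ _ _ f fL.
pose fl : {linear 'cV[E]_D -> 'cV[E]_D} := HB.pack f fA.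
have memU x : (x \in lker (linfun fl)) = (iota z *m x == c *: x).
  by rewrite memv_ker lfunE /= subr_eq0.
have stU : rep_stable Gal H (lker (linfun fl)).
  move=> g Gg x; rewrite !memU => /eqP hx; have [y Ey] := hyp_in_monodromy Gg.
  by rewrite -Ey mulmxA -iotaM (cz y (in_setT y)) iotaM -mulmxA hx -scalemxAr.
have [U0|UT] := irr _ stU.
  have : u^T \in lker (linfun fl).
    by rewrite memU -[iota z]trmxK -trmx_mul Eu linearZ.
  by rewrite U0 memv0 -trmx0 (inj_eq trmx_inj) (negPf u0).
apply/is_scalar_mxP; exists c; apply/matrixP => i j.
have : (delta_mx j 0 : 'cV[E]_D) \in lker (linfun fl) by rewrite UT memvf.
rewrite memU => /eqP/matrixP/(_ i 0); rewrite -colE !mxE eqxx andbT => ->.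
by case: eqP => _; rewrite ?mulr1 ?mulr1n ?mulr0 ?mulr0n.
Qed.

Variables (S R : {group coset_of 'Z([set: gT])%g}).
Local Notation Gbar := ([set: gT] / 'Z([set: gT]))%G.
Hypotheses (simS : almost_simple S Gbar) (sSR : S \subset R) (nRG : (R <| Gbar)%g).

(** Openness of the kernel lets [H] factor through a finite level; the description of the sheaf at
    infinity supplies the two inputs of [wild_dim_bound], namely the bound 1/W on the upper numbers
    and a nontrivial wild element. *)
Theorem hypergeometric_wild_bound (F : closedFieldType) n (Phi : mx_representation F R n) :
  p \notin [pchar F] -> (exists2 x, x \in S & Phi x != 1%:M) ->
  (D - m <= (n - \rank (rfix_mx Phi R)) * #|Gbar : R|%g)%N.
Proof.
have W_gt0 : (0 < D - m)%N by rewrite subn_gt0.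
have [v Pv] := exists_place_at_infty HOm; have vV := Pv.1.
have CF : coeff_field v kk := coeff_field_infty HOm Pv.
have [xs hxs] := hyp_open.
have [s [_ xss ss]] := stable_hull HOm xs.
have Hs (g g' : End) : Gal g -> Gal g' -> {in s, g =1 g'} -> H g = H g'.
  move=> Gg Gg' Eg; have [h Gh [gK _]] := Gal_inverse HOm Gg.
  have E1 : H h *m H g = 1%:M.
    by rewrite -HM //; apply: hyp_identity; [exact: Gal_comp|exact: gK].
  have E2 : H h *m H g' = 1%:M.
    rewrite -HM //; apply: hxs; first exact: Gal_comp.
    by move=> x /xss xs' /=; rewrite -Eg // gK.
  have [Uh _] := mulmx1_unit E1.
  by apply: (can_inj (mulKmx Uh)); rewrite E1 E2.
have [X [G [act GL]]] := exists_level HOm ss.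
have [pi T vpi] := exists_tot HOm Pv ss GL.
set Gam := decomp_group HOm v ss GL in T vpi.
have HL (g : End) a : Gal g -> a \in Gam -> (forall x, Lv s x -> act a x = g x) ->
    H (act a) = H g.
  move=> Gg Ga Eg; apply: Hs => //; first exact: (decomp_Gal Ga).1.
  by move=> x xs'; apply: Eg; exact: level_mem.
have ex a : exists y, a \in Gam -> iota y = H (act a).
  have [Ga|] := boolP (a \in Gam); last by exists 1%g.
  by have [y Ey] := hyp_in_monodromy (decomp_Gal Ga).1; exists y.
pose f a := projT1 (cid (ex a)).
have fP a : a \in Gam -> iota (f a) = H (act a) by exact: (projT2 (cid (ex a))).
have fM : {in Gam &, {morph f : a b / (a * b)%g}}.
  move=> a b Ga Gb; apply: iota_inj; rewrite iotaM !fP ?groupM //.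
  have [Gala _] := decomp_Gal Ga; have [Galb _] := decomp_Gal Gb.
  rewrite -HM //; apply: HL; [exact: Gal_comp|exact: groupM|].
  by move=> x Lx; rewrite (tot_M T).
have f1E a : a \in Gam -> (f a == 1%g) = (H (act a) == 1%:M).
  by move=> Ga; rewrite -fP // -iota_one (inj_eq iota_inj).
have [Tame [Wild [[TWf TW0] [stT stW] [dT trT] [dW niW] [_ trW]]]] := hyp_infty hypH Pv.
(* An element with larger upper number would lift to an upper ramification group of index above 1/W,
   which is trivial on [Wild], and on [Tame] too because it is wild. *)
have breaks a : a \in Gam -> f a != 1%g ->
    herb v Gam act pi (act a pi) <= (D - m)%:R^-1 + 1.
  move=> Ga; rewrite f1E //; apply: contraR; rewrite -ltNge => lt.
  pose r := herb v Gam act pi (act a pi) - 1.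
  have rW : (D - m)%:R^-1 < r by rewrite ltrBrDr.
  have [||h up Eh] := @upper_lift p Om t HOm v Pv s ss X G act pi GL T vpi a r => //.
    by rewrite subrK.
  have r0 : 0 < r by apply: lt_trans rW; rewrite invr_gt0 ltr0n.
  have wh := upper_wild HOm Pv r0 up.
  rewrite (HL h a wh.1.1 Ga); last by move=> x Lx; rewrite Eh.
  have fixall (x : 'cV[E]_D) : H h *m x = x.
    have : x \in (Tame + Wild)%VS by rewrite TWf memvf.
    case/memv_addP => y yT [z zW ->].
    by rewrite mulmxDr (trT h wh) ?(trW r rW h up).
  by apply/eqP/matrixP => i j; have := congr1 (fun M : 'cV_D => M i 0) (fixall (delta_mx j 0));
    rewrite -colE !mxE eqxx andbT => ->.
(* Otherwise all of [Wild], which has positive dimension, would be invariant under wild inertia. *)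
have wild : exists2 b, b \in ram v Gam act pi 1 & f b != 1%g.
  apply: contrapT => no.
  have Wild0 x : x \in Wild -> x = 0.
    move=> xW; apply: (niW x xW) => h wh.
    have [a Ga Ea] := inertia_decomp HOm Pv ss GL wh.1.
    rewrite -(HL h a wh.1.1 Ga Ea).
    have [fa|fa] := eqVneq (f a) 1%g; first by rewrite -fP // fa iota_one mul1mx.
    case: no; exists a => //; rewrite inE Ga; have [//|a1 /=] := eqVneq a 1%g.
    have := wh.2 pi (tot_pi0 T); rewrite -Ea; last exact: (tot_pi T).
    have ne := act_moves CF T Ga a1.
    move=> /(_ ne); have pi0 := tot_pi0 T.
    have Epi : act a pi - pi = pi * (act a pi / pi - 1).
      by rewrite mulrBr mulr1 mulrCA divff // mulr1.
    have ne' : act a pi / pi - 1 != 0 by apply: contraNneq ne => E0; rewrite Epi E0 mulr0.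
    rewrite Epi (vlM vV) //.
    by rewrite ltrDl (ram_wP CF T Ga a1) pmulr_lgt0 ?ltr0n //; exact: (tot_vpi T).
  have : (Wild <= 0)%VS by apply/subvP => x /Wild0->; exact: mem0v.
  by rewrite subv0 -dimv_eq0 dW => /eqP W0; rewrite W0 in W_gt0.
have Ep : p \notin [pchar E] by rewrite (Qlbar_char0 HE).
have D_gt0 : (0 < D)%N by apply: leq_trans lt_mD.
exact: (wild_dim_bound (sepclosure_char HOm) CF T vpi fM W_gt0 breaks D_gt0 Ep iota_one iotaM
  iota_inj monodromy_center wild simS sSR nRG).
Qed.

End Monodromy.

Theorem theorem4p8
    (p l : nat) (p_prime : prime p) (l_prime : prime l) (neq_lp : l != p)
    (Om : fieldType) (t : Om) (HOm : sepclosure_Fpbar_t p t)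
    (E : closedFieldType) (vE : E -> rat) (HE : Qlbar l vE)
    (D m : nat) (lt_mD : (m < D)%N)
    (H : {rmorphism Om -> Om} -> 'M[E]_D)
    (hypH : hypergeometric p t vE D m H)
    (gT : finGroupType) (iota : gT -> 'M[E]_D)
    (finG : finite_matrix_group iota (geometric_monodromy p t H))
    (S R : {group coset_of 'Z([set: gT])%g})
    (GbarS : almost_simple S ([set: gT] / 'Z([set: gT]))%G)
    (sSR : S \subset R) (nR : (R <| [set: gT] / 'Z([set: gT]))%g) :
  (forall (F : closedFieldType) (d : nat) (Phi : mx_representation F R d),
     p \notin [pchar F] ->
     (exists2 x, x \in S & Phi x != 1%:M) ->
     (D - m <= d * #|[set: gT] / 'Z([set: gT]) : R|%g <= d * #|Out S|)%N)
  /\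
  (forall (F : closedFieldType) (e : nat)
     (Psi : coset_of 'Z([set: gT])%g -> 'M[F]_e),
     p \notin [pchar F] ->
     projective_repr R Psi ->
     (exists2 x, x \in S & ~~ is_scalar_mx (Psi x)) ->
     (D - m <= (e ^ 2 - 1) * #|[set: gT] / 'Z([set: gT]) : R|%g
            <= (e ^ 2 - 1) * #|Out S|)%N).
Proof.
have idx := index_le_Out GbarS sSR (normal_sub nR).
split=> [F d Phi Fp nt|F e Psi Fp PPsi [x Sx nsx]].
  have le := hypergeometric_wild_bound HOm HE lt_mD hypH finG GbarS sSR nR Fp nt.
  apply/andP; split; last by rewrite leq_mul2l idx orbT.
  by apply: leq_trans le _; rewrite leq_mul2r leq_subr orbT.
apply/andP; split; last by rewrite leq_mul2l idx orbT.
have Rx := subsetP sSR _ Sx.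
have nt : exists2 y, y \in S & conj_repr PPsi y != 1%:M.
  by exists x => //; exact: conj_repr_nontrivial.
have le := hypergeometric_wild_bound HOm HE lt_mD hypH finG GbarS sSR nR Fp nt.
apply: leq_trans le _; rewrite leq_mul2r; apply/orP; right.
rewrite -mulnn; apply: leq_sub2l; apply: conj_repr_rfix.
(* For [e = 0] the only matrix is scalar, so [e] is positive. *)
rewrite lt0n; apply: contra nsx => /eqP e0; move: (Psi x); rewrite e0 => A.
by rewrite /is_scalar_mx; case: insub => // -[].
Qed.
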